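(* The functions $X^3$ and $Y^2$ are modular functions of weight $0$ for $\Gamma_0(6)$, and $Y^2=X^3+1$. The map $\phi\colon X(6)\to E_1$ given by $\phi(\tau)=(X(\tau),Y(\tau))$ for $\tau\in X(6)\setminus\{\infty\}$ (and $\phi(\infty)=O$, the point at infinity) is an isomorphism, where $E_1$ is the elliptic curve $y^2=x^3+1$.
   Context: $\omega:=e^{2\pi i/3}$. $X(6)=\Gamma(6)\backslash\mathbb{H}^*$ is the compactified modular curve of level $6$, $\mathbb{H}^*=\mathbb{H}\cup\mathbb{Q}\cup\{\infty\}$. For $\tau\in\mathbb{H}$, $\wp(z;\tau)$ is the Weierstrass $\wp$-function of the lattice $\mathbb{Z}+\mathbb{Z}\tau$ and $e_{\alpha,\beta}(\tau):=\wp((\alpha\tau+\beta)/6;\tau)$. Put $A:=e_{2,1}+\omega^2e_{2,3}+\omega e_{2,5}$, $B:=e_{2,1}+\omega e_{2,3}+\omega^2e_{2,5}$, $\mathcal{C}:=e_{0,1}-e_{0,4}$, $\mathcal{D}:=e_{3,1}-e_{3,4}$, $X:=-\omega^2A/B$ and $Y:=-3\mathcal{C}/\mathcal{D}$. *)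

(* Defs.v *)
From HB Require Import structures.
From mathcomp Require Import all_boot all_order all_algebra.
From mathcomp Require Import generic_quotient ring.
From mathcomp Require Import all_classical all_reals all_analysis.
From mathcomp Require Import complex.
From mathcomp.analysis.showcase Require Import summability.

Set Implicit Arguments.
Unset Strict Implicit.
Unset Printing Implicit Defensive.

Import Order.TTheory GRing.Theory Num.Theory.
Import numFieldNormedType.Exports.

Local Open Scope classical_set_scope.
Local Open Scope ring_scope.
Local Open Scope complex_scope.
Local Open Scope quotient_scope.

HB.instance Definition _ (R : realType) := NormedModule.copy R[i] (R[i]^o).

Section ComplexFunctions.
Variable R : realType.
Local Notation C := R[i].

Definition cexp (z : C) : C :=
  (expR (complex.Re z) * cos (complex.Im z)) +i* (expR (complex.Re z) * sin (complex.Im z)).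

Definition twopii : C := (2 * pi) *i.

Definition holomorphic_at (f : C -> C) (z0 : C) : Prop :=
  \forall z \near z0, derivable f z 1.

Definition meromorphic_at (f : C -> C) (z0 : C) : Prop :=
  exists (n : nat) (h : C -> C), holomorphic_at h z0 /\
    \forall z \near z0^', f z * (z - z0) ^+ n = h z.

Definition upper_half : set C := [set z | 0 < complex.Im z].

(* The sum is the unconditional one, i.e. the limit along the directed set of
   finite subsets of the nonzero lattice points. *)
Definition wp (z tau : C) : C :=
  z ^- 2 + summability.sum (fun p : {p : int * int | p != 0} =>
    let l : C := (val p).1%:~R + (val p).2%:~R * tau in
    (z - l) ^- 2 - l ^- 2).

Definition omega : C := cexp (twopii / 3).

Definition e_ (alpha beta : nat) (tau : C) : C :=
  wp ((alpha%:R * tau + beta%:R) / 6) tau.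

Definition Afun (tau : C) : C :=
  e_ 2 1 tau + omega ^+ 2 * e_ 2 3 tau + omega * e_ 2 5 tau.
Definition Bfun (tau : C) : C :=
  e_ 2 1 tau + omega * e_ 2 3 tau + omega ^+ 2 * e_ 2 5 tau.
Definition Cfun (tau : C) : C := e_ 0 1 tau - e_ 0 4 tau.
Definition Dfun (tau : C) : C := e_ 3 1 tau - e_ 3 4 tau.
Definition Xfun (tau : C) : C := - omega ^+ 2 * Afun tau / Bfun tau.
Definition Yfun (tau : C) : C := - 3 * Cfun tau / Dfun tau.

Definition SL2Z : set 'M[int]_2 := [set g | \det g = 1].

Definition Gamma (N : int) : set 'M[int]_2 :=
  [set g | SL2Z g /\
    [/\ (N %| (g 0 0 - 1)%R)%Z, (N %| (g 0 1)%R)%Z, (N %| (g 1 0)%R)%Z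
      & (N %| (g 1 1 - 1)%R)%Z]].

Definition Gamma0 (N : int) : set 'M[int]_2 :=
  [set g | SL2Z g /\ (N %| (g 1 0)%R)%Z].

Definition autj (g : 'M[int]_2) (z : C) : C := (g 1 0)%:~R * z + (g 1 1)%:~R.

Definition mobius (g : 'M[int]_2) (z : C) : C :=
  ((g 0 0)%:~R * z + (g 0 1)%:~R) / autj g z.

(* The last clause is meromorphy at the cusp g(oo): the weight k slash of f by
   g is a meromorphic function of exp(2 pi i tau / N) near 0. *)
Definition modular_function (G : set 'M[int]_2) (k : int) (f : C -> C) : Prop :=
  [/\ forall tau, upper_half tau -> meromorphic_at f tau,
      forall g tau, G g -> upper_half tau ->
        f (mobius g tau) = autj g tau ^ k * f tau
    & forall g, SL2Z g -> exists (N : nat) (M : R) (F : C -> C),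
        [/\ (0 < N)%N, meromorphic_at F 0
          & forall tau, upper_half tau -> M < complex.Im tau ->
              autj g tau ^ (- k) * f (mobius g tau)
              = F (cexp (twopii * tau / N%:R))]].

End ComplexFunctions.

Section ModularCurve.
Variable R : realType.
Local Notation C := R[i].

(* [None] is the point at infinity of the Riemann sphere. *)
Definition mobius_sphere (g : 'M[int]_2) (s : option C) : option C :=
  match s with
  | Some z => if autj g z == 0 then None else Some (mobius g z)
  | None => if g 1 0 == 0 then None
            else Some ((g 0 0)%:~R / (g 1 0)%:~R)
  end.

Lemma det2 (g : 'M[int]_2) : \det g = g 0 0 * g 1 1 - g 0 1 * g 1 0.
Proof.
rewrite (expand_det_row _ 0) big_ord_recl big_ord1 /cofactor !det_mx11 !mxE /=.
rewrite expr0 mul1r expr1 mulN1r mulrN.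
by congr (_ * g _ _ - g _ _ * g _ _); apply/val_inj.
Qed.

Lemma mul2 (g h : 'M[int]_2) i j :
  (g *m h) i j = g i 0 * h 0 j + g i 1 * h 1 j.
Proof.
rewrite mxE big_ord_recl big_ord1.
by congr (_ + g i _ * h _ j); apply/val_inj.
Qed.

Lemma mobius_sphereM (g h : 'M[int]_2) s : \det g = 1 -> \det h = 1 ->
  mobius_sphere (g *m h) s = mobius_sphere g (mobius_sphere h s).
Proof.
move=> _ /(congr1 (fun n : int => n%:~R : C)); rewrite det2.
rewrite rmorphB !rmorphM rmorph1 /= => dh.
case: s => [z|] /=; last first.
  rewrite -!(intr_eq0 C) !mul2 !rmorphD !rmorphM /=.
  have [c0|c0] := eqVneq ((h 1 0)%:~R : C) 0.
    have a0 : (h 0 0)%:~R != 0 :> C.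
      by apply: contra_eqN dh => /eqP->; rewrite c0 mul0r mulr0 subrr eq_sym oner_eq0.
    rewrite /= -(intr_eq0 C) c0 !mulr0 !addr0 mulf_eq0 (negPf a0) orbF.
    by case: eqVneq => // c1; congr Some; field; rewrite a0 c1.
  rewrite /= /mobius /autj.
  have -> : (g 1 0)%:~R * ((h 0 0)%:~R / (h 1 0)%:~R) + (g 1 1)%:~R =
    ((g 1 0)%:~R * (h 0 0)%:~R + (g 1 1)%:~R * (h 1 0)%:~R) / (h 1 0)%:~R :> C.
    by field.
  rewrite mulf_eq0 invr_eq0 (negPf c0) orbF.
  by case: eqVneq => // n0; congr Some; field; rewrite c0 n0.
rewrite /mobius /autj !mul2 !rmorphD !rmorphM /=.
set n := (h 0 0)%:~R * z + (h 0 1)%:~R; set j := (h 1 0)%:~R * z + (h 1 1)%:~R.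
have -> : ((g 1 0)%:~R * (h 0 0)%:~R + (g 1 1)%:~R * (h 1 0)%:~R) * z
    + ((g 1 0)%:~R * (h 0 1)%:~R + (g 1 1)%:~R * (h 1 1)%:~R)
  = (g 1 0)%:~R * n + (g 1 1)%:~R * j by rewrite /n /j; ring.
have -> : ((g 0 0)%:~R * (h 0 0)%:~R + (g 0 1)%:~R * (h 1 0)%:~R) * z
    + ((g 0 0)%:~R * (h 0 1)%:~R + (g 0 1)%:~R * (h 1 1)%:~R)
  = (g 0 0)%:~R * n + (g 0 1)%:~R * j by rewrite /n /j; ring.
have [j0|j0] := eqVneq j 0.
  have n0 : n != 0.
    have : (h 0 0)%:~R * j - (h 1 0)%:~R * n = 1 by rewrite -[RHS]dh /n /j; ring.
    rewrite j0 mulr0 sub0r; apply: contra_eqN => /eqP->.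
    by rewrite mulr0 oppr0 eq_sym oner_eq0.
  rewrite /= j0 !mulr0 !addr0 mulf_eq0 (negPf n0) orbF intr_eq0.
  by case: eqVneq => // c1; congr Some; field; rewrite n0 intr_eq0 c1.
rewrite /= /mobius /autj.
have -> : (g 1 0)%:~R * (n / j) + (g 1 1)%:~R
  = ((g 1 0)%:~R * n + (g 1 1)%:~R * j) / j by field.
rewrite mulf_eq0 invr_eq0 (negPf j0) orbF.
by case: eqVneq => // k0; congr Some; field; rewrite j0 k0.
Qed.

Lemma mobius_sphere1 s : mobius_sphere 1%:M s = s.
Proof.
case: s => [z|]; rewrite /= /mobius /autj !mxE //=.
by rewrite !mul0r !mul1r add0r addr0 oner_eq0 divr1.
Qed.

Definition Hstar_set : set (option C) :=
  [set s | if s is Some z then upper_half z \/ exists q : rat, z = (ratr q)%:C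
           else True].

Definition Hstar : Type := set_type Hstar_set.
HB.instance Definition _ := Choice.on Hstar.

Definition infty : Hstar := exist _ None (mem_set (I : Hstar_set None)).

Definition in_upper : set Hstar :=
  [set s | if val s is Some z then upper_half z else False].

(* Usual topology on the upper half-plane; a basic neighbourhood of the cusp
   g(oo) is the image under g of {oo} and a half-plane Im z > M. *)
Definition Hstar_open (U : set Hstar) : Prop :=
  (forall (s : Hstar) (z : C), U s -> val s = Some z -> upper_half z ->
     \forall w \near z, forall t : Hstar, val t = Some w -> U t) /\
  (forall (s : Hstar) (g : 'M[int]_2), U s -> SL2Z g ->
     val s = mobius_sphere g None ->
     exists2 M : R, 0 < M & forall (w : C) (t : Hstar),
       M < complex.Im w -> val t = mobius_sphere g (Some w) -> U t).

Lemma Hstar_openT : Hstar_open setT.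
Proof.
by split=> [s z _ _ _|s g _ _ _]; [near=> w|exists 1].
Unshelve. all: by end_near.
Qed.

Lemma Hstar_openI (U V : set Hstar) :
  Hstar_open U -> Hstar_open V -> Hstar_open (U `&` V).
Proof.
move=> [U1 U2] [V1 V2]; split=> [s z [Us Vs] sz hz|s g [Us Vs] hg sg].
  have := V1 _ _ Vs sz hz; have := U1 _ _ Us sz hz.
  by apply: filterS2 => w hU hV t tw; split; [exact: hU|exact: hV].
have [M M0 hM] := U2 _ _ Us hg sg; have [N N0 hN] := V2 _ _ Vs hg sg.
exists (Num.max M N); first by rewrite lt_max M0.
move=> w t; rewrite gt_max => /andP[Mw Nw] tw.
by split; [exact: hM tw|exact: hN tw].
Qed.

Lemma Hstar_open_bigU (I : Type) (f : I -> set Hstar) :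
  (forall i, Hstar_open (f i)) -> Hstar_open (\bigcup_i f i).
Proof.
move=> fo; split=> [s z [i _ fs] sz hz|s g [i _ fs] hg sg].
  have := (fo i).1 _ _ fs sz hz.
  by apply: filterS => w h t tw; exists i => //; exact: h.
have [M M0 hM] := (fo i).2 _ _ fs hg sg.
by exists M => // w t Mw tw; exists i => //; exact: hM tw.
Qed.

HB.instance Definition _ := @isOpenTopological.Build Hstar Hstar_open
  Hstar_openT Hstar_openI Hstar_open_bigU.

Definition Gamma_rel (N : int) : rel Hstar :=
  fun s t => `[< exists2 g, Gamma N g & mobius_sphere g (val s) = val t >].

Lemma Gamma_relP N : equiv_class_of (Gamma_rel N).
Proof.
have Gamma1 : Gamma N 1%:M by split; [exact: det1|rewrite !mxE /= !subrr dvdz0].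
have GammaM g h : Gamma N g -> Gamma N h -> Gamma N (g *m h).
  move=> [dg [g00 g01 g10 g11]] [dh [h00 h01 h10 h11]].
  split; first by rewrite /SL2Z /= det_mulmx dg dh mulr1.
  rewrite !mul2; split.
  - have -> : g 0 0 * h 0 0 + g 0 1 * h 1 0 - 1
      = (g 0 0 - 1) * h 0 0 + (h 0 0 - 1) + g 0 1 * h 1 0 by ring.
    by apply: rpredD; [apply: rpredD => //|]; exact: dvdz_mulr.
  - by apply: rpredD; [exact: dvdz_mull|exact: dvdz_mulr].
  - by apply: rpredD; [exact: dvdz_mulr|exact: dvdz_mull].
  - have -> : g 1 0 * h 0 1 + g 1 1 * h 1 1 - 1
      = (g 1 1 - 1) * h 1 1 + (h 1 1 - 1) + g 1 0 * h 0 1 by ring.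
    by apply: rpredD; [apply: rpredD => //|]; exact: dvdz_mulr.
have GammaV g : Gamma N g -> exists2 h, Gamma N h & h *m g = 1%:M.
  move=> [dg [g00 g01 g10 g11]]; exists (\adj g); last by rewrite mul_adj_mx dg.
  have adjE i j : (\adj g) i j = (-1) ^+ (i + j) * g (1 - j) (1 - i).
    rewrite !mxE /cofactor det_mx11 !mxE addnC.
    by congr (_ * g _ _); apply/val_inj;
      case: i => -[|[|//]] ?; case: j => -[|[|//]] ?.
  split.
    have := congr1 determinant (mul_adj_mx g).
    by rewrite det_mulmx dg mulr1 det1.
  rewrite !adjE /= !subr0 !subrr !expr2 !expr0 !expr1 !mulN1r opprK !mul1r.
  by rewrite !rpredN.
split.
- by move=> s; apply/asboolP; exists 1%:M; rewrite ?mobius_sphere1.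
- move=> s t; apply/asboolP/asboolP => -[g Gg gs];
    have [h Gh hg] := GammaV g Gg; exists h => //;
    by rewrite -gs -mobius_sphereM ?hg ?mobius_sphere1//; [case: Gh|case: Gg].
- move=> t s u /asboolP[g Gg gs] /asboolP[h Gh ht]; apply/asboolP.
  exists (h *m g); first exact: GammaM.
  by rewrite mobius_sphereM ?gs//; [case: Gh|case: Gg].
Qed.

Canonical Gamma_equiv (N : int) := EquivRelPack (Gamma_relP N).

Definition X_ (N : int) : Type := quotient_topology {eq_quot Gamma_equiv N}.
HB.instance Definition _ (N : int) := Topological.on (X_ N).

Definition proj_X (N : int) (s : Hstar) : X_ N :=
  \pi_(quotient_topology {eq_quot Gamma_equiv N}) s.

Definition complex_of (s : Hstar) : C := odflt 0 (val s).

(* The value at a point of H^*; at a cusp it is the limit along H. *)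
Definition value_at (f : C -> C) (s : Hstar) (v : C) : Prop :=
  (in_upper s -> f (complex_of s) = v) /\
  (~ in_upper s -> f (complex_of t) @[t --> within in_upper (nbhs s)] --> v).

End ModularCurve.

Section RiemannSurfaces.
Variable R : realType.
Local Notation C := R[i].

Record chart (T : Type) := Chart { chart_dom : set T; chart_coord : T -> C }.

Definition holomorphic_map (S T : topologicalType)
    (AS : set (chart S)) (AT : set (chart T)) (f : S -> T) : Prop :=
  continuous f /\
  forall p, exists (a : chart S) (b : chart T),
    [/\ AS a, AT b, chart_dom a p, chart_dom b (f p)
      & exists2 h : C -> C, holomorphic_at h (chart_coord a p)
        & forall x, chart_dom a x -> chart_dom b (f x) ->
            h (chart_coord a x) = chart_coord b (f x)].

Definition isomorphism (S T : topologicalType)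
    (AS : set (chart S)) (AT : set (chart T)) (f : S -> T) : Prop :=
  exists g : T -> S, [/\ cancel f g, cancel g f,
    holomorphic_map AS AT f & holomorphic_map AT AS g].

Definition X6 : topologicalType := X_ R 6.
Definition proj6 : Hstar R -> X6 := @proj_X R 6.

(* Gamma(6) has no elliptic points and every cusp has width 6, so tau itself and
   exp(2 pi i tau / 6) o g^-1 are local coordinates. The equations on
   [chart_coord] force the projection to be injective on V, resp. M to be large
   enough for the coordinate to be well defined near the cusp g(oo). *)
Definition upper_chart (a : chart X6) : Prop :=
  exists V : set C, [/\ open V, V `<=` @upper_half R,
    chart_dom a = [set proj6 s | s in [set s | exists2 z, V z & val s = Some z]]
    & forall s z, V z -> val s = Some z -> chart_coord a (proj6 s) = z].

Definition cusp_chart (a : chart X6) : Prop :=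
  exists (g : 'M[int]_2) (M : R), [/\ SL2Z g, 0 < M,
    chart_dom a = [set proj6 s | s in [set s |
      val s = mobius_sphere g None \/
      exists2 z, M < complex.Im z & val s = mobius_sphere g (Some z)]],
    forall s, val s = mobius_sphere g None -> chart_coord a (proj6 s) = 0
    & forall s z, M < complex.Im z -> val s = mobius_sphere g (Some z) ->
        chart_coord a (proj6 s) = cexp (twopii R * z / 6)].

Definition atlas_X6 : set (chart X6) :=
  [set a | upper_chart a \/ cusp_chart a].

Definition nonzero3 : set 'rV[C]_3 := [set v | v != 0].

Definition homothetic : rel (set_type nonzero3) :=
  fun u v => `[< exists2 c : C, c != 0 & val v = c *: val u >].

Lemma homotheticP : equiv_class_of homothetic.
Proof.
split.
- by move=> u; apply/asboolP; exists 1; rewrite ?oner_eq0 ?scale1r.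
- move=> u v; apply/asboolP/asboolP => -[c c0 e];
    by exists c^-1; rewrite ?invr_eq0// e scalerA mulVf// scale1r.
- move=> v u w /asboolP[c c0 e] /asboolP[d d0 e']; apply/asboolP.
  by exists (d * c); rewrite ?mulf_neq0// e' e scalerA.
Qed.

Canonical homothetic_equiv := EquivRelPack homotheticP.

Definition P2 : Type := quotient_topology {eq_quot homothetic_equiv}.
HB.instance Definition _ := Topological.on P2.

Definition row3 (x y z : C) : 'rV[C]_3 := \row_i [:: x; y; z]`_i.

Lemma row3_affine_neq0 (x y : C) : row3 x y 1 \in nonzero3.
Proof.
apply/mem_set/eqP => /matrixP/(_ 0 2); rewrite !mxE /=.
by apply/eqP/oner_neq0.
Qed.

Lemma row3_O_neq0 : row3 0 1 0 \in nonzero3.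
Proof.
apply/mem_set/eqP => /matrixP/(_ 0 1); rewrite !mxE /=.
by apply/eqP/oner_neq0.
Qed.

Definition P2_affine (x y : C) : P2 :=
  \pi_(quotient_topology {eq_quot homothetic_equiv})
    (exist _ (row3 x y 1) (row3_affine_neq0 x y)).

Definition P2_O : P2 :=
  \pi_(quotient_topology {eq_quot homothetic_equiv})
    (exist _ (row3 0 1 0) row3_O_neq0).

(* Homogeneous coordinates, for a chosen representative: only used below in
   homogeneous equations and in quotients of degree 0. *)
Definition hcoord (p : P2) (i : 'I_3) : C :=
  val (repr (p : quotient_topology {eq_quot homothetic_equiv})) 0 i.

Definition E1_set : set P2 :=
  [set p | hcoord p 1 ^+ 2 * hcoord p 2 = hcoord p 0 ^+ 3 + hcoord p 2 ^+ 3].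

Definition E1 : topologicalType := set_type E1_set.

(* With F = y^2 z - x^3 - z^3, the implicit function theorem makes x/z, y/z and
   x/y local coordinates where respectively dF/dy, dF/dx and dF/dz is nonzero
   in the affine piece z <> 0, z <> 0 and y <> 0. *)
Definition atlas_E1 : set (chart E1) :=
  [set a | let U := chart_dom a in let phi := chart_coord a in
    let x (p : E1) := hcoord (val p) 0 in
    let y (p : E1) := hcoord (val p) 1 in
    let z (p : E1) := hcoord (val p) 2 in
    [/\ open U, {in U &, injective phi} &
      [\/ forall p, U p -> [/\ z p != 0, y p != 0 & phi p = x p / z p],
          forall p, U p -> [/\ z p != 0, x p != 0 & phi p = y p / z p]
        | forall p, U p -> [/\ y p != 0, y p ^+ 2 - 3 * z p ^+ 2 != 0
                             & phi p = x p / y p]]]].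

End RiemannSurfaces.

Arguments atlas_X6 : clear implicits.
Arguments atlas_E1 : clear implicits.

(* Main.v *)
Require Import Defs.
From HB Require Import structures.
From mathcomp Require Import all_boot all_order all_algebra.
From mathcomp Require Import generic_quotient ring lra zify finmap.
From mathcomp Require Import all_classical all_reals all_analysis complex.
From mathcomp.analysis.showcase Require Import summability.

(** Write [q = exp(2 pi i tau)] and [w = exp(2 pi i tau / 6)]. By the Lipschitz
    formula, differences of the values [e_{a,b}(tau)] are, up to the factor
    [(2 pi i)^2], differences of the Lambert series
    [S(u) = sum_n u q^n / (1 - u q^n)^2] at [u = zeta^b w^a], [zeta = exp(2 pi i / 6)].

    Liouville's theorem on [C^* / q^Z] gives the duplication formula for [S] and
    the translation formulas by points of order 2. Evaluated at the 6-torsion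
    points, these are algebraic relations which imply
    [(A^3 - 8 y m) (y A^3 + m^2) = 0] for explicit [y], [m]. The second factor is
    excluded by the behaviour at [w = 0] and the identity theorem, and the vanishing
    of the first one is equivalent to [Y^2 = X^3 + 1].

    Conversely [(X, Y)] determines all values of [S] at the 6-torsion points up to
    a common factor. The duplication formula then determines [S] near its pole,
    hence everywhere, so two points of [H] with the same [(X, Y)] have homothetic
    lattices with matching 6-torsion, i.e. they are [Gamma(6)]-equivalent.

    For [g] in [SL_2(Z)], the map [w |-> P g w] of the unit disc to [X(6)], with
    [P g w = g(tau)] and [P g 0] the cusp [g(oo)], is open and continuous, and
    injective for [Im tau > 1/6]. In the coordinate [w], [(X, Y)] extends to a
    holomorphic map [Q g] into [E_1]. Together these define a continuous map [phi]
    on [X(6)], which is injective on [H], hence everywhere by the open mapping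
    theorem and the separation of cusps. It is surjective: the set of [x]-coordinates
    of its affine points is open, and closed because [X(6)] is covered by finitely
    many compact discs, and [tau |-> tau + 3] realizes [(x, y) |-> (x, -y)]. The
    inverse is holomorphic by the inverse function theorem in the charts. *)

Set Implicit Arguments.
Unset Strict Implicit.
Unset Printing Implicit Defensive.

Import Order.TTheory GRing.Theory Num.Theory.
Import numFieldNormedType.Exports.

Local Open Scope classical_set_scope.
Local Open Scope ring_scope.
Local Open Scope complex_scope.

(** Function theory starts from power series: [Ana] means being the sum of one near the point. Its
    leading term controls the modulus to first order, which gives open mapping, maximum modulus and,
    on the compact annulus between [ab q] and 1, the Liouville theorem. The sum in [wp] carries
    regularizing terms that spoil reindexing. They cancel in differences of two values, and [Xfun],
    [Yfun] depend only on such differences up to a common factor; hence the relation [proportional],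
    through which every Moebius transformation is handled. Injectivity rests on a contraction:
    duplication expresses 4 times the value at [2 * z] by the value at [z] through a map that is
    2-Lipschitz near infinity. Two functions with the same principal part and the same order 2 data
    therefore agree near 0, and by doubling everywhere. Points of the upper half-plane are treated
    like cusps: the discs [ab w < rho] around the cusps already cover the curve, so one kind of
    coordinate serves for all points. *)

Section Abs.
Variable R : realType.
Local Notation C := R[i].

(** The norm of [R[i]] takes its values in [R[i]]. Moving it to [R] puts all estimates in a real
    field, where [lra] and [nra] apply. *)
Definition ab (z : C) : R := complex.Re `|z|.

Lemma abE (z : C) : (ab z)%:C = `|z|.
Proof. by rewrite /ab normc_def. Qed.

Lemma ab_ge0 (z : C) : 0 <= ab z.
Proof. by rewrite -ler0c abE. Qed.

Lemma abM (z w : C) : ab (z * w) = ab z * ab w.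
Proof. by apply: complexI; rewrite rmorphM /= !abE normrM. Qed.

Lemma ab_eq0 (z : C) : (ab z == 0) = (z == 0).
Proof. by rewrite -(inj_eq (@complexI R)) abE normr_eq0. Qed.

Lemma ab_gt0 (z : C) : (0 < ab z) = (z != 0).
Proof. by rewrite lt_def ab_eq0 ab_ge0 andbT. Qed.

Lemma ab0 : ab 0 = 0.
Proof. by apply/eqP; rewrite ab_eq0. Qed.

Lemma ab1 : ab 1 = 1.
Proof. by apply: complexI; rewrite abE normr1. Qed.

Lemma abV (z : C) : ab z^-1 = (ab z)^-1.
Proof. by apply: complexI; rewrite fmorphV /= !abE normfV. Qed.

Lemma abX (z : C) n : ab (z ^+ n) = ab z ^+ n.
Proof. by apply: complexI; rewrite rmorphXn /= !abE normrX. Qed.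

Lemma abN (z : C) : ab (- z) = ab z.
Proof. by apply: complexI; rewrite !abE normrN. Qed.

Lemma abBC (z w : C) : ab (z - w) = ab (w - z).
Proof. by rewrite -abN opprB. Qed.

Lemma abD (z w : C) : ab (z + w) <= ab z + ab w.
Proof. by rewrite -lecR rmorphD /= !abE ler_normD. Qed.

Lemma abB (z w : C) : ab (z - w) <= ab z + ab w.
Proof. by rewrite -(abN w) abD. Qed.

Lemma ab_dist (x y z : C) : ab (x - z) <= ab (x - y) + ab (y - z).
Proof. by rewrite -[x - z](subrKA y) abD. Qed.

Lemma abB_ge (z w : C) : ab z - ab w <= ab (z - w).
Proof. by have := abD (z - w) w; rewrite subrK; lra. Qed.

Lemma abD_ge (z w : C) : ab z - ab w <= ab (z + w).
Proof. by have := abB_ge z (- w); rewrite opprK abN. Qed.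

Lemma abR (x : R) : ab x%:C = `|x|.
Proof. by rewrite /ab normc_def /= expr0n addr0 sqrtr_sqr. Qed.

Lemma ab_nat n : ab n%:R = n%:R.
Proof. by apply: complexI; rewrite abE normr_nat rmorph_nat. Qed.

Lemma ab_int (n : int) : ab n%:~R = `|n|%:~R.
Proof. by apply: complexI; rewrite abE normrMz normr1 rmorph_int. Qed.

Lemma ab_sum (I : Type) (r : seq I) (P : pred I) (F : I -> C) :
  ab (\sum_(i <- r | P i) F i) <= \sum_(i <- r | P i) ab (F i).
Proof.
elim/big_rec2: _ => [|i x y _ h]; first by rewrite ab0.
exact: le_trans (abD _ _) (lerD _ h).
Qed.

Lemma ab_sqr (z : C) : ab z ^+ 2 = complex.Re z ^+ 2 + complex.Im z ^+ 2.
Proof. by rewrite /ab normc_def /= sqr_sqrtr // addr_ge0 ?sqr_ge0. Qed.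

Lemma ab_Re (z : C) : `|complex.Re z| <= ab z.
Proof.
rewrite -(ler_pXn2r (n := 2)) ?nnegrE ?normr_ge0 ?ab_ge0 // ab_sqr real_normK ?num_real //.
by rewrite lerDl sqr_ge0.
Qed.

Lemma ab_Im (z : C) : `|complex.Im z| <= ab z.
Proof.
rewrite -(ler_pXn2r (n := 2)) ?nnegrE ?normr_ge0 ?ab_ge0 // ab_sqr real_normK ?num_real //.
by rewrite lerDr sqr_ge0.
Qed.

Lemma ab_ReIm (z : C) : ab z <= `|complex.Re z| + `|complex.Im z|.
Proof.
rewrite -(ler_pXn2r (n := 2)) ?nnegrE ?addr_ge0 ?normr_ge0 ?ab_ge0 // ab_sqr.
rewrite sqrrD !real_normK ?num_real // addrAC lerDl.
by rewrite mulrn_wge0 // mulr_ge0.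
Qed.

Lemma real_lt (e : C) : 0 < e -> e = (ab e)%:C.
Proof. by move=> e0; rewrite abE gtr0_norm. Qed.

(** * Neighbourhoods by radii, compactness and connectedness in the complex plane *)

Lemma nearP (z0 : C) (P : C -> Prop) :
  (\forall z \near z0, P z) <-> exists2 r : R, 0 < r & forall z, ab (z - z0) < r -> P z.
Proof.
split=> [/nbhs_ballP[e /= e0 eP]|[r r0 h]].
  exists (ab e) => [|z hz]; first by rewrite ab_gt0 gt_eqF.
  by apply: eP; rewrite -ball_normE /ball_ /= distrC -abE (real_lt e0) ltcR.
apply/nbhs_ballP; exists r%:C => /=; first by rewrite ltcR.
by move=> z; rewrite -ball_normE /ball_ /= distrC -abE ltcR; exact: h.
Qed.

Lemma dnearP (z0 : C) (P : C -> Prop) :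
  (\forall z \near z0^', P z) <->
  exists2 r : R, 0 < r & forall z, z != z0 -> ab (z - z0) < r -> P z.
Proof.
split=> [/nearP[r r0 h]|[r r0 h]]; first by exists r => // z z0' hz; exact: h.
by apply/nearP; exists r => // z hz z0'; exact: h.
Qed.

Lemma cvgatP (T : Type) (F : set_system T) (FF : Filter F) (f : T -> C) (l : C) :
  (f @ F --> l) <-> forall e : R, 0 < e -> \forall x \near F, ab (f x - l) < e.
Proof.
split=> [h e e0|h].
  by apply: (h [set y | ab (y - l) < e]); apply/nearP; exists e.
by move=> A /nearP[r r0 rA]; apply: filterS (h r r0) => x; exact: rA.
Qed.

Lemma contP (f : C -> C) (z0 : C) :
  {for z0, continuous f} <->
  forall e : R, 0 < e -> exists2 d : R, 0 < d & forall z, ab (z - z0) < d -> ab (f z - f z0) < e.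
Proof.
split=> [/cvgatP h e e0|h]; first by apply/nearP; exact: h.
by apply/(@cvgatP _ (nbhs z0)) => e /h /nearP.
Qed.

Lemma cont_abP (f : C -> R) (z0 : C) :
  {for z0, continuous f} <->
  forall e : R, 0 < e -> exists2 d : R, 0 < d & forall z, ab (z - z0) < d -> `|f z - f z0| < e.
Proof.
split=> [/cvgrPdist_lt h e e0|h].
  have /nearP[r r0 H] := h _ e0.
  by exists r => // z /H; rewrite distrC.
apply/(@cvgrPdist_lt _ _ _ (nbhs z0)) => e /h[d d0 H]; apply/nearP; exists d => // z /H.
by rewrite distrC.
Qed.

Lemma continuous_ab : continuous ab.
Proof.
move=> z0; apply/cont_abP => e e0; exists e => // z; apply: le_lt_trans.
have := abB_ge z z0; have := abB_ge z0 z; rewrite abBC => h1 h2.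
by rewrite ler_norml; lra.
Qed.

Lemma continuous_mkC : continuous (fun p : R * R => p.1 +i* p.2 : C).
Proof.
move=> p; apply/cvgatP => e e0.
have h1 : (fst : R * R -> R) @ p --> p.1 by apply: cvg_fst.
have h2 : (snd : R * R -> R) @ p --> p.2 by apply: cvg_snd.
have e2 : 0 < e / 2 by lra.
move/cvgrPdist_lt: h1 => /(_ _ e2) n1; move/cvgrPdist_lt: h2 => /(_ _ e2) n2.
apply: filterS2 n1 n2 => q.
have -> : q.1 +i* q.2 - (p.1 +i* p.2) = (q.1 - p.1) +i* (q.2 - p.2) :> C by [].
move=> h1 h2; apply: (le_lt_trans (ab_ReIm _)) => /=.
by rewrite distrC [X in _ + X]distrC; lra.
Qed.

Lemma compact_square (r : R) :
  compact [set z : C | `|complex.Re z| <= r /\ `|complex.Im z| <= r].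
Proof.
have hc : compact (`[- r, r] `*` `[- r, r] : set (R * R)).
  by apply: compact_setX; exact: segment_compact.
have := continuous_compact (f := fun p : R * R => p.1 +i* p.2 : C)
  (continuous_subspaceT continuous_mkC) hc.
congr compact; apply/seteqP; split=> z /=.
  by move=> [[x y] /=]; rewrite !in_itv /= -!ler_norml => -[? ?] <-.
move=> [h1 h2]; exists (complex.Re z, complex.Im z) => /=; last by case: z {h1 h2}.
by rewrite !in_itv /= -!ler_norml.
Qed.

Lemma closedCP (A : set C) :
  (forall z, ~ A z -> exists2 r : R, 0 < r & forall w, ab (w - z) < r -> ~ A w) -> closed A.
Proof.
move=> h; rewrite -[A]setCK; apply: open_closedC; rewrite openE => z /= /h /nearP.
by apply.
Qed.

(** Heine-Borel, as a closed part of a compact square. Closedness is given by radii because this is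
    how it is checked for the discs, annuli and boxes below. *)
Lemma compactP (A : set C) (M : R) : (forall z, A z -> ab z <= M) ->
  (forall z, ~ A z -> exists2 r : R, 0 < r & forall w, ab (w - z) < r -> ~ A w) -> compact A.
Proof.
move=> bA /closedCP cA; apply: (subclosed_compact cA (compact_square (r := M))) => z /bA h.
by split; apply: le_trans h; [exact: ab_Re|exact: ab_Im].
Qed.

Lemma ab_max (A : set C) (f : C -> C) : A !=set0 -> compact A ->
  (forall z, A z -> {for z, continuous f}) ->
  exists2 z, A z & forall w, A w -> ab (f w) <= ab (f z).
Proof.
move=> A0 cA cf.
have [|z /set_mem Az h] := compact_EVT_max (f := ab \o f) A0 cA.
  apply: continuous_in_subspaceT => z /set_mem /cf cz.
  by apply: continuous_comp => //; exact: continuous_ab.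
by exists z => // w Aw; apply: h; exact: mem_set.
Qed.

Lemma ab_min (A : set C) (f : C -> C) : A !=set0 -> compact A ->
  (forall z, A z -> {for z, continuous f}) ->
  exists2 z, A z & forall w, A w -> ab (f z) <= ab (f w).
Proof.
move=> A0 cA cf.
have [|z /set_mem Az h] := compact_EVT_min (f := ab \o f) A0 cA.
  apply: continuous_in_subspaceT => z /set_mem /cf cz.
  by apply: continuous_comp => //; exact: continuous_ab.
by exists z => // w Aw; apply: h; exact: mem_set.
Qed.

Lemma compact_disc (z0 : C) (r : R) : compact [set z | ab (z - z0) <= r].
Proof.
apply: (compactP (M := r + ab z0)) => /= [z h|z].
  by have := abD (z - z0) z0; rewrite subrK; lra.
move=> /negP; rewrite -ltNge => h; exists (ab (z - z0) - r); first lra.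
by move=> w h2; apply/negP; rewrite -ltNge; have := ab_dist z w z0; rewrite (abBC z w); lra.
Qed.

Definition seg (z0 z1 : C) (t : R) : C := z0 + t%:C * (z1 - z0).

(** The segment is connected: at the supremum [u] of the parameters up to which [P] holds
    throughout, the negative alternative contradicts points of the segment just before [u], and the
    positive one carries [P] beyond [u]. The identity theorem and the surjectivity of the
    parametrization both run through this lemma. *)
Lemma segment_ind (P : C -> Prop) (z0 z1 : C) :
  (forall t, 0 <= t <= 1 -> exists2 r : R, 0 < r &
     (forall w, ab (w - seg z0 z1 t) < r -> P w) \/
     (forall w, ab (w - seg z0 z1 t) < r -> ~ P w)) ->
  P z0 -> P z1.
Proof.
move=> loc P0.
have seg0 : seg z0 z1 0 = z0 by rewrite /seg mul0r addr0.
have seg1 : seg z0 z1 1 = z1 by rewrite /seg mul1r addrC subrK.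
have segB s t : ab (seg z0 z1 s - seg z0 z1 t) = `|s - t| * ab (z1 - z0).
  by rewrite -abR -abM; congr ab; rewrite /seg rmorphB /=; ring.
pose A := [set t : R | 0 <= t <= 1 /\ forall s, 0 <= s <= t -> P (seg z0 z1 s)].
have A0 : A 0.
  split=> [|s]; first by rewrite lexx ler01.
  by rewrite -eq_le => /eqP <-; rewrite seg0.
have hA : has_sup A.
  by split; [exists 0|exists 1 => t [/andP[]]].
set u := sup A.
have u0 : 0 <= u by apply: ub_le_sup A0; case: hA.
have u1 : u <= 1 by apply: ge_sup => [|t [/andP[]]]; first by exists 0.
have /loc[r r0] : 0 <= u <= 1 by rewrite u0 u1.
set k := ab (z1 - z0); have k0 : 0 <= k by exact: ab_ge0.
(* [k] vanishes when the segment is a single point, hence [k + 1]. *)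
pose d := r / (k + 1); have d0 : 0 < d by rewrite divr_gt0 //; lra.
have near_u s : `|s - u| < d -> ab (seg z0 z1 s - seg z0 z1 u) < r.
  rewrite segB -/k ltr_pdivlMr; last lra.
  by apply: le_lt_trans; rewrite ler_wpM2l // lerDl.
have [t At] := sup_adherent d0 hA; rewrite -/u => ht.
have tu : t <= u by apply: ub_le_sup At; case: hA.
have Pt : P (seg z0 z1 t).
  by case: At => /andP[t0 _]; apply; rewrite t0 lexx.
case=> [Pr|nP]; last first.
  by case: (nP _ (near_u t _)) => //; rewrite ltr_norml; apply/andP; split; lra.
have key s : 0 <= s <= u + d / 2 -> P (seg z0 z1 s).
  move=> /andP[s0 su]; have [st|ts] := leP s t; first by case: At => _; apply; rewrite s0.
  by apply: Pr; apply: near_u; rewrite ltr_norml; apply/andP; split; lra.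
have [h|h] := leP 1 (u + d / 2); first by rewrite -seg1; apply: key; rewrite ler01.
have : u + d / 2 <= u.
  by apply: ub_le_sup; [case: hA|split=> //; apply/andP; split; lra].
lra.
Qed.

End Abs.

(** * Unconditional and absolute summation over arbitrary index types *)

Section UnorderedSums.
Variable R : realType.
Local Notation C := R[i].

(* [HS f s]: [f] is unconditionally summable with sum [s]; [AS f M]: absolutely
   summable, with sum of absolute values at most [M]. *)
Definition HS (I : choiceType) (f : I -> C) (s : C) : Prop :=
  forall e : R, 0 < e -> exists A : {fset I}, forall B : {fset I},
    (A `<=` B)%fset -> ab (\sum_(i <- B) f i - s) < e.

Definition AS (I : choiceType) (f : I -> C) (M : R) : Prop :=
  forall B : {fset I}, \sum_(i <- B) ab (f i) <= M.

Lemma HS_ext (I : choiceType) (f g : I -> C) s : f =1 g -> HS f s -> HS g s.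
Proof. by move=> fg h e /h[A H]; exists A => B /H; under eq_bigr do rewrite fg. Qed.

Lemma AS_ext (I : choiceType) (f g : I -> C) M : f =1 g -> AS f M -> AS g M.
Proof. by move=> fg h B; under eq_bigr do rewrite -fg. Qed.

Lemma HS_uniq (I : choiceType) (f : I -> C) s t : HS f s -> HS f t -> s = t.
Proof.
move=> hs ht; apply/eqP; rewrite -subr_eq0 -ab_eq0 eq_le ab_ge0 andbT leNgt.
apply/negP => h; have h2 : 0 < ab (s - t) / 2 by lra.
have [A HA] := hs _ h2; have [B HB] := ht _ h2.
have := HA _ (fsubsetUl A B); have := HB _ (fsubsetUr A B).
set x := \sum_(i <- _) _ => h3 h4.
by have := ab_dist s x t; rewrite (abBC s x); lra.
Qed.

Lemma HS_add (I : choiceType) (f g : I -> C) s t :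
  HS f s -> HS g t -> HS (fun i => f i + g i) (s + t).
Proof.
move=> hs ht e e0; have h2 : 0 < e / 2 by lra.
have [A HA] := hs _ h2; have [B HB] := ht _ h2.
exists (A `|` B)%fset => D; rewrite fsubUset => /andP[/HA h3 /HB h4].
rewrite big_split /= opprD addrACA.
by have := abD (\sum_(i <- D) f i - s) (\sum_(i <- D) g i - t); lra.
Qed.

Lemma HS_scale (I : choiceType) (f : I -> C) s c :
  HS f s -> HS (fun i => c * f i) (c * s).
Proof.
move=> hs e e0; have h : 0 < e / (ab c + 1).
  by rewrite divr_gt0 //; have := ab_ge0 c; lra.
have [A HA] := hs _ h; exists A => B /HA.
rewrite -big_distrr /= -mulrBr abM => h1.
have c0 := ab_ge0 c.
rewrite ltr_pdivlMr in h1; last lra.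
apply: le_lt_trans h1; rewrite mulrC ler_wpM2l ?ab_ge0 //; lra.
Qed.

Lemma HS_opp (I : choiceType) (f : I -> C) s : HS f s -> HS (fun i => - f i) (- s).
Proof.
by move=> /(HS_scale (-1)); rewrite mulN1r; apply: HS_ext => i; rewrite mulN1r.
Qed.

Lemma HS_sub (I : choiceType) (f g : I -> C) s t :
  HS f s -> HS g t -> HS (fun i => f i - g i) (s - t).
Proof. by move=> hs /HS_opp; exact: HS_add. Qed.

Lemma HS0 (I : choiceType) : HS (fun=> 0 : C) 0 (I := I).
Proof. by move=> e e0; exists fset0 => B _; rewrite big1 // subrr ab0. Qed.

Lemma AS_ge0 (I : choiceType) (f : I -> C) M : AS f M -> 0 <= M.
Proof. by move=> /(_ fset0); rewrite big_seq_fset0. Qed.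

Lemma AS_le (I : choiceType) (f g : I -> C) M :
  (forall i, ab (f i) <= ab (g i)) -> AS g M -> AS f M.
Proof. by move=> h hg B; apply: le_trans (hg B); apply: ler_sum. Qed.

Lemma AS_scale (I : choiceType) (f : I -> C) M c :
  AS f M -> AS (fun i => c * f i) (ab c * M).
Proof.
move=> h B; under eq_bigr do rewrite abM.
by rewrite -big_distrr /= ler_wpM2l ?ab_ge0.
Qed.

Lemma AS_add (I : choiceType) (f g : I -> C) M N :
  AS f M -> AS g N -> AS (fun i => f i + g i) (M + N).
Proof.
move=> hf hg B; apply: le_trans (lerD (hf B) (hg B)).
by rewrite -big_split; apply: ler_sum => i _; exact: abD.
Qed.

Lemma AS_inj (I J : choiceType) (h : J -> I) (f : I -> C) M :
  injective h -> AS f M -> AS (f \o h) M.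
Proof.
move=> hi hf B; apply: le_trans (hf (h @` B)%fset).
by rewrite big_imfset //= => x y _ _; exact: hi.
Qed.

Lemma sum_fsetU (V : zmodType) (I : choiceType) (f : I -> V) (A B : {fset I}) :
  [disjoint A & B]%fset ->
  \sum_(i <- (A `|` B)%fset) f i = \sum_(i <- A) f i + \sum_(i <- B) f i.
Proof.
move=> dAB; rewrite -big_cat; apply: perm_big; apply: uniq_perm; rewrite ?fset_uniq //.
  rewrite cat_uniq !fset_uniq andbT /=; apply/hasPn => i iB; apply/negP => iA.
  by move/fdisjointP: dAB => /(_ _ iA); rewrite iB.
by move=> i; rewrite mem_cat inE.
Qed.

Lemma sum_fsetD (V : zmodType) (I : choiceType) (f : I -> V) (A B : {fset I}) :
  (A `<=` B)%fset ->
  \sum_(i <- B) f i = \sum_(i <- A) f i + \sum_(i <- (B `\` A)%fset) f i.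
Proof.
move=> AB; rewrite -sum_fsetU; last first.
  by apply/fdisjointP => i iA; rewrite inE iA.
suff -> : (A `|` B `\` A = B)%fset by [].
by apply/fsetP => i; rewrite !inE; case: (boolP (i \in A)) => //= /(fsubsetP AB).
Qed.

Lemma sub_sum_nneg (I : choiceType) (g : I -> R) (A B : {fset I}) :
  (forall i, 0 <= g i) -> (A `<=` B)%fset -> \sum_(i <- A) g i <= \sum_(i <- B) g i.
Proof. by move=> g0 AB; rewrite (sum_fsetD g AB) lerDl sumr_ge0. Qed.

Lemma nneg_sum (I : choiceType) (g : I -> R) (M : R) : (forall i, 0 <= g i) ->
  (forall B : {fset I}, \sum_(i <- B) g i <= M) ->
  exists s : R, forall e : R, 0 < e -> exists A : {fset I}, forall B : {fset I},
    (A `<=` B)%fset -> `|\sum_(i <- B) g i - s| < e.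
Proof.
move=> g0 hM; pose E := [set x | exists B : {fset I}, x = \sum_(i <- B) g i].
have hE : has_sup E.
  split; first by exists (\sum_(i <- fset0) g i); exists fset0.
  by exists M => x [B ->].
exists (sup E) => e e0; have [x [A ->] hA] := sup_adherent e0 hE.
exists A => B AB; have := sub_sum_nneg g0 AB.
have : \sum_(i <- B) g i <= sup E by apply: ub_le_sup; [case: hE|exists B].
by rewrite ltr_norml => h1 h2; apply/andP; split; lra.
Qed.

(** Split into real and imaginary parts and each of these into positive and negative parts; a
    bounded nonnegative family has the supremum of its finite sums as sum. *)
Lemma AS_ex (I : choiceType) (f : I -> C) M : AS f M -> exists s, HS f s.
Proof.
move=> hf.
have key (g : I -> R) : (forall i, 0 <= g i <= ab (f i)) -> exists s, HS (fun i => (g i)%:C) s.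
  move=> hg; have [i|B|s H] := @nneg_sum _ g M; first by case/andP: (hg i).
    by apply: le_trans (hf B); apply: ler_sum => i _; case/andP: (hg i).
  exists s%:C => e /H[A HA]; exists A => B /HA.
  by rewrite -rmorph_sum -rmorphB abR.
have reim (h : C -> R) : (forall z, `|h z| <= ab z) -> exists s, HS (fun i => (h (f i))%:C) s.
  move=> hh.
  have [i|s1 H1] := key (fun i => Num.max (h (f i)) 0).
    by have := hh (f i); rewrite ler_norml le_max lexx orbT ge_max /= => /andP[_ ->]; exact: ab_ge0.
  have [i|s2 H2] := key (fun i => Num.max (- h (f i)) 0).
    by have := hh (f i); rewrite -normrN ler_norml le_max lexx orbT ge_max /= => /andP[_ ->]; exact: ab_ge0.
  exists (s1 - s2); apply: HS_ext (HS_sub H1 H2) => i /=.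
  rewrite -rmorphB; congr (_%:C).
  by case: (ltP 0 (h (f i))) => h0; [rewrite max_r; lra|rewrite max_l; lra].
have [s1 H1] := reim _ (@ab_Re R); have [s2 H2] := reim _ (@ab_Im R).
exists (s1 + 'i * s2); apply: HS_ext (HS_add H1 (HS_scale 'i H2)) => i /=.
by rewrite -complexE.
Qed.

Lemma HS_bound (I : choiceType) (f : I -> C) M s : AS f M -> HS f s -> ab s <= M.
Proof.
move=> hf hs; rewrite leNgt; apply/negP => h.
have [//|A HA] := hs (ab s - M); first lra.
have := HA _ (fsubset_refl A); have := hf A.
have := ab_sum (enum_fset A) xpredT f; have := abB_ge s (\sum_(i <- A) f i).
rewrite (abBC s) /= => h1 h2 h3 h4; lra.
Qed.

(** Reindexing along the injection [h]. Since [k] is a left inverse, [h (k i) != i] says that [i]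
    lies outside the image of [h], where [f] has to vanish. *)
Lemma HS_zero_ext (I J : choiceType) (h : J -> I) (k : I -> J) (f : I -> C) s :
  cancel h k -> (forall i, h (k i) != i -> f i = 0) -> HS (f \o h) s -> HS f s.
Proof.
move=> hk f0 hs e /hs[A HA]; exists (h @` A)%fset => B AB.
pose B' := (k @` [fset i in B | h (k i) == i])%fset.
have -> : \sum_(i <- B) f i = \sum_(j <- B') (f \o h) j.
  rewrite big_imfset /=; last first.
    by move=> x y; rewrite !inE => /andP[_ /eqP <-] /andP[_ /eqP <-] /=; rewrite !hk => ->.
  rewrite big_fset /= [LHS](bigID (fun i => h (k i) == i)) /= [X in _ + X]big1 => [|i /f0 //].
  by rewrite addr0; apply: eq_bigr => i /eqP ->.
apply: HA; apply/fsubsetP => j jA; apply/imfsetP; exists (h j) => /=; last by rewrite hk.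
by rewrite !inE hk eqxx andbT; move/fsubsetP: AB; apply; apply/imfsetP; exists j.
Qed.

Lemma AS_zero_ext (I J : choiceType) (h : J -> I) (k : I -> J) (f : I -> C) M :
  cancel h k -> (forall i, h (k i) != i -> f i = 0) -> AS (f \o h) M -> AS f M.
Proof.
move=> hk f0 hs B.
pose B' := (k @` [fset i in B | h (k i) == i])%fset.
apply: le_trans (hs B'); rewrite big_imfset /=; last first.
  by move=> x y; rewrite !inE => /andP[_ /eqP <-] /andP[_ /eqP <-] /=; rewrite !hk => ->.
rewrite big_fset /= [X in X <= _](bigID (fun i => h (k i) == i)) /=.
rewrite [X in _ + X <= _]big1 => [|i /f0 ->]; last exact: ab0.
by rewrite addr0; apply: ler_sum => i /eqP ->.
Qed.

Lemma HS_bij (I J : choiceType) (h : J -> I) (k : I -> J) (f : I -> C) s :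
  cancel h k -> cancel k h -> HS (f \o h) s -> HS f s.
Proof. by move=> hk kh; apply: HS_zero_ext => // i; rewrite kh eqxx. Qed.

Lemma HS_fin1 (I : choiceType) (f : I -> C) i0 : (forall i, i != i0 -> f i = 0) -> HS f (f i0).
Proof.
move=> f0 e e0; exists [fset i0]%fset => B; rewrite fsub1set => iB.
rewrite (big_fsetD1 i0) //= big_seq big1 ?addr0 ?subrr ?ab0 // => i.
by rewrite !inE => /andP[/f0].
Qed.

(** The exclusive-or says that the images of [h] and [g] partition [I]. It is applied to the two
    signs of an integer, to even and odd indices, and to one index against all others. *)
Lemma HS_split (I J K : choiceType) (h : J -> I) (h' : I -> J) (g : K -> I) (g' : I -> K)
    (f : I -> C) s t : cancel h h' -> cancel g g' ->
  (forall i, (h (h' i) == i) (+) (g (g' i) == i)) ->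
  HS (f \o h) s -> HS (f \o g) t -> HS f (s + t).
Proof.
move=> hh gg hgx hs ht.
have H1 : HS (fun i => if h (h' i) == i then f i else 0) s.
  apply: (HS_zero_ext hh) => [i /negPf -> //|].
  by apply: HS_ext hs => j /=; rewrite hh eqxx.
have H2 : HS (fun i => if g (g' i) == i then f i else 0) t.
  apply: (HS_zero_ext gg) => [i /negPf -> //|].
  by apply: HS_ext ht => j /=; rewrite gg eqxx.
apply: HS_ext (HS_add H1 H2) => i /=.
by have := hgx i; case: (h _ == i); case: (g _ == i); rewrite ?addr0 ?add0r.
Qed.

Lemma AS_split (I J K : choiceType) (h : J -> I) (h' : I -> J) (g : K -> I) (g' : I -> K)
    (f : I -> C) M N : cancel h h' -> cancel g g' ->
  (forall i, (h (h' i) == i) (+) (g (g' i) == i)) ->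
  AS (f \o h) M -> AS (f \o g) N -> AS f (M + N).
Proof.
move=> hh gg hgx hs ht.
have H1 : AS (fun i => if h (h' i) == i then f i else 0) M.
  apply: (AS_zero_ext hh) => [i /negPf -> //|].
  by apply: AS_ext hs => j /=; rewrite hh eqxx.
have H2 : AS (fun i => if g (g' i) == i then f i else 0) N.
  apply: (AS_zero_ext gg) => [i /negPf -> //|].
  by apply: AS_ext ht => j /=; rewrite gg eqxx.
apply: AS_ext (AS_add H1 H2) => i /=.
by have := hgx i; case: (h _ == i); case: (g _ == i); rewrite ?addr0 ?add0r.
Qed.

Let negzK : cancel Negz (fun n : int => if n is Negz m then m else 0%N).
Proof. by []. Qed.

Let poszK : cancel Posz (fun n : int => if n is Posz m then m else 0%N).
Proof. by []. Qed.

Lemma HS_int (f : int -> C) s t :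
  HS (fun n : nat => f n) s -> HS (fun n => f (Negz n)) t -> HS f (s + t).
Proof. by apply: (HS_split poszK negzK) => -[] n; rewrite eqxx. Qed.

Lemma AS_int (f : int -> C) M N :
  AS (fun n : nat => f n) M -> AS (fun n => f (Negz n)) N -> AS f (M + N).
Proof. by apply: (AS_split poszK negzK) => -[] n; rewrite eqxx. Qed.

Let succK : cancel succn predn. Proof. by []. Qed.
Let zeroK : cancel (fun=> 0%N : nat) (fun=> tt). Proof. by case. Qed.

Lemma HS_natS (f : nat -> C) s : HS (fun n => f n.+1) s -> HS f (s + f 0%N).
Proof.
move=> h; apply: (HS_split succK zeroK _ h) => [[|n]|]; rewrite ?eqxx //.
by apply: (@HS_fin1 _ _ tt) => -[]; rewrite eqxx.
Qed.

Lemma AS_natS (f : nat -> C) M : AS (fun n => f n.+1) M -> AS f (M + ab (f 0%N)).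
Proof.
move=> h; apply: (AS_split succK zeroK _ h) => [[|n]|B]; rewrite ?eqxx //.
have h1 : (B `<=` [fset tt])%fset by apply/fsubsetP => -[]; rewrite inE eqxx.
apply: le_trans (sub_sum_nneg _ h1) _ => [i|]; first exact: ab_ge0.
by rewrite big_seq_fset1.
Qed.

Lemma sum_fsetM (V : zmodType) (I J : choiceType) (A : {fset I}) (B : {fset J}) (f : I * J -> V) :
  \sum_(p <- (A `*` B)%fset) f p = \sum_(i <- A) \sum_(j <- B) f (i, j).
Proof.
rewrite -big_allpairs.
apply: perm_big; apply: uniq_perm; rewrite ?fset_uniq //.
  by apply: allpairs_uniq => //; rewrite ?fset_uniq // => -[a b] [c d].
move=> [i j]; rewrite in_fsetM /=.
apply/idP/allpairsP => [/andP[iA jB]|[[a b] /= [ha hb [-> ->]]]]; first by exists (i, j).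
by rewrite ha hb.
Qed.

(** One finite set of columns has to serve finitely many rows at once; this is the uniformity that
    both Fubini arguments need. *)
Lemma row_approx (I J : choiceType) (f : I * J -> C) (s : I -> C) (A : seq I) (e : R) :
  0 < e -> (forall i, HS (fun j => f (i, j)) (s i)) ->
  exists B : {fset J}, forall D : {fset J}, (B `<=` D)%fset ->
    forall i, i \in A -> ab (\sum_(j <- D) f (i, j) - s i) < e.
Proof.
move=> e0 hs; elim: A => [|i A [B HB]]; first by exists fset0.
have [B' HB'] := hs i _ e0; exists (B `|` B')%fset => D; rewrite fsubUset => /andP[h1 h2] k.
by rewrite inE => /orP[/eqP ->|]; [exact: HB'|exact: HB].
Qed.

Lemma AS_rows (I J : choiceType) (f : I * J -> C) (s : I -> C) M :
  AS f M -> (forall i, HS (fun j => f (i, j)) (s i)) -> AS s M.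
Proof.
move=> hf hs A; rewrite leNgt; apply/negP => h.
(* The successor keeps [k] positive when [A] is empty; each of the rows then receives an equal share
   [e] of the excess. *)
set k := (size (enum_fset A)).+1%:R : R; have k0 : 0 < k by rewrite ltr0n.
pose e := (\sum_(i <- A) ab (s i) - M) / k; have e0 : 0 < e by rewrite divr_gt0 // subr_gt0.
have [B HB] := row_approx (enum_fset A) e0 hs.
have : \sum_(i <- A) ab (s i) <= \sum_(i <- A) (\sum_(j <- B) ab (f (i, j)) + e).
  rewrite big_seq [X in _ <= X]big_seq; apply: ler_sum => i iA.
  have := HB _ (fsubset_refl B) i iA; have := abB_ge (s i) (\sum_(j <- B) f (i, j)).
  have := ab_sum (enum_fset B) xpredT (fun j => f (i, j)); rewrite (abBC (s i)) /= => h1 h2 h3.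
  lra.
rewrite big_split /= -(sum_fsetM _ _ (fun p => ab (f p))) /=.
have := hf (A `*` B)%fset; rewrite big_const_seq count_predT iter_addr_0 -mulr_natr.
have : e * (size (enum_fset A))%:R < e * k by rewrite ltr_pM2l // ltr_nat.
rewrite {2}/e divfK ?gt_eqF //; lra.
Qed.

(** The double sum over a large finite rectangle is close to [S], and each of its finitely many rows
    is within [e / 2 / k] of its own sum. *)
Lemma HS_fubini (I J : choiceType) (f : I * J -> C) (s : I -> C) M S :
  AS f M -> (forall i, HS (fun j => f (i, j)) (s i)) -> HS f S -> HS s S.
Proof.
move=> hf hs hS e e0; have e2 : 0 < e / 2 by lra.
have [A0 HA0] := hS _ e2; exists [fset p.1 | p in A0]%fset => A AA.
set k := (size (enum_fset A)).+1%:R : R; have k0 : 0 < k by rewrite ltr0n.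
have d0 : 0 < e / 2 / k by rewrite divr_gt0.
have [B HB] := row_approx (enum_fset A) d0 hs.
pose D := (B `|` [fset p.2 | p in A0])%fset.
have h1 : (A0 `<=` A `*` D)%fset.
  apply/fsubsetP => p pA; rewrite in_fsetM; apply/andP; split.
    by move/fsubsetP: AA; apply; apply/imfsetP; exists p.
  by rewrite inE; apply/orP; right; apply/imfsetP; exists p.
have := HA0 _ h1; rewrite sum_fsetM => h2.
have h3 : ab (\sum_(i <- A) s i - \sum_(i <- A) \sum_(j <- D) f (i, j)) <= e / 2.
  rewrite -sumrB; apply: le_trans (ab_sum _ _ _) _.
  apply: (@le_trans _ _ (\sum_(i <- A) (e / 2 / k))).
    rewrite big_seq [X in _ <= X]big_seq; apply: ler_sum => i iA.
    by rewrite abBC; apply/ltW/HB => //; exact: fsubsetUl.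
  have -> : \sum_(i <- A) (e / 2 / k) = e / 2 / k * (size (enum_fset A))%:R.
    by rewrite big_const_seq count_predT iter_addr_0 mulr_natr.
  by rewrite mulrAC ler_pdivrMr // ler_wpM2l ?ler_nat //; lra.
by have := ab_dist (\sum_(i <- A) s i) (\sum_(i <- A) \sum_(j <- D) f (i, j)) S; lra.
Qed.

Lemma HS_fubini' (I J : choiceType) (f : I * J -> C) (s : I -> C) M S :
  AS f M -> (forall i, HS (fun j => f (i, j)) (s i)) -> HS s S -> HS f S.
Proof.
move=> hf hs hS; have [S' hS'] := AS_ex hf.
by rewrite (HS_uniq hS (HS_fubini hf hs hS')).
Qed.

Lemma AS_prod (I J : choiceType) (f : I -> C) (g : J -> C) M N :
  AS f M -> AS g N -> AS (fun p : I * J => f p.1 * g p.2) (M * N).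
Proof.
move=> hf hg B.
have BS : (B `<=` [fset p.1 | p in B] `*` [fset p.2 | p in B])%fset.
  by apply/fsubsetP => p pB; rewrite in_fsetM; apply/andP; split; apply/imfsetP; exists p.
apply: le_trans (sub_sum_nneg _ BS) _ => [i|]; first exact: ab_ge0.
rewrite sum_fsetM /=; under eq_bigr do (under eq_bigr do rewrite abM; rewrite -big_distrr /=).
rewrite -big_distrl /=; apply: ler_pM => //; apply: sumr_ge0 => *; exact: ab_ge0.
Qed.

(** Connects [HS] with the limit along finite sets that occurs in the definition of [wp]; limits are
    unique because the plane is Hausdorff. *)
Lemma HS_sum (I : choiceType) (f : I -> C) M s :
  AS f M -> HS f s -> summability.sum f = s.
Proof.
move=> _ hs.
apply: (@cvg_lim _ (@norm_hausdorff _ _) _ totally (totally_filter (I := I))).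
apply/(@cvgatP _ _ totally (totally_filter (I := I))) => e /hs[A HA]; exists A => // B /= /HA.
by rewrite /partial_sum -(big_seq_fsetE _ _ xpredT f).
Qed.

Lemma AS_nat (f : nat -> C) M : (forall n, \sum_(i < n) ab (f i) <= M) -> AS f M.
Proof.
move=> h B; apply: le_trans (h (\max_(i <- B) i).+1).
rewrite -(big_mkord xpredT (fun i => ab (f i))) /=.
pose D := [fset i | i in index_iota 0 (\max_(i <- B) i).+1]%fset.
have BD : (B `<=` D)%fset.
  apply/fsubsetP => i iB; apply/imfsetP; exists i => //=.
  by rewrite /= mem_index_iota /= ltnS; apply: (@leq_bigmax_seq _ _ xpredT (fun i => i)).
apply: le_trans (sub_sum_nneg _ BD) _ => [i|]; first exact: ab_ge0.
rewrite le_eqVlt; apply/orP; left; apply/eqP; apply: perm_big.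
apply: uniq_perm; rewrite ?fset_uniq ?iota_uniq // => i.
by apply/imfsetP/idP => [[j /= hj ->] //|hi]; exists i.
Qed.

Lemma AS_geo (x : C) : ab x < 1 -> AS (fun n => x ^+ n) (1 - ab x)^-1.
Proof.
move=> h; apply: AS_nat => n; under eq_bigr do rewrite abX.
have h0 : 0 < 1 - ab x by lra.
rewrite -[X in _ <= X]mul1r ler_pdivlMr // mulrC.
have := subrX1 (ab x) n; rewrite -opprB -[ab x - 1]opprB mulNr => /oppr_inj <-.
by have := exprn_ge0 n (ab_ge0 x); lra.
Qed.

(** A sum [s] exists by absolute summability, and separating the term of index 0 gives
    [s = x * s + 1]. *)
Lemma HS_geo (x : C) : ab x < 1 -> HS (fun n => x ^+ n) (1 - x)^-1.
Proof.
move=> h; have [s hs] := AS_ex (AS_geo h).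
have := HS_scale x hs; under [fun i => _]funext do rewrite -exprS.
move=> /(@HS_natS (fun n => x ^+ n)) /(HS_uniq hs) e.
have x1 : 1 - x != 0.
  by rewrite subr_eq0; apply/eqP => e1; move: h; rewrite -e1 ab1 ltxx.
suff -> : (1 - x)^-1 = s by [].
by apply: (mulfI x1); rewrite divff //; rewrite expr0 in e; rewrite mulrBl mul1r {1}e; ring.
Qed.

End UnorderedSums.

(** * Power series with a submultiplicative norm *)

Section Analytic.
Variable R : realType.
Local Notation C := R[i].

Definition coefs (f : C -> C) (z0 : C) (r M : R) (a : nat -> C) : Prop :=
  [/\ 0 < r, AS (fun n => a n * r%:C ^+ n) M
    & forall h, ab h <= r -> HS (fun n => a n * h ^+ n) (f (z0 + h))].

(* [M] bounds the sum of [|a_n| r^n], a submultiplicative norm: products and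
   inverses of power series are then handled as in a Banach algebra. *)
Definition ana (f : C -> C) (z0 : C) (r M : R) : Prop := exists a, coefs f z0 r M a.

Lemma abrX (r : R) n : 0 <= r -> ab (r%:C ^+ n) = r ^+ n.
Proof. by move=> r0; rewrite abX abR ger0_norm. Qed.

Lemma coefs_AS f z0 r M a h : coefs f z0 r M a -> ab h <= r -> AS (fun n => a n * h ^+ n) M.
Proof.
move=> [r0 aM _] hr; apply: AS_le aM => n; rewrite !abM ler_wpM2l ?ab_ge0 //.
rewrite abX abrX; last exact: ltW.
by apply: lerXn2r => //; rewrite nnegrE ?ab_ge0 // ltW.
Qed.

Lemma ana_gt0 f z0 r M : ana f z0 r M -> 0 < r.
Proof. by case=> a []. Qed.

Lemma ana_bound f z0 r M z : ana f z0 r M -> ab (z - z0) <= r -> ab (f z) <= M.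
Proof.
move=> [a H] hz; have [_ _ /(_ _ hz)] := H; rewrite subrKC.
exact: HS_bound (coefs_AS H hz).
Qed.

Lemma ana_ge0 f z0 r M : ana f z0 r M -> 0 <= M.
Proof. by case=> a [_ /AS_ge0]. Qed.

Lemma coefs_le f z0 r M a r' M' : 0 < r' -> r' <= r -> M <= M' ->
  coefs f z0 r M a -> coefs f z0 r' M' a.
Proof.
move=> r0' rr MM H; split=> // [B|h hr]; last by case: H => _ _; apply; lra.
apply: le_trans (coefs_AS (h := r'%:C) H _ B) MM.
by rewrite abR gtr0_norm.
Qed.

Lemma ana_le f z0 r M r' M' : 0 < r' -> r' <= r -> M <= M' -> ana f z0 r M -> ana f z0 r' M'.
Proof. by move=> h1 h2 h3 [a H]; exists a; exact: coefs_le H. Qed.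

Lemma ana_ext f g z0 r M : (forall z, ab (z - z0) <= r -> f z = g z) ->
  ana f z0 r M -> ana g z0 r M.
Proof.
move=> fg [a [r0 aM H]]; exists a; split=> // h hr.
by rewrite -fg; [exact: H|rewrite addrAC subrr add0r].
Qed.

Lemma ana_cst c z0 r : 0 < r -> ana (fun=> c) z0 r (ab c).
Proof.
move=> r0; exists (fun n => if n is 0 then c else 0); split=> // [B|h hr].
  have H : HS (fun n => (ab ((if n is 0 then c else 0) * r%:C ^+ n))%:C) (ab c)%:C.
    have := @HS_fin1 R _ (fun n => (ab ((if n is 0 then c else 0) * r%:C ^+ n))%:C) 0%N.
    by rewrite expr0 mulr1; apply => -[|n] // _; rewrite mul0r ab0.
  rewrite leNgt; apply/negP => h.
  have [//|A HA] := H (\sum_(i <- B) ab ((if i is 0 then c else 0) * r%:C ^+ i) - ab c).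
    by rewrite subr_gt0.
  have := HA (A `|` B)%fset (fsubsetUl _ _).
  rewrite -rmorph_sum -rmorphB abR.
  have := @sub_sum_nneg R _ (fun n => ab ((if n is 0 then c else 0) * r%:C ^+ n)) B (A `|` B)%fset
    (fun=> ab_ge0 _) (fsubsetUr _ _) => h1.
  rewrite ger0_norm; lra.
have := @HS_fin1 R _ (fun n => (if n is 0 then c else 0) * h ^+ n) 0%N.
by rewrite expr0 mulr1; apply => -[|n] // _; rewrite mul0r.
Qed.

Lemma coefs_add f g z0 r M N a b : coefs f z0 r M a -> coefs g z0 r N b ->
  coefs (fun z => f z + g z) z0 r (M + N) (fun n => a n + b n).
Proof.
move=> [r0 aM aH] [_ bM bH]; split=> //.
  by apply: AS_ext (AS_add aM bM) => n; rewrite mulrDl.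
by move=> h hr; apply: HS_ext (HS_add (aH h hr) (bH h hr)) => n; rewrite mulrDl.
Qed.

Lemma ana_add f g z0 r M N : ana f z0 r M -> ana g z0 r N ->
  ana (fun z => f z + g z) z0 r (M + N).
Proof. by move=> [a Ha] [b Hb]; exists (fun n => a n + b n); exact: coefs_add. Qed.

(** The Weierstrass theorem on sums of analytic functions: the two summations are exchanged by
    Fubini. Products, inverses and changes of centre are all instances of it. *)
Lemma ana_sum (I : choiceType) (f : I -> C -> C) (F : C -> C) z0 r (N : I -> R) M :
  0 < r -> (forall i, ana (f i) z0 r (N i)) ->
  (forall A : {fset I}, \sum_(i <- A) N i <= M) ->
  (forall z, ab (z - z0) <= r -> HS (fun i => f i z) (F z)) -> ana F z0 r M.
Proof.
move=> r0 hf hN hF; pose a i := projT1 (cid (hf i)).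
have Ha i : coefs (f i) z0 r (N i) (a i) by rewrite /a; case: cid.
have hAS h : ab h <= r -> AS (fun p : I * nat => a p.1 p.2 * h ^+ p.2) M.
  move=> hr B.
  have BS : (B `<=` [fset p.1 | p in B] `*` [fset p.2 | p in B])%fset.
    by apply/fsubsetP => p pB; rewrite in_fsetM; apply/andP; split; apply/imfsetP; exists p.
  apply: le_trans (sub_sum_nneg _ BS) _ => [i|]; first exact: ab_ge0.
  rewrite sum_fsetM; apply: le_trans (hN [fset p.1 | p in B]%fset); apply: ler_sum => i _.
  exact: (coefs_AS (Ha i) hr).
have swapK : cancel (fun p : nat * I => (p.2, p.1)) (fun p => (p.2, p.1)) by case.
have swapK' : cancel (fun p : I * nat => (p.2, p.1)) (fun p => (p.2, p.1)) by case.
have hASs h : ab h <= r -> AS (fun p : nat * I => a p.2 p.1 * h ^+ p.1) M.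
  by move=> /hAS; apply: (AS_inj (h := fun p : nat * I => (p.2, p.1))) => -[? ?] [? ?] [-> ->].
have rr : ab r%:C <= r by rewrite abR ger0_norm // ltW.
have rn0 n : r%:C ^+ n != 0 :> C by rewrite expf_neq0 // (inj_eq (@complexI R) r 0) gt_eqF.
have hb n : exists s, HS (fun i => a i n * r%:C ^+ n) s.
  apply: (AS_ex (M := M)).
  by apply: (AS_inj (h := fun i => (n, i)) _ (hASs _ rr)) => ? ? [].
(* The coefficient sum is taken at the point [r], where the norms give summability, and then divided
   by [r ^+ n]. *)
pose b n := projT1 (cid (hb n)) / r%:C ^+ n.
have Hb h n : HS (fun i => a i n * h ^+ n) (b n * h ^+ n).
  rewrite /b; case: cid => s /= /(HS_scale ((r%:C)^-1 ^+ n * h ^+ n)) hs.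
  have -> : s / r%:C ^+ n * h ^+ n = (r%:C)^-1 ^+ n * h ^+ n * s.
    by rewrite exprVn; ring.
  by apply: HS_ext hs => i; rewrite exprVn; field.
exists b; split=> //.
  by apply: (AS_rows (hASs _ rr)) => n; exact: Hb.
move=> h hr; apply: (HS_fubini (hASs _ hr)) => [n|]; first exact: Hb.
have hz : ab (z0 + h - z0) <= r by rewrite addrAC subrr add0r.
have := HS_fubini' (hAS _ hr) _ (hF _ hz) => /(_ (fun i => let: And3 _ _ H := Ha i in H h hr)) H.
by apply: (HS_bij swapK' swapK); apply: HS_ext H => -[].
Qed.

Lemma ana_shift g z0 r M c k : ana g z0 r M ->
  ana (fun z => c * (z - z0) ^+ k * g z) z0 r (ab c * r ^+ k * M).
Proof.
move=> [a H]; have [r0 aM aH] := H.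
pose b n := if (n < k)%N then 0 else c * a (n - k)%N.
have kK : cancel (addn k) (subn^~ k) by move=> n; rewrite addKn.
have bz n x : (k + (n - k))%N != n -> b n * x ^+ n = 0.
  rewrite /b; case: ltnP => [|h]; first by rewrite mul0r.
  by rewrite subnKC // eqxx.
have bE x n : b (k + n)%N * x ^+ (k + n) = c * x ^+ k * (a n * x ^+ n).
  by rewrite /b ltnNge leq_addr /= addKn exprD; ring.
exists b; split=> //.
  apply: (AS_zero_ext kK) => [n|]; first exact: bz.
  rewrite -(abrX k (ltW r0)) -abM.
  by apply: AS_ext (AS_scale (c * r%:C ^+ k) aM) => n /=; rewrite bE.
move=> h hr; apply: (HS_zero_ext kK) => [n|]; first exact: bz.
have := HS_scale (c * h ^+ k) (aH _ hr).
have -> : z0 + h - z0 = h by ring.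
by apply: HS_ext => n /=; rewrite bE.
Qed.

(** The product is read as the sum over [n] of the monomials of [f] times [g], so it follows from
    [ana_sum] and [ana_shift], with the Cauchy product hidden in the former. *)
Lemma ana_mul f g z0 r M N : ana f z0 r M -> ana g z0 r N ->
  ana (fun z => f z * g z) z0 r (M * N).
Proof.
move=> [a [r0 aM aH]] hg; have N0 := ana_ge0 hg.
apply: (ana_sum (f := fun i z => a i * (z - z0) ^+ i * g z)
    (N := fun i => ab (a i) * r ^+ i * N)) => // [i|A|z hz].
- exact: ana_shift.
- rewrite -big_distrl /= ler_wpM2r //; apply: le_trans (aM A).
  by apply: ler_sum => i _; rewrite abM abrX //; exact: ltW.
- have := HS_scale (g z) (aH _ hz); rewrite subrKC [_ * f z]mulrC.
  by apply: HS_ext => n; rewrite mulrC.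
Qed.

Lemma ana_exp f z0 r M k : ana f z0 r M -> ana (fun z => f z ^+ k) z0 r (M ^+ k).
Proof.
move=> hf; elim: k => [|k IH]; last first.
  rewrite exprS; apply: ana_ext (ana_mul hf IH) => z _; by rewrite exprS.
by have := ana_cst 1 z0 (ana_gt0 hf); rewrite ab1; apply: ana_ext.
Qed.

Lemma ana_X z0 r : 0 < r -> ana (fun z => z - z0) z0 r r.
Proof.
move=> r0; have := ana_shift 1 1 (ana_cst 1 z0 r0).
rewrite ab1 mul1r expr1 mulr1; apply: ana_ext => z _.
by rewrite mul1r expr1 mulr1.
Qed.

Lemma ana_id z0 r : 0 < r -> ana (fun z => z) z0 r (ab z0 + r).
Proof.
by move=> r0; apply: ana_ext (ana_add (ana_cst z0 z0 r0) (ana_X z0 r0)) => z _; rewrite subrKC.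
Qed.

Lemma sum_geo_le (t : R) (A : {fset nat}) : 0 <= t < 1 -> \sum_(i <- A) t ^+ i <= (1 - t)^-1.
Proof.
move=> /andP[t0 t1].
have := @AS_geo R t%:C; rewrite abR ger0_norm // => /(_ t1 A).
by under eq_bigr do rewrite abrX //.
Qed.

(** Neumann series: [g] has norm at most [t], which is smaller than [ab c], so the powers of [g / c]
    are dominated by a geometric series. *)
Lemma ana_invB g z0 r c t : ana g z0 r t -> t < ab c ->
  ana (fun z => (c - g z)^-1) z0 r (ab c - t)^-1.
Proof.
move=> hg tc; have t0 := ana_ge0 hg; have r0 := ana_gt0 hg.
have c0 : 0 < ab c by lra.
have cn0 : c != 0 by rewrite -ab_gt0.
have tc1 : 0 <= t / ab c < 1 by rewrite divr_ge0 ?ab_ge0 //= ltr_pdivrMr // mul1r.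
apply: (ana_sum (f := fun k z => c^-1 * (g z / c) ^+ k)
    (N := fun k => (ab c)^-1 * (t / ab c) ^+ k)) => // [k|A|z hz].
- rewrite -abV; apply: ana_mul; first exact: ana_cst.
  by apply: ana_exp; apply: ana_mul => //; exact: ana_cst.
- rewrite -big_distrr /=.
  have -> : (ab c - t)^-1 = (ab c)^-1 * (1 - t / ab c)^-1.
    by rewrite -invfM; congr _^-1; field; rewrite gt_eqF.
  by rewrite ler_wpM2l ?invr_ge0 ?ab_ge0 // sum_geo_le.
- have hx : ab (g z / c) < 1.
    have := ana_bound hg hz; rewrite abM abV => h.
    by rewrite ltr_pdivrMr // mul1r; lra.
  have := HS_scale c^-1 (HS_geo hx); rewrite -invfM.
  by have -> : c * (1 - g z / c) = c - g z by field.
Qed.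

(** Each monomial in [z - z0] is a power of [(z1 - z0) + (z - z1)], whose norm is at most
    [ab (z1 - z0) + r'], hence at most [r]. *)
Lemma ana_recenter f z0 r M z1 r' : ana f z0 r M -> 0 < r' -> ab (z1 - z0) + r' <= r ->
  ana f z1 r' M.
Proof.
move=> [a H] r0' hr; have [r0 aM aH] := H.
apply: (ana_sum (f := fun n z => a n * (z - z0) ^+ n)
    (N := fun n => ab (a n) * (ab (z1 - z0) + r') ^+ n)) => // [n|A|z hz].
- apply: ana_mul; first exact: ana_cst.
  apply: ana_exp; have := ana_add (ana_cst (z1 - z0) z1 r0') (ana_X z1 r0').
  by apply: ana_ext => z _; ring.
- apply: le_trans (aM A); apply: ler_sum => n _; rewrite abM abrX; last exact: ltW.
  have := ab_ge0 (z1 - z0) => h0.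
  by apply: ler_wpM2l; rewrite ?ab_ge0 //; apply: lerXn2r => //; rewrite nnegrE; lra.
- have := aH (z - z0); rewrite subrKC; apply.
  by have := ab_dist z z1 z0; lra.
Qed.

(** Dividing [f - f z0] by [z - z0] shifts the coefficients; at the centre itself the quotient is
    given the value of the derivative, the coefficient of index 1. *)
Lemma coefs_slope f z0 r M a : coefs f z0 r M a ->
  coefs (fun z => if z == z0 then a 1%N else (f z - a 0%N) / (z - z0)) z0 r (M / r)
    (fun n => a n.+1).
Proof.
move=> [r0 aM aH]; have rn0 : r%:C != 0 :> C by rewrite (inj_eq (@complexI R) r 0) gt_eqF.
split=> //.
  have := AS_scale (r%:C)^-1 (AS_inj (h := succn) (@succn_inj) aM).
  rewrite abV abR gtr0_norm // mulrC.
  by apply: AS_ext => n /=; rewrite exprS; field.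
move=> h hr; have [-> | hn] := eqVneq h 0.
  rewrite addr0 eqxx.
  have := @HS_fin1 R _ (fun n => a n.+1 * 0 ^+ n) 0%N.
  by rewrite expr0 mulr1; apply => -[|n] // _; rewrite expr0n mulr0.
have -> : (z0 + h == z0) = false by rewrite -subr_eq0 addrAC subrr add0r (negPf hn).
have -> : z0 + h - z0 = h by ring.
have [s hs] := AS_ex (AS_inj (h := succn) (@succn_inj) (coefs_AS (And3 r0 aM aH) hr)).
have /(HS_uniq (aH _ hr)) := HS_natS hs; rewrite expr0 mulr1 => ->.
rewrite addrK mulrC; apply: HS_ext (HS_scale h^-1 hs) => n /=.
by rewrite exprS; field.
Qed.

Lemma coefs0 f z0 r M a : coefs f z0 r M a -> f z0 = a 0%N.
Proof.
move=> [r0 aM aH]; have := aH 0; rewrite ab0 addr0 => /(_ (ltW r0)) h.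
apply: (HS_uniq h); have := @HS_fin1 R _ (fun n => a n * 0 ^+ n) 0%N.
by rewrite expr0 mulr1; apply => -[|n] // _; rewrite expr0n mulr0.
Qed.

Definition Ana (f : C -> C) (z0 : C) : Prop := exists r M, ana f z0 r M.

Lemma Ana_ext f g z0 : (exists2 d, 0 < d & forall z, ab (z - z0) < d -> f z = g z) ->
  Ana f z0 -> Ana g z0.
Proof.
move=> [d d0 fg] [r [M H]]; have r0 := ana_gt0 H.
exists (Num.min (d / 2) r), M.
have m0 : 0 < Num.min (d / 2) r by rewrite lt_min r0 andbT; lra.
apply: ana_ext (ana_le m0 _ (lexx M) H) => [z|]; last by rewrite ge_min lexx orbT.
by rewrite le_min => /andP[h _]; apply: fg; lra.
Qed.

Lemma Ana_eq f g z0 : f =1 g -> Ana f z0 -> Ana g z0.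
Proof. by move=> fg; apply: Ana_ext; exists 1. Qed.

Lemma Ana_common f g z0 : Ana f z0 -> Ana g z0 ->
  exists r M N, ana f z0 r M /\ ana g z0 r N.
Proof.
move=> [r [M H]] [s [N K]]; have r0 := ana_gt0 H; have s0 := ana_gt0 K.
have m0 : 0 < Num.min r s by rewrite lt_min r0.
exists (Num.min r s), M, N; split.
  by apply: (ana_le m0 _ (lexx _) H); rewrite ge_min lexx.
by apply: (ana_le m0 _ (lexx _) K); rewrite ge_min lexx orbT.
Qed.

Lemma Ana_cst c z0 : Ana (fun=> c) z0.
Proof. by exists 1, (ab c); exact: ana_cst. Qed.

Lemma Ana_id z0 : Ana (fun z => z) z0.
Proof. by exists 1, (ab z0 + 1); exact: ana_id. Qed.

Lemma Ana_add f g z0 : Ana f z0 -> Ana g z0 -> Ana (fun z => f z + g z) z0.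
Proof.
move=> hf hg; have [r [M [N [h1 h2]]]] := Ana_common hf hg.
by exists r, (M + N); exact: ana_add.
Qed.

Lemma Ana_mul f g z0 : Ana f z0 -> Ana g z0 -> Ana (fun z => f z * g z) z0.
Proof.
move=> hf hg; have [r [M [N [h1 h2]]]] := Ana_common hf hg.
by exists r, (M * N); exact: ana_mul.
Qed.

Lemma Ana_opp f z0 : Ana f z0 -> Ana (fun z => - f z) z0.
Proof. by move=> h; apply: Ana_eq (Ana_mul (Ana_cst (-1) z0) h) => z; rewrite mulN1r. Qed.

Lemma Ana_sub f g z0 : Ana f z0 -> Ana g z0 -> Ana (fun z => f z - g z) z0.
Proof. by move=> hf /Ana_opp; exact: Ana_add. Qed.

Lemma Ana_exp f z0 k : Ana f z0 -> Ana (fun z => f z ^+ k) z0.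
Proof. by move=> [r [M H]]; exists r, (M ^+ k); exact: ana_exp. Qed.

Lemma Ana_near f z0 : Ana f z0 -> exists2 d, 0 < d & forall z, ab (z - z0) < d -> Ana f z.
Proof.
move=> [r [M H]]; have r0 := ana_gt0 H; exists r => // z hz.
by exists (r - ab (z - z0)), M; apply: (ana_recenter H); lra.
Qed.

(** The factorization that replaces derivatives in most arguments below. It holds for every [z],
    also far from [z0], since [g] is the divided difference there. *)
Lemma Ana_slope f z0 : Ana f z0 -> exists g, Ana g z0 /\ forall z, f z = f z0 + (z - z0) * g z.
Proof.
move=> [r [M [a H]]]; have := coefs_slope H; set g := (fun z => _) => Hg.
exists g; split; first by exists r, (M / r), (fun n => a n.+1).
move=> z; rewrite /g (coefs0 H); have [->|h] := eqVneq z z0.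
  by rewrite subrr mul0r addr0 (coefs0 H).
by rewrite mulrC divfK ?subr_eq0 // subrKC.
Qed.

Lemma Ana_bound f z0 : Ana f z0 -> exists d M : R, 0 < d /\ forall z, ab (z - z0) < d -> ab (f z) <= M.
Proof.
move=> [r [M H]]; exists r, M; split; first exact: ana_gt0 H.
by move=> z hz; apply: (ana_bound H); exact: ltW.
Qed.

Lemma Ana_cont f z0 : Ana f z0 -> {for z0, continuous f}.
Proof.
move=> /Ana_slope[g [/Ana_bound[d [M [d0 hM]]] fE]]; apply/contP => e e0.
have M0 : 0 <= M by apply: le_trans (ab_ge0 _) (hM z0 _); rewrite subrr ab0.
exists (Num.min d (e / (M + 1))); first by rewrite lt_min d0 divr_gt0 //; lra.
move=> z; rewrite lt_min => /andP[zd].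
rewrite ltr_pdivlMr; last lra.
move=> h; rewrite fE [_ + _ * _]addrC addrK abM; apply: le_lt_trans h.
by rewrite ler_wpM2l ?ab_ge0 //; have := hM _ zd; lra.
Qed.

(** On a disc of radius [s] the deviation from [f z0] has norm at most [s * M]; shrinking [s] makes
    it less than [ab (f z0)], and the Neumann series applies. *)
Lemma Ana_inv f z0 : Ana f z0 -> f z0 != 0 -> Ana (fun z => (f z)^-1) z0.
Proof.
move=> /Ana_slope[g [[r [M H]] fE]] f0; have r0 := ana_gt0 H; have M0 := ana_ge0 H.
have c0 : 0 < ab (f z0) by rewrite ab_gt0.
pose s := Num.min r (ab (f z0) / 2 / (M + 1)).
have s0 : 0 < s by rewrite lt_min r0 !divr_gt0 //; lra.
have sr : s <= r by rewrite ge_min lexx.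
have sM : s * M < ab (f z0).
  have : s <= ab (f z0) / 2 / (M + 1) by rewrite ge_min lexx orbT.
  rewrite ler_pdivlMr; last lra.
  by nra.
have hg := ana_mul (ana_cst (-1) z0 s0) (ana_mul (ana_X z0 s0) (ana_le s0 sr (lexx M) H)).
rewrite abN ab1 mul1r in hg.
exists s, (ab (f z0) - s * M)^-1; apply: ana_ext (ana_invB hg sM) => z _.
by rewrite (fE z); congr _^-1; ring.
Qed.

Lemma Ana_div f g z0 : Ana f z0 -> Ana g z0 -> g z0 != 0 -> Ana (fun z => f z / g z) z0.
Proof. by move=> hf hg g0; apply: Ana_mul => //; exact: Ana_inv. Qed.

Lemma Ana_scale f c z0 : c != 0 -> Ana f (c * z0) -> Ana (fun z => f (c * z)) z0.
Proof.
move=> c0 [r [M [a H]]]; have [r0 aM aH] := H; have c0' : 0 < ab c by rewrite ab_gt0.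
exists (r / ab c), M, (fun n => a n * c ^+ n).
have r1 : 0 < r / ab c by rewrite divr_gt0.
split; [exact: r1| |move=> h hr].
  apply: AS_le aM => n; rewrite !abM abX !abrX; try exact: ltW.
  rewrite -mulrA -exprMn.
  by rewrite mulrCA divff ?mulr1 ?gt_eqF.
rewrite mulrDr; apply: HS_ext (aH (c * h) _) => [n|].
  by rewrite exprMn mulrA.
by rewrite abM mulrC -ler_pdivlMr.
Qed.

(** The order of vanishing is the least index of a nonzero coefficient, and each passage to the
    slope removes one factor [z - z0]. *)
Lemma Ana_factor f z0 : Ana f z0 ->
  (exists2 d : R, 0 < d & forall z, ab (z - z0) < d -> f z = 0) \/
  (exists k g, [/\ Ana g z0, g z0 != 0 & forall z, f z = (z - z0) ^+ k * g z]).
Proof.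
move=> [r [M [a H]]].
have [h|h] := pselect (forall n, a n = 0).
  left; exists r; first by case: H.
  move=> z hz; have [_ _ /(_ _ (ltW hz))] := H; rewrite subrKC => /HS_uniq; apply.
  by apply: HS_ext (@HS0 R _) => n; rewrite h mul0r.
right; have ex : exists n, a n != 0.
  by apply: contrapT => h'; apply: h => n; apply/eqP/negPn/negP => an; apply: h'; exists n.
case: (ex_minnP ex) => k; clear h ex.
elim: k f M a H => [|k IH] f M a H ak mk.
  exists 0%N, f; split; first by exists r, M, a.
    by rewrite (coefs0 H).
  by move=> z; rewrite expr0 mul1r.
have a0 : a 0%N = 0 by apply/eqP/negPn/negP => /mk.
have hm n : a n.+1 != 0 -> (k <= n)%N by move/mk; rewrite ltnS.
have [j [g [hg g0 gE]]] := IH _ _ _ (coefs_slope H) ak hm.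
exists j.+1, g; split=> // z; rewrite exprS -mulrA -gE.
have [->|zn] := eqVneq z z0; first by rewrite (coefs0 H) a0 subrr mul0r.
by rewrite a0 subr0 mulrCA divff ?mulr1 ?subr_eq0.
Qed.

Lemma Ana_derivable f z0 : Ana f z0 -> derivable f z0 1.
Proof.
move=> /Ana_slope[g [/Ana_cont/contP gc fE]].
apply/cvg_ex; exists (g z0); apply/(@cvgatP _ _ (0^')) => e /gc[d d0 H].
apply/dnearP; exists d => // h h0; rewrite subr0 => hd.
have -> : (f \o shift z0) h%:A = f z0 + h * g (h + z0).
  by rewrite /= [h%:A]mulr1 fE addrK.
rewrite [f z0 + _]addrC addrK.
have -> : h^-1 *: (h * g (h + z0)) = g (h + z0) by apply: mulKf.
by apply: H; rewrite addrK.
Qed.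

Lemma Ana_holomorphic f z0 : Ana f z0 -> holomorphic_at f z0.
Proof.
by move=> /Ana_near[d d0 H]; apply/nearP; exists d => // z /H; exact: Ana_derivable.
Qed.

End Analytic.

(** * Identity theorem, open mapping, inverse functions and the Liouville theorem *)

Section FunctionTheory.
Variable R : realType.
Local Notation C := R[i].

Lemma Ana_const_or_factor (f : C -> C) z0 : Ana f z0 ->
  (exists2 d : R, 0 < d & forall z, ab (z - z0) < d -> f z = f z0) \/
  (exists k g, [/\ Ana g z0, g z0 != 0 & forall z, f z = f z0 + (z - z0) ^+ k.+1 * g z]).
Proof.
move=> hf; have [[d d0 h]|[k [g [hg g0 fE]]]] := Ana_factor (Ana_sub hf (Ana_cst (f z0) z0)).
  by left; exists d => // z /h /eqP; rewrite subr_eq0 => /eqP.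
right; case: k fE => [|k] fE.
  by have := fE z0; rewrite subrr expr0 mul1r => /eqP; rewrite eq_sym (negPf g0).
by exists k, g; split=> // z; rewrite -fE subrKC.
Qed.

Lemma Ana_near_ball (f : C -> C) z0 e : Ana f z0 -> 0 < e ->
  exists2 d : R, 0 < d & forall z, ab (z - z0) < d -> ab (f z - f z0) < e.
Proof. by move=> /Ana_cont/contP h /h. Qed.

Lemma Ana_near_neq0 (f : C -> C) z0 : Ana f z0 -> f z0 != 0 ->
  exists2 d : R, 0 < d & forall z, ab (z - z0) < d -> f z != 0.
Proof.
move=> hf f0; have e0 : 0 < ab (f z0) by rewrite ab_gt0.
have [d d0 H] := Ana_near_ball hf e0; exists d => // z /H h.
by apply: contraTneq h => ->; rewrite sub0r abN ltxx.
Qed.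

(** Isolated zeros, phrased as the alternative that the continuation arguments along segments
    consume. *)
Lemma Ana_dichotomy (f : C -> C) z0 c : Ana f z0 ->
  exists2 d : R, 0 < d & (forall z, ab (z - z0) < d -> f z = c) \/
    (forall z, z != z0 -> ab (z - z0) < d -> f z != c).
Proof.
move=> hf; have hfc := Ana_sub hf (Ana_cst c z0).
have [[d d0 h]|[k [g [hg g0 fE]]]] := Ana_factor hfc.
  by exists d => //; left=> z /h /eqP; rewrite subr_eq0 => /eqP.
have [d d0 H] := Ana_near_neq0 hg g0; exists d => //; right=> z zz /H gz.
by rewrite -subr_eq0 fE mulf_neq0 // expf_neq0 // subr_eq0.
Qed.

(* Moving along a suitable k-th root direction changes |f| to first order. *)
Lemma Ana_move (f : C -> C) z0 k (g : C -> C) (s d : R) : Ana g z0 -> g z0 != 0 ->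
  (forall z, f z = f z0 + (z - z0) ^+ k.+1 * g z) -> 0 < d ->
  exists2 t : R, 0 < t < 1 & exists2 z, ab (z - z0) < d &
    ab (f z - f z0 * (1 + (s * t)%:C)) <= ab (f z0) * `|s| * t / 2.
Proof.
move=> hg g0 fE d0.
(* With this root, moving by [t * rho] changes [f] to leading order by [s * t ^+ k.+1 * f z0]; the
   parameter of the statement is therefore [t ^+ k.+1]. *)
pose rho := k.+1.-root (s%:C * f z0 / g z0).
have rhoK : rho ^+ k.+1 = s%:C * f z0 / g z0 by rewrite rootCK.
have e0 : 0 < ab (g z0) / 2 by rewrite divr_gt0 // ab_gt0.
have [d1 d10 H] := Ana_near_ball hg e0.
pose m := Num.min d d1; have m0 : 0 < m by rewrite lt_min d0.
have rho1 : 0 < ab rho + 1 by have := ab_ge0 rho; lra.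
pose t := Num.min (m / (ab rho + 1)) (1 / 2).
have t0 : 0 < t by rewrite lt_min divr_gt0 //=; lra.
have t1 : t < 1.
  have : t <= 1 / 2 by rewrite ge_min lexx orbT.
  lra.
have tr : t * ab rho < m.
  have : t <= m / (ab rho + 1) by rewrite ge_min lexx.
  by rewrite ler_pdivlMr // mulrDr mulr1; lra.
exists (t ^+ k.+1); first by rewrite exprn_gt0 //= exprn_ilt1 // ltW.
have zz : ab (z0 + t%:C * rho - z0) < m by rewrite addrAC subrr add0r abM abR gtr0_norm.
exists (z0 + t%:C * rho); first by apply: lt_le_trans zz _; rewrite ge_min lexx.
set z := z0 + _ in zz *.
have zd1 : ab (z - z0) < d1 by apply: lt_le_trans zz _; rewrite ge_min lexx orbT.
have -> : f z - f z0 * (1 + (s * t ^+ k.+1)%:C) =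
    f z0 * s%:C * (t ^+ k.+1)%:C * ((g z - g z0) / g z0).
  rewrite fE; have -> : z - z0 = t%:C * rho by rewrite /z; ring.
  by rewrite exprMn rhoK rmorphM !rmorphXn /=; field.
have tk0 : 0 <= t ^+ k.+1 by rewrite exprn_ge0 // ltW.
rewrite !abM !abR abV (ger0_norm tk0).
rewrite ler_wpM2l ?mulr_ge0 ?ab_ge0 //.
rewrite ler_pdivrMr ?ab_gt0 //; have := H _ zd1; lra.
Qed.

(** Minimum modulus principle: [Ana_move] with [s = -1] moves the value towards 0, and the error of
    half the step cannot undo the decrease. *)
Lemma Ana_decrease (f : C -> C) z0 d : Ana f z0 -> f z0 != 0 -> 0 < d ->
  (exists2 e : R, 0 < e & forall z, ab (z - z0) < e -> f z = f z0) \/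
  (exists2 z, ab (z - z0) < d & ab (f z) < ab (f z0)).
Proof.
move=> hf f0 d0; case: (Ana_const_or_factor hf) => [h|[k [g [hg g0 fE]]]]; first by left.
right; have [t /andP[t0 t1] [z zd hz]] := Ana_move (-1) hg g0 fE d0.
exists z => //; have F0 : 0 < ab (f z0) by rewrite ab_gt0.
have := abD (f z - f z0 * (1 + (-1 * t)%:C)) (f z0 * (1 + (-1 * t)%:C)); rewrite subrK.
have -> : 1 + (-1 * t)%:C = (1 - t)%:C :> C by rewrite mulN1r rmorphB rmorphN rmorph1.
rewrite [ab (f z0 * _)]abM abR ger0_norm; last lra.
move: hz; have -> : 1 + (-1 * t)%:C = (1 - t)%:C :> C by rewrite mulN1r rmorphB rmorphN rmorph1.
rewrite normrN normr1 mulr1; nra.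
Qed.

Lemma Ana_increase (f : C -> C) z0 d : Ana f z0 -> f z0 != 0 -> 0 < d ->
  (exists2 e : R, 0 < e & forall z, ab (z - z0) < e -> f z = f z0) \/
  (exists2 z, ab (z - z0) < d & ab (f z0) < ab (f z)).
Proof.
move=> hf f0 d0; case: (Ana_const_or_factor hf) => [h|[k [g [hg g0 fE]]]]; first by left.
right; have [t /andP[t0 t1] [z zd]] := Ana_move 1 hg g0 fE d0.
have -> : 1 + (1 * t)%:C = (1 + t)%:C :> C by rewrite mul1r rmorphD rmorph1.
rewrite normr1 mulr1 => hz; exists z => //; have F0 : 0 < ab (f z0) by rewrite ab_gt0.
have := abB_ge (f z0 * (1 + t)%:C) (f z).
rewrite abBC [ab (f z0 * _)]abM abR ger0_norm; last lra.
nra.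
Qed.

Definition locally_eq (f : C -> C) (c z : C) : Prop :=
  exists2 d : R, 0 < d & forall w, ab (w - z) < d -> f w = c.

Lemma locally_eq_at (f : C -> C) c z : locally_eq f c z -> f z = c.
Proof. by case=> d d0; apply; rewrite subrr ab0. Qed.

(** Turns the alternative about values of [f] into one about the open condition [locally_eq], on a
    full disc. The centre joins the second case because each of its neighbourhoods contains other
    points of the disc. *)
Lemma locally_eq_dichotomy (f : C -> C) z0 c d : 0 < d ->
  (forall z, ab (z - z0) < d -> f z = c) \/ (forall z, z != z0 -> ab (z - z0) < d -> f z != c) ->
  exists2 r : R, 0 < r & (forall w, ab (w - z0) < r -> locally_eq f c w) \/
    (forall w, ab (w - z0) < r -> ~ locally_eq f c w).
Proof.
move=> d0 H; exists d => //; case: H => H; [left|right] => w hw.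
  exists (d - ab (w - z0)); first by rewrite subr_gt0.
  by move=> v hv; apply: H; have := ab_dist v w z0; lra.
move=> [e e0 He]; have [ww|ww] := eqVneq w z0; last first.
  by have /eqP := H _ ww hw; apply; apply: He; rewrite subrr ab0.
pose s := Num.min e (d - ab (w - z0)) / 2.
have s0 : 0 < s by rewrite divr_gt0 // lt_min e0 subr_gt0.
have sE : s < e.
  have : 2 * s <= e by rewrite mulrC divfK // ge_min lexx.
  lra.
have sD : ab (w - z0) + s < d.
  have : 2 * s <= d - ab (w - z0) by rewrite mulrC divfK // ge_min lexx orbT.
  lra.
have hs : ab (w + s%:C - w) = s by rewrite addrAC subrr add0r abR gtr0_norm.
have := H (w + s%:C); rewrite He ?hs // eqxx => h; suff : false by []; apply: h.
- rewrite -ww -subr_eq0 addrAC subrr add0r -ab_eq0 abR normr_eq0 gt_eqF //.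
- by have := ab_dist (w + s%:C) w z0; rewrite hs; lra.
Qed.

Lemma Ana_identity (f : C -> C) c z0 z1 :
  (forall t : R, 0 <= t <= 1 -> Ana f (seg z0 z1 t)) -> locally_eq f c z0 -> locally_eq f c z1.
Proof.
move=> hf; apply: segment_ind => t /hf ht.
by have [d d0 /(locally_eq_dichotomy d0)] := Ana_dichotomy c ht.
Qed.

Lemma seg_disc (z1 z2 w : C) r t : ab (z1 - w) <= r -> ab (z2 - w) <= r -> 0 <= t <= 1 ->
  ab (seg z1 z2 t - w) <= r.
Proof.
move=> h1 h2 /andP[t0 t1].
have -> : seg z1 z2 t - w = (1 - t)%:C * (z1 - w) + t%:C * (z2 - w).
  by rewrite /seg rmorphB rmorph1 /=; ring.
apply: le_trans (abD _ _) _; rewrite !abM !abR !ger0_norm //; last lra.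
nra.
Qed.

(* If |f - w| is smaller at the centre than on the boundary circle, its minimum
   over the disc is interior, and an interior minimum must vanish. *)
Lemma disc_solution (f : C -> C) z1 (rho : R) w : 0 < rho ->
  (forall z, ab (z - z1) <= rho -> Ana f z) ->
  (forall z, ab (z - z1) = rho -> ab (f z1 - w) < ab (f z - w)) ->
  exists2 z, ab (z - z1) < rho & f z = w.
Proof.
move=> r0 hf hb.
pose g z := f z - w.
have hg z : ab (z - z1) <= rho -> Ana g z.
  by move=> /hf h; apply: Ana_sub => //; exact: Ana_cst.
have [||z /= hz hmin] := @ab_min R [set z | ab (z - z1) <= rho] g _ (@compact_disc R z1 rho).
- by exists z1; rewrite /= subrr ab0 ltW.
- by move=> z /hg/Ana_cont.
have z1in : ab (z1 - z1) <= rho by rewrite subrr ab0 ltW.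
have zlt : ab (z - z1) < rho.
  rewrite lt_neqAle hz andbT; apply/eqP => e.
  by have := hb _ e; have := hmin _ z1in; rewrite /g; lra.
exists z => //; apply/eqP; rewrite -subr_eq0; apply: contraT => gz.
have d0 : 0 < rho - ab (z - z1) by rewrite subr_gt0.
case: (Ana_decrease (hg _ hz) gz d0) => [lc|[v hv]]; last first.
  have vin : ab (v - z1) <= rho by have := ab_dist v z z1; lra.
  by have := hmin _ vin; lra.
have lz : locally_eq g (g z) z by exact: lc.
have prop v : ab (v - z1) <= rho -> g v = g z.
  move=> hv; apply: locally_eq_at; apply: Ana_identity lz => t ht.
  by apply: hg; apply: seg_disc ht.
have bp : ab (z1 + rho%:C - z1) = rho by rewrite addrAC subrr add0r abR gtr0_norm.
by have := hb _ bp; rewrite -/(g _) -/(g _) !prop // ?bp // ltxx.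
Qed.

(** On a small circle [f - f z0] has a minimum [m > 0]; a value [w] within [m / 2] of [f z0]
    satisfies the boundary condition of [disc_solution]. *)
Lemma open_mapping (f : C -> C) z0 d : Ana f z0 -> ~ locally_eq f (f z0) z0 -> 0 < d ->
  exists2 e : R, 0 < e & forall w, ab (w - f z0) < e -> exists2 z, ab (z - z0) < d & f z = w.
Proof.
move=> hf nc d0.
have [d1 d10 H1] := Ana_near hf.
have [d2 d20 [H2|H2]] := Ana_dichotomy (f z0) hf; first by case: nc; exists d2.
pose r := Num.min d (Num.min d1 d2) / 2.
have m0 : 0 < Num.min d (Num.min d1 d2) by rewrite !lt_min d0 d10.
have r0 : 0 < r by rewrite divr_gt0.
have r2 : 2 * r = Num.min d (Num.min d1 d2) by rewrite mulrC divfK.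
have rd : r < d.
  have : 2 * r <= d by rewrite r2 ge_min lexx.
  lra.
have rd1 : r < d1.
  have : 2 * r <= d1 by rewrite r2 !ge_min lexx orbT.
  lra.
have rd2 : r < d2.
  have : 2 * r <= d2 by rewrite r2 !ge_min lexx !orbT.
  lra.
have cc : compact [set z : C | ab (z - z0) = r].
  apply: (compactP (M := r + ab z0)) => /= [z h|z h].
    by have := abD (z - z0) z0; rewrite subrK; lra.
  exists `|ab (z - z0) - r|; first by rewrite normr_gt0 subr_eq0; apply/eqP.
  move=> w hw e; move: hw; apply/negP; rewrite -leNgt -e.
  have := ab_dist z w z0; have := ab_dist w z z0; rewrite (abBC z w) => a b.
  by rewrite ler_norml; apply/andP; split; lra.
have [||z /= hz hmin] := @ab_min R [set z | ab (z - z0) = r] (fun z => f z - f z0) _ cc.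
- by exists (z0 + r%:C); rewrite /= addrAC subrr add0r abR gtr0_norm.
- move=> z /= hz; apply: Ana_cont; apply: Ana_sub; last exact: Ana_cst.
  by apply: H1; rewrite hz.
set m := ab (f z - f z0) in hmin.
have m1 : 0 < m.
  rewrite ab_gt0 subr_eq0; apply: H2; last by rewrite hz.
  by apply/eqP => e; move: hz; rewrite e subrr ab0 => e'; rewrite -e' ltxx in r0.
exists (m / 2); first by rewrite divr_gt0.
move=> w hw.
have [||v hv <-] := @disc_solution f z0 r w r0; last by exists v => //; lra.
  by move=> v hv; apply: H1; lra.
move=> v /hmin; rewrite abBC in hw.
by have := ab_dist (f v) w (f z0); rewrite -(abBC w) (abBC w (f z0)) => h1 h2; lra.
Qed.

(** A root of [1 + x + ... + x ^+ (K - 1)]; it differs from 1, where this polynomial takes the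
    nonzero value [K]. *)
Lemma unity_root_neq1 K : (1 < K)%N -> exists2 x : C, x != 1 & x ^+ K = 1.
Proof.
move=> K1; have [x rx] : exists x : C, root (\poly_(i < K) (1 : C)) x.
  apply/closed_rootP; rewrite size_poly_eq; first by case: K K1 => [|[]].
  exact: oner_neq0.
move: rx; rewrite rootE horner_poly => /eqP sx.
exists x.
  apply/eqP => x1; move: sx; rewrite x1.
  under eq_bigr do rewrite expr1n mulr1.
  rewrite sumr_const card_ord => /eqP; rewrite pnatr_eq0.
  by case: K K1.
apply/eqP; rewrite -subr_eq0 subrX1.
by under [X in _ * X]eq_bigr do rewrite -[x ^+ _]mul1r; rewrite sx mulr0.
Qed.

(** The quotient by [h] is a polynomial with value [K] at 0, which exceeds 1 with room to spare
    unless [K = 1]; that case is an equality. *)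
Lemma exp1D_lower K : (0 < K)%N -> exists2 e : R, 0 < e &
  forall h : C, ab h <= e -> ab h <= ab ((1 + h) ^+ K - 1).
Proof.
move=> K0; pose s (h : C) := \sum_(i < K) (1 + h) ^+ i.
have sA : Ana s 0.
  rewrite /s; elim: {K0} K @s => [|K IH].
    by apply: Ana_eq (Ana_cst 0 0) => z; rewrite big_ord0.
  apply: Ana_eq (Ana_add IH (Ana_exp K (Ana_add (Ana_cst 1 0) (Ana_id 0)))) => z.
  by rewrite big_ord_recr.
have s0 : s 0 = K%:R.
  by rewrite /s; under eq_bigr do rewrite addr0 expr1n; rewrite sumr_const card_ord.
have e0 : 0 < (1 / 2 : R) by lra.
have [d d0 H] := Ana_near_ball sA e0; exists (d / 2); first lra.
move=> h hd; have -> : (1 + h) ^+ K - 1 = h * s h by rewrite subrX1 addrAC subrr add0r.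
have hK : K%:R = 1 :> R \/ 2 <= K%:R :> R.
  by case: K K0 {s sA s0 H} => [|[|K]] // _; [left|right; rewrite ler_nat].
rewrite abM ler_peMr ?ab_ge0 //.
case: hK => [K1|K2].
  have KE : K = 1%N by apply/eqP; rewrite -(eqr_nat R) K1.
  by rewrite /s KE big_ord1 expr0 ab1.
have := H h; rewrite subr0 s0 => /(_ _) h1.
have {h1} h1 : ab (s h - K%:R) < 1 / 2 by apply: h1; lra.
have := abB_ge K%:R (s h); rewrite abBC ab_nat; lra.
Qed.

(** If [f - f z0] vanished to order [K > 1], then with [x] a [K]-th root of unity other than 1 the
    equation [f z = f z0 + r ^+ K * g z0] would have a solution close to [z0 + r] and another close
    to [z0 + r * x]. *)
Lemma injective_slope (f : C -> C) z0 d : Ana f z0 -> 0 < d ->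
  (forall z w, ab (z - z0) < d -> ab (w - z0) < d -> f z = f w -> z = w) ->
  exists g, [/\ Ana g z0, g z0 != 0 & forall z, f z = f z0 + (z - z0) * g z].
Proof.
move=> hf d0 inj; case: (Ana_const_or_factor hf) => [[e e0 h]|[k [g [hg g0 fE]]]].
  pose s := Num.min d e / 2; have s0 : 0 < s by rewrite divr_gt0 // lt_min d0.
  have m2 : 2 * s = Num.min d e by rewrite mulrC divfK.
  have sd : s < d.
  have : 2 * s <= d by rewrite m2 ge_min lexx.
  lra.
  have se : s < e.
  have : 2 * s <= e by rewrite m2 ge_min lexx orbT.
  lra.
  have hs : ab (z0 + s%:C - z0) = s by rewrite addrAC subrr add0r abR gtr0_norm.
  have := inj (z0 + s%:C) z0; rewrite hs subrr ab0 h ?hs // => /(_ sd d0 erefl) /eqP.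
  by rewrite -subr_eq0 addrAC subrr add0r -ab_eq0 abR gtr0_norm // gt_eqF.
case: k fE => [|k] fE; first by exists g; split=> // z; rewrite fE expr1.
move: fE; have : (1 < k.+2)%N by []; move: k.+2 => K K1 fE.
have [x x1 xK] := unity_root_neq1 K1.
have [e1 e10 He1] := exp1D_lower (ltnW K1).
(* [e1] is the range of the lower bound for [(1 + h) ^+ K - 1]; the bound by [ab (x - 1) / 2] keeps
   the two discs of radius [e * r] disjoint. *)
pose e := Num.min (Num.min e1 (1 / 2)) (ab (x - 1) / 2).
have x10 : 0 < ab (x - 1) by rewrite ab_gt0 subr_eq0.
have e0 : 0 < e by rewrite !lt_min e10 [_ < _ / 2]divr_gt0 // andbT /=; lra.
have ee1 : e <= e1 by rewrite !ge_min lexx.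
have eh : e <= 1 / 2 by rewrite !ge_min lexx orbT.
have ex : 2 * e <= ab (x - 1) by rewrite mulrC -ler_pdivlMr // ge_min lexx orbT.
have G0 : 0 < ab (g z0) by rewrite ab_gt0.
have p2 : 0 < (2 : R) ^+ K by rewrite exprn_gt0.
(* On the boundary the main term is at least [e * ab (g z0)] and the variation of [g] costs at most
   [2 ^+ K * eta], which leaves [2 * eta], more than the error [eta] at the centre. *)
pose eta := e * ab (g z0) / (2 ^+ K + 2).
have eta0 : 0 < eta by rewrite !divr_gt0 ?mulr_gt0 //; lra.
have etaE : eta * (2 ^+ K + 2) = e * ab (g z0) by rewrite divfK // gt_eqF //; lra.
have [d1 d10 H1] := Ana_near hf.
have [d2 d20 H2] := Ana_near_ball hg eta0.
pose r := Num.min d (Num.min d1 d2) / 4.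
have r0 : 0 < r by rewrite divr_gt0 // !lt_min d0 d10.
have r4 : 4 * r = Num.min d (Num.min d1 d2) by rewrite mulrC divfK.
have rd : 4 * r <= d by rewrite r4 ge_min lexx.
have rd1 : 4 * r <= d1 by rewrite r4 !ge_min lexx orbT.
have rd2 : 4 * r <= d2 by rewrite r4 !ge_min lexx !orbT.
have rC0 : r%:C != 0 :> C by rewrite -ab_gt0 abR gtr0_norm.
have x0 : ab x = 1.
  by have := congr1 (@ab R) xK; rewrite abX ab1 => /eqP; rewrite pexpr_eq1 ?ab_ge0 ?(ltnW K1) // => /eqP.
have sol (y : C) : y ^+ K = 1 -> ab y = 1 ->
    exists2 z, ab (z - (z0 + r%:C * y)) < e * r & f z = f z0 + r%:C ^+ K * g z0.
  move=> yK y1; have y0 : y != 0 by rewrite -ab_gt0 y1.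
  have near z : ab (z - (z0 + r%:C * y)) <= e * r -> ab (z - z0) < 2 * r.
    have := ab_dist z (z0 + r%:C * y) z0.
    have -> : ab (z0 + r%:C * y - z0) = r by rewrite addrAC subrr add0r abM abR gtr0_norm // y1 mulr1.
    by move=> h h'; nra.
  apply: disc_solution => [|z /near hz|z hz]; first by rewrite mulr_gt0.
    by apply: H1; lra.
  have hz' := near z; rewrite hz lexx in hz'; have {}hz' := hz' isT.
  pose h := (z - (z0 + r%:C * y)) / (r%:C * y).
  have hE : ab h = e by rewrite !abM abV abM abR gtr0_norm // y1 mulr1 hz mulfK // gt_eqF.
  have zE : z - z0 = r%:C * y * (1 + h) by rewrite mulrDr mulr1 [_ * h]mulrC divfK ?mulf_neq0 //; ring.
  have c1 : f (z0 + r%:C * y) - (f z0 + r%:C ^+ K * g z0) = r%:C ^+ K * (g (z0 + r%:C * y) - g z0).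
    rewrite fE; have -> : z0 + r%:C * y - z0 = r%:C * y by ring.
    by rewrite exprMn yK; ring.
  have c2 : f z - (f z0 + r%:C ^+ K * g z0) =
      r%:C ^+ K * (((1 + h) ^+ K - 1) * g z0 + (1 + h) ^+ K * (g z - g z0)).
    by rewrite fE zE !exprMn yK; ring.
  rewrite c1 c2 !abM ltr_pM2l ?ab_gt0 ?expf_neq0 //.
  have n1 : ab (g (z0 + r%:C * y) - g z0) < eta.
    apply: H2; rewrite addrAC subrr add0r abM abR gtr0_norm // y1; lra.
  have n2 : ab (g z - g z0) < eta by apply: H2; lra.
  have n3 : ab ((1 + h) ^+ K) <= 2 ^+ K.
    rewrite abX; apply: lerXn2r; rewrite ?nnegrE ?ab_ge0 //.
    by have := abD 1 h; rewrite ab1 hE; lra.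
  have n4 : e <= ab ((1 + h) ^+ K - 1) by rewrite -hE He1 // hE.
  have := abD_ge (((1 + h) ^+ K - 1) * g z0) ((1 + h) ^+ K * (g z - g z0)); rewrite !abM.
  have m1 : ab ((1 + h) ^+ K) * ab (g z - g z0) <= 2 ^+ K * eta.
    by apply: ler_pM => //; rewrite ?ab_ge0 // ltW.
  have m2 : e * ab (g z0) <= ab ((1 + h) ^+ K - 1) * ab (g z0) by rewrite ler_wpM2r // ltW.
  lra.
have [z hz zw] := sol 1 (expr1n _ _) (ab1 R); have [v hv vw] := sol x xK x0.
have zv : z = v.
  have er : e * r <= r / 2 by nra.
  apply: inj; last by rewrite zw vw.
    have := ab_dist z (z0 + r%:C * 1) z0.
    have -> : ab (z0 + r%:C * 1 - z0) = r by rewrite addrAC subrr add0r abM abR gtr0_norm // ab1 mulr1.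
    lra.
  have := ab_dist v (z0 + r%:C * x) z0.
  have -> : ab (z0 + r%:C * x - z0) = r by rewrite addrAC subrr add0r abM abR gtr0_norm // x0 mulr1.
  lra.
have := ab_dist (z0 + r%:C * x) v (z0 + r%:C * 1); rewrite (abBC _ v) -{2}zv.
have -> : z0 + r%:C * x - (z0 + r%:C * 1) = r%:C * (x - 1) by ring.
rewrite abM abR gtr0_norm //; nra.
Qed.

(** A left inverse suffices: the open mapping theorem shows that all points near [f z0] are values
    of [f], and the difference quotients of [h] are values of the inverse of the slope of [f]. *)
Lemma inverse_holomorphic (f h : C -> C) z0 d : 0 < d ->
  (forall z, ab (z - z0) < d -> Ana f z /\ h (f z) = z) -> holomorphic_at h (f z0).
Proof.
move=> d0 H.
have nc z : ab (z - z0) < d -> ~ locally_eq f (f z) z.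
  move=> hz [e e0 he]; pose s := Num.min e (d - ab (z - z0)) / 2.
  have s0 : 0 < s by rewrite divr_gt0 // lt_min e0 subr_gt0.
  have m2 : 2 * s = Num.min e (d - ab (z - z0)) by rewrite mulrC divfK.
  have se : s < e.
  have : 2 * s <= e by rewrite m2 ge_min lexx.
  lra.
  have sd : ab (z - z0) + s < d.
    have : 2 * s <= d - ab (z - z0) by rewrite m2 ge_min lexx orbT.
    lra.
  have hs : ab (z + s%:C - z) = s by rewrite addrAC subrr add0r abR gtr0_norm.
  have hzs : ab (z + s%:C - z0) < d by have := ab_dist (z + s%:C) z z0; rewrite hs; lra.
  have := he (z + s%:C); rewrite hs => /(_ se) /(congr1 h).
  rewrite (H _ hz).2 (H _ hzs).2 => /eqP; rewrite -subr_eq0 addrAC subrr add0r -ab_eq0.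
  by rewrite abR gtr0_norm // gt_eqF.
have hd0 : ab (z0 - z0) < d by rewrite subrr ab0.
have [e e0 He] := open_mapping (H _ hd0).1 (nc _ hd0) d0.
apply/nearP; exists e => // w /He[z hz <-] {w}.
have s0 : 0 < d - ab (z - z0) by rewrite subr_gt0.
have sub v : ab (v - z) < d - ab (z - z0) -> ab (v - z0) < d.
  by have := ab_dist v z z0; lra.
have [|g [hg g0 fE]] := injective_slope (H _ hz).1 s0.
  by move=> v w /sub hv /sub hw /(congr1 h); rewrite (H _ hv).2 (H _ hw).2.
apply/cvg_ex; exists (g z)^-1; apply/(@cvgatP _ _ (0^')) => e' e0'.
have [d' d0' Hd'] := Ana_near_ball (Ana_inv hg g0) e0'.
pose s := Num.min d' (d - ab (z - z0)); have sp : 0 < s by rewrite lt_min d0'.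
have [e2 e20 He2] := open_mapping (H _ hz).1 (nc _ hz) sp.
apply/dnearP; exists e2 => // k k0; rewrite subr0 => hk.
have [|v] := He2 (k + f z); first by rewrite addrK.
rewrite lt_min => /andP[vd' /sub vd] vE.
have -> : (h \o shift (f z)) k%:A = v by rewrite /= [k%:A]mulr1 -vE (H _ vd).2.
rewrite (H _ hz).2.
have kE : k = (v - z) * g v by apply: (addIr (f z)); rewrite -vE fE addrC.
have vz : v - z != 0 by apply: contraNneq k0 => e3; rewrite kE e3 mul0r.
have gv : g v != 0 by apply: contraNneq k0 => e3; rewrite kE e3 mulr0.
have -> : k^-1 *: (v - z) = (g v)^-1.
  by rewrite kE; change (((v - z) * g v)^-1 * (v - z) = (g v)^-1); rewrite invfM mulrAC mulVf // mul1r.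
exact: Hd'.
Qed.

(** The punctured plane is path connected. If the segment from [u] to [v] meets 0, then [v] is a
    negative multiple of [u], and the detour through ['i * u] avoids 0. *)
Lemma Cstar_ind (P : C -> Prop) :
  (forall u, u != 0 -> exists2 r : R, 0 < r &
     (forall w, ab (w - u) < r -> P w) \/ (forall w, ab (w - u) < r -> ~ P w)) ->
  forall u v, u != 0 -> v != 0 -> P u -> P v.
Proof.
move=> H.
have step u v : (forall t : R, 0 <= t <= 1 -> seg u v t != 0) -> P u -> P v.
  by move=> h; apply: segment_ind => t /h /H.
move=> u v u0 v0 Pu.
have [h|h] := pselect (forall t : R, 0 <= t <= 1 -> seg u v t != 0); first exact: step h Pu.
have [t t01 st] : exists2 t : R, 0 <= t <= 1 & seg u v t = 0.
  apply: contrapT => h'; apply: h => t ht; apply/eqP => e; apply: h'; by exists t.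
have vE : t%:C * v = - ((1 - t)%:C * u).
  by apply/eqP; rewrite -addr_eq0 -st /seg rmorphB rmorph1; apply/eqP; ring.
have tn0 : t != 0.
  apply/eqP => e; move: vE; rewrite e mul0r subr0 mul1r => /esym/eqP.
  by rewrite oppr_eq0 (negPf u0).
have t1 : 0 < t by rewrite lt_def tn0; case/andP: t01.
pose kap := (1 - t) / t.
have tC0 : t%:C != 0 :> C by rewrite -ab_eq0 abR normr_eq0.
have vk : v = - (kap%:C * u).
  apply: (mulfI tC0); rewrite vE /kap rmorphM fmorphV /=; field.
  by [].
have k0 : 0 < kap.
  have : 0 <= kap by rewrite divr_ge0 ?subr_ge0 //; case/andP: t01.
  rewrite le_eqVlt => /orP[/eqP e|//].
  by move: v0; rewrite vk -e mul0r oppr0 eqxx.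
have reim (a b : R) : (a != 0) || (b != 0) -> (a +i* b : C) != 0.
  by rewrite eq_complex /= negb_and.
have step1 : P ('i * u).
  apply: step Pu => s /andP[s0 s1].
  have -> : seg u ('i * u) s = ((1 - s) +i* s) * u.
    have -> : ((1 - s) +i* s) = 1 - s%:C + 'i * s%:C :> C by simpc.
    by rewrite /seg; ring.
  rewrite mulf_neq0 // reim //; case: (eqVneq s 0) => [->|]; last by rewrite orbT.
  by rewrite subr0 oner_neq0.
apply: step step1 => s /andP[s0 s1].
have -> : seg ('i * u) v s = ((- (s * kap)) +i* (1 - s)) * u.
  have -> : ((- (s * kap)) +i* (1 - s)) = - (s%:C * kap%:C) + 'i * (1 - s%:C) :> C by simpc.
  by rewrite /seg vk; ring.
rewrite mulf_neq0 // reim //; case: (eqVneq s 1) => [->|ns].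
  by rewrite mul1r oppr_eq0 gt_eqF.
by rewrite subr_eq0 [1 == s]eq_sym ns orbT.
Qed.

(** A fundamental domain for multiplication by [q]: the least power bringing [u] past the right edge
    of the annulus does not overshoot the other edge. *)
Lemma annulus_rep (q u : C) (F : C -> C) : 0 < ab q < 1 -> u != 0 ->
  (forall u, u != 0 -> F (q * u) = F u) ->
  exists v, [/\ ab q <= ab v, ab v <= 1 & F v = F u].
Proof.
move=> /andP[q0 q1] u0 hF; have qn0 : q != 0 by rewrite -ab_gt0.
have U0 : 0 < ab u by rewrite ab_gt0.
have FX n w : w != 0 -> F (q ^+ n * w) = F w.
  move=> w0; elim: n => [|n IH]; first by rewrite mul1r.
  by rewrite exprS -mulrA hF // mulf_neq0 // expf_neq0.
have small (e : R) : 0 < e -> exists n, ab q ^+ n < e.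
  move=> e0; have : (fun n => ab q ^+ n) @ \oo --> 0.
    by apply: cvg_expr; rewrite ger0_norm // ltW.
  move=> /cvgrPdist_lt /(_ _ e0) [n _ /(_ n (leqnn n))].
  by rewrite sub0r normrN ger0_norm ?exprn_ge0 ?ab_ge0 // => h; exists n.
have [u1|u1] := leP (ab u) 1.
  have ex : exists n, ab q ^+ n.+1 < ab u.
    have [n hn] := small _ U0; exists n; apply: le_lt_trans hn.
    by rewrite exprS ger_pMl ?exprn_gt0 // ltW.
  case: (ex_minnP ex) => n hn mn; exists (u / q ^+ n).
  rewrite abM abV abX ler_pdivlMr ?exprn_gt0 // -exprS ler_pdivrMr ?exprn_gt0 // mul1r.
  split; first exact: ltW.
    case: n hn mn => [|n] hn mn; first by rewrite expr0.
    by rewrite leNgt; apply/negP => /mn; rewrite ltnn.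
  by rewrite -(FX n (u / q ^+ n)) ?mulf_neq0 ?invr_eq0 ?expf_neq0 // mulrCA divff ?mulr1 ?expf_neq0.
have ex : exists n, ab q ^+ n * ab u <= 1.
  have [|n hn] := small ((ab u)^-1); first by rewrite invr_gt0.
  by exists n; rewrite -ler_pdivlMr // mul1r ltW.
case: (ex_minnP ex) => n hn mn; exists (q ^+ n * u); rewrite FX // abM abX; split=> //.
case: n hn mn => [|n] hn mn; first by move: hn; rewrite expr0 mul1r => h; lra.
have h1 : 1 < ab q ^+ n * ab u by rewrite ltNge; apply/negP => /mn; rewrite ltnn.
by rewrite exprS -mulrA; nra.
Qed.

(** The maximum over the compact annulus is a maximum over the whole punctured plane, so [F] is
    constant near it by maximum modulus, and everywhere by continuation. *)
Lemma liouville_Cstar (q : C) (F : C -> C) : 0 < ab q < 1 ->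
  (forall u, u != 0 -> Ana F u) -> (forall u, u != 0 -> F (q * u) = F u) ->
  forall u v, u != 0 -> v != 0 -> F u = F v.
Proof.
move=> qq hA hF; have /andP[q0 q1] := qq.
have [|||z [/= z1 z2] zmax] :=
    @ab_max R [set u | ab q <= ab u /\ ab u <= 1] F.
- by exists 1; rewrite /= ab1; split=> //; exact: ltW.
- apply: (compactP (M := 1)) => /= [z []|z h] //.
  have [h1|h1] := ltP (ab z) (ab q).
    exists (ab q - ab z); first by rewrite subr_gt0.
    by move=> w hw [h2 _]; have := abB_ge w z; lra.
  have h2 : 1 < ab z by rewrite ltNge; apply/negP => h2; apply: h.
  exists (ab z - 1); first by rewrite subr_gt0.
  by move=> w hw [_ h3]; have := abB_ge z w; rewrite abBC; lra.
- by move=> u [/= h _]; apply: Ana_cont; apply: hA; rewrite -ab_gt0; lra.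
have zn0 : z != 0 by rewrite -ab_gt0; lra.
have gmax u : u != 0 -> ab (F u) <= ab (F z).
  by move=> u0; have [v [h1 h2 <-]] := annulus_rep qq u0 hF; apply: zmax.
have lz : locally_eq F (F z) z.
  have [Fz|Fz] := eqVneq (F z) 0.
    exists (ab z); first by rewrite ab_gt0.
    move=> w hw; have w0 : w != 0.
      by apply: contraTneq hw => ->; rewrite sub0r abN ltxx.
    apply/eqP; rewrite Fz -ab_eq0 eq_le ab_ge0 andbT.
    by have := gmax _ w0; rewrite Fz ab0.
  have Z0 : 0 < ab z by rewrite ab_gt0.
  case: (Ana_increase (hA _ zn0) Fz Z0) => [//|[w hw hlt]].
  have w0 : w != 0 by apply: contraTneq hw => ->; rewrite sub0r abN ltxx.
  by have := gmax _ w0; lra.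
have all u : u != 0 -> F u = F z.
  move=> u0; apply: locally_eq_at; apply: (Cstar_ind _ zn0 u0 lz) => v v0.
  by have [d d0 /(locally_eq_dichotomy d0)] := Ana_dichotomy (F z) (hA _ v0).
by move=> u v u0 v0; rewrite !all.
Qed.

(** A quotient defines an analytic map to the Riemann sphere: either it extends, or its inverse
    extends with value 0. The values of [X] and [Y] at a cusp are sorted by it. *)
Lemma Ana_quotient (N M : C -> C) z0 : Ana N z0 -> Ana M z0 -> ~ locally_eq M 0 z0 ->
  (exists2 g, Ana g z0 & exists2 d : R, 0 < d &
     forall z, z != z0 -> ab (z - z0) < d -> M z != 0 /\ N z / M z = g z) \/
  (exists2 g, Ana g z0 /\ g z0 = 0 & exists2 d : R, 0 < d &
     forall z, z != z0 -> ab (z - z0) < d -> [/\ M z != 0, N z != 0 & M z / N z = g z]).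
Proof.
move=> hN hM nM; case: (Ana_factor hM) => [//|[m [M1 [hM1 M10 ME]]]].
have [d d0 HM1] := Ana_near_neq0 hM1 M10.
case: (Ana_factor hN) => [[e e0 N0]|[n [N1 [hN1 N10 NE]]]].
  left; exists (fun=> 0); first exact: Ana_cst.
  exists (Num.min d e); first by rewrite lt_min d0.
  move=> z zz; rewrite lt_min => /andP[/HM1 h /N0 ->]; rewrite mul0r; split=> //.
  by rewrite ME mulf_neq0 // expf_neq0 // subr_eq0.
have [e e0 HN1] := Ana_near_neq0 hN1 N10.
have X z k : Ana (fun v => (v - z) ^+ k) z by apply: Ana_exp; apply: Ana_sub; [exact: Ana_id|exact: Ana_cst].
have [mn|nm] := leqP m n.
  left; exists (fun z => (z - z0) ^+ (n - m) * (N1 z / M1 z)).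
    by apply: Ana_mul; [exact: X|exact: Ana_div].
  exists d => // z; rewrite -subr_eq0 => zz /HM1 h; rewrite ME NE; split.
    by rewrite mulf_neq0 // expf_neq0.
  rewrite -{1}(subnKC mn) exprD; field.
  by rewrite h expf_neq0.
right; exists (fun z => (z - z0) ^+ (m - n) * (M1 z / N1 z)).
  split; first by apply: Ana_mul; [exact: X|exact: Ana_div].
  by rewrite subrr expr0n subn_eq0 leqNgt nm mul0r.
exists (Num.min d e); first by rewrite lt_min d0.
move=> z; rewrite -subr_eq0 lt_min => zz /andP[/HM1 h /HN1 h']; rewrite ME NE; split.
- by rewrite mulf_neq0 // expf_neq0.
- by rewrite mulf_neq0 // expf_neq0.
- rewrite -{1}(subnKC (ltnW nm)) exprD; field.
  by rewrite h' expf_neq0.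
Qed.

Lemma meromorphic_quotient (N M : C -> C) z0 : Ana N z0 -> Ana M z0 -> ~ locally_eq M 0 z0 ->
  forall f, (exists2 d : R, 0 < d & forall z, z != z0 -> ab (z - z0) < d -> f z = N z / M z) ->
  meromorphic_at f z0.
Proof.
move=> hN hM nM f [d d0 fE]; case: (Ana_factor hM) => [//|[m [M1 [hM1 M10 ME]]]].
have [e e0 HM1] := Ana_near_neq0 hM1 M10.
exists m, (fun z => N z / M1 z); split; first by apply: Ana_holomorphic; exact: Ana_div.
apply/dnearP; exists (Num.min d e); first by rewrite lt_min d0.
move=> z zz; rewrite lt_min => /andP[zd /HM1 h]; rewrite fE // ME; field.
by rewrite h expf_neq0 // subr_eq0.
Qed.

End FunctionTheory.

(** * The complex exponential and sixth roots of unity *)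

Section ComplexExp.
Variable R : realType.
Local Notation C := R[i].

Lemma cexpD (z w : C) : cexp (z + w) = cexp z * cexp w.
Proof.
case: z w => [a b] [c d]; rewrite /cexp /= expRD cosD sinD.
by apply/eqP; rewrite eq_complex /=; apply/andP; split; apply/eqP; ring.
Qed.

Lemma ab_cexp (z : C) : ab (cexp z) = expR (complex.Re z).
Proof.
apply/eqP; rewrite -(eqrXn2 (n := 2)) ?ab_ge0 ?expR_ge0 // ab_sqr /cexp /=.
by rewrite !exprMn -mulrDr cos2Dsin2 mulr1.
Qed.

Lemma cexp_neq0 (z : C) : cexp z != 0.
Proof. by rewrite -ab_gt0 ab_cexp expR_gt0. Qed.

Lemma cexp0 : cexp 0 = 1 :> C.
Proof. by rewrite /cexp /= expR0 cos0 sin0 mulr1 mulr0. Qed.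

Lemma cexpN (z : C) : cexp (- z) = (cexp z)^-1.
Proof.
apply: (mulfI (cexp_neq0 z)); rewrite -cexpD subrr cexp0 divff //.
exact: cexp_neq0.
Qed.

Lemma cexpB (z w : C) : cexp (z - w) = cexp z / cexp w.
Proof. by rewrite cexpD cexpN. Qed.

Lemma cexpX (z : C) n : cexp (n%:R * z) = cexp z ^+ n.
Proof.
elim: n => [|n IH]; first by rewrite mul0r cexp0.
by rewrite -addn1 natrD mulrDl mul1r cexpD IH exprD.
Qed.

Lemma cexpXz (z : C) (n : int) : cexp (n%:~R * z) = cexp z ^ n.
Proof.
case: n => n; first exact: cexpX.
by rewrite NegzE mulrNz mulNr cexpN cexpX.
Qed.

Lemma cexp_pii : cexp (twopii R / 2) = -1.
Proof.
have -> : twopii R / 2 = pi *i.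
  apply: (@mulIf _ 2); first by rewrite pnatr_eq0.
  rewrite divfK ?pnatr_eq0 // /twopii; have -> : (2 : C) = (2 : R)%:C by rewrite rmorph_nat.
  by rewrite /real_complex_def; apply/eqP; rewrite eq_complex /=; apply/andP; split; apply/eqP; ring.
by apply/eqP; rewrite eq_complex /= expR0 cospi sinpi !mul1r oppr0 !eqxx.
Qed.

Lemma cexp_twopii : cexp (twopii R) = 1.
Proof.
have -> : twopii R = twopii R / 2 + twopii R / 2 by field.
by rewrite cexpD cexp_pii mulrNN mulr1.
Qed.

Lemma twopii_neq0 : twopii R != 0.
Proof. by rewrite /twopii eq_complex /= eqxx /= gt_eqF // mulr_gt0 // pi_gt0. Qed.

Lemma cexp_period (z : C) (n : int) : cexp (z + n%:~R * twopii R) = cexp z.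
Proof. by rewrite cexpD cexpXz cexp_twopii exp1rz mulr1. Qed.

(** A multiple of the period brings the imaginary part into the interval from 0 to [2 * pi]. There
    injectivity of [cos] between 0 and [pi] applies to it or to its reflection at [pi]. *)
Lemma cexp_eq1 (z : C) : cexp z = 1 -> exists n : int, z = n%:~R * twopii R.
Proof.
move=> ez.
pose n := Num.floor (complex.Im z / (2 * pi)).
exists n; have p0 : 0 < 2 * pi :> R by rewrite mulr_gt0 // pi_gt0.
pose w := z + (- n)%:~R * twopii R.
have ew : cexp w = 1 by rewrite cexp_period.
have wR : complex.Re w = 0.
  have := ab_cexp w; by rewrite ew ab1 -(expR0 R) => /expR_inj.
have wI : complex.Im w = complex.Im z - n%:~R * (2 * pi).
  rewrite /w /twopii; have -> : (- n)%:~R = ((- n)%:~R : R)%:C by rewrite rmorph_int.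
  by case: (z) => a b /=; rewrite mul0r addr0 mulrNz mulNr.
have r0 : 0 <= complex.Im w by rewrite wI subr_ge0 -ler_pdivlMr // floor_le_tmp.
have r1 : complex.Im w < 2 * pi.
  have := floorD1_gt (complex.Im z / (2 * pi)); rewrite -/n ltr_pdivrMr // intrD mulrDl mul1r wI.
  lra.
have cw : cos (complex.Im w) = 1.
  by move: ew => /(congr1 (@complex.Re R)) /=; rewrite wR expR0 mul1r.
have I0 : complex.Im w = 0.
  have [h|h] := leP (complex.Im w) pi.
    by apply: cos_inj; rewrite ?in_itv /= ?r0 ?h ?lexx ?pi_ge0 // cos0.
  have : 2 * pi - complex.Im w = 0.
    apply: cos_inj; rewrite ?in_itv /= ?lexx ?pi_ge0 //; first by apply/andP; split; lra.
    have -> : 2 * pi - complex.Im w = - complex.Im w + pi *+ 2 by rewrite mulr2n; ring.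
    by rewrite cosD2pi cosN cos0.
  lra.
have w0 : w = 0 by apply/eqP; rewrite eq_complex wR I0 /= eqxx.
by apply/eqP; rewrite -subr_eq0 -w0 /w mulrNz mulNr.
Qed.

Lemma cexp_inj (z w : C) : cexp z = cexp w -> exists n : int, z = w + n%:~R * twopii R.
Proof.
move=> e; have : cexp (z - w) = 1 by rewrite cexpB e divff // cexp_neq0.
by move=> /cexp_eq1[n hn]; exists n; rewrite -hn subrKC.
Qed.

(** [acos] only yields arguments between 0 and [pi], so the sign of the argument is taken from the
    imaginary part. *)
Lemma cexp_surj (u : C) : u != 0 -> exists z, cexp z = u.
Proof.
move=> u0; have r0 : 0 < ab u by rewrite ab_gt0.
pose c := complex.Re u / ab u; pose s := complex.Im u / ab u.
have cs : c ^+ 2 + s ^+ 2 = 1.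
  by rewrite !exprMn -mulrDl -ab_sqr -exprMn divff ?gt_eqF // expr1n.
have c1 : -1 <= c <= 1.
  by rewrite -ler_norml normrM normfV (gtr0_norm r0) ler_pdivrMr // mul1r ab_Re.
have sE : Num.sqrt (1 - c ^+ 2) = `|s| by rewrite -cs addrAC subrr add0r sqrtr_sqr.
exists (ln (ab u) +i* (if 0 <= s then acos c else - acos c)).
rewrite /cexp /= lnK ?posrE //.
have -> : cos (if 0 <= s then acos c else - acos c) = c.
  by case: ifP => _; rewrite ?cosN acosK.
have -> : sin (if 0 <= s then acos c else - acos c) = s.
  case: ifPn => h; rewrite ?sinN sin_acos // sE; first by rewrite ger0_norm.
  by rewrite ltr0_norm ?opprK // ltNge.
by rewrite /c /s ![ab u * _]mulrC !divfK ?gt_eqF //; case: (u).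
Qed.

Lemma real_deriv0 (f : R^o -> R^o) (l : R) : is_derive (0 : R^o) (1 : R^o) f l ->
  forall e : R, 0 < e -> exists2 d : R, 0 < d &
    forall h, `|h| < d -> `|f h - f 0 - l * h| <= e * `|h|.
Proof.
move=> [df <-] e e0.
have : h^-1 *: (f (h%:A + 0) - f 0) @[h --> 0^'] --> 'D_1 f 0 by exact: df.
move=> /cvgrPdist_lt /(_ _ e0).
move=> /nbhs_ballP[d /= d0 H]; exists d => // h hd.
have [->|h0] := eqVneq h 0; first by rewrite subrr mulr0 subr0 normr0 mulr0.
have := H h; rewrite -ball_normE /= sub0r normrN => /(_ hd h0).
rewrite [h%:A]mulr1 addr0 => h1.
have -> : f h - f 0 - 'D_1 f 0 * h = - (('D_1 f 0 - h^-1 *: (f h - f 0)) * h).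
  by change (f h - f 0 - 'D_1 f 0 * h = - (('D_1 f 0 - h^-1 * (f h - f 0)) * h)); field.
by rewrite normrN normrM ler_wpM2r // ltW.
Qed.

Lemma cexp_near0 (e : R) : 0 < e -> exists2 d : R, 0 < d &
  forall h : C, ab h < d -> ab (cexp h - 1 - h) <= e * ab h.
Proof.
move=> e0.
(* The two coordinates contribute [4 * x * r] and [5 * x * r], and [9 / 12 < 1]; the bound [x <= 1]
   keeps [expR a] below 3. *)
have e1 : 0 < Num.min (e / 12) 1 by rewrite lt_min ltr01 andbT; lra.
set x := Num.min _ _ in e1.
have xe : x <= e / 12 by rewrite ge_min lexx.
have x1 : x <= 1 by rewrite ge_min lexx orbT.
clearbody x.
have hE : is_derive (0 : R) 1 (@expR R) 1.
  by have := is_derive_expR (0 : R); rewrite expR0.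
have hC : is_derive (0 : R) 1 (@cos R) 0.
  by have := is_derive_cos (0 : R); rewrite sin0 oppr0.
have hS : is_derive (0 : R) 1 (@sin R) 1.
  by have := is_derive_sin (0 : R); rewrite cos0.
have [d1 d10 H1] := real_deriv0 hE e1.
have [d2 d20 H2] := real_deriv0 hC e1.
have [d3 d30 H3] := real_deriv0 hS e1.
exists (Num.min (Num.min d1 d2) (Num.min d3 x)); first by rewrite !lt_min d10 d20 d30 e1.
case=> a b; rewrite !lt_min => /andP[/andP[h1 h2] /andP[h3 h4]].
have ha := ab_Re (a +i* b); have hb := ab_Im (a +i* b); rewrite /= in ha hb.
set r := ab (a +i* b) in h1 h2 h3 h4 ha hb *.
have := H1 a (le_lt_trans ha h1); have := H2 b (le_lt_trans hb h2).
have := H3 b (le_lt_trans hb h3).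
rewrite expR0 cos0 sin0 subr0 mul0r subr0 !mul1r => n3 n2 n1.
have r0 : 0 <= r by exact: ab_ge0.
have -> : cexp (a +i* b) - 1 - (a +i* b) = (expR a * cos b - 1 - a) +i* (expR a * sin b - b).
  by apply/eqP; rewrite eq_complex /= oppr0 addr0 !eqxx.
apply: le_trans (ab_ReIm _) _ => /=.
have eA : `|expR a - 1| <= 2 * r.
  have -> : expR a - 1 = (expR a - 1 - a) + a by ring.
  apply: le_trans (ler_normD _ _) _; nra.
have eA3 : `|expR a| <= 3.
  have -> : expR a = (expR a - 1) + 1 by ring.
  by apply: le_trans (ler_normD _ _) _; rewrite normr1; lra.
have p1 : `|expR a * cos b - 1 - a| <= 4 * x * r.
  have -> : expR a * cos b - 1 - a = expR a * (cos b - 1) + (expR a - 1 - a) by ring.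
  apply: le_trans (ler_normD _ _) _; rewrite normrM.
  have : `|expR a| * `|cos b - 1| <= 3 * (x * `|b|) by apply: ler_pM.
  nra.
have p2 : `|expR a * sin b - b| <= 5 * x * r.
  have -> : expR a * sin b - b = expR a * (sin b - b) + (expR a - 1) * b by ring.
  apply: le_trans (ler_normD _ _) _; rewrite !normrM.
  have : `|expR a| * `|sin b - b| <= 3 * (x * `|b|) by apply: ler_pM.
  have : `|expR a - 1| * `|b| <= 2 * r * `|b| by apply: ler_wpM2r.
  nra.
nra.
Qed.

Lemma cexp_derivable (z0 : C) : derivable (@cexp R) z0 1.
Proof.
apply/cvg_ex; exists (cexp z0); apply/(@cvgatP _ _ (0^')) => e e0.
have z0p : 0 < ab (cexp z0) by rewrite ab_gt0 cexp_neq0.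
have e1 : 0 < e / ab (cexp z0) / 2 by rewrite !divr_gt0.
have [d d0 H] := cexp_near0 e1.
apply/dnearP; exists d => // h h0; rewrite subr0 => hd.
have -> : (@cexp R \o shift z0) h%:A = cexp h * cexp z0 by rewrite /= [h%:A]mulr1 cexpD.
have -> : h^-1 *: (cexp h * cexp z0 - cexp z0) - cexp z0 = cexp z0 * (cexp h - 1 - h) / h.
  by change (h^-1 * (cexp h * cexp z0 - cexp z0) - cexp z0 = cexp z0 * (cexp h - 1 - h) / h); field.
have hp : 0 < ab h by rewrite ab_gt0.
rewrite !abM abV ltr_pdivrMr //.
have eE : e = e / ab (cexp z0) / 2 * (ab (cexp z0) * 2) by field; rewrite gt_eqF.
have := H _ hd; set k := e / _ / _ in eE e1 *; rewrite eE => h1.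
have : ab (cexp z0) * ab (cexp h - 1 - h) <= ab (cexp z0) * (k * ab h) by rewrite ler_wpM2l // ltW.
have : 0 < ab (cexp z0) * (k * ab h) by apply: mulr_gt0 => //; apply: mulr_gt0.
lra.
Qed.

Lemma cexp_cont (z0 : C) : {for z0, continuous (@cexp R)}.
Proof. by apply: differentiable_continuous; apply/derivable1_diffP; exact: cexp_derivable. Qed.

Definition zeta : C := cexp (twopii R / 6).

Lemma zeta3 : zeta ^+ 3 = -1.
Proof. by rewrite -cexpX -cexp_pii; congr cexp; field. Qed.

Lemma zeta2 : zeta ^+ 2 = omega R.
Proof. by rewrite -cexpX; congr cexp; field. Qed.

Lemma zeta_neq0 : zeta != 0. Proof. exact: cexp_neq0. Qed.

Lemma zetaX_eq1 (n : int) : zeta ^ n = 1 -> (6 %| n)%Z.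
Proof.
rewrite -cexpXz => /cexp_eq1[k]; rewrite mulrA mulrAC => /(mulIf twopii_neq0) h.
apply/dvdzP; exists k; apply/eqP; rewrite -(eqr_int C) rmorphM /= -h.
by rewrite divfK.
Qed.

Lemma omega_neq1 : omega R != 1.
Proof. by rewrite -zeta2; apply/eqP => /(@zetaX_eq1 2). Qed.

Lemma omega3 : omega R ^+ 3 = 1.
Proof. by rewrite -zeta2 -exprM (exprM zeta 3 2) zeta3 sqrrN expr1n. Qed.

Lemma omega_sum : 1 + omega R + omega R ^+ 2 = 0.
Proof.
have := subrX1 (omega R) 3; rewrite omega3 subrr !big_ord_recl big_ord0 /= => /esym/eqP.
rewrite mulf_eq0 subr_eq0 (negPf omega_neq1) /= => /eqP.
by rewrite /bump /= addr0 expr0 expr1 addrA.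
Qed.

End ComplexExp.

(** * One-sided Lambert series and their analytic dependence on both arguments *)

Section LambertSum.
Variable R : realType.
Local Notation C := R[i].

Definition csum (I : choiceType) (f : I -> C) : C := xget 0 [set s | HS f s].

Lemma csumP (I : choiceType) (f : I -> C) M : AS f M -> HS f (csum f).
Proof. by move=> /AS_ex[s hs]; rewrite /csum; case: xgetP => [? -> //|/(_ s)]. Qed.

Lemma csumE (I : choiceType) (f : I -> C) s : HS f s -> csum f = s.
Proof.
move=> hs; rewrite /csum; case: xgetP => [x -> /= h|/(_ s)//]; exact: HS_uniq h hs.
Qed.

(** For [ab x < 1] this is the sum of [n * x ^+ n]. Composed with [z |-> exp(2 pi i z)] it is, up to
    the factor [(2 pi i)^2], the sum of the [(z - m) ^- 2] over the integers [m]: a double pole at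
    1, and invariance under inversion. *)
Definition lam (x : C) : C := x / (1 - x) ^+ 2.

Lemma lamV x : x != 0 -> lam x^-1 = lam x.
Proof.
move=> x0; rewrite /lam; have [->|x1] := eqVneq x 1; first by rewrite invr1.
have h1 : 1 - x != 0 by rewrite subr_eq0 eq_sym.
have h2 : x - 1 != 0 by rewrite subr_eq0.
have -> : 1 - x^-1 = (x - 1) / x by field.
by field; rewrite x0 h1 h2.
Qed.

Lemma lam_dup x : x ^+ 2 != 1 -> lam x + lam (- x) = 4 * lam (x ^+ 2).
Proof.
move=> x1; rewrite /lam opprK.
have h1 : 1 - x ^+ 2 != 0 by rewrite subr_eq0 eq_sym.
have : (1 - x) * (1 + x) != 0 by have -> : (1 - x) * (1 + x) = 1 - x ^+ 2 by ring.
rewrite mulf_eq0 negb_or => /andP[h2 h3]; field.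
by rewrite h1 h2 h3.
Qed.

Lemma lam_bound x : ab x <= 1 / 2 -> ab (lam x) <= 4 * ab x.
Proof.
move=> h; rewrite /lam abM abV abX.
have h1 : 1 / 2 <= ab (1 - x) by have := abB_ge 1 x; rewrite ab1; lra.
have h2 : 1 / 4 <= ab (1 - x) ^+ 2 by rewrite expr2; nra.
have h3 : 0 < ab (1 - x) ^+ 2 by lra.
rewrite ler_pdivrMr //; have := ab_ge0 x; nra.
Qed.

Lemma small_pow (t e : R) : 0 <= t < 1 -> 0 < e -> exists n, t ^+ n < e.
Proof.
move=> /andP[t0 t1] e0; have : (fun n => t ^+ n) @ \oo --> 0.
  by apply: cvg_expr; rewrite ger0_norm.
move=> /cvgrPdist_lt /(_ _ e0) [n _ /(_ n (leqnn n))].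
by rewrite sub0r normrN ger0_norm ?exprn_ge0 // => h; exists n.
Qed.

Lemma small_mul_pow (c q : C) (e : R) : ab q < 1 -> 0 < e -> exists n, ab (c * q ^+ n) < e.
Proof.
move=> q1 e0; have c1 : 0 < ab c + 1 by have := ab_ge0 c; lra.
have [||n hn] := @small_pow (ab q) (e / (ab c + 1)); first by rewrite ab_ge0.
  by rewrite divr_gt0.
exists n; rewrite abM abX; move: hn; rewrite ltr_pdivlMr // mulrC; apply: le_lt_trans.
by rewrite ler_wpM2r ?exprn_ge0 ?ab_ge0 // lerDl.
Qed.

(** As [c * q ^+ n] tends to 0, a property of [c] follows from its small case together with descent
    from [c * q]; for series this descent is the separation of the first term. *)
Lemma pow_ind (q : C) (P : C -> Prop) : ab q < 1 ->
  (forall c, ab c < 1 / 4 -> P c) -> (forall c, P (c * q) -> P c) -> forall c, P c.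
Proof.
move=> q1 h0 hS c; have [|n] := @small_mul_pow c q (1 / 4) q1; first lra.
elim: n c => [|n IH] c; first by rewrite mulr1; exact: h0.
by rewrite exprS mulrA => h; apply: hS; exact: IH.
Qed.

Lemma AS_lam c q : ab q < 1 -> exists M, AS (fun n => lam (c * q ^+ n)) M.
Proof.
move=> q1; move: c; apply: (@pow_ind q _ q1) => [c hc|c [M hM]].
  have hg := AS_scale (4 * (1 / 4)%:C) (AS_geo q1).
  exists (ab (4 * (1 / 4)%:C) * (1 - ab q)^-1); apply: AS_le hg => n.
  have cq : ab (c * q ^+ n) <= 1 / 4 * ab q ^+ n.
    by rewrite abM abX ler_wpM2r ?exprn_ge0 ?ab_ge0 // ltW.
  have qn : ab q ^+ n <= 1 by rewrite exprn_ile1 ?ab_ge0 // ltW.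
  apply: le_trans (lam_bound _) _; first lra.
  rewrite [X in _ <= X]abM abX [ab (4 * _)]abM ab_nat abR ger0_norm; lra.
exists (M + ab (lam (c * q ^+ 0))); apply: AS_natS (fun n => lam (c * q ^+ n)) _ _.
by apply: AS_ext hM => n; rewrite exprS mulrA.
Qed.

Fact lamsum_key : unit. Proof. exact: tt. Qed.
(* Locked so that conversion never tries to evaluate it. *)
Definition lamsum (c q : C) : C := locked_with lamsum_key (csum (fun n => lam (c * q ^+ n))).

Lemma lamsumE c q : lamsum c q = csum (fun n => lam (c * q ^+ n)).
Proof. by rewrite /lamsum unlock. Qed.

Lemma lamsumP c q : ab q < 1 -> HS (fun n => lam (c * q ^+ n)) (lamsum c q).
Proof. by move=> /(AS_lam c)[M hM]; rewrite lamsumE; exact: csumP hM. Qed.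

Lemma lamsumS c q : ab q < 1 -> lamsum c q = lam c + lamsum (c * q) q.
Proof.
move=> q1; have := lamsumP (c * q) q1; rewrite addrC => h; rewrite [LHS]lamsumE; apply: csumE.
have h' : HS (fun n => lam (c * q ^+ n.+1)) (lamsum (c * q) q).
  by apply: HS_ext h => n; rewrite exprS mulrA.
by have := @HS_natS R (fun n => lam (c * q ^+ n)) _ h'; rewrite expr0 mulr1.
Qed.

Lemma HS_evenodd (f : nat -> C) s t :
  HS (fun n => f n.*2) s -> HS (fun n => f n.*2.+1) t -> HS f (s + t).
Proof.
apply: (@HS_split R _ _ _ double half (fun n => n.*2.+1) half) => n /=.
- exact: doubleK.
- by rewrite uphalf_double.
- have := odd_double_half n; case: (odd n) => /= h; rewrite -{2 4}h ?add1n ?add0n ?eqxx ?addbT //.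
    by rewrite ltn_eqF.
  by rewrite gtn_eqF.
Qed.

Lemma lamsum_dup c q : ab q < 1 -> (forall n, (c * q ^+ n) ^+ 2 != 1) ->
  lamsum c q + lamsum (- c) q = 4 * lamsum (c ^+ 2) (q ^+ 2).
Proof.
move=> q1 hc; have q2 : ab (q ^+ 2) < 1 by rewrite abX exprn_ilt1 ?ab_ge0.
apply: (HS_uniq (HS_add (lamsumP c q1) (lamsumP (- c) q1))).
apply: HS_ext (HS_scale 4 (lamsumP (c ^+ 2) q2)) => n.
have e : c ^+ 2 * q ^+ 2 ^+ n = (c * q ^+ n) ^+ 2 by rewrite [(c * _) ^+ 2]exprMn [q ^+ n ^+ 2]exprAC.
by rewrite e mulNr lam_dup.
Qed.

Lemma lamsum_evenodd c q : ab q < 1 ->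
  lamsum c (q ^+ 2) + lamsum (c * q) (q ^+ 2) = lamsum c q.
Proof.
move=> q1; have q2 : ab (q ^+ 2) < 1 by rewrite abX exprn_ilt1 ?ab_ge0.
symmetry; rewrite [LHS]lamsumE; apply: csumE; apply: HS_evenodd.
  by apply: HS_ext (lamsumP c q2) => n; rewrite -exprM -mul2n.
by apply: HS_ext (lamsumP (c * q) q2) => n; rewrite -mulrA -exprM -exprS -mul2n.
Qed.

(** The norm of a series on a small disc comes arbitrarily close to the absolute value at the
    centre, so strict inequalities at a point become inequalities of norms. *)
Lemma Ana_norm (f : C -> C) z0 (e : R) : Ana f z0 -> 0 < e -> exists r, ana f z0 r (ab (f z0) + e).
Proof.
move=> /Ana_slope[g [[r [M H]] fE]] e0; have r0 := ana_gt0 H; have M0 := ana_ge0 H.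
pose s := Num.min r (e / (M + 1)).
have s0 : 0 < s by rewrite lt_min r0 divr_gt0 //; lra.
have sr : s <= r by rewrite ge_min lexx.
have sM : s * M <= e.
  have : s <= e / (M + 1) by rewrite ge_min lexx orbT.
  rewrite ler_pdivlMr; last lra.
  by nra.
exists s; have h := ana_add (ana_cst (f z0) z0 s0) (ana_mul (ana_X z0 s0) (ana_le s0 sr (lexx M) H)).
apply: ana_ext (ana_le s0 (lexx s) _ h) => [z _|]; first by rewrite [in RHS]fE.
by rewrite lerD2l.
Qed.

(** The nome [k] varies along with the argument [v], because later both are monomials in [w]. For
    small [v] the terms have geometrically decaying norms; otherwise the first term is split off. *)
Lemma Ana_lamsum (v k : C -> C) u0 : Ana v u0 -> Ana k u0 -> ab (k u0) < 1 ->
  (forall n, v u0 * k u0 ^+ n != 1) -> Ana (fun u => lamsum (v u) (k u)) u0.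
Proof.
move=> hv hk k1 h1.
have [d1 d10 Hd1] : exists2 d : R, 0 < d & forall u, ab (u - u0) < d -> ab (k u) < 1.
  have e0 : 0 < 1 - ab (k u0) by rewrite subr_gt0.
  have [d d0 H] := Ana_near_ball hk e0; exists d => // u /H.
  by have := abB_ge (k u) (k u0); lra.
move: {2}(v u0) (erefl (v u0)) h1 => c ec.
move: c v hv ec; apply: (@pow_ind (k u0) _ k1) => [c hc|c IH] v hv ec h1; last first.
  have hvk : Ana (fun u => v u * k u) u0 by exact: Ana_mul.
  have hvk1 n : v u0 * k u0 * k u0 ^+ n != 1 by have := h1 n.+1; rewrite exprS mulrA.
  have := IH _ hvk (congr1 (fun x => x * k u0) ec) hvk1.
  move=> h; have hL : Ana (fun u => lam (v u)) u0.
    apply: Ana_div => //.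
      by apply: Ana_exp; apply: Ana_sub => //; exact: Ana_cst.
    by rewrite expf_neq0 // subr_eq0 eq_sym; have := h1 0%N; rewrite mulr1.
  apply: Ana_ext (Ana_add hL h); exists d1 => // u /Hd1 hu.
  by rewrite -lamsumS.
(* The midpoint between [ab (k u0)] and 1: it bounds the norm of [k] on a small disc and is still
   less than 1. *)
pose th := (1 + ab (k u0)) / 2.
have th1 : th < 1 by rewrite /th; lra.
have th0 : 0 <= th by have := ab_ge0 (k u0); rewrite /th; lra.
have e1 : 0 < (1 - ab (k u0)) / 2 by lra.
have [r1 R1] := Ana_norm hk e1.
have e2 : 0 < 1 / 2 - ab (v u0) by rewrite ec; lra.
have [r2 R2] := Ana_norm hv e2.
have r10 := ana_gt0 R1; have r20 := ana_gt0 R2.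
pose r := Num.min (Num.min r1 r2) (d1 / 2).
have r0 : 0 < r by rewrite !lt_min r10 r20 /=; lra.
have rr1 : r <= r1 by rewrite !ge_min lexx.
have rr2 : r <= r2 by rewrite !ge_min lexx orbT.
have rd1 : r <= d1 / 2 by rewrite !ge_min lexx !orbT.
have hk' : ana k u0 r th by apply: (ana_le r0 rr1 _ R1); rewrite /th; lra.
have hv' : ana v u0 r (1 / 2) by apply: (ana_le r0 rr2 _ R2); lra.
exists r, (2 * (1 - th)^-1).
apply: (ana_sum (f := fun n u => lam (v u * k u ^+ n)) (N := fun n => 2 * th ^+ n)) => //.
- move=> n; have tn1 : th ^+ n <= 1 by rewrite exprn_ile1 // ltW.
  have tn0 : 0 <= th ^+ n by rewrite exprn_ge0.
  have hx : ana (fun u => v u * k u ^+ n) u0 r (1 / 2 * th ^+ n).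
    by apply: ana_mul => //; exact: ana_exp.
  have hx1 : 1 / 2 * th ^+ n < ab 1 by rewrite ab1; lra.
  have := ana_mul hx (ana_exp 2 (ana_invB hx hx1)).
  move=> h; apply: ana_ext (ana_le r0 (lexx r) _ h) => [u _|].
    by rewrite /lam exprVn.
  rewrite ab1; have h2 : (1 - 1 / 2 * th ^+ n)^-1 <= 2.
    by rewrite -[X in _ <= X]invrK lef_pV2 ?posrE; lra.
  have h3 : 0 <= (1 - 1 / 2 * th ^+ n)^-1 by rewrite invr_ge0; lra.
  move: h2 h3; set i := (1 - _)^-1 => h2 h3.
  have i4 : i ^+ 2 <= 4 by rewrite expr2; nra.
  nra.
- move=> A; rewrite -big_distrr /= ler_wpM2l //.
  by apply: sum_geo_le; rewrite th0.
- by move=> u hu; apply: lamsumP; apply: Hd1; lra.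
Qed.

End LambertSum.

(** * The even elliptic function [S] on the punctured plane modulo powers of [q] *)

Section Torus.
Variable R : realType.
Local Notation C := R[i].
Variable q : C.
Hypothesis q0 : q != 0.
Hypothesis q1 : ab q < 1.

(** The sum of [lam (u * q ^ n)] over all integers [n], in which the terms with [n < 0] are
    rewritten by [lamV] so that both halves converge. It is the Weierstrass function divided by
    [(2 pi i)^2], up to an additive constant. *)
Definition S (u : C) : C := lamsum u q + lamsum (q / u) q.

Definition inlat (u : C) : Prop := exists n : int, u = q ^ n.

Lemma inlatM u v : inlat u -> inlat v -> inlat (u * v).
Proof. by move=> [n ->] [m ->]; exists (n + m); rewrite expfzDr. Qed.

Lemma inlatV u : inlat u -> inlat u^-1.
Proof. by move=> [n ->]; exists (- n); rewrite -invr_expz. Qed.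

Lemma inlat1 : inlat 1. Proof. by exists 0; rewrite expr0z. Qed.

Lemma inlatq : inlat q. Proof. by exists 1; rewrite expr1z. Qed.

Lemma inlat_neq0 u : inlat u -> u != 0.
Proof. by move=> [n ->]; rewrite expfz_neq0. Qed.

Lemma inlatMl u v : inlat u -> (inlat (u * v) <-> inlat v).
Proof.
move=> hu; split=> h; last exact: inlatM.
by have := inlatM (inlatV hu) h; rewrite mulKf // inlat_neq0.
Qed.

Lemma SqM u : u != 0 -> S (q * u) = S u.
Proof.
move=> u0; rewrite /S; have -> : q / (q * u) = u^-1 by field; rewrite q0 u0.
rewrite (lamsumS u q1) (lamsumS u^-1 q1) lamV // [u * q]mulrC [u^-1 * q]mulrC.
by ring.
Qed.

Lemma SV u : u != 0 -> S u^-1 = S u.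
Proof.
move=> u0; rewrite -(SqM u0) /S; have -> : q / (q * u) = u^-1 by field; rewrite q0 u0.
by rewrite invrK addrC.
Qed.

Lemma S_lat u v : inlat v -> u != 0 -> S (v * u) = S u.
Proof.
have nat n w : w != 0 -> S (q ^+ n * w) = S w.
  move=> w0; elim: n => [|n IH]; first by rewrite mul1r.
  by rewrite exprS -mulrA SqM // mulf_neq0 // expf_neq0.
move=> [[n|n] ->] u0; first exact: nat.
rewrite -(nat n.+1 (q ^ (Negz n) * u)); last by rewrite mulf_neq0 // expfz_neq0.
have -> : q ^ Negz n = (q ^+ n.+1)^-1 by [].
by rewrite mulrA divff ?expf_neq0 // mul1r.
Qed.

Lemma nlat_nat u n : ~ inlat u -> u * q ^+ n != 1.
Proof.
move=> h; apply/eqP => e; apply: h; exists (- n%:Z).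
by rewrite -exprnN; apply: (mulIf (expf_neq0 n q0)); rewrite e mulVf // expf_neq0.
Qed.

Lemma nlatV u : ~ inlat u -> ~ inlat (q / u).
Proof.
move=> h h'; apply: h.
by have := inlatM inlatq (inlatV h'); rewrite invf_div mulrC divfK.
Qed.

Lemma powq_lt1 n : ab (q ^+ n.+1) < 1.
Proof. by rewrite abX exprn_ilt1 ?ab_ge0. Qed.

(** One radius has to work for all [n]; only finitely many powers matter, since for small [c] no
    point near it can reach 1. *)
Lemma nat_neq1_near v0 : (forall n, v0 * q ^+ n != 1) ->
  exists2 d : R, 0 < d & forall v, ab (v - v0) < d -> forall n, v * q ^+ n != 1.
Proof.
move: v0; apply: (@pow_ind R q _ q1) => [c hc|c IH] h.
  exists (1 / 2); first lra.
  move=> v hv n; rewrite -subr_eq0 -ab_gt0 abBC.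
  have := abB_ge 1 (v * q ^+ n); rewrite ab1 abM abX.
  have : ab q ^+ n <= 1 by rewrite exprn_ile1 ?ab_ge0 // ltW.
  have : 0 <= ab q ^+ n by rewrite exprn_ge0 ?ab_ge0.
  by have := abB_ge v c; have := ab_ge0 v; nra.
have [|d d0 H] := IH; first by move=> n; have := h n.+1; rewrite exprS mulrA.
have c1 : 0 < ab (c - 1) by rewrite ab_gt0 subr_eq0; have := h 0%N; rewrite mulr1.
exists (Num.min d (ab (c - 1))); first by rewrite lt_min d0.
move=> v; rewrite lt_min => /andP[vd v1] [|n].
  rewrite mulr1 -subr_eq0 -ab_gt0.
  by have := ab_dist c v 1; rewrite (abBC c v); lra.
rewrite exprS mulrA; apply: H.
rewrite -mulrBl abM; apply: le_lt_trans vd.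
by rewrite ler_piMr ?ab_ge0 // ltW.
Qed.

Lemma inv_near (u0 : C) (e : R) : u0 != 0 -> 0 < e ->
  exists2 d : R, 0 < d & forall u, ab (u - u0) < d -> ab (q / u - q / u0) < e.
Proof.
move=> u00; apply: (Ana_near_ball (f := fun u => q / u)).
by apply: Ana_div => //; [exact: Ana_cst|exact: Ana_id].
Qed.

Lemma neq0_near (u0 : C) : u0 != 0 ->
  exists2 d : R, 0 < d & forall u, ab (u - u0) < d -> u != 0.
Proof.
move=> u00; exists (ab u0); first by rewrite ab_gt0.
by move=> u; apply: contraTneq => ->; rewrite sub0r abN ltxx.
Qed.

Lemma lat_cases u : inlat u -> (exists n, u * q ^+ n = 1) \/ (exists n, q / u * q ^+ n = 1).
Proof.
move=> [[n|n] ->].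
  case: n => [|n]; first by left; exists 0%N; rewrite mulr1.
  right; exists n; rewrite -exprnP exprS invfM mulrA divff // mul1r mulVf //.
  by rewrite expf_neq0.
by left; exists n.+1; rewrite NegzE -exprnN mulVf // expf_neq0.
Qed.

Lemma nlat_near u0 : u0 != 0 -> ~ inlat u0 ->
  exists2 d : R, 0 < d & forall u, ab (u - u0) < d -> ~ inlat u.
Proof.
move=> u00 h.
have [d1 d10 H1] := nat_neq1_near (fun n => nlat_nat n h).
have [d2 d20 H2] := nat_neq1_near (fun n => nlat_nat n (nlatV h)).
have [d3 d30 H3] := inv_near u00 d20.
exists (Num.min d1 d3); first by rewrite lt_min d10.
move=> u; rewrite lt_min => /andP[/H1 h1 /H3/H2 h2] /lat_cases[[n /eqP]|[n /eqP]].
  by rewrite (negPf (h1 n)).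
by rewrite (negPf (h2 n)).
Qed.

Lemma nlat_near1 : exists2 d : R, 0 < d & forall u, u != 1 -> ab (u - 1) < d -> ~ inlat u.
Proof.
have h n : q * q ^+ n != 1.
  by rewrite -exprS; apply: contraTneq (powq_lt1 n) => ->; rewrite ab1 ltxx.
have [d d0 H] := nat_neq1_near h.
have [d3 d30 H3] := inv_near (oner_neq0 C) d0.
exists (Num.min d d3); first by rewrite lt_min d0.
move=> u u1; rewrite lt_min => /andP[ud ud3] /lat_cases[[n /eqP]|[n /eqP]].
  case: n => [|n]; first by rewrite mulr1 (negPf u1).
  have := H (u * q) _ n; rewrite exprS mulrA => /(_ _)/negPf -> //.
  rewrite -{2}[q]mul1r -mulrBl abM; apply: le_lt_trans ud.
  by rewrite ler_piMr ?ab_ge0 // ltW.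
have := H (q / u) _ n => /(_ _)/negPf -> //.
by have := H3 _ ud3; rewrite divr1.
Qed.

Lemma S_Ana u0 : u0 != 0 -> ~ inlat u0 -> Ana S u0.
Proof.
move=> u00 h; apply: Ana_add; apply: Ana_lamsum => //.
- exact: Ana_id.
- exact: Ana_cst.
- by move=> n; exact: nlat_nat.
- by apply: Ana_div => //; [exact: Ana_cst|exact: Ana_id].
- exact: Ana_cst.
- by move=> n; apply: nlat_nat; exact: nlatV.
Qed.

Definition Sreg (u : C) : C := lamsum (u * q) q + lamsum (q / u) q.

Lemma SE u : S u = lam u + Sreg u.
Proof. by rewrite /S /Sreg lamsumS // addrA. Qed.

Lemma Sreg_Ana : Ana Sreg 1.
Proof.
have h n : q * q ^+ n != 1.
  by rewrite -exprS; apply: contraTneq (powq_lt1 n) => ->; rewrite ab1 ltxx.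
apply: Ana_add; apply: Ana_lamsum => //; try exact: Ana_cst.
- by apply: Ana_mul; [exact: Ana_id|exact: Ana_cst].
- by move=> n; rewrite mul1r.
- by apply: Ana_div; [exact: Ana_cst|exact: Ana_id|exact: oner_neq0].
- by move=> n; rewrite divr1.
Qed.

Lemma S_pole (M : R) : exists2 d : R, 0 < d &
  forall u, u != 1 -> ab (u - 1) < d -> M < ab (S u).
Proof.
have [d [N [d0 H]]] := Ana_bound Sreg_Ana.
pose K := `|M| + `|N| + 1; have K0 : 0 < K by rewrite /K; have := normr_ge0 M; have := normr_ge0 N; lra.
exists (Num.min d (Num.min (1 / 2) (1 / (2 * K)))).
  by rewrite !lt_min d0 !divr_gt0 ?mulr_gt0.
move=> u u1; rewrite !lt_min => /andP[/H hN /andP[h1 h2]].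
have w0 : 0 < ab (u - 1) by rewrite ab_gt0 subr_eq0.
have hu : 1 / 2 < ab u by have := abB_ge 1 (1 - u); rewrite subKr ab1 (abBC 1 u); lra.
have hl : K < ab (lam u).
  rewrite /lam abM abV abX abBC ltr_pdivlMr ?exprn_gt0 //.
  have h3 : ab (u - 1) * (2 * K) < 1 by rewrite -ltr_pdivlMr // mulr_gt0.
  rewrite expr2; nra.
have := abD_ge (lam u) (Sreg u); rewrite -SE; have := ler_norm M; have := ler_norm N.
by rewrite /K in hl; lra.
Qed.

(** Local constancy would propagate through the punctured plane, past the lattice points where [S]
    is large, up to the pole at 1. *)
Lemma S_not_locally_eq e u0 : u0 != 0 -> ~ inlat u0 -> ~ locally_eq S e u0.
Proof.
move=> u00 hu hl.
have one : locally_eq S e 1.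
  apply: (Cstar_ind _ u00 (oner_neq0 C) hl) => u un0.
  have [hlat|hn] := pselect (inlat u); last first.
    by have [d d0 /(locally_eq_dichotomy d0)] := Ana_dichotomy e (S_Ana un0 hn).
  have [d d0 H] := S_pole (ab e).
  have dd : 0 < Num.min d 1 * ab u by rewrite mulr_gt0 ?ab_gt0 // lt_min d0 ltr01.
  apply: (locally_eq_dichotomy dd); right=> v vu hv.
  have vn : v / u != 1.
    by apply: contra_neq vu => /(congr1 (fun x => x * u)); rewrite divfK // mul1r.
  have : ab (v / u - 1) < Num.min d 1.
    have -> : v / u - 1 = (v - u) / u by field.
    by rewrite abM abV ltr_pdivrMr // ab_gt0.
  rewrite lt_min => /andP[/(H _ vn) h v1]; move: h.
  have v0 : v != 0.
    by apply: contraTneq v1 => ->; rewrite mul0r sub0r abN ab1 ltxx.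
  have -> : v / u = u^-1 * v by rewrite mulrC.
  rewrite S_lat //; last exact: inlatV.
  by move=> h; apply/eqP => eS; rewrite eS ltxx in h.
have [d d0 H] := S_pole (ab e); case: one => d' d0' H'.
pose s := Num.min d d' / 2.
have s0 : 0 < s by rewrite divr_gt0 // lt_min d0.
have s2 : 2 * s = Num.min d d' by rewrite mulrC divfK.
have sd : s < d.
  have : 2 * s <= d by rewrite s2 ge_min lexx.
  lra.
have sd' : s < d'.
  have : 2 * s <= d' by rewrite s2 ge_min lexx orbT.
  lra.
have hs : ab (1 + s%:C - 1) = s by rewrite addrAC subrr add0r abR gtr0_norm.
have := H (1 + s%:C); rewrite hs H' ?hs // ltxx => /(_ _ sd) h; suff : false by [].
apply: h; rewrite -subr_eq0 -ab_gt0 hs //.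
Qed.

(** Liouville for a function with singular set [B]. Every singular point is carried to 1 by a
    symmetry of [F], so an extension [H] at 1 alone removes all singularities. *)
Lemma elliptic_const (F : C -> C) (B : C -> Prop) (H : C -> C) (d : R) :
  (forall u, u != 0 -> ~ B u -> Ana F u) ->
  (forall u, u != 0 -> ~ B u -> exists2 d : R, 0 < d & forall v, ab (v - u) < d -> ~ B v) ->
  (forall u, u != 0 -> B u -> exists2 c, c * u = 1 &
     forall v, v != 0 -> F (c * v) = F v /\ (B (c * v) <-> B v)) ->
  Ana H 1 -> 0 < d -> (forall u, u != 1 -> ab (u - 1) < d -> ~ B u /\ F u = H u) -> B 1 ->
  (forall u, u != 0 -> F (q * u) = F u /\ (B (q * u) <-> B u)) ->
  forall u, u != 0 -> ~ B u -> F u = H 1.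
Proof.
move=> hA hB hc hH d0 h1 B1 hq.
(* All singular points receive the same value [H 1], so that [G] inherits the symmetries of [F]. *)
pose G u := if `[< B u >] then H 1 else F u.
have G1 : Ana G 1.
  apply: Ana_ext hH; exists d => // u ud; rewrite /G.
  have [->|u1] := eqVneq u 1; first by rewrite asboolT.
  by have [nB ->] := h1 _ u1 ud; rewrite asboolF.
have GA u : u != 0 -> Ana G u.
  move=> u0; have [Bu|nB] := pselect (B u); last first.
    have [e e0 He] := hB _ u0 nB.
    apply: Ana_ext (hA _ u0 nB); exists e => // v /He nBv.
    by rewrite /G asboolF.
  have [c cu hcv] := hc _ u0 Bu.
  have c0 : c != 0 by apply: contra_eqN cu => /eqP ->; rewrite mul0r eq_sym oner_eq0.
  have := @Ana_scale R G c u c0; rewrite cu => /(_ G1).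
  apply: Ana_ext; have [e e0 He] := neq0_near u0; exists e => // v /He /hcv[hF hBv].
  rewrite /G hF; congr (if _ then _ else _); exact: asbool_equiv_eq.
have Gq u : u != 0 -> G (q * u) = G u.
  by move=> /hq[hF hBv]; rewrite /G hF; congr (if _ then _ else _); exact: asbool_equiv_eq.
move=> u u0 nB.
have q01 : 0 < ab q < 1 by rewrite ab_gt0 q0.
have := liouville_Cstar q01 GA Gq u0 (oner_neq0 C).
by rewrite /G asboolF // asboolT.
Qed.

(** The duplication formula of [lam] summed over the lattice. The points [u], [- u], [p * u],
    [- (p * u)] are the four halves of [u ^+ 2]; those with [p] supply the odd powers of [q]. *)
Lemma S_dup p u : p ^+ 2 = q -> u != 0 -> ~ inlat (u ^+ 2) ->
  S u + S (- u) + S (p * u) + S (- (p * u)) = 4 * S (u ^+ 2).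
Proof.
move=> pq u0 hu; have p0 : p != 0 by apply: contraNneq q0 => e; rewrite -pq e expr0n.
have hn (v : C) n : ~ inlat (v ^+ 2) -> (v * q ^+ n) ^+ 2 != 1.
  by move=> h; rewrite exprMn -exprM; exact: nlat_nat.
have hpu : ~ inlat ((p * u) ^+ 2) by rewrite exprMn pq => /(inlatMl _ inlatq).
have hV (v : C) : ~ inlat (v ^+ 2) -> ~ inlat ((q / v) ^+ 2).
  rewrite exprMn => h h'; apply: h.
  have := (inlatMl (v ^-1 ^+ 2) (inlatM inlatq inlatq)).1.
  by rewrite -expr2 => /(_ h') /inlatV; rewrite exprVn invrK.
rewrite /S !invrN !mulrN.
have e1 := lamsum_dup q1 (fun n => hn u n hu).
have e2 := lamsum_dup q1 (fun n => hn (p * u) n hpu).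
have e3 := lamsum_dup q1 (fun n => hn (q / u) n (hV _ hu)).
have e4 := lamsum_dup q1 (fun n => hn (q / (p * u)) n (hV _ hpu)).
have f1 := lamsum_evenodd (u ^+ 2) q1.
have f2 := lamsum_evenodd (q / u ^+ 2) q1.
have g2 : (p * u) ^+ 2 = u ^+ 2 * q by rewrite exprMn pq mulrC.
have g3 : (q / u) ^+ 2 = q / u ^+ 2 * q by field.
have g4 : (q / (p * u)) ^+ 2 = q / u ^+ 2.
  by rewrite exprMn exprVn g2; field; rewrite q0 u0.
rewrite g2 in e2; rewrite g3 in e3; rewrite g4 in e4.
have E (a b c d a' b' c' d' x y z w X Y : C) : a + a' = 4 * x -> b + b' = 4 * y ->
    c + c' = 4 * w -> d + d' = 4 * z -> x + y = X -> z + w = Y ->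
    a + c + (a' + c') + (b + d) + (b' + d') = 4 * (X + Y).
  move=> h1 h2 h3 h4 <- <-.
  have -> : a + c + (a' + c') + (b + d) + (b' + d') = (a + a') + (b + b') + (c + c') + (d + d') by ring.
  by rewrite h1 h2 h3 h4; ring.
exact: E e1 e2 e3 e4 f1 f2.
Qed.

Lemma S_tors_Ana t u : t != 0 -> u != 0 -> ~ inlat (t * u) -> Ana (fun u => S (t * u)) u.
Proof. by move=> t0 u0 h; apply: Ana_scale => //; apply: S_Ana; rewrite ?mulf_neq0. Qed.

(** Translation by a point of order 2. The double pole of [S u] at 1 meets a double zero of
    [S (t * u) - S t], so the product is elliptic without poles. If [k] were 0, the second factor
    would vanish near 1, making [S] constant near [t]. *)
Lemma S_two_torsion t : t != 0 -> ~ inlat t -> inlat (t ^+ 2) ->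
  exists2 k, k != 0 & forall u, u != 0 -> ~ inlat u -> ~ inlat (t * u) ->
    (S u - S t) * (S (t * u) - S t) = k.
Proof.
move=> t0 ht ht2; set e := S t.
pose G u := S (t * u) - e.
have GA : Ana G 1.
  apply: Ana_sub; last exact: Ana_cst.
  by apply: S_tors_Ana; rewrite ?mulr1 ?oner_neq0.
have Gsym u : u != 0 -> G u^-1 = G u.
  move=> u0; rewrite /G -SV ?mulf_neq0 ?invr_eq0 // invfM invrK.
  rewrite -(S_lat (v := t ^+ 2)) ?mulf_neq0 ?invr_eq0 //.
  by congr (S _ - _); field.
have [g [gA GE]] := Ana_slope GA.
have G0 : G 1 = 0 by rewrite /G mulr1 subrr.
have gsym u : u != 0 -> u != 1 -> g u = - (u^-1 * g u^-1).
  move=> u0 u1; have := Gsym u u0; rewrite (GE u) (GE u^-1) G0 !add0r => h.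
  apply: (@mulfI _ (u - 1)); first by rewrite subr_eq0.
  by rewrite -h; field.
(* The zero is double: invariance of [G] under inversion reads [g u = - (u^-1 * g u^-1)], and
   letting [u] tend to 1 gives [g 1 = - g 1]. *)
have g1 : g 1 = 0.
  apply/eqP; rewrite -ab_eq0 eq_le ab_ge0 andbT leNgt; apply/negP => gp.
  have e4 : 0 < ab (g 1) / 4 by lra.
  have [d1 d10 H1] := Ana_near_ball gA e4.
  have iA : Ana (fun u : C => u^-1) 1 by apply: Ana_inv; [exact: Ana_id|exact: oner_neq0].
  pose dd := Num.min d1 (1 / 4).
  have dd0 : 0 < dd by rewrite lt_min d10; lra.
  have [d2 d20 H2] := Ana_near_ball iA dd0.
  pose s := Num.min d1 d2 / 2.
  have s0 : 0 < s by rewrite divr_gt0 // lt_min d10.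
  have s2 : 2 * s = Num.min d1 d2 by rewrite mulrC divfK.
  have sd1 : s < d1.
    have : 2 * s <= d1 by rewrite s2 ge_min lexx.
    lra.
  have sd2 : s < d2.
    have : 2 * s <= d2 by rewrite s2 ge_min lexx orbT.
    lra.
  pose u : C := 1 + s%:C.
  have us : ab (u - 1) = s by rewrite addrAC subrr add0r abR gtr0_norm.
  have u1 : u != 1 by rewrite -subr_eq0 -ab_gt0 us.
  have u0 : u != 0.
    have -> : u = (1 + s)%:C by rewrite rmorphD rmorph1.
    by rewrite -ab_gt0 abR gtr0_norm; lra.
  have := H2 u; rewrite us invr1 lt_min => /(_ sd2)/andP[v1 v2].
  have h1 := H1 u; rewrite us in h1; have {}h1 := h1 sd1.
  have h2 := H1 u^-1 v1.
  have : 2 * g 1 = (g 1 - g u) + (g 1 - g u^-1) - (u^-1 - 1) * (g u^-1 - g 1) - (u^-1 - 1) * g 1.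
    by rewrite (gsym u) //; ring.
  move=> /(congr1 (@ab R)).
  have -> : ab (2 * g 1) = 2 * ab (g 1) by rewrite abM ab_nat.
  move=> E; have := abB (g 1 - g u + (g 1 - g u^-1) - (u^-1 - 1) * (g u^-1 - g 1)) ((u^-1 - 1) * g 1).
  rewrite -E; have := abB (g 1 - g u + (g 1 - g u^-1)) ((u^-1 - 1) * (g u^-1 - g 1)).
  have := abD (g 1 - g u) (g 1 - g u^-1); rewrite !abM (abBC (g 1) (g u)) (abBC (g 1) (g u^-1)).
  have := ab_ge0 (u^-1 - 1); have := ab_ge0 (g u^-1 - g 1); nra.
have [k [kA gE]] := Ana_slope gA.
have GE2 u : G u = (u - 1) ^+ 2 * k u by rewrite GE G0 gE g1; ring.
pose F u := (S u - e) * (S (t * u) - e).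
pose B u := inlat u \/ inlat (t * u).
(* The first factor is [(u - 1) ^+ 2 * (S u - e)] with the pole cleared, and [k u] is [G u] divided
   by [(u - 1) ^+ 2]. *)
pose H u := (u + (u - 1) ^+ 2 * (Sreg u - e)) * k u.
have X1 : Ana (fun u : C => u - 1) 1 by apply: Ana_sub; [exact: Ana_id|exact: Ana_cst].
have HA : Ana H 1.
  apply: Ana_mul => //; apply: Ana_add; first exact: Ana_id.
  by apply: Ana_mul; [exact: Ana_exp|apply: Ana_sub; [exact: Sreg_Ana|exact: Ana_cst]].
have [d1 d10 H1] := nlat_near1.
have [d2 d20 H2] : exists2 d : R, 0 < d & forall u, ab (u - 1) < d -> ~ inlat (t * u).
  have [d d0 Hd] := nlat_near t0 ht; exists (d / ab t); first by rewrite divr_gt0 ?ab_gt0.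
  move=> u; rewrite ltr_pdivlMr ?ab_gt0 // => hu; apply: Hd.
  by rewrite -{2}[t]mulr1 -mulrBr abM mulrC.
have dm : 0 < Num.min d1 d2 by rewrite lt_min d10.
have FH u : u != 1 -> ab (u - 1) < Num.min d1 d2 -> ~ B u /\ F u = H u.
  move=> u1; rewrite lt_min => /andP[/(H1 _ u1) n1 /H2 n2]; split; first by case.
  rewrite /F -/(G u) GE2 SE /H /lam; field.
  by rewrite subr_eq0 eq_sym.
have FS v : v != 0 -> F (t * v) = F v /\ (B (t * v) <-> B v).
  move=> v0; rewrite /F /B mulrA -expr2 [S (t ^+ 2 * v)]S_lat // mulrC; split=> //.
  split; first by case=> [|/(inlatMl _ ht2)]; [right|left].
  by case=> [/(inlatMl _ ht2)|]; [right|left].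
have FL c v : inlat c -> v != 0 -> F (c * v) = F v /\ (B (c * v) <-> B v).
  move=> hc v0; rewrite /F /B (mulrCA t c v) [S (c * v)]S_lat // [S (c * (t * v))]S_lat ?mulf_neq0 //; split=> //.
  by split; case=> [/(inlatMl _ hc)|/(inlatMl _ hc)]; by [left|right].
have key := @elliptic_const F B H (Num.min d1 d2) _ _ _ HA dm FH (or_introl inlat1)
  (fun v => FL q v inlatq).
have Fk u : u != 0 -> ~ B u -> F u = H 1.
  apply: key.
  - move=> v v0 nB; apply: Ana_mul; apply: Ana_sub; try exact: Ana_cst.
      by apply: S_Ana => // h; apply: nB; left.
    by apply: S_tors_Ana => // h; apply: nB; right.
  - move=> v v0 nB.
    have [a a0 Ha] := nlat_near v0 (fun h => nB (or_introl h)).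
    have [b b0 Hb] := nlat_near (mulf_neq0 t0 v0) (fun h => nB (or_intror h)).
    exists (Num.min a (b / ab t)); first by rewrite lt_min a0 divr_gt0 ?ab_gt0.
    move=> w; rewrite lt_min ltr_pdivlMr ?ab_gt0 // => /andP[/Ha h1 h2] [//|].
    by apply: Hb; rewrite -mulrBr abM mulrC.
  - move=> v v0 [hv|hv].
      by exists v^-1; [rewrite mulVf|move=> w w0; apply: FL => //; exact: inlatV].
    exists ((t * v)^-1 * t); first by rewrite -mulrA mulVf ?mulf_neq0.
    move=> w w0; rewrite -mulrA.
    have [e1 e2] := FL (t * v)^-1 (t * w) (inlatV hv) (mulf_neq0 t0 w0).
    have [e3 e4] := FS w w0; rewrite e1 e3; split=> //.
    by rewrite e2.
exists (H 1); last by move=> u u0 n1 n2; apply: Fk => // -[].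
apply/eqP => H0.
apply: (@S_not_locally_eq e t t0 ht).
have [d d0 Hp] := S_pole (ab e).
exists (Num.min (Num.min d 1) (Num.min d1 d2) * ab t).
  by rewrite mulr_gt0 ?ab_gt0 // !lt_min d0 ltr01 d10.
move=> w hw; have [->|wt] := eqVneq w t; first by [].
pose u := t^-1 * w.
have tu : t * u = w by rewrite /u mulrA divff // mul1r.
have u1 : u != 1 by apply: contra_neq wt => e1; rewrite -tu e1 mulr1.
have hu : ab (u - 1) < Num.min (Num.min d 1) (Num.min d1 d2).
  rewrite -(ltr_pM2r (x := ab t)) ?ab_gt0 // -abM.
  by have -> : (u - 1) * t = w - t by rewrite -tu; ring.
move: hu; rewrite lt_min => /andP[hu1 hu2]; move: hu1; rewrite lt_min => /andP[hu1 hu3].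
have [nB FE] := FH _ u1 hu2.
have un0 : u != 0 by apply: contraTneq hu3 => ->; rewrite sub0r abN ab1 ltxx.
have := Fk _ un0 nB; rewrite H0 /F tu => /eqP; rewrite mulf_eq0 !subr_eq0 => /orP[/eqP h|/eqP //].
by have := Hp _ u1 hu1; rewrite h ltxx.
Qed.

Lemma S_locally_eq_scale e t (d : R) : t != 0 -> 0 < d ->
  (forall u, ab (u - 1) < d -> S (t * u) = e) -> locally_eq S e t.
Proof.
move=> t0 d0 h; exists (d * ab t); first by rewrite mulr_gt0 ?ab_gt0.
move=> w hw; have -> : w = t * (t^-1 * w) by rewrite mulrA divff // mul1r.
apply: h; rewrite -(ltr_pM2r (x := ab t)) ?ab_gt0 // -abM.
by have -> : (t^-1 * w - 1) * t = w - t by field.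
Qed.

Lemma nlat_near_scale t v : t != 0 -> v != 0 -> ~ inlat (t * v) ->
  exists2 d : R, 0 < d & forall u, ab (u - v) < d -> ~ inlat (t * u).
Proof.
move=> t0 v0 ht; have [d d0 Hd] := nlat_near (mulf_neq0 t0 v0) ht.
exists (d / ab t); first by rewrite divr_gt0 ?ab_gt0.
by move=> u; rewrite ltr_pdivlMr ?ab_gt0 // => hu; apply: Hd; rewrite -mulrBr abM mulrC.
Qed.

(** As for order 2, but the double pole at 1 now meets two simple zeros, of [S (t * u) - S t] and of
    [S (t^-1 * u) - S t]; the second one comes from evenness. *)
Lemma S_three_torsion t : t != 0 -> ~ inlat t -> inlat (t ^+ 3) ->
  exists2 k, k != 0 & forall u, u != 0 -> ~ inlat u -> ~ inlat (t * u) -> ~ inlat (t^-1 * u) ->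
    (S u - S t) * (S (t * u) - S t) * (S (t^-1 * u) - S t) = k.
Proof.
move=> t0 ht ht3; set e := S t.
have ti0 : t^-1 != 0 by rewrite invr_eq0.
have hti : ~ inlat t^-1 by move=> /inlatV; rewrite invrK.
have tA : Ana (fun u => S (t * u)) 1 by apply: S_tors_Ana; rewrite ?mulr1 ?oner_neq0.
have tiA : Ana (fun u => S (t^-1 * u)) 1 by apply: S_tors_Ana; rewrite ?mulr1 ?oner_neq0.
have [g1 [g1A G1]] := Ana_slope tA; have [g2 [g2A G2]] := Ana_slope tiA.
have Ste : S (t * 1) = e by rewrite mulr1.
have Stie : S (t^-1 * 1) = e by rewrite mulr1 SV.
have G1E u : S (t * u) - e = (u - 1) * g1 u by rewrite G1 Ste; ring.
have G2E u : S (t^-1 * u) - e = (u - 1) * g2 u by rewrite G2 Stie; ring.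
pose F u := (S u - e) * (S (t * u) - e) * (S (t^-1 * u) - e).
pose B u := [\/ inlat u, inlat (t * u) | inlat (t^-1 * u)].
pose H u := (u + (u - 1) ^+ 2 * (Sreg u - e)) * g1 u * g2 u.
have X1 : Ana (fun u : C => u - 1) 1 by apply: Ana_sub; [exact: Ana_id|exact: Ana_cst].
have HA : Ana H 1.
  apply: Ana_mul => //; apply: Ana_mul => //; apply: Ana_add; first exact: Ana_id.
  by apply: Ana_mul; [exact: Ana_exp|apply: Ana_sub; [exact: Sreg_Ana|exact: Ana_cst]].
have [d1 d10 H1] := nlat_near1.
have ht1 : ~ inlat (t * 1) by rewrite mulr1.
have hti1 : ~ inlat (t^-1 * 1) by rewrite mulr1.
have [d2 d20 H2] := nlat_near_scale t0 (oner_neq0 C) ht1.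
have [d3 d30 H3] := nlat_near_scale ti0 (oner_neq0 C) hti1.
pose dm := Num.min d1 (Num.min d2 d3).
have dm0 : 0 < dm by rewrite !lt_min d10 d20.
have FH u : u != 1 -> ab (u - 1) < dm -> ~ B u /\ F u = H u.
  move=> u1; rewrite !lt_min => /andP[/(H1 _ u1) n1 /andP[/H2 n2 /H3 n3]]; split; first by case.
  rewrite /F G1E G2E SE /H /lam; field.
  by rewrite subr_eq0 eq_sym.
have tt v : v != 0 -> S (t * (t * v)) = S (t^-1 * v).
  move=> v0; rewrite -[RHS](S_lat (v := t ^+ 3)) ?mulf_neq0 //; congr S; field.
  exact: t0.
have ttl v : inlat (t * (t * v)) <-> inlat (t^-1 * v).
  rewrite -(inlatMl (t^-1 * v) ht3).
  by have -> : t ^+ 3 * (t^-1 * v) = t * (t * v) by field.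
have FS v : v != 0 -> F (t * v) = F v /\ (B (t * v) <-> B v).
  move=> v0; rewrite /F /B tt // mulKf //; split; first by ring.
  by rewrite (propext (ttl v)); split; case; by [constructor 1|constructor 2|constructor 3].
have FL c v : inlat c -> v != 0 -> F (c * v) = F v /\ (B (c * v) <-> B v).
  move=> hc v0; rewrite /F /B (mulrCA t c v) (mulrCA t^-1 c v) [S (c * v)]S_lat //.
  rewrite [S (c * (t * v))]S_lat ?mulf_neq0 // [S (c * (t^-1 * v))]S_lat ?mulf_neq0 //; split=> //.
  by rewrite (propext (inlatMl v hc)) (propext (inlatMl (t * v) hc)) (propext (inlatMl (t^-1 * v) hc)).
have key := @elliptic_const F B H dm _ _ _ HA dm0 FH (Or31 _ _ inlat1) (fun v => FL q v inlatq).
have Fk u : u != 0 -> ~ B u -> F u = H 1.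
  apply: key.
  - move=> v v0 nB; apply: Ana_mul; first apply: Ana_mul; apply: Ana_sub; try exact: Ana_cst.
    + by apply: S_Ana => // h; apply: nB; constructor 1.
    + by apply: S_tors_Ana => // h; apply: nB; constructor 2.
    + by apply: S_tors_Ana => // h; apply: nB; constructor 3.
  - move=> v v0 nB.
    have [a a0 Ha] := nlat_near v0 (fun h => nB (Or31 _ _ h)).
    have [b b0 Hb] := nlat_near_scale t0 v0 (fun h => nB (Or32 _ _ h)).
    have [c c0 Hc] := nlat_near_scale ti0 v0 (fun h => nB (Or33 _ _ h)).
    exists (Num.min a (Num.min b c)); first by rewrite !lt_min a0 b0.
    by move=> w; rewrite !lt_min => /andP[/Ha h1 /andP[/Hb h2 /Hc h3]] [].
  - move=> v v0 [hv|hv|hv].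
    + by exists v^-1; [rewrite mulVf|move=> w w0; apply: FL => //; exact: inlatV].
    + exists ((t * v)^-1 * t); first by rewrite -mulrA mulVf ?mulf_neq0.
      move=> w w0; rewrite -mulrA.
      have [e1 e2] := FL (t * v)^-1 (t * w) (inlatV hv) (mulf_neq0 t0 w0).
      by have [e3 e4] := FS w w0; rewrite e1 e3 (propext e2).
    + move/ttl: hv => hv; exists ((t * (t * v))^-1 * (t * t)).
        by rewrite -[X in X = _]mulrA -(mulrA t t v) mulVf ?mulf_neq0.
      move=> w w0; rewrite -mulrA -(mulrA t t w).
      have tw0 := mulf_neq0 t0 w0.
      have [e1 e2] := FL (t * (t * v))^-1 (t * (t * w)) (inlatV hv) (mulf_neq0 t0 tw0).
      have [e3 e4] := FS (t * w) tw0.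
      by have [e5 e6] := FS w w0; rewrite e1 e3 e5 (propext e2) (propext e4).
exists (H 1); last by move=> u u0 n1 n2 n3; apply: Fk => // -[].
(* A zero product near 1 is impossible: the first factor is large there, and the other two have
   isolated zeros since [S] is nowhere locally constant. *)
apply/eqP => H0.
have [a a0 [Ha|Ha]] := Ana_dichotomy e tA.
  exact: (S_not_locally_eq t0 ht (S_locally_eq_scale t0 a0 Ha)).
have [b b0 [Hb|Hb]] := Ana_dichotomy e tiA.
  exact: (S_not_locally_eq ti0 hti (S_locally_eq_scale ti0 b0 Hb)).
have [d d0 Hp] := S_pole (ab e).
pose s := Num.min (Num.min (Num.min a b) d) dm / 2.
have s0 : 0 < s by rewrite divr_gt0 // !lt_min a0 b0 d0 d10 d20 d30.
have s2 : s < Num.min (Num.min (Num.min a b) d) dm.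
  have -> : Num.min (Num.min (Num.min a b) d) dm = 2 * s by rewrite mulrC divfK.
  lra.
move: s2; rewrite lt_min => /andP[+ sdm]; rewrite lt_min => /andP[+ sd]; rewrite lt_min => /andP[sa sb].
pose u : C := 1 + s%:C.
have us : ab (u - 1) = s by rewrite addrAC subrr add0r abR gtr0_norm.
have u1 : u != 1 by rewrite -subr_eq0 -ab_gt0 us.
have u0 : u != 0.
  have -> : u = (1 + s)%:C by rewrite rmorphD rmorph1.
  by rewrite -ab_gt0 abR gtr0_norm; lra.
have [|nB _] := FH _ u1; first by rewrite us.
have := Fk _ u0 nB; rewrite H0 /F => /eqP; rewrite !mulf_eq0 !subr_eq0.
have /negPf -> : S (t * u) != e by apply: Ha => //; rewrite us.
have /negPf -> : S (t^-1 * u) != e by apply: Hb => //; rewrite us.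
rewrite !orbF => /eqP h.
by have := Hp _ u1; rewrite us h ltxx => /(_ sd).
Qed.

(** A nonzero constant product forbids a vanishing factor. This separates torsion values without
    counting zeros of elliptic functions. *)
Lemma S_two_torsion_inj t u : t != 0 -> ~ inlat t -> inlat (t ^+ 2) ->
  u != 0 -> ~ inlat u -> ~ inlat (t * u) -> S u != S t.
Proof.
move=> t0 ht ht2 u0 h1 h2; have [k k0 H] := S_two_torsion t0 ht ht2.
by apply: contraNneq k0 => e; rewrite -(H u) // e subrr mul0r.
Qed.

Lemma S_three_torsion_inj t u : t != 0 -> ~ inlat t -> inlat (t ^+ 3) ->
  u != 0 -> ~ inlat u -> ~ inlat (t * u) -> ~ inlat (t^-1 * u) -> S u != S t.
Proof.
move=> t0 ht ht2 u0 h1 h2 h3; have [k k0 H] := S_three_torsion t0 ht ht2.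
by apply: contraNneq k0 => e; rewrite -(H u) // e subrr !mul0r.
Qed.

End Torus.

(** * Polynomial identities behind the equation of the curve *)

Section TorsionAlgebra.
Variable F : numFieldType.
Implicit Types e a y k s : F.

(** The hypothesis is the duplication formula at a point of order 3, where doubling preserves the
    value [a]. It amounts to the 3-division polynomial in [a - e1]; in [k1 / (a - e1)], the value at
    the translate by a point of order 2, it becomes monic without cubic term. *)
Lemma quartic_relation (e1 e2 e3 a : F) : a != e1 -> a != e2 -> a != e3 ->
  let k1 := (e2 - e1) * (e3 - e1) in let k2 := (e1 - e2) * (e3 - e2) in
  let k3 := (e1 - e3) * (e2 - e3) in
  4 * a = a + (e1 + k1 / (a - e1)) + (e2 + k2 / (a - e2)) + (e3 + k3 / (a - e3)) ->
  let y := k1 / (a - e1) in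
  y ^+ 4 - 6 * k1 * y ^+ 2 - 4 * (2 * e1 - e2 - e3) * k1 * y - 3 * k1 ^+ 2 = 0.
Proof.
move=> m1 m2 m3 k1 k2 k3 E y.
have n1 : a - e1 != 0 by rewrite subr_eq0.
have n2 : a - e2 != 0 by rewrite subr_eq0.
have n3 : a - e3 != 0 by rewrite subr_eq0.
have h : k1 * (a - e2) * (a - e3) + k2 * (a - e1) * (a - e3) + k3 * (a - e1) * (a - e2)
    - (3 * a - e1 - e2 - e3) * ((a - e1) * (a - e2) * (a - e3)) = 0.
  have -> : 3 * a - e1 - e2 - e3 = 4 * a - a - e1 - e2 - e3 by ring.
  by rewrite E; field; rewrite n1 n2 n3.
have : (a - e1) ^+ 4 * (y ^+ 4 - 6 * k1 * y ^+ 2 - 4 * (2 * e1 - e2 - e3) * k1 * y - 3 * k1 ^+ 2) =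
    k1 ^+ 2 * (k1 * (a - e2) * (a - e3) + k2 * (a - e1) * (a - e3) + k3 * (a - e1) * (a - e2)
    - (3 * a - e1 - e2 - e3) * ((a - e1) * (a - e2) * (a - e3))).
  by rewrite /y /k2 /k3 /k1; field.
by rewrite h mulr0 => /eqP; rewrite mulf_eq0 expf_eq0 (negPf n1) andbF /= => /eqP.
Qed.

(** [A] and [B] are the Lagrange resolvents of the three roots other than [y]. Because the quartic
    lacks its cubic term, their product and the sum of their cubes are rational in [y] and [k]. *)
Lemma resolvent (k s w y u v t : F) : k != 0 -> 1 + w + w ^+ 2 = 0 ->
  (forall z, z \in [:: y; u; v; t] -> z ^+ 4 - 6 * k * z ^+ 2 - 4 * s * k * z - 3 * k ^+ 2 = 0) ->
  uniq [:: y; u; v; t] ->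
  let A := u + w ^+ 2 * v + w * t in let B := u + w * v + w ^+ 2 * t in
  let m := y ^+ 2 - 9 * k in
  [/\ y != 0, u + v + t = - y, A * B = - 2 * m, m != 0
    & y * (A ^+ 3 + B ^+ 3) = (7 * y ^+ 2 + 9 * k) * m].
Proof.
move=> k0 w1 rt un A B m; move: un.
rewrite /= !inE !negb_or -!andbA => /and5P[yu yv yt uv /andP[ut /andP[vt _]]].
have P z : z \in [:: y; u; v; t] -> z ^+ 4 = 6 * k * z ^+ 2 + 4 * s * k * z + 3 * k ^+ 2.
  by move=> /rt h; apply/eqP; rewrite -subr_eq0 -[X in _ == X]h; apply/eqP; ring.
have Py : y ^+ 4 = 6 * k * y ^+ 2 + 4 * s * k * y + 3 * k ^+ 2 by apply: P; rewrite !inE eqxx.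
have Pu : u ^+ 4 = 6 * k * u ^+ 2 + 4 * s * k * u + 3 * k ^+ 2 by apply: P; rewrite !inE eqxx orbT.
have Pv : v ^+ 4 = 6 * k * v ^+ 2 + 4 * s * k * v + 3 * k ^+ 2 by apply: P; rewrite !inE eqxx !orbT.
have Pt : t ^+ 4 = 6 * k * t ^+ 2 + 4 * s * k * t + 3 * k ^+ 2 by apply: P; rewrite !inE eqxx !orbT.
have y0 : y != 0.
  apply: contraNneq k0 => e; have := Py; rewrite e !expr0n /= !mulr0 !add0r => /esym/eqP.
  by rewrite mulf_eq0 pnatr_eq0 /= expf_eq0.
(* First and second divided differences of the quartic yield the symmetric functions of its
   roots. *)
have dd1 z x : z != x -> z ^+ 4 = 6 * k * z ^+ 2 + 4 * s * k * z + 3 * k ^+ 2 ->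
    x ^+ 4 = 6 * k * x ^+ 2 + 4 * s * k * x + 3 * k ^+ 2 ->
    z ^+ 3 + z ^+ 2 * x + z * x ^+ 2 + x ^+ 3 = 6 * k * (z + x) + 4 * s * k.
  move=> zx hz hx; apply: (@mulfI _ (z - x)); first by rewrite subr_eq0.
  have -> : (z - x) * (z ^+ 3 + z ^+ 2 * x + z * x ^+ 2 + x ^+ 3) = z ^+ 4 - x ^+ 4 by ring.
  by rewrite hz hx; ring.
have dyu := dd1 _ _ yu Py Pu; have dyv := dd1 _ _ yv Py Pv; have dyt := dd1 _ _ yt Py Pt.
have dd2 x z : x != z ->
    y ^+ 3 + y ^+ 2 * x + y * x ^+ 2 + x ^+ 3 = 6 * k * (y + x) + 4 * s * k ->
    y ^+ 3 + y ^+ 2 * z + y * z ^+ 2 + z ^+ 3 = 6 * k * (y + z) + 4 * s * k ->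
    y ^+ 2 + y * (x + z) + (x ^+ 2 + x * z + z ^+ 2) = 6 * k.
  move=> xz hx hz; apply: (@mulfI _ (x - z)); first by rewrite subr_eq0.
  have -> : (x - z) * (y ^+ 2 + y * (x + z) + (x ^+ 2 + x * z + z ^+ 2)) =
    (y ^+ 3 + y ^+ 2 * x + y * x ^+ 2 + x ^+ 3) - (y ^+ 3 + y ^+ 2 * z + y * z ^+ 2 + z ^+ 3) by ring.
  by rewrite hx hz; ring.
have duv := dd2 _ _ uv dyu dyv; have dut := dd2 _ _ ut dyu dyt.
have sum0 : y + u + v + t = 0.
  apply: (@mulfI _ (v - t)); first by rewrite subr_eq0.
  have -> : (v - t) * (y + u + v + t) = (y ^+ 2 + y * (u + v) + (u ^+ 2 + u * v + v ^+ 2)) -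
     (y ^+ 2 + y * (u + t) + (u ^+ 2 + u * t + t ^+ 2)) by ring.
  by rewrite duv dut subrr mulr0.
have tE : t = - (y + u + v) by apply/eqP; rewrite -addr_eq0 addrC sum0.
have wE : w ^+ 2 = - 1 - w by apply/eqP; rewrite -subr_eq0 -[X in _ == X]w1; apply/eqP; ring.
have w3 : w ^+ 3 = 1 by rewrite exprS wE mulrBr mulrN1 -expr2 wE; ring.
have AB : A * B = - 2 * m.
  have -> : A * B = u ^+ 2 + w ^+ 3 * v ^+ 2 + w ^+ 3 * t ^+ 2 + (w + w ^+ 2) * (u * v)
      + (w + w ^+ 2) * (u * t) + (w * w ^+ 3 + w ^+ 2) * (v * t) by rewrite /A /B; ring.
  rewrite w3 mulr1 wE; have -> : w + (- 1 - w) = -1 by ring.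
  rewrite tE /m; have -> : - 2 * (y ^+ 2 - 9 * k) = - 2 * y ^+ 2 + 3 * (6 * k) by ring.
  by rewrite -duv; ring.
have k6 : 6 * k = y ^+ 2 + y * (u + v) + (u ^+ 2 + u * v + v ^+ 2) by rewrite duv.
have S3 : y * (A ^+ 3 + B ^+ 3) = (7 * y ^+ 2 + 9 * k) * m.
  have -> : A ^+ 3 + B ^+ 3 = 2 * (u ^+ 3 + v ^+ 3 + t ^+ 3) + 12 * (u * v * t)
      - 3 * (u ^+ 2 * (v + t) + v ^+ 2 * (u + t) + t ^+ 2 * (u + v)).
    have -> : A ^+ 3 + B ^+ 3 = 2 * u ^+ 3 + (w ^+ 3 + w ^+ 3 ^+ 2) * (v ^+ 3 + t ^+ 3)
       + 3 * (w + w ^+ 2) * (u ^+ 2 * (v + t)) + 3 * (w ^+ 2 + w * w ^+ 3) * (u * v ^+ 2 + u * t ^+ 2)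
       + 12 * w ^+ 3 * (u * v * t) + 3 * (w * w ^+ 3 + w ^+ 2 * w ^+ 3) * (v ^+ 2 * t + v * t ^+ 2).
      by rewrite /A /B; ring.
    by rewrite w3 expr1n !mulr1 wE; ring.
  have k4 : 3 * k ^+ 2 = y ^+ 4 - 6 * k * y ^+ 2 - y * (4 * s * k) by rewrite Py; ring.
  have sk : 4 * s * k = (y ^+ 3 + y ^+ 2 * u + y * u ^+ 2 + u ^+ 3) - 6 * k * (y + u).
    by rewrite dyu; ring.
  have -> : (7 * y ^+ 2 + 9 * k) * m = 7 * y ^+ 4 - 9 * (6 * k) * y ^+ 2 - 27 * (3 * k ^+ 2).
    by rewrite /m; ring.
  by rewrite k4 sk k6 tE; ring.
(* If [m] vanished, both resolvents would be 0, which forces two of the roots to coincide. *)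
have m0 : m != 0.
  apply/eqP => m0; rewrite m0 mulr0 in AB; rewrite m0 mulr0 in S3.
  have AB0 : A = 0 /\ B = 0.
    move/eqP: AB; rewrite mulf_eq0 => /orP[/eqP A0|/eqP B0].
      move/eqP: S3; rewrite mulf_eq0 (negPf y0) A0 expr0n add0r expf_eq0 /= => /eqP B0.
      by [].
    move/eqP: S3; rewrite mulf_eq0 (negPf y0) B0 expr0n addr0 expf_eq0 /= => /eqP A0.
    by [].
  have [A0 B0] := AB0.
  have w12 : w ^+ 2 - w != 0.
    rewrite wE; apply/eqP => e; have h3 : w * (w ^+ 2) = 1 by rewrite -exprS w3.
    have w2 : 2 * w = -1 by apply/eqP; rewrite -subr_eq0 -oppr_eq0 -e; apply/eqP; ring.
    have := congr1 (fun x => 4 * x) wE.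
    have -> : 4 * w ^+ 2 = (2 * w) ^+ 2 by ring.
    have -> : 4 * (- 1 - w) = - 4 - 2 * (2 * w) by ring.
    rewrite w2 => /eqP; rewrite -subr_eq0.
    have -> : (-1) ^+ 2 - (- 4 - 2 * -1) = 3 :> F by ring.
    by rewrite pnatr_eq0.
  have : (w ^+ 2 - w) * (v - t) = A - B by rewrite /A /B; ring.
  rewrite A0 B0 subrr => /eqP; rewrite mulf_eq0 (negPf w12) subr_eq0 /= => /eqP e.
  by rewrite e eqxx in vt.
by split=> //; rewrite tE; ring.
Qed.

(** [A ^+ 3] and [B ^+ 3] have known sum and product, hence are the roots of a quadratic; it splits
    over the field with the roots [8 * y * m] and [- m ^+ 2 / y]. *)
Lemma resolvent_roots (k y A B : F) (m := y ^+ 2 - 9 * k) : y != 0 ->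
  A * B = - 2 * m -> y * (A ^+ 3 + B ^+ 3) = (7 * y ^+ 2 + 9 * k) * m ->
  (A ^+ 3 - 8 * y * m) * (y * A ^+ 3 + m ^+ 2) = 0.
Proof.
move=> y0 AB S3.
have h : A ^+ 3 * B ^+ 3 = - 8 * m ^+ 3 by rewrite -exprMn AB; ring.
have -> : (A ^+ 3 - 8 * y * m) * (y * A ^+ 3 + m ^+ 2) =
  A ^+ 3 * (y * (A ^+ 3 + B ^+ 3)) - y * (A ^+ 3 * B ^+ 3)
   - A ^+ 3 * (8 * y ^+ 2 - m) * m - 8 * y * m ^+ 3 by ring.
by rewrite S3 h /m; ring.
Qed.

(* [C], [D] and [Y] are the quantities of the theorem, [a] is the value at a point
   of order 3 and the [ei] are the values at the points of order 2. *)
Lemma CD_relations (e1 e2 e3 a : F) : a != e1 -> a != e2 -> a != e3 ->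
  e1 != e2 -> e1 != e3 -> e2 != e3 ->
  let k1 := (e2 - e1) * (e3 - e1) in let k2 := (e1 - e2) * (e3 - e2) in
  let k3 := (e1 - e3) * (e2 - e3) in
  4 * a = a + (e1 + k1 / (a - e1)) + (e2 + k2 / (a - e2)) + (e3 + k3 / (a - e3)) ->
  let y := k1 / (a - e1) in
  let C := e1 + y - a in let D := e3 + k3 / (a - e3) - (e2 + k2 / (a - e2)) in
  let Y := - 3 * C / D in
  [/\ D != 0, C != 0, Y ^+ 2 * (y ^+ 2 - 9 * k1) = 9 * (y ^+ 2 - k1),
    (a - e1) / (a - e2) = ((9 / Y ^+ 2 + 1) / 2 - 3 / Y) / 2
    & (a - e1) / (a - e3) = ((9 / Y ^+ 2 + 1) / 2 + 3 / Y) / 2].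
Proof.
move=> n1 n2 n3 n12 n13 n23 k1 k2 k3 E y C D Y.
pose a1 := a - e1; pose a2 := a - e2; pose a3 := a - e3.
have a10 : a1 != 0 by rewrite subr_eq0.
have a20 : a2 != 0 by rewrite subr_eq0.
have a30 : a3 != 0 by rewrite subr_eq0.
have a230 : a2 - a3 != 0.
  have -> : a2 - a3 = e3 - e2 by rewrite /a2 /a3; ring.
  by rewrite subr_eq0 eq_sym.
(* The duplication formula with denominators cleared, in a shape where it expresses a square by a
   product; every conclusion is drawn from it. *)
have rel : (a1 * a2 + a1 * a3 - a2 * a3) ^+ 2 = 4 * a1 ^+ 2 * (a2 * a3).
  have : a1 * a2 * a3 * (3 * a - e1 - e2 - e3 - (k1 / a1 + k2 / a2 + k3 / a3)) = 0.
    have -> : 3 * a - e1 - e2 - e3 = 4 * a - a - e1 - e2 - e3 by ring.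
    by rewrite E -/a1 -/a2 -/a3; ring.
  have -> : a1 * a2 * a3 * (3 * a - e1 - e2 - e3 - (k1 / a1 + k2 / a2 + k3 / a3)) =
     4 * a1 ^+ 2 * (a2 * a3) - (a1 * a2 + a1 * a3 - a2 * a3) ^+ 2.
    by rewrite /k1 /k2 /k3 /a1 /a2 /a3; field; rewrite -/a1 -/a2 -/a3 a10 a20 a30.
  by move/eqP; rewrite subr_eq0 => /eqP ->.
set N := a1 * a2 + a1 * a3 - a2 * a3 in rel.
have N0 : N != 0.
  apply/eqP => N0; move/eqP: rel; rewrite N0 expr0n eq_sym !mulf_eq0 /=.
  by rewrite (negPf a10) (negPf a20) (negPf a30) pnatr_eq0.
have CE : C = - N / a1 by rewrite /C /y /k1 /N /a1 /a2 /a3; field.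
have DE : D = (a2 - a3) * N / (a2 * a3).
  by rewrite /D /k2 /k3 /N /a1 /a2 /a3; field; rewrite -/a2 -/a3 a20 a30.
have C0 : C != 0 by rewrite CE mulf_neq0 ?oppr_eq0 ?invr_eq0.
have D0 : D != 0 by rewrite DE !mulf_neq0 ?invr_eq0 ?mulf_neq0.
have YE : Y = 3 * (a2 * a3) / (a1 * (a2 - a3)).
  by rewrite /Y CE DE; field; rewrite N0 a10 a20 a30 a230.
have n30 : 3 != 0 :> F by rewrite pnatr_eq0.
have Y0 : Y != 0 by rewrite YE !mulf_neq0 ?invr_eq0 ?mulf_neq0.
have key : a1 ^+ 2 * (a2 - a3) ^+ 2 = (2 * a1 * (a2 + a3) - a2 * a3) * (a2 * a3).
  have e : a1 ^+ 2 * (a2 - a3) ^+ 2 = (N + a2 * a3) ^+ 2 - 4 * a1 ^+ 2 * (a2 * a3) by rewrite /N; ring.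
  by rewrite e -rel /N; ring.
(* [9 / Y ^+ 2] and [3 / Y] give the sum and the difference of [a1 / a2] and [a1 / a3]. So [Y] alone
   determines both ratios, which is what the converse direction uses. *)
have s9 : 9 / Y ^+ 2 = 2 * (a1 / a2 + a1 / a3) - 1.
  have -> : 9 / Y ^+ 2 = a1 ^+ 2 * (a2 - a3) ^+ 2 / (a2 * a3) ^+ 2.
    by rewrite YE; field; rewrite a10 a20 a30 a230.
  by rewrite key; field; rewrite a20 a30.
have s3 : 3 / Y = a1 / a3 - a1 / a2.
  by rewrite YE; field; rewrite a10 a20 a30 a230.
split=> //; last 2 first.
- by rewrite s9 s3 -/a1 -/a2; field; rewrite a20 a30.
- by rewrite s9 s3 -/a1 -/a3; field; rewrite a20 a30.
have kE : k1 = a1 ^+ 2 - N by rewrite /k1 /N /a1 /a2 /a3; ring.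
have yE : y = k1 / a1 by [].
have Y2 : Y ^+ 2 * (a1 ^+ 2 * (a2 - a3) ^+ 2) = 9 * (a2 * a3) ^+ 2.
  by rewrite YE; field; rewrite a10 a230.
have X0 : a1 ^+ 2 * (a2 - a3) ^+ 2 != 0 by rewrite mulf_neq0 ?expf_neq0.
apply: (@mulIf _ (a1 ^+ 2 * (a2 - a3) ^+ 2 * a1 ^+ 2)); first by rewrite mulf_neq0 ?expf_neq0.
have -> : Y ^+ 2 * (y ^+ 2 - 9 * k1) * (a1 ^+ 2 * (a2 - a3) ^+ 2 * a1 ^+ 2) =
   Y ^+ 2 * (a1 ^+ 2 * (a2 - a3) ^+ 2) * (k1 * (k1 - 9 * a1 ^+ 2)) by rewrite yE; field.
rewrite Y2; have -> : 9 * (y ^+ 2 - k1) * (a1 ^+ 2 * (a2 - a3) ^+ 2 * a1 ^+ 2) =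
   9 * (a1 ^+ 2 * (a2 - a3) ^+ 2) * (k1 * (k1 - a1 ^+ 2)) by rewrite yE; field.
have e : a1 ^+ 2 * (a2 - a3) ^+ 2 = (N + a2 * a3) ^+ 2 - N ^+ 2 by rewrite rel /N; ring.
rewrite e kE.
have -> : 9 * (a2 * a3) ^+ 2 * ((a1 ^+ 2 - N) * (a1 ^+ 2 - N - 9 * a1 ^+ 2)) =
   9 * (a1 ^+ 2 - N) * (a2 * a3) * (- (a2 * a3 * N) - 2 * (4 * a1 ^+ 2 * (a2 * a3))) by ring.
by rewrite -rel; ring.
Qed.

End TorsionAlgebra.

(** The pairs for which [(a tau + b) / 6] is a lattice point, that is, a pole. *)
Definition lat6 (a b : int) : bool := (6 %| a)%Z && (6 %| b)%Z.

(** What the algebra knows about the values of [S] at the 6-torsion points. Abstracting it allows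
    two systems, for two values of [w], to be compared without unfolding any series. *)
Record division_system (F : numFieldType) (eS : int -> int -> F) : Prop := DivisionSystem {
  ds_period : forall a b c d, lat6 (c - a) (d - b) -> eS c d = eS a b;
  ds_sym : forall a b c d, lat6 (c + a) (d + b) -> eS c d = eS a b;
  ds_dup : forall a b, ~~ lat6 (2 * a) (2 * b) ->
    eS a b + eS a (b + 3) + eS (a + 3) b + eS (a + 3) (b + 3) = 4 * eS (2 * a) (2 * b);
  ds_two : forall t1 t2, ~~ lat6 t1 t2 -> lat6 (2 * t1) (2 * t2) ->
    exists2 k, k != 0 & forall a b, ~~ lat6 a b -> ~~ lat6 (t1 + a) (t2 + b) ->
      (eS a b - eS t1 t2) * (eS (t1 + a) (t2 + b) - eS t1 t2) = k;
  ds_inj2 : forall t1 t2 a b, ~~ lat6 t1 t2 -> lat6 (2 * t1) (2 * t2) ->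
    ~~ lat6 a b -> ~~ lat6 (t1 + a) (t2 + b) -> eS a b != eS t1 t2;
  ds_inj3 : forall t1 t2 a b, ~~ lat6 t1 t2 -> lat6 (3 * t1) (3 * t2) ->
    ~~ lat6 a b -> ~~ lat6 (t1 + a) (t2 + b) -> ~~ lat6 (- t1 + a) (- t2 + b) ->
    eS a b != eS t1 t2 }.

(** * Relations between the values at the 6-torsion points *)

Section DivisionAlgebra.
Variables (F : numFieldType) (eS : int -> int -> F) (om : F).
Hypothesis DS : division_system eS.
Hypothesis om_sum : 1 + om + om ^+ 2 = 0.

Let period := ds_period DS.
Let sym := ds_sym DS.
Let dup := ds_dup DS.
Let two := ds_two DS.
Let inj2 := ds_inj2 DS.
Let inj3 := ds_inj3 DS.

Let om3 : om ^+ 3 = 1.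
Proof.
have e : om ^+ 2 = - 1 - om by apply/eqP; rewrite -subr_eq0 -[X in _ == X]om_sum; apply/eqP; ring.
by rewrite exprS e mulrBr mulrN1 -expr2 e; ring.
Qed.

Definition e1 := eS 0 3.
Definition e2 := eS 3 0.
Definition e3 := eS 3 3.
Definition k1 := (e2 - e1) * (e3 - e1).
Definition k2 := (e1 - e2) * (e3 - e2).
Definition k3 := (e1 - e3) * (e2 - e3).

Lemma e21_neq : e2 != e1. Proof. exact: inj2. Qed.
Lemma e31_neq : e3 != e1. Proof. exact: inj2. Qed.
Lemma e32_neq : e3 != e2. Proof. exact: inj2. Qed.

Lemma k1_neq0 : k1 != 0.
Proof. by rewrite mulf_neq0 // subr_eq0; [exact: e21_neq|exact: e31_neq]. Qed.

Lemma two_torsion_shift a b : ~~ lat6 a b -> ~~ lat6 a (b + 3) -> ~~ lat6 (a + 3) b ->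
  ~~ lat6 (a + 3) (b + 3) ->
  [/\ [/\ eS a b != e1, eS a b != e2 & eS a b != e3],
    eS a (b + 3) = e1 + k1 / (eS a b - e1), eS (a + 3) b = e2 + k2 / (eS a b - e2)
    & eS (a + 3) (b + 3) = e3 + k3 / (eS a b - e3)].
Proof.
move=> h0 h1 h2 h3.
have n1 : eS a b != e1 by apply: inj2 => //; rewrite add0r addrC.
have n2 : eS a b != e2 by apply: inj2 => //; rewrite add0r addrC.
have n3 : eS a b != e3 by apply: inj2 => //; rewrite addrC [3 + b]addrC.
have solve (x e k z : F) : x != e -> (x - e) * (z - e) = k -> z = e + k / (x - e).
  by move=> xe <-; rewrite mulrAC divff ?subr_eq0 // mul1r subrKC.
split=> //; apply: solve => //.
- have [//|//|k kn0 H] := @two 0 3; have := H a b h0; rewrite add0r [3 + b]addrC => /(_ h1) ->.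
  by rewrite -(H 3 0).
- have [//|//|k kn0 H] := @two 3 0; have := H a b h0; rewrite add0r [3 + a]addrC => /(_ h2) ->.
  by rewrite -(H 0 3).
- have [//|//|k kn0 H] := @two 3 3; have := H a b h0; rewrite [3 + b]addrC [3 + a]addrC => /(_ h3) ->.
  rewrite -(H 0 3) //; congr (_ * (_ - _)); apply: period; by [].
Qed.

(** At a point of order 3 doubling is negation, so the right side of the duplication formula is the
    value at the point itself. *)
Lemma three_torsion_data a b : ~~ lat6 a b -> lat6 (3 * a) (3 * b) ->
  [/\ [/\ eS a b != e1, eS a b != e2 & eS a b != e3],
    eS a (b + 3) = e1 + k1 / (eS a b - e1), eS (a + 3) b = e2 + k2 / (eS a b - e2),
    eS (a + 3) (b + 3) = e3 + k3 / (eS a b - e3)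
    & 4 * eS a b = eS a b + (e1 + k1 / (eS a b - e1)) + (e2 + k2 / (eS a b - e2))
       + (e3 + k3 / (eS a b - e3))].
Proof.
rewrite /lat6 => h0 h3.
have [||||H1 H2 H3 H4] := @two_torsion_shift a b; rewrite /lat6; try lia.
split=> //; rewrite -H2 -H3 -H4 dup; last by rewrite /lat6; lia.
by congr (_ * _); apply: sym; rewrite /lat6; lia.
Qed.

(** The point (0,1) is the sum of (0,4), of order 3, and (0,3), of order 2. So [yq] is one of the
    four roots of the quartic; the others come from (2,1), (2,3), (2,5), whose resolvents are [Aw]
    and [Bw]. *)
Definition yq := eS 0 1 - e1.
Definition Aw := eS 2 1 + om ^+ 2 * eS 2 3 + om * eS 2 5.
Definition Bw := eS 2 1 + om * eS 2 3 + om ^+ 2 * eS 2 5.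
Definition Cw := eS 0 1 - eS 0 4.
Definition Dw := eS 3 1 - eS 3 4.
Definition Xw := - om ^+ 2 * Aw / Bw.
Definition Yw := - 3 * Cw / Dw.
Definition mq := yq ^+ 2 - 9 * k1.

Lemma yqE : yq = k1 / (eS 0 4 - e1).
Proof.
have [//|//|_ h _ _ _] := @three_torsion_data 0 4.
have e : eS 0 1 = eS 0 (4 + 3) by apply: period.
by rewrite /yq e h; ring.
Qed.

Lemma root_at a b c : ~~ lat6 a b -> lat6 (3 * a) (3 * b) -> lat6 0 (c - (b + 3)) ->
  let y := eS a c - e1 in y = k1 / (eS a b - e1) /\
  y ^+ 4 - 6 * k1 * y ^+ 2 - 4 * (2 * e1 - e2 - e3) * k1 * y - 3 * k1 ^+ 2 = 0.
Proof.
move=> h1 h2 hc /=; have [[n1 n2 n3] h _ _ E] := three_torsion_data h1 h2.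
have -> : eS a c = eS a (b + 3) by apply: period; rewrite subrr.
have e : eS a (b + 3) - e1 = k1 / (eS a b - e1) by rewrite h; ring.
by split=> //; rewrite e; apply: quartic_relation.
Qed.

Lemma AwE : Aw = (eS 2 1 - e1) + om ^+ 2 * (eS 2 3 - e1) + om * (eS 2 5 - e1).
Proof.
rewrite /Aw; apply/eqP; rewrite -subr_eq0; apply/eqP.
by transitivity (e1 * (1 + om + om ^+ 2)); [ring|rewrite om_sum mulr0].
Qed.

Lemma BwE : Bw = (eS 2 1 - e1) + om * (eS 2 3 - e1) + om ^+ 2 * (eS 2 5 - e1).
Proof.
rewrite /Bw; apply/eqP; rewrite -subr_eq0; apply/eqP.
by transitivity (e1 * (1 + om + om ^+ 2)); [ring|rewrite om_sum mulr0].
Qed.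

(** The roots are images of the values at the four subgroups of order 3 under the injective map
    [x |-> k1 / (x - e1)], and [ds_inj3] separates these values. *)
Lemma roots_uniq : uniq [:: eS 0 1 - e1; eS 2 1 - e1; eS 2 3 - e1; eS 2 5 - e1].
Proof.
have sh a b c : ~~ lat6 a b -> lat6 (3 * a) (3 * b) -> lat6 0 (c - (b + 3)) ->
    eS a c - e1 = k1 / (eS a b - e1).
  by move=> h1 h2 h3; have [] := root_at h1 h2 h3.
rewrite (sh 0 4 1) // (sh 2 4 1) // (sh 2 0 3) // (sh 2 2 5) //.
have inj : injective (fun x => k1 / (x - e1)).
  by move=> x y /(mulfI k1_neq0)/invr_inj/addIr.
rewrite -[X in uniq X]/[seq k1 / (x - e1) | x <- [:: eS 0 4; eS 2 4; eS 2 0; eS 2 2]].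
rewrite map_inj_uniq //= !inE !negb_or -!andbA.
by apply/and5P; split; rewrite ?andbT //; try (apply/andP; split); rewrite // eq_sym; apply: inj3.
Qed.

Lemma resolvent_data :
  [/\ yq != 0, eS 2 1 - e1 + (eS 2 3 - e1) + (eS 2 5 - e1) = - yq, Aw * Bw = - 2 * mq, mq != 0
    & yq * (Aw ^+ 3 + Bw ^+ 3) = (7 * yq ^+ 2 + 9 * k1) * mq].
Proof.
have := @resolvent _ k1 (2 * e1 - e2 - e3) om yq (eS 2 1 - e1) (eS 2 3 - e1) (eS 2 5 - e1)
  k1_neq0 (om_sum) _ roots_uniq; rewrite -AwE -BwE; apply.
move=> z; rewrite !inE => /or4P[]/eqP ->.
- by case: (@root_at 0 4 1).
- by case: (@root_at 2 4 1).
- by case: (@root_at 2 0 3).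
- by case: (@root_at 2 2 5).
Qed.

Lemma Aw_neq0 : Aw != 0.
Proof.
have [_ _ h m0 _] := resolvent_data.
by apply: contraNneq m0 => e; move: h; rewrite e mul0r => /esym/eqP; rewrite mulf_eq0 oppr_eq0 pnatr_eq0.
Qed.

Lemma Bw_neq0 : Bw != 0.
Proof.
have [_ _ h m0 _] := resolvent_data.
by apply: contraNneq m0 => e; move: h; rewrite e mulr0 => /esym/eqP; rewrite mulf_eq0 oppr_eq0 pnatr_eq0.
Qed.

Lemma CD_data :
  [/\ Dw != 0, Cw != 0, Yw ^+ 2 * mq = 9 * (yq ^+ 2 - k1),
    (eS 0 4 - e1) / (eS 0 4 - e2) = ((9 / Yw ^+ 2 + 1) / 2 - 3 / Yw) / 2
    & (eS 0 4 - e1) / (eS 0 4 - e3) = ((9 / Yw ^+ 2 + 1) / 2 + 3 / Yw) / 2].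
Proof.
have [//|//|[n1 n2 n3] h1 h2 h3 E] := @three_torsion_data 0 4.
have eC : Cw = e1 + k1 / (eS 0 4 - e1) - eS 0 4 by rewrite -yqE /Cw /yq; ring.
have eD : Dw = e3 + k3 / (eS 0 4 - e3) - (e2 + k2 / (eS 0 4 - e2)).
  by rewrite -h2 -h3 /Dw; congr (_ - _); exact: period.
rewrite /Yw /mq yqE eC eD; apply: CD_relations => //; rewrite eq_sym.
- exact: e21_neq.
- exact: e31_neq.
- exact: e32_neq.
Qed.

Lemma curve_or : (Aw ^+ 3 - 8 * yq * mq) * (yq * Aw ^+ 3 + mq ^+ 2) = 0.
Proof. by have [h1 _ h2 _ h3] := resolvent_data; exact: (@resolvent_roots _ k1 yq Aw Bw h1 h2 h3). Qed.

(** With [Aw * Bw = - 2 * mq] the hypothesis turns into [yq * Bw ^+ 3 = - mq ^+ 2], hence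
    [Xw ^+ 3 * mq = 8 * yq ^+ 2]. Adding [mq] gives [9 * (yq ^+ 2 - k1)], which is
    [Yw ^+ 2 * mq]. *)
Lemma curve_of (h : Aw ^+ 3 = 8 * yq * mq) : Yw ^+ 2 = Xw ^+ 3 + 1.
Proof.
have [y0 _ AB m0 _] := resolvent_data; have [_ _ Y2 _ _] := CD_data.
have B0 := Bw_neq0; have A0 := Aw_neq0.
apply: (mulIf m0); rewrite Y2.
have X3 : Xw ^+ 3 * Bw ^+ 3 = - Aw ^+ 3.
  rewrite /Xw; have -> : (- om ^+ 2 * Aw / Bw) ^+ 3 * Bw ^+ 3 = - (om ^+ 3) ^+ 2 * Aw ^+ 3.
    by field.
  by rewrite om3 expr1n mulN1r.
have yB : yq * Bw ^+ 3 = - mq ^+ 2.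
  have n8 : 8 * mq != 0 by rewrite mulf_neq0 // pnatr_eq0.
  apply: (mulfI n8); have -> : 8 * mq * (yq * Bw ^+ 3) = Aw ^+ 3 * Bw ^+ 3 by rewrite h; ring.
  by rewrite -exprMn AB; ring.
have X3m : Xw ^+ 3 * mq = 8 * yq ^+ 2.
  apply: (mulIf m0); transitivity (- (Xw ^+ 3 * Bw ^+ 3) * yq).
    have -> : Xw ^+ 3 * mq * mq = Xw ^+ 3 * - (- mq ^+ 2) by ring.
    by rewrite -yB; ring.
  by rewrite X3 opprK h; ring.
have -> : (Xw ^+ 3 + 1) * mq = Xw ^+ 3 * mq + mq by ring.
by rewrite X3m /mq; ring.
Qed.

End DivisionAlgebra.

(** * The torsion values as analytic functions of [w], and their behaviour at [w = 0] *)

Section DivisionPoints.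
Variable R : realType.
Local Notation C := R[i].
Local Notation zeta := (zeta R).
Local Notation omega := (omega R).

Lemma abXz (z : C) (n : int) : ab (z ^ n) = ab z ^ n.
Proof. by case: n => n; [exact: abX|rewrite NegzE -!exprnN abV abX]. Qed.

Lemma ab_zeta : ab zeta = 1.
Proof. by have := congr1 (@ab R) (zeta3 R); rewrite abX abN ab1 => /eqP; rewrite pexpr_eq1 ?ab_ge0 // => /eqP. Qed.

Lemma zeta6 : zeta ^+ 6 = 1.
Proof. by rewrite (exprM _ 3 2) zeta3 sqrrN expr1n. Qed.

Definition divpt (w : C) (a b : int) : C := zeta ^ b * w ^ a.

Fact divS_key : unit. Proof. exact: tt. Qed.
(* By [wpd_divS], differences of the [divS w a b] are those of the [e_{a,b}(tau)]
   divided by [(2 pi i)^2], where [w = exp(2 pi i tau / 6)]. *)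
Definition divS (w : C) (a b : int) : C := locked_with divS_key (S (w ^+ 6) (divpt w a b)).

Lemma divSE w a b : divS w a b = S (w ^+ 6) (divpt w a b).
Proof. by rewrite /divS unlock. Qed.

Section FixedW.
Variable w : C.
Hypothesis w0 : w != 0.
Hypothesis w1 : ab w < 1.
Local Notation q := (w ^+ 6).
Local Notation pt := (divpt w).
Local Notation eS := (divS w).

Lemma q_neq0 : q != 0. Proof. by rewrite expf_neq0. Qed.
Lemma q_lt1 : ab q < 1. Proof. by rewrite abX exprn_ilt1 ?ab_ge0. Qed.
Hint Resolve q_neq0 q_lt1 : core.

Lemma pt_neq0 a b : pt a b != 0.
Proof. by rewrite mulf_neq0 ?expfz_neq0 // zeta_neq0. Qed.
Hint Resolve pt_neq0 : core.

Lemma ptD a b c d : pt (a + c) (b + d) = pt a b * pt c d.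
Proof. by rewrite /divpt !expfzDr ?zeta_neq0 //; ring. Qed.

Lemma ptN a b : pt (- a) (- b) = (pt a b)^-1.
Proof. by rewrite /divpt invfM !invr_expz. Qed.

Lemma ptX a b n : pt a b ^+ n = pt (n%:Z * a) (n%:Z * b).
Proof. by rewrite /divpt exprMn !exprnP !exprz_exp ![_ * n%:Z]mulrC. Qed.

(** Absolute values determine the exponent of [w], since [ab zeta = 1] and [ab w < 1]; what remains
    is a power of [zeta] equal to 1. *)
Lemma lat6P a b : inlat q (pt a b) <-> lat6 a b.
Proof.
split=> [[n e]|/andP[/dvdzP[k ->] /dvdzP[l ->]]].
  have ea : a = 6 * n.
    have := congr1 (@ab R) e; rewrite /divpt abM !abXz abX ab_zeta exp1rz mul1r exprnP exprz_exp.
    by apply: ieexprIz; rewrite ?ab_gt0 // lt_eqF.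
  have eb : zeta ^ b = 1.
    move: e; rewrite /divpt ea -exprz_exp -exprnP => /(congr1 (fun x => x / q ^ n)).
    by rewrite mulfK ?expfz_neq0 // divff // expfz_neq0.
  by rewrite /lat6 ea dvdz_mulr // (@zetaX_eq1 R).
exists k; rewrite /divpt ![_ * 6]mulrC -!exprz_exp -!exprnP zeta6 exp1rz mul1r.
by [].
Qed.

Lemma nlat6P a b : ~~ lat6 a b -> ~ inlat q (pt a b).
Proof. by move=> /negP h /lat6P. Qed.

Lemma eS_period a b c d : lat6 (c - a) (d - b) -> eS c d = eS a b.
Proof.
move=> h; have -> : c = (c - a) + a by rewrite subrK.
have -> : d = (d - b) + b by rewrite subrK.
by rewrite !divSE ptD S_lat //; apply/lat6P.
Qed.

Lemma eS_opp a b : eS (- a) (- b) = eS a b.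
Proof. by rewrite !divSE ptN SV. Qed.

Lemma eS_sym a b c d : lat6 (c + a) (d + b) -> eS c d = eS a b.
Proof. by move=> h; rewrite -[RHS]eS_opp; apply: eS_period; rewrite !opprK. Qed.

Lemma eS_dup a b : ~~ lat6 (2 * a) (2 * b) ->
  eS a b + eS a (b + 3) + eS (a + 3) b + eS (a + 3) (b + 3) = 4 * eS (2 * a) (2 * b).
Proof.
move=> h; have p2 : (w ^+ 3) ^+ 2 = q by rewrite -exprM.
have m1 : pt 0 3 = -1 by rewrite /divpt expr0z mulr1 -exprnP zeta3.
have p3 : pt 3 0 = w ^+ 3 by rewrite /divpt expr0z mul1r.
have := S_dup q_neq0 q_lt1 p2 (pt_neq0 a b); rewrite ptX => /(_ (nlat6P h)).
have e1 : - pt a b = pt a (b + 3) by rewrite -[a in RHS]addr0 ptD m1 mulrN1.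
have e2 : w ^+ 3 * pt a b = pt (a + 3) b by rewrite -[b in RHS]addr0 ptD p3 mulrC.
have e3 : - (w ^+ 3 * pt a b) = pt (a + 3) (b + 3).
  by rewrite e2 -{2}[a + 3]addr0 ptD m1 mulrN1.
by rewrite !divSE e3 e1 e2.
Qed.

Lemma eS_two t1 t2 : ~~ lat6 t1 t2 -> lat6 (2 * t1) (2 * t2) ->
  exists2 k, k != 0 & forall a b, ~~ lat6 a b -> ~~ lat6 (t1 + a) (t2 + b) ->
    (eS a b - eS t1 t2) * (eS (t1 + a) (t2 + b) - eS t1 t2) = k.
Proof.
move=> h1 h2; have [|k k0 H] := S_two_torsion q_neq0 q_lt1 (pt_neq0 t1 t2) (nlat6P h1).
  by rewrite ptX; apply/lat6P.
exists k => // a b n1 n2; rewrite !divSE ptD; apply: H => //; first exact: nlat6P.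
by rewrite -ptD; exact: nlat6P.
Qed.

Lemma eS_inj2 t1 t2 a b : ~~ lat6 t1 t2 -> lat6 (2 * t1) (2 * t2) ->
  ~~ lat6 a b -> ~~ lat6 (t1 + a) (t2 + b) -> eS a b != eS t1 t2.
Proof.
move=> h1 h2 n1 n2; rewrite !divSE; apply: S_two_torsion_inj => //; try exact: nlat6P.
  by rewrite ptX; apply/lat6P.
by rewrite -ptD; exact: nlat6P.
Qed.

Lemma eS_inj3 t1 t2 a b : ~~ lat6 t1 t2 -> lat6 (3 * t1) (3 * t2) ->
  ~~ lat6 a b -> ~~ lat6 (t1 + a) (t2 + b) -> ~~ lat6 (- t1 + a) (- t2 + b) -> eS a b != eS t1 t2.
Proof.
move=> h1 h2 n1 n2 n3; rewrite !divSE; apply: S_three_torsion_inj => //; try exact: nlat6P.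
- by rewrite ptX; apply/lat6P.
- by rewrite -ptD; exact: nlat6P.
- by rewrite -ptN -ptD; exact: nlat6P.
Qed.

Lemma divS_system : division_system eS.
Proof.
split; [exact: eS_period|exact: eS_sym|exact: eS_dup|exact: eS_two|exact: eS_inj2|exact: eS_inj3].
Qed.

End FixedW.

(** For [al] between 0 and 6 both arguments of [lamsum] are monomials in [w] with exponents at least
    0, so this form of [divS] makes sense, and is analytic, also at [w = 0]. *)
Definition Eh (al : nat) (be : int) (w : C) : C :=
  lamsum (zeta ^ be * w ^+ al) (w ^+ 6) + lamsum (zeta ^ (- be) * w ^+ (6 - al)) (w ^+ 6).

Lemma EhE (w : C) (al : nat) (be : int) : w != 0 -> (al <= 6)%N -> divS w al be = Eh al be w.
Proof.
move=> w0 h.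
have z0 : zeta ^ be != 0 by rewrite expfz_neq0 // zeta_neq0.
have wn n : w ^+ n != 0 by rewrite expf_neq0.
have e : zeta ^ (- be) * w ^+ (6 - al) = w ^+ 6 / (zeta ^ be * w ^+ al).
  rewrite -invr_expz -{2}(subnK h) exprD; move: (wn al) (w ^+ (6 - al)) => h1 v.
  by rewrite [zeta ^ be * _]mulrC invfM mulrA mulfK // mulrC.
by rewrite divSE /S /Eh /divpt e -exprnP.
Qed.

Lemma Eh_Ana (al : nat) be w : ab w < 1 -> (al < 6)%N -> ~~ lat6 al be -> Ana (Eh al be) w.
Proof.
move=> w1 h nl.
have wlt n : (0 < n)%N -> ab w ^+ n < 1.
  by move=> n0; rewrite exprn_ilt1 ?ab_ge0 //; case: n n0.
have abz b : ab (zeta ^ b) = 1 by rewrite abXz ab_zeta exp1rz.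
have ne (b : int) n m : (0 < n + m * 6)%N -> zeta ^ b * w ^+ n * (w ^+ 6) ^+ m != 1.
  move=> nm; apply/eqP => /(congr1 (@ab R)); rewrite !abM abz mul1r -exprM !abX -exprD ab1.
  by move=> e; have := wlt (n + 6 * m)%N; rewrite e ltxx mulnC => /(_ nm).
have X n : Ana (fun w : C => w ^+ n) w by apply: Ana_exp; exact: Ana_id.
have w6 : ab (w ^+ 6) < 1 by rewrite abX wlt.
apply: Ana_add; apply: Ana_lamsum => //; try (apply: Ana_mul => //; exact: Ana_cst).
- move=> n; have [n0|n0] := posnP (al + n * 6)%N; last exact: ne.
  have al0 : al = 0%N by apply/eqP; move/eqP: n0; rewrite addn_eq0 => /andP[].
  have nn0 : n = 0%N by lia.
  rewrite al0 nn0 !expr0 !mulr1; apply: contra nl => /eqP/(@zetaX_eq1 R) hb.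
  by rewrite /lat6 al0 hb andbT.
- by move=> n; apply: ne; rewrite addn_gt0 subn_gt0 h.
Qed.

Lemma divS_extension a b : ~~ lat6 a b -> exists E : C -> C,
  (forall w : C, ab w < 1 -> Ana E w) /\ (forall w : C, w != 0 -> ab w < 1 -> divS w a b = E w).
Proof.
move=> nl; pose al := `|(a %% 6)%Z|%N.
have m0 : (0 <= a %% 6)%Z by rewrite modz_ge0.
have alE : al%:Z = (a %% 6)%Z by rewrite gez0_abs.
have m6 : (al < 6)%N by rewrite -ltz_nat alE ltz_pmod.
have dE : (6 %| al%:Z - a)%Z.
  by rewrite alE {2}(divz_eq a 6) opprD addrCA subrr addr0 rpredN dvdz_mull.
exists (Eh al b); split=> [w w1|w w0 w1].
  apply: Eh_Ana => //; apply: contra nl; rewrite /lat6 => /andP[h ->]; rewrite andbT.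
  have -> : a = al%:Z - (al%:Z - a) by rewrite opprB addrC subrK.
  by rewrite rpredB.
have hl : lat6 (al%:Z - a) (b - b) by rewrite /lat6 dE subrr dvdz0.
by rewrite -(eS_period w0 w1 hl) EhE // ltnW.
Qed.

Lemma lamsum_small (c q : C) : ab c <= 1 / 2 -> ab q <= 1 / 2 -> ab (lamsum c q) <= 8 * ab c.
Proof.
move=> hc hq; have q1 : ab q < 1 by lra.
have hg : AS (fun n => lam (c * q ^+ n)) (ab (4 * c) * (1 - ab q)^-1).
  apply: AS_le (AS_scale (4 * c) (AS_geo q1)) => n.
  have qn : ab q ^+ n <= 1 by rewrite exprn_ile1 ?ab_ge0 // ltW.
  have cq : ab (c * q ^+ n) = ab c * ab q ^+ n by rewrite abM abX.
  have c0 := ab_ge0 c.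
  apply: le_trans (lam_bound _) _; first by rewrite cq; nra.
  by rewrite -mulrA [X in _ <= X]abM ab_nat.
apply: le_trans (HS_bound hg (lamsumP c q1)) _.
rewrite abM ab_nat; have : (1 - ab q)^-1 <= 2.
  by rewrite -[X in _ <= X]invrK lef_pV2 ?posrE; lra.
have := ab_ge0 c; nra.
Qed.

Lemma lam_asym (x : C) : ab x <= 1 / 4 -> ab (lam x - x) <= 8 * ab x ^+ 2.
Proof.
move=> h; have h1 : 3 / 4 <= ab (1 - x) by have := abB_ge 1 x; rewrite ab1; lra.
have n1 : 1 - x != 0 by rewrite -ab_gt0; lra.
have -> : lam x - x = x ^+ 2 * (2 - x) / (1 - x) ^+ 2 by rewrite /lam; field.
rewrite !abM abV !abX; have h2 : 1 / 2 <= ab (1 - x) ^+ 2 by rewrite expr2; nra.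
have h3 : ab (2 - x) <= 3 by have := abB 2 x; rewrite ab_nat; lra.
rewrite ler_pdivrMr; last lra.
have x0 : 0 <= ab x ^+ 2 by rewrite exprn_ge0 ?ab_ge0.
have := ab_ge0 (2 - x); nra.
Qed.

(** Apart from the first term [lam x], where [x] has size [ab w ^+ 2], everything starts at order 4
    in [w], and so does the error of replacing [lam x] by [x]. *)
Lemma Eh2_asym (be : int) (w : C) : ab w <= 1 / 2 -> ab (Eh 2 be w - zeta ^ be * w ^+ 2) <= 26 * ab w ^+ 4.
Proof.
move=> h; have w0 := ab_ge0 w.
have w2 : ab w ^+ 2 <= 1 / 4 by rewrite expr2; nra.
have w4 : ab w ^+ 4 <= 1 / 16 by rewrite (exprM _ 2 2) expr2; nra.
have w20 : 0 <= ab w ^+ 2 by rewrite exprn_ge0.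
have w40 : 0 <= ab w ^+ 4 by rewrite exprn_ge0.
have abz b : ab (zeta ^ b) = 1 by rewrite abXz ab_zeta exp1rz.
have q2 : ab (w ^+ 6) <= 1 / 2 by rewrite abX (exprD _ 4 2); nra.
have q1 : ab (w ^+ 6) < 1 by lra.
rewrite /Eh lamsumS // [(6 - 2)%N]/=.
set x := zeta ^ be * w ^+ 2; set x2 := zeta ^ (- be) * _.
have ax : ab x = ab w ^+ 2 by rewrite abM abz mul1r abX.
have ax2 : ab x2 = ab w ^+ 4 by rewrite abM abz mul1r abX.
have ax3 : ab (x * w ^+ 6) = ab w ^+ 4 * ab w ^+ 4 by rewrite abM ax abX -!exprD.
have -> : lam x + lamsum (x * w ^+ 6) (w ^+ 6) + lamsum x2 (w ^+ 6) - x =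
  (lam x - x) + lamsum (x * w ^+ 6) (w ^+ 6) + lamsum x2 (w ^+ 6) by ring.
have b1 : ab (lam x - x) <= 8 * ab w ^+ 4.
  have := @lam_asym x; rewrite ax => /(_ w2); by rewrite -exprM.
have b2 : ab (lamsum (x * w ^+ 6) (w ^+ 6)) <= 8 * ab (x * w ^+ 6).
  by apply: lamsum_small => //; rewrite ax3; nra.
have b3 : ab (lamsum x2 (w ^+ 6)) <= 8 * ab x2.
  by apply: lamsum_small => //; rewrite ax2; lra.
have := abD (lam x - x + lamsum (x * w ^+ 6) (w ^+ 6)) (lamsum x2 (w ^+ 6)).
have := abD (lam x - x) (lamsum (x * w ^+ 6) (w ^+ 6)).
rewrite ax3 in b2; rewrite ax2 in b3; nra.
Qed.

Lemma zeta1E : zeta = - omega ^+ 2.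
Proof.
have h := zeta3 R; have w := zeta2 R.
have : zeta ^+ 3 * zeta = zeta ^+ 2 ^+ 2 by rewrite -exprSr -exprM.
by rewrite h w mulN1r => <-; rewrite opprK.
Qed.

Lemma zeta5E : zeta ^+ 5 = - omega.
Proof. by rewrite (exprD _ 3 2) zeta3 zeta2 mulN1r. Qed.

Lemma ab_omega : ab omega = 1.
Proof. by rewrite -zeta2 abX ab_zeta expr1n. Qed.

Lemma divS2_asym (be : int) (w : C) : w != 0 -> ab w <= 1 / 2 ->
  ab (divS w 2 be - zeta ^ be * w ^+ 2) <= 26 * ab w ^+ 4.
Proof. by move=> w0 h; rewrite (@EhE w 2) //; exact: Eh2_asym. Qed.

(** The leading coefficients at (2,1), (2,3), (2,5) are [- omega ^+ 2], [-1], [- omega]. The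
    resolvent [Aw] adds them up to [- 3 * omega ^+ 2], while in [Bw] they cancel; so [X] has a pole
    at infinity. *)
Lemma AB_asym (w : C) : w != 0 -> ab w <= 1 / 2 ->
  ab (Aw (divS w) omega + 3 * omega ^+ 2 * w ^+ 2) <= 78 * ab w ^+ 4 /\
  ab (Bw (divS w) omega) <= 78 * ab w ^+ 4.
Proof.
move=> w0 h.
have h1 := divS2_asym 1 w0 h; have h3 := divS2_asym 3 w0 h; have h5 := divS2_asym 5 w0 h.
have z1 : zeta ^ 1 = - omega ^+ 2 by rewrite expr1z zeta1E.
have z3 : zeta ^ 3 = -1 by rewrite -exprnP zeta3.
have z5 : zeta ^ 5 = - omega by rewrite -exprnP zeta5E.
rewrite z1 in h1; rewrite z3 in h3; rewrite z5 in h5.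
have o2 : ab (omega ^+ 2) = 1 by rewrite abX ab_omega expr1n.
rewrite /Aw /Bw; set x := divS w 2 1 in h1 *; set y := divS w 2 3 in h3 *; set z := divS w 2 5 in h5 *.
move: x y z h1 h3 h5 => x y z h1 h3 h5; split.
  have -> : x + omega ^+ 2 * y + omega * z + 3 * omega ^+ 2 * w ^+ 2 =
    (x - - omega ^+ 2 * w ^+ 2) + omega ^+ 2 * (y - -1 * w ^+ 2) + omega * (z - - omega * w ^+ 2) by ring.
  apply: le_trans (abD _ _) _; have := abD (x - - omega ^+ 2 * w ^+ 2) (omega ^+ 2 * (y - -1 * w ^+ 2)).
  by rewrite ![ab (_ * (_ - _))]abM o2 ab_omega !mul1r; lra.
have -> : x + omega * y + omega ^+ 2 * z =
    (x - - omega ^+ 2 * w ^+ 2) + omega * (y - -1 * w ^+ 2) + omega ^+ 2 * (z - - omega * w ^+ 2)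
    - (omega ^+ 2 + omega + omega ^+ 3) * w ^+ 2 by ring.
have -> : omega ^+ 2 + omega + omega ^+ 3 = 0 by rewrite omega3 -(omega_sum R); ring.
rewrite mul0r subr0; apply: le_trans (abD _ _) _.
have := abD (x - - omega ^+ 2 * w ^+ 2) (omega * (y - -1 * w ^+ 2)).
by rewrite ![ab (_ * (_ - _))]abM o2 ab_omega !mul1r; lra.
Qed.

Lemma A_lower (w : C) : w != 0 -> ab w <= 1 / 16 -> ab w ^+ 2 <= ab (Aw (divS w) omega).
Proof.
move=> w0 h; have [|hA _] := AB_asym w0; first lra.
have o2 : ab (omega ^+ 2) = 1 by rewrite abX ab_omega expr1n.
have := abB_ge (3 * omega ^+ 2 * w ^+ 2) (Aw (divS w) omega + 3 * omega ^+ 2 * w ^+ 2).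
have -> (x y : C) : x - (y + x) = - y by ring.
rewrite abN [ab (3 * _ * _)]abM [ab (3 * _)]abM ab_nat o2 abX.
have w00 := ab_ge0 w; have w20 : 0 <= ab w ^+ 2 by rewrite exprn_ge0.
have w2 : ab w ^+ 2 <= 1 / 256 by rewrite expr2; nra.
move: hA; rewrite (exprD _ 2 2); nra.
Qed.

Lemma X_pole (M : R) : exists2 d : R, 0 < d & forall w : C, w != 0 -> ab w < d ->
  M < ab (Xw (divS w) omega).
Proof.
pose K := `|M| + 1; have K0 : 0 < K by rewrite /K; have := normr_ge0 M; lra.
exists (Num.min (1 / 16) (1 / (78 * K))); first by rewrite lt_min !divr_gt0 ?mulr_gt0.
move=> w w0; rewrite lt_min => /andP[w1 w2].
have hA := A_lower w0 (ltW w1); have [|_ hB] := AB_asym w0; first lra.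
have B0 : Bw (divS w) omega != 0.
  by apply: Bw_neq0 (divS_system w0 _) (omega_sum R); lra.
have wp : 0 < ab w by rewrite ab_gt0.
have w2p : 0 < ab w ^+ 2 by rewrite exprn_gt0.
rewrite /Xw abM abV ltr_pdivlMr ?ab_gt0 //.
have -> : ab (- omega ^+ 2 * Aw (divS w) omega) = ab (Aw (divS w) omega).
  by rewrite abM abN abX ab_omega expr1n mul1r.
have wK : ab w * (78 * K) < 1 by rewrite -ltr_pdivlMr // mulr_gt0.
have : M < K by rewrite /K; have := ler_norm M; lra.
move: hB; set b := ab (Bw _ _); rewrite (exprD _ 2 2) => hB MK.
have b0 : 0 < b by rewrite /b ab_gt0.
have w21 : ab w ^+ 2 * (78 * K) < 1 by rewrite expr2; nra.
have : K * b <= K * (78 * (ab w ^+ 2 * ab w ^+ 2)) by rewrite ler_wpM2l // ltW.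
nra.
Qed.

(** At [w = 0] all terms vanish except the first. With [lam_zeta] and [lam_m1] this gives the limit
    [- 3 / 4] of [yq], in particular a nonzero one. *)
Lemma Eh0_value (be : int) : Eh 0 be 0 = lam (zeta ^ be).
Proof.
have z6 : ab ((0 : C) ^+ 6) < 1 by rewrite expr0n ab0.
have l0 : lamsum 0 ((0 : C) ^+ 6) = 0.
  apply: HS_uniq (lamsumP 0 z6) _; apply: HS_ext (@HS0 R _) => n.
  by rewrite mul0r /lam mul0r.
by rewrite /Eh !expr0n /= mulr1 mulr0 lamsumS ?ab0 // mulr0; rewrite expr0n /= in l0; rewrite l0 !addr0.
Qed.

Lemma lam_zeta : lam zeta = -1.
Proof.
have z2 : zeta ^+ 2 = zeta - 1.
  have := omega_sum R; rewrite -zeta2 => e.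
  have zo := zeta1E; rewrite -zeta2 in zo.
  have z4 : zeta ^+ 2 ^+ 2 = - zeta by rewrite -exprM (exprD _ 3 1) zeta3 mulN1r.
  by apply/eqP; rewrite -subr_eq0 -[X in _ == X]e z4; apply/eqP; ring.
have z0 := zeta_neq0 R.
rewrite /lam; have -> : (1 - zeta) ^+ 2 = - zeta.
  have -> : (1 - zeta) ^+ 2 = 1 - 2 * zeta + zeta ^+ 2 by ring.
  by rewrite z2; ring.
by rewrite invrN mulrN divff.
Qed.

Lemma lam_m1 : lam (-1) = - 1 / 4 :> C.
Proof. by rewrite /lam; field. Qed.

Lemma small_pos4 (a b c d : R) : 0 < a -> 0 < b -> 0 < c -> 0 < d ->
  exists2 s, 0 < s & [/\ s < a, s < b, s < c & s < d].
Proof.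
move=> a0 b0 c0 d0; pose m := Num.min (Num.min a b) (Num.min c d).
have m0 : 0 < m by rewrite !lt_min a0 b0 c0 d0.
exists (m / 2); first by rewrite divr_gt0.
have : m / 2 < m by lra.
by rewrite {2}/m !lt_min => /andP[/andP[? ?] /andP[? ?]].
Qed.

(** The wrong branch means [4 * y * A = - B ^+ 2]. Near the cusp the left side has size at least of
    order [s ^+ 2] and the right side at most of order [s ^+ 8]. *)
Lemma branch_arith (s Y B y A : R) : 0 < s -> s < 1 / 16 -> s < Y / 2 / (78 * 78) ->
  0 <= B -> B <= 78 * s ^+ 4 -> s ^+ 2 <= A -> Y / 2 <= y -> 4 * (y * A) = B ^+ 2 -> False.
Proof.
move=> s0 s1 sY B0 hB hA hy e.
have s2p : 0 < s ^+ 2 by rewrite exprn_gt0.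
have B2 : B ^+ 2 <= (78 * 78) * (s ^+ 4 * s ^+ 4).
  have : B ^+ 2 <= (78 * s ^+ 4) ^+ 2 by rewrite !expr2; apply: ler_pM.
  by move=> h; apply: le_trans h _; rewrite expr2 mulrACA.
have Yp : 78 * 78 * s < Y / 2 by rewrite mulrC -ltr_pdivlMr // mulr_gt0.
have l1 : Y / 2 * s ^+ 2 <= y * A by apply: ler_pM => //; [lra|exact: ltW].
have s21 : s ^+ 2 <= s by rewrite expr2; nra.
have s44 : s ^+ 4 * s ^+ 4 <= s ^+ 2 * s.
  have -> : s ^+ 4 * s ^+ 4 = s ^+ 2 * s * (s ^+ 5) by ring.
  rewrite ler_piMr //; first by rewrite mulr_ge0 // ltW.
  by rewrite exprn_ile1 ?ltW //; lra.
have l2 : 78 * 78 * s * s ^+ 2 < Y / 2 * s ^+ 2 by rewrite ltr_pM2r.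
have l3 : (78 * 78) * (s ^+ 4 * s ^+ 4) <= (78 * 78) * (s ^+ 2 * s) by rewrite ler_wpM2l // mulr_ge0.
have e2 : 78 * 78 * s * s ^+ 2 = (78 * 78) * (s ^+ 2 * s) by ring.
have p : 0 < y * A by nra.
lra.
Qed.

Lemma ab_half (a b : C) : ab (a - b) < ab b / 2 -> ab b / 2 <= ab a.
Proof. by have := abB_ge b a; rewrite (abBC b); move: (ab (a - b)) (ab a) (ab b) => x y z; lra. Qed.

(** If the first factor [f1] is not identically 0 near [w = 0], it is nonzero at some small real
    [v], where the second factor must then vanish, against the asymptotics. So [f1] vanishes near 0
    and, by continuation, in the whole disc. *)
Lemma right_branch (w : C) : w != 0 -> ab w < 1 ->
  Aw (divS w) omega ^+ 3 = 8 * yq (divS w) * mq (divS w).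
Proof.
move=> w0 w1.
pose yh v := Eh 0 1 v - Eh 0 3 v.
pose kh v := (Eh 3 0 v - Eh 0 3 v) * (Eh 3 3 v - Eh 0 3 v).
pose mh v := yh v ^+ 2 - 9 * kh v.
pose Ah v := Eh 2 1 v + omega ^+ 2 * Eh 2 3 v + omega * Eh 2 5 v.
pose f1 v := Ah v ^+ 3 - 8 * yh v * mh v.
pose f2 v := yh v * Ah v ^+ 3 + mh v ^+ 2.
have E al be v : (al < 6)%N -> v != 0 -> divS v al be = Eh al be v.
  by move=> h v0; rewrite EhE // ltnW.
have yE v : v != 0 -> yq (divS v) = yh v by move=> v0; rewrite /yq /e1 !(@E 0%N).
have kE v : v != 0 -> k1 (divS v) = kh v.
  by move=> v0; rewrite /k1 /e1 /e2 /e3 !(@E 0%N) // !(@E 3%N).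
have mE v : v != 0 -> mq (divS v) = mh v by move=> v0; rewrite /mq yE // kE.
have AE v : v != 0 -> Aw (divS v) omega = Ah v by move=> v0; rewrite /Aw !(@E 2%N).
have yA v : ab v < 1 -> Ana yh v by move=> v1; apply: Ana_sub; exact: Eh_Ana.
have kA v : ab v < 1 -> Ana kh v by move=> v1; apply: Ana_mul; apply: Ana_sub; exact: Eh_Ana.
have mA v : ab v < 1 -> Ana mh v.
  move=> v1; apply: Ana_sub; first by apply: Ana_exp; exact: yA.
  by apply: Ana_mul; [exact: Ana_cst|exact: kA].
have AA v : ab v < 1 -> Ana Ah v.
  move=> v1; apply: Ana_add; first apply: Ana_add; try apply: Ana_mul; try exact: Ana_cst; exact: Eh_Ana.
have f1A v : ab v < 1 -> Ana f1 v.
  move=> v1; apply: Ana_sub; first by apply: Ana_exp; exact: AA.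
  by apply: Ana_mul; [apply: Ana_mul; [exact: Ana_cst|exact: yA]|exact: mA].
have z1 : ab (0 : C) < 1 by rewrite ab0.
have loc : locally_eq f1 0 0.
  have [d d0 [H|H]] := Ana_dichotomy 0 (f1A 0 z1); first by exists d.
  have y0 : yh 0 != 0.
    rewrite /yh !Eh0_value expr1z -exprnP zeta3 lam_zeta lam_m1.
    have -> : - 1 - - 1 / 4 = - (3 / 4) :> C by field.
    by rewrite oppr_eq0 mulf_neq0 // ?invr_eq0 pnatr_eq0.
  have e0 : 0 < ab (yh 0) / 2 by rewrite divr_gt0 // ab_gt0.
  have [d2 d20 H2] := Ana_near_ball (yA 0 z1) e0.
  pose Y0 := ab (yh 0).
  have Y0p : 0 < Y0 by rewrite ab_gt0.
  have c0 : 0 < Y0 / 2 / (78 * 78) by rewrite !divr_gt0 ?mulr_gt0.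
  have c1 : 0 < 1 / 16 :> R by rewrite divr_gt0.
  have [s s0 [sd sd2 sc1 sc2]] := small_pos4 d0 d20 c1 c0.
  pose v : C := s%:C.
  have vs : ab v = s by rewrite abR gtr0_norm.
  have v0 : v != 0 by rewrite -ab_gt0 vs.
  have v1 : ab v < 1 by rewrite vs; apply: lt_trans sc1 _; rewrite mul1r invf_lt1 ?ltr1n.
  have DS := divS_system v0 v1.
  have nf1 : f1 v != 0 by apply: H => //; rewrite subr0 vs.
  have := curve_or DS (omega_sum R); rewrite AE // yE // mE // => /eqP.
  rewrite mulf_eq0 -/(f1 v) (negPf nf1) /= => /eqP f2v.
  have [_ _ AB _ _] := resolvent_data DS (omega_sum R); rewrite AE // mE // in AB.
  have hA : ab v ^+ 2 <= ab (Ah v) by rewrite -AE // A_lower // vs ltW.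
  have A0 := Aw_neq0 DS (omega_sum R); rewrite AE // in A0.
  have v12 : ab v <= 1 / 2 by rewrite vs; apply: ltW; apply: lt_trans sc1 _; rewrite !mul1r ltf_pV2 ?posrE // ltr_nat.
  have [_ hB] := AB_asym v0 v12.
  have hy : ab (yh v - yh 0) < Y0 / 2 by apply: H2; rewrite subr0 vs.
  move: (Bw (divS v) omega) AB hB => B AB hB.
  (* The vanishing second factor, combined with [AB], loses a factor [Ah v ^+ 2] and reaches the
     form that [branch_arith] refutes. *)
  have yAB : 4 * (yh v * Ah v) = - B ^+ 2.
    apply: (mulfI (expf_neq0 2 A0)).
    have -> : Ah v ^+ 2 * (4 * (yh v * Ah v)) = 4 * (yh v * Ah v ^+ 3 + mh v ^+ 2) - (- 2 * mh v) ^+ 2 by ring.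
    by rewrite f2v -AB; ring.
  have := congr1 (@ab R) yAB; rewrite abN abX abM ab_nat [ab (yh v * _)]abM => e.
  rewrite vs in hA hB.
  by exfalso; exact: (branch_arith s0 sc1 sc2 (ab_ge0 B) hB hA (ab_half hy) e).
have : locally_eq f1 0 w.
  apply: Ana_identity loc => t /andP[t0 t1]; apply: f1A; rewrite /seg add0r subr0 abM abR ger0_norm //.
  have := ab_ge0 w; nra.
move=> /locally_eq_at; rewrite /f1 -AE // -yE // -mE // => /eqP; rewrite subr_eq0 => /eqP //.
Qed.

Lemma curve_w (w : C) : w != 0 -> ab w < 1 -> Yw (divS w) ^+ 2 = Xw (divS w) omega ^+ 3 + 1.
Proof.
move=> w0 w1; apply: curve_of (divS_system w0 w1) (omega_sum R) _.
exact: right_branch.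
Qed.

End DivisionPoints.

(** * Sums over the period lattice and the Lipschitz formula *)

Section LatticeSums.
Variable R : realType.
Local Notation C := R[i].

Lemma intC (n : int) : (n%:~R : C) = (n%:~R : R)%:C.
Proof. by rewrite rmorph_int. Qed.

Lemma ImRM (x : R) (z : C) : complex.Im (x%:C * z) = x * complex.Im z.
Proof. by case: z => a b /=; rewrite mul0r addr0. Qed.

Lemma ImD (z w : C) : complex.Im (z + w) = complex.Im z + complex.Im w.
Proof. by case: z; case: w. Qed.

Lemma ReD (z w : C) : complex.Re (z + w) = complex.Re z + complex.Re w.
Proof. by case: z; case: w. Qed.

Lemma ImN (z : C) : complex.Im (- z) = - complex.Im z.
Proof. by case: z. Qed.

Lemma ReN (z : C) : complex.Re (- z) = - complex.Re z.
Proof. by case: z. Qed.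

Lemma ImC (x : R) : complex.Im (x%:C : C) = 0. Proof. by []. Qed.
Lemma ReC (x : R) : complex.Re (x%:C : C) = x. Proof. by []. Qed.

(** The weight [(1 + |m|)] to the power [-3/2]. It is summable over the integers, and a product of
    two of them dominates the inverse cube of a lattice distance, so convergence over the lattice
    reduces to one variable. *)
Definition pw (m : int) : R := ((1 + `|m|%:~R) * Num.sqrt (1 + `|m|%:~R))^-1.

(** Comparison with the telescoping differences of [2 / sqrt], in place of an integral test. *)
Lemma pw_step (k : R) : 1 <= k ->
  ((1 + k) * Num.sqrt (1 + k))^-1 <= 2 / Num.sqrt k - 2 / Num.sqrt (1 + k).
Proof.
move=> k1; set s := Num.sqrt (1 + k); set t := Num.sqrt k.
have s2 : s ^+ 2 = 1 + k by rewrite sqr_sqrtr //; lra.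
have t2 : t ^+ 2 = k by rewrite sqr_sqrtr //; lra.
have s0 : 0 < s by rewrite sqrtr_gt0; lra.
have t0 : 0 < t by rewrite sqrtr_gt0; lra.
have ts : t < s by rewrite ltr_sqrt; lra.
rewrite -s2; have -> : 2 / t - 2 / s = (2 * (s - t) * s ^+ 2 / t) / (s ^+ 2 * s).
  by field; rewrite gt_eqF ?gt_eqF.
rewrite -[X in X <= _]mul1r ler_pM2r ?invr_gt0 ?mulr_gt0 ?exprn_gt0 //.
rewrite ler_pdivlMr // mul1r.
have e : (s - t) * (s + t) = 1 by rewrite -subr_sqr s2 t2; lra.
have p : 0 < s + t by lra.
rewrite -(ler_pM2r p).
have -> : 2 * (s - t) * s ^+ 2 * (s + t) = 2 * s ^+ 2 * ((s - t) * (s + t)) by ring.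
rewrite e mulr1 !expr2; nra.
Qed.

Lemma pw_partial n : \sum_(i < n.+1) pw i%:Z <= 3 - 2 / Num.sqrt (1 + n%:R).
Proof.
elim: n => [|n IH].
  by rewrite big_ord1 /pw normr0 addr0 sqrtr1 mulr1 !divr1 invr1; lra.
rewrite big_ord_recr.
have h : (1 : R) <= 1 + n%:R by rewrite lerDl.
have e : n.+1%:R = 1 + n%:R :> R by rewrite -natr1 addrC.
have := pw_step h; rewrite -e => hs; rewrite -e in IH; apply: le_trans (lerD IH hs) _.
by rewrite addrA subrK.
Qed.

Lemma pw_gt0 m : 0 < pw m.
Proof.
have h : 0 < 1 + `|m|%:~R :> R by rewrite ltr_pwDl // ler0z.
by rewrite /pw invr_gt0 mulr_gt0 // sqrtr_gt0.
Qed.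

Lemma AS_pw : exists M, AS (fun m : int => (pw m)%:C) M.
Proof.
have h : AS (fun n : nat => (pw n%:Z)%:C) 3.
  apply: AS_nat => n; under eq_bigr do rewrite abR gtr0_norm ?pw_gt0 //.
  have h0 : \sum_(i < n) pw i <= \sum_(i < n.+1) pw i by rewrite big_ord_recr /= lerDl ltW // pw_gt0.
  apply: le_trans h0 (le_trans (pw_partial n) _).
  by rewrite gerBl divr_ge0 // sqrtr_ge0.
exists (3 + 3); apply: AS_int => //; apply: AS_ext (AS_inj succn_inj h) => n /=.
by congr (_%:C); rewrite /pw NegzE normrN.
Qed.

Definition lpt (tau : C) (p : int * int) : C := p.1%:~R + p.2%:~R * tau.

Lemma Im_lpt tau p : complex.Im (lpt tau p) = p.2%:~R * complex.Im tau.
Proof. by rewrite /lpt !intC ImD ImRM /= add0r. Qed.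

Lemma int_ge1 (m : int) : m != 0 -> 1 <= `|m|%:~R :> R.
Proof. by move=> m0; rewrite -[1]/(1%:~R) ler_int -gtz0_ge1 normr_gt0. Qed.

(** The imaginary part bounds the coefficient of [tau], and then the triangle inequality bounds the
    other one. *)
Lemma lat_bound (tau : C) : 0 < complex.Im tau -> exists2 K : R, 0 < K &
  forall p, p != 0 -> 1 + `|p.1|%:~R <= K * ab (lpt tau p) /\ 1 + `|p.2|%:~R <= K * ab (lpt tau p).
Proof.
move=> y0; set y := complex.Im tau in y0 *; have t0 := ab_ge0 tau.
pose c := 1 + (ab tau + 1) / y.
have c0 : 0 < (ab tau + 1) / y by rewrite divr_gt0 //; lra.
exists (2 * c); first by rewrite /c; lra.
move=> [m n] /= p0; set L := ab _; have L0 : 0 <= L by exact: ab_ge0.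
have hn : `|n|%:~R * y <= L.
  apply: le_trans (ab_Im _); rewrite Im_lpt /= normrM (gtr0_norm y0) intr_norm //.
have hm : `|m|%:~R <= L + `|n|%:~R * ab tau.
  have := abB (lpt tau (m, n)) (n%:~R * tau); rewrite /lpt /= addrK abM !ab_int.
  by [].
have hn' : `|n|%:~R <= L / y by rewrite ler_pdivlMr.
have hm' : `|m|%:~R <= L + L / y * ab tau by apply: le_trans hm _; rewrite lerD2l ler_wpM2r.
have Ly : 0 <= L / y by rewrite divr_ge0 // ltW.
have cL : c * L = L + L / y * ab tau + L / y by rewrite /c; field; rewrite gt_eqF.
have mn : 1 <= `|m|%:~R + `|n|%:~R :> R.
  have m0 : 0 <= `|m|%:~R :> R by rewrite ler0z.
  have n0 : 0 <= `|n|%:~R :> R by rewrite ler0z.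
  have [e|/int_ge1 h] := eqVneq m 0; last by lra.
  have /int_ge1 h : n != 0 by apply: contraNneq p0 => e'; rewrite e e'.
  lra.
have Lt : 0 <= L / y * ab tau by rewrite mulr_ge0.
rewrite -mulrA cL; split; lra.
Qed.

(** A quantitative form of avoiding the lattice: the distance to a lattice point grows linearly in
    both of its indices. *)
Definition sep (tau z : C) (K : R) : Prop := 0 < K /\ forall p,
  1 + `|p.1|%:~R <= K * ab (z - lpt tau p) /\ 1 + `|p.2|%:~R <= K * ab (z - lpt tau p).

Lemma sep_cube (K L a b : R) : 0 < K -> 0 < a -> 0 < b -> a <= K * L -> b <= K * L ->
  L^-1 ^+ 3 <= K ^+ 3 * ((a * Num.sqrt a)^-1 * (b * Num.sqrt b)^-1).
Proof.
move=> K0 a0 b0 ha hb; have L0 : 0 < L by rewrite -(pmulr_rgt0 _ K0); lra.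
set s := Num.sqrt a; set t := Num.sqrt b.
have s0 : 0 < s by rewrite sqrtr_gt0.
have t0 : 0 < t by rewrite sqrtr_gt0.
have s2 : s ^+ 2 = a by rewrite sqr_sqrtr // ltW.
have t2 : t ^+ 2 = b by rewrite sqr_sqrtr // ltW.
have st : s * t <= K * L.
  have [sL tL LL] : [/\ 0 <= s, 0 <= t & 0 <= K * L] by rewrite mulr_ge0 !ltW.
  have := @ler_pXn2r R 2 isT (s * t) (K * L); rewrite !nnegrE => /(_ (mulr_ge0 sL tL) LL) <-.
  rewrite exprMn s2 t2 [X in _ <= X]expr2.
  by apply: ler_pM => //; exact: ltW.
rewrite -invfM exprVn -[K ^+ 3 * _]invrK lef_pV2 ?posrE ?invr_gt0 ?mulr_gt0 ?exprn_gt0 ?invr_gt0 ?mulr_gt0 //.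
rewrite [(_ / _)^-1]invfM invrK -s2 -t2.
have -> : (K ^+ 3)^-1 * (s ^+ 2 * s * (t ^+ 2 * t)) = (s * t / K) ^+ 3.
  by field; rewrite gt_eqF.
have [sL tL LL KL] : [/\ 0 <= s, 0 <= t, 0 <= L & 0 <= K] by rewrite !ltW.
apply: lerXn2r; rewrite ?nnegrE ?divr_ge0 ?mulr_ge0 //.
by rewrite ler_pdivrMr // [L * K]mulrC.
Qed.

Lemma sep_neq0 tau z K p : sep tau z K -> z - lpt tau p != 0.
Proof.
move=> [K0 /(_ p) [h _]]; rewrite -ab_gt0 -(pmulr_rgt0 _ K0).
by apply: lt_le_trans h; rewrite ltr_pwDl // ler0z.
Qed.

(** Inverse squares are not summable over the lattice, but their differences decay like inverse
    cubes. *)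
Lemma diff_bound (x y : C) : x != 0 -> y != 0 ->
  ab (x ^- 2 - y ^- 2) <= ab (y - x) * ((ab x)^-1 * (ab y)^-1 ^+ 2 + (ab x)^-1 ^+ 2 * (ab y)^-1).
Proof.
move=> x0 y0; have -> : x ^- 2 - y ^- 2 = (y - x) * (x^-1 * y^-1 ^+ 2 + x^-1 ^+ 2 * y^-1).
  by field; rewrite x0 y0.
rewrite abM ler_wpM2l ?ab_ge0 //; apply: le_trans (abD _ _) _.
by rewrite (abM x^-1) (abM (x^-1 ^+ 2)) !abX !abV.
Qed.

Lemma cube_mix (x y c : R) : 0 <= x -> 0 <= y -> x ^+ 3 <= c -> y ^+ 3 <= c ->
  x * y ^+ 2 + x ^+ 2 * y <= 2 * c.
Proof.
move=> x0 y0 hx hy.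
have : x * y ^+ 2 + x ^+ 2 * y <= x ^+ 3 + y ^+ 3.
  have -> : x ^+ 3 + y ^+ 3 = x * y ^+ 2 + x ^+ 2 * y + (x + y) * (x - y) ^+ 2 by ring.
  by rewrite lerDl mulr_ge0 ?addr_ge0 ?sqr_ge0.
lra.
Qed.

Lemma term_bound (x y : C) (K : R) p : 0 < K -> x != 0 -> y != 0 ->
  1 + `|p.1|%:~R <= K * ab x -> 1 + `|p.2|%:~R <= K * ab x ->
  1 + `|p.1|%:~R <= K * ab y -> 1 + `|p.2|%:~R <= K * ab y ->
  ab (x ^- 2 - y ^- 2) <= ab (y - x) * (2 * K ^+ 3) * (pw p.1 * pw p.2).
Proof.
move=> K0 x0 y0 h1 h2 h3 h4; apply: le_trans (diff_bound x0 y0) _.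
have pos (m : int) : 0 < 1 + `|m|%:~R :> R by rewrite ltr_pwDl // ler0z.
rewrite -mulrA ler_wpM2l ?ab_ge0 // -mulrA.
apply: cube_mix; rewrite ?invr_ge0 ?ab_ge0 //; exact: sep_cube.
Qed.

Lemma AS_pw2 : exists M, AS (fun p : int * int => (pw p.1 * pw p.2)%:C) M.
Proof.
have [M h] := AS_pw; exists (M * M); apply: AS_ext (AS_prod h h) => p.
by rewrite rmorphM.
Qed.

Lemma AS_diff tau z w K : sep tau z K -> sep tau w K ->
  exists M, AS (fun p => (z - lpt tau p) ^- 2 - (w - lpt tau p) ^- 2) M.
Proof.
move=> hz hw; have [M h] := AS_pw2; pose c := ab (w - z) * (2 * K ^+ 3).
exists (ab c%:C * M); apply: AS_le (AS_scale c%:C h) => p.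
have [K0 hz2] := hz; have [_ hw2] := hw.
have [h1 h2] := hz2 p; have [h3 h4] := hw2 p.
have := @term_bound (z - lpt tau p) (w - lpt tau p) K p K0 (sep_neq0 p hz) (sep_neq0 p hw) h1 h2 h3 h4.
have -> : w - lpt tau p - (z - lpt tau p) = w - z by ring.
move=> h5; apply: le_trans h5 _; rewrite -rmorphM abR.
exact: ler_norm.
Qed.

Lemma wp_term tau z K : 0 < complex.Im tau -> sep tau z K ->
  exists2 s, wp z tau = z ^- 2 + s &
    HS (fun p : {p : int * int | p != 0} => (z - lpt tau (val p)) ^- 2 - (lpt tau (val p)) ^- 2) s.
Proof.
move=> y0 hz; have [K1 K10 HK] := lat_bound y0; have [K0 hz2] := hz.
pose K2 := K + K1; have K20 : 0 < K2 by rewrite addr_gt0.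
have [M h] := AS_pw2; pose c := ab z * (2 * K2 ^+ 3).
have hA : AS (fun p : {p : int * int | p != 0} => (z - lpt tau (val p)) ^- 2 - (lpt tau (val p)) ^- 2)
    (ab c%:C * M).
  have hv := AS_inj (val_inj : injective (val : {p : int * int | p != 0} -> _)) (AS_scale c%:C h).
  apply: AS_le hv => p /=.
  have [h1 h2] := hz2 (val p); have [h3 h4] := HK _ (valP p).
  have l0 : - lpt tau (val p) != 0.
    rewrite oppr_eq0 -ab_gt0 -(pmulr_rgt0 _ K10); apply: lt_le_trans h3.
    by rewrite ltr_pwDl // ler0z.
  have a1 := ab_ge0 (z - lpt tau (val p)); have a2 := ab_ge0 (lpt tau (val p)).
  have b1 : K * ab (z - lpt tau (val p)) <= K2 * ab (z - lpt tau (val p)).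
    by apply: ler_wpM2r => //; rewrite /K2; lra.
  have b2 : K1 * ab (lpt tau (val p)) <= K2 * ab (- lpt tau (val p)).
    by rewrite abN; apply: ler_wpM2r => //; rewrite /K2; lra.
  have := @term_bound (z - lpt tau (val p)) (- lpt tau (val p)) K2 (val p) K20 (sep_neq0 (val p) hz) l0
     (le_trans h1 b1) (le_trans h2 b1) (le_trans h3 b2) (le_trans h4 b2).
  rewrite sqrrN.
  have -> : - lpt tau (val p) - (z - lpt tau (val p)) = - z by ring.
  rewrite abN => h5; apply: le_trans h5 _; rewrite -rmorphM abR.
  exact: ler_norm.
have [s hs] := AS_ex hA; exists s => //.
by rewrite /wp; congr (_ + _); exact: HS_sum hA hs.
Qed.

Lemma HS_punctured (f : int * int -> C) s :
  HS (fun p : {p : int * int | p != 0} => f (val p)) s -> HS f (s + f 0).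
Proof.
move=> h; have one : ((1, 1) : int * int) != 0 by [].
pose d : {p : int * int | p != 0} := exist _ (1, 1) one.
apply: (HS_split (h := val) (h' := insubd d) (g := fun _ : unit => 0) (g' := fun=> tt) _ _ _ h) => //.
- exact: valKd.
- by case.
- move=> i; rewrite val_insubd [X in _ (+) X]eq_sym.
  by case: (eqVneq i 0) => [->|_]; rewrite ?eqxx.
- by apply: (@HS_fin1 R _ _ tt) => -[]; rewrite eqxx.
Qed.

(** The regularizing terms cancel, so the difference is a sum over the full lattice, origin
    included, that may be reindexed freely. *)
Lemma wp_diff tau z w K : 0 < complex.Im tau -> sep tau z K -> sep tau w K ->
  HS (fun p => (z - lpt tau p) ^- 2 - (w - lpt tau p) ^- 2) (wp z tau - wp w tau).
Proof.
move=> y0 hz hw; have [s -> Hs] := wp_term y0 hz; have [t -> Ht] := wp_term y0 hw.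
have := HS_sub Hs Ht => h.
have {}h : HS (fun p : {p : int * int | p != 0} =>
    (fun p => (z - lpt tau p) ^- 2 - (w - lpt tau p) ^- 2) (val p)) (s - t).
  by apply: HS_ext h => p; ring.
have := @HS_punctured (fun p => (z - lpt tau p) ^- 2 - (w - lpt tau p) ^- 2) _ h; have -> : lpt tau 0 = 0 by rewrite /lpt mul0r addr0.
rewrite !subr0; have -> : z ^- 2 + s - (w ^- 2 + t) = s - t + (z ^- 2 - w ^- 2) by ring.
by [].
Qed.

Definition dpt (tau : C) (a b : int) : C := (a%:~R * tau + b%:~R) / 6.

Lemma int_abs6 (x y : int) : `|y| <= `|x| + `|x - 6 * y|.
Proof. by lia. Qed.

(** Six times the distance from a division point to a lattice point is the length of a nonzero
    lattice vector, so [lat_bound] applies. *)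
Lemma dpt_sep tau a b : 0 < complex.Im tau -> ~~ lat6 a b -> exists K, sep tau (dpt tau a b) K.
Proof.
move=> y0 nl; have [K K0 HK] := lat_bound y0.
pose c : R := (1 + `|a|%:~R) * (1 + `|b|%:~R).
have a0 : 0 <= `|a|%:~R :> R by rewrite ler0z.
have b0 : 0 <= `|b|%:~R :> R by rewrite ler0z.
have c1 : 1 <= c by rewrite /c; nra.
exists (c * K * 6); split; first by rewrite !mulr_gt0 //; lra.
move=> [m n] /=; pose p : int * int := (b - 6 * m, a - 6 * n).
have p0 : p != 0.
  apply: contra nl => /eqP[h1 h2]; rewrite /lat6.
  by rewrite (subr0_eq h1) (subr0_eq h2) !dvdz_mulr.
have [h1 h2] := HK p p0.
have e : lpt tau p = 6 * (dpt tau a b - lpt tau (m, n)).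
  by rewrite /lpt /dpt /= !rmorphB !rmorphM /=; field.
have e2 : ab (lpt tau p) = 6 * ab (dpt tau a b - lpt tau (m, n)).
  by rewrite e abM ab_nat.
rewrite e2 /= in h1 h2; set L := ab (dpt tau a b - lpt tau (m, n)) in h1 h2 *.
have key (x y : int) : 0 <= `|x|%:~R :> R -> 1 + `|y|%:~R <= (1 + `|x|%:~R) * (1 + `|x - 6 * y|%:~R) :> R.
  move=> x0; have x60 : 0 <= `|x - 6 * y|%:~R :> R by rewrite ler0z.
  have : `|y|%:~R <= `|x|%:~R + `|x - 6 * y|%:~R :> R by rewrite -rmorphD ler_int; exact: int_abs6.
  nra.
have L0 : 0 <= L by exact: ab_ge0.
split.
  apply: le_trans (key b m b0) _; apply: le_trans (ler_wpM2l _ h1) _; first lra.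
  have : (1 + `|b|%:~R) * (K * (6 * L)) <= c * (K * (6 * L)).
    by apply: ler_wpM2r; [rewrite !mulr_ge0 // ltW|rewrite /c; nra].
  by rewrite !mulrA.
apply: le_trans (key a n a0) _; apply: le_trans (ler_wpM2l _ h2) _; first lra.
have : (1 + `|a|%:~R) * (K * (6 * L)) <= c * (K * (6 * L)).
  by apply: ler_wpM2r; [rewrite !mulr_ge0 // ltW|rewrite /c; nra].
by rewrite !mulrA.
Qed.

Lemma sep_le tau z K K' : sep tau z K -> K <= K' -> sep tau z K'.
Proof.
move=> [K0 h] KK; split; first exact: lt_le_trans KK.
move=> p; have [h1 h2] := h p.
have hh : K * ab (z - lpt tau p) <= K' * ab (z - lpt tau p) by apply: ler_wpM2r => //; exact: ab_ge0.
by split; [exact: le_trans h1 hh|exact: le_trans h2 hh].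
Qed.

Lemma dpt_sep2 tau a b c d : 0 < complex.Im tau -> ~~ lat6 a b -> ~~ lat6 c d ->
  exists2 K, sep tau (dpt tau a b) K & sep tau (dpt tau c d) K.
Proof.
move=> y0 h1 h2; have [K s1] := dpt_sep y0 h1; have [K' s2] := dpt_sep y0 h2.
by exists (Num.max K K'); apply: sep_le; [exact: s1| |exact: s2|]; rewrite le_max lexx ?orbT.
Qed.

Definition wpd (tau : C) (a b : int) : C := wp (dpt tau a b) tau.

Lemma wpd_diff tau a b c d : 0 < complex.Im tau -> ~~ lat6 a b -> ~~ lat6 c d ->
  exists M, [/\
   HS (fun p => (dpt tau a b - lpt tau p) ^- 2 - (dpt tau c d - lpt tau p) ^- 2) (wpd tau a b - wpd tau c d)
   & AS (fun p => (dpt tau a b - lpt tau p) ^- 2 - (dpt tau c d - lpt tau p) ^- 2) M].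
Proof.
move=> y0 h1 h2; have [K s1 s2] := dpt_sep2 y0 h1 h2.
have [M hM] := AS_diff s1 s2; exists M; split=> //; exact: wp_diff s1 s2.
Qed.

Lemma lat6_act (g : 'M[int]_2) a b : \det g = 1 ->
  lat6 (a * g 0 0 + b * g 1 0) (a * g 0 1 + b * g 1 1) = lat6 a b.
Proof.
rewrite det2 => dg; apply/idP/idP => /andP[h1 h2]; rewrite /lat6.
  have -> : a = (a * g 0 0 + b * g 1 0) * g 1 1 - (a * g 0 1 + b * g 1 1) * g 1 0.
    by transitivity (a * (g 0 0 * g 1 1 - g 0 1 * g 1 0)); [rewrite dg mulr1|ring].
  have {3}-> : b = (a * g 0 1 + b * g 1 1) * g 0 0 - (a * g 0 0 + b * g 1 0) * g 0 1.
    by transitivity (b * (g 0 0 * g 1 1 - g 0 1 * g 1 0)); [rewrite dg mulr1|ring].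
  by rewrite !rpredB // dvdz_mulr.
by rewrite !rpredD // dvdz_mulr.
Qed.

Lemma autj_neq0 (g : 'M[int]_2) (tau : C) : \det g = 1 -> 0 < complex.Im tau -> autj g tau != 0.
Proof.
move=> dg y0; apply/eqP => e.
have := congr1 (@complex.Im R) e; rewrite /autj !intC ImD ImRM /= addr0 => /eqP.
rewrite mulf_eq0 (gt_eqF y0) orbF intr_eq0 => /eqP c0.
move: e; rewrite /autj c0 mul0r add0r => /eqP; rewrite intr_eq0 => /eqP d0.
by move: dg; rewrite det2 c0 d0 !mulr0 subrr.
Qed.

Lemma Im_mobius (g : 'M[int]_2) (tau : C) : \det g = 1 -> 0 < complex.Im tau ->
  complex.Im (mobius g tau) = complex.Im tau / ab (autj g tau) ^+ 2.
Proof.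
move=> dg y0; have j0 := autj_neq0 dg y0.
have a0 : ab (autj g tau) ^+ 2 != 0 by rewrite expf_neq0 // ab_eq0.
apply: (mulIf a0); rewrite divfK //.
have e : mobius g tau * autj g tau = (g 0 0)%:~R * tau + (g 0 1)%:~R by rewrite /mobius divfK.
have dR : ((g 0 0)%:~R * (g 1 1)%:~R - (g 0 1)%:~R * (g 1 0)%:~R = 1 :> R).
  by rewrite -!rmorphM -rmorphB -det2 dg.
rewrite ab_sqr; move: e; rewrite /autj !intC; case: (mobius g tau) => x y.
case: tau y0 {j0 a0} => s t /= t0 /eqP; rewrite eq_complex /= => /andP[/eqP e1 /eqP e2].
move: e1 e2; rewrite !mul0r !subr0 !addr0 => e1 e2.
move: ((g 0 0)%:~R) ((g 0 1)%:~R) ((g 1 0)%:~R) ((g 1 1)%:~R) dR e1 e2 => a b c d dR e1 e2.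
have -> : y * ((c * s + d) ^+ 2 + (c * t) ^+ 2) =
  (c * s + d) * (x * (c * t) + y * (c * s + d)) - c * t * (x * (c * s + d) - y * (c * t)) by ring.
rewrite e1 e2; transitivity (t * (a * d - b * c)); first by ring.
by rewrite dR mulr1.
Qed.

Lemma Im_mobius_gt0 (g : 'M[int]_2) (tau : C) : \det g = 1 -> 0 < complex.Im tau ->
  0 < complex.Im (mobius g tau).
Proof.
by move=> dg y0; rewrite Im_mobius // divr_gt0 // exprn_gt0 // ab_gt0 autj_neq0.
Qed.

Lemma mobius_lattice_alg (F : numFieldType) (x y m n a b c d t M J : F) :
  J = c * t + d -> J * M = a * t + b ->
  ((x * a + y * c) * t + (x * b + y * d)) / 6 - (m * d + n * b + (m * c + n * a) * t) =
  J * ((x * M + y) / 6 - (m + n * M)).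
Proof.
move=> eJ eM.
have -> : J * ((x * M + y) / 6 - (m + n * M)) = (x * (J * M) + y * J) / 6 - (m * J + n * (J * M)) by field.
by rewrite eM eJ; field.
Qed.

Lemma sqr_scale (F : fieldType) (j x y : F) : j != 0 ->
  j ^+ 2 * ((j * x) ^- 2 - (j * y) ^- 2) = x ^- 2 - y ^- 2.
Proof. by move=> j0; rewrite !exprMn !(invfM (j ^+ 2)) -mulrBr mulVKf // expf_neq0. Qed.

Lemma wpd_mobius (g : 'M[int]_2) tau a b c d : \det g = 1 -> 0 < complex.Im tau ->
  ~~ lat6 a b -> ~~ lat6 c d ->
  wpd (mobius g tau) a b - wpd (mobius g tau) c d = autj g tau ^+ 2 *
   (wpd tau (a * g 0 0 + b * g 1 0) (a * g 0 1 + b * g 1 1)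
    - wpd tau (c * g 0 0 + d * g 1 0) (c * g 0 1 + d * g 1 1)).
Proof.
move=> dg y0 n1 n2; have y1 := Im_mobius_gt0 dg y0.
have [M [hs hM]] := wpd_diff y1 n1 n2.
have [|| M' [hs' _]] := @wpd_diff tau (a * g 0 0 + b * g 1 0) (a * g 0 1 + b * g 1 1)
  (c * g 0 0 + d * g 1 0) (c * g 0 1 + d * g 1 1) y0; rewrite ?lat6_act //.
apply: HS_uniq hs _.
(* The change of lattice coordinates induced by [g], and its inverse [s'], valid because the
   determinant is 1. *)
pose s (p : int * int) : int * int := (p.1 * g 1 1 + p.2 * g 0 1, p.1 * g 1 0 + p.2 * g 0 0).
pose s' (p : int * int) : int * int := (p.1 * g 0 0 - p.2 * g 0 1, p.2 * g 1 1 - p.1 * g 1 0).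
have dg' := dg; rewrite det2 in dg'.
have ss' : cancel s s'.
  move=> [m n]; rewrite /s /s' /=; congr (_, _).
    by transitivity (m * (g 0 0 * g 1 1 - g 0 1 * g 1 0)); [ring|rewrite dg' mulr1].
  by transitivity (n * (g 0 0 * g 1 1 - g 0 1 * g 1 0)); [ring|rewrite dg' mulr1].
have s's : cancel s' s.
  move=> [m n]; rewrite /s /s' /=; congr (_, _).
    by transitivity (m * (g 0 0 * g 1 1 - g 0 1 * g 1 0)); [ring|rewrite dg' mulr1].
  by transitivity (n * (g 0 0 * g 1 1 - g 0 1 * g 1 0)); [ring|rewrite dg' mulr1].
apply: (HS_bij (h := s') (k := s)) => //.
have j0 := autj_neq0 dg y0.
apply: HS_ext (HS_scale (autj g tau ^+ 2) hs') => p; rewrite /= -{1 2}(s's p).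
move: (s' p) => {}p.
have key x y : dpt tau (x * g 0 0 + y * g 1 0) (x * g 0 1 + y * g 1 1) - lpt tau (s p) =
    autj g tau * (dpt (mobius g tau) x y - lpt (mobius g tau) p).
  have e : autj g tau * mobius g tau = (g 0 0)%:~R * tau + (g 0 1)%:~R by rewrite /mobius mulrC divfK.
  rewrite /dpt /lpt /s /= !rmorphD !rmorphM; exact: mobius_lattice_alg e.
by rewrite !key sqr_scale.
Qed.

Lemma round_Re (z : C) : exists n : int, `|complex.Re (z - n%:~R)| <= 1 / 2.
Proof.
exists (Num.floor (complex.Re z + 1 / 2)); rewrite intC ReD ReN ReC.
have := floor_le_tmp (complex.Re z + 1 / 2); have := floorD1_gt (complex.Re z + 1 / 2).
rewrite rmorphD /= => h1 h2; rewrite ler_norml; apply/andP; split; lra.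
Qed.

Lemma strip_lower (z : C) (m : int) : `|complex.Re z| <= 1 / 2 -> m != 0 ->
  1 + `|m|%:~R <= 4 * ab (z - m%:~R).
Proof.
move=> hz /int_ge1 hm; have := ab_Re (z - m%:~R); rewrite intC ReD ReN ReC => h.
have : `|m|%:~R - 1 / 2 <= `|complex.Re z - m%:~R|.
  rewrite distrC; have := lerB_dist (m%:~R) (complex.Re z); rewrite -intr_norm; lra.
lra.
Qed.

Lemma pw_sq (a x : R) : 1 <= a -> a <= 4 * x -> x^-1 ^+ 2 <= 16 * (a * Num.sqrt a)^-1.
Proof.
move=> a1 h; have a0 : 0 < a by lra.
have s1 : Num.sqrt a <= a.
  have s0 : 1 <= Num.sqrt a by rewrite -{1}[1 : R]sqrtr1 ler_wsqrtr.
  have := sqr_sqrtr (ltW a0); rewrite expr2; nra.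
have sp : 0 < Num.sqrt a by rewrite sqrtr_gt0.
have x0 : 0 < x by lra.
rewrite exprVn -[16]invrK -invfM lef_pV2 ?posrE ?mulr_gt0 ?exprn_gt0 ?invr_gt0 //.
rewrite mulrC ler_pdivrMr // expr2; nra.
Qed.

(** In the strip of width 1 only the term with [m = 0] can be large; the rest is bounded uniformly
    in [z]. *)
Lemma strip_sum : exists2 C0 : R, 0 < C0 & forall z : C, `|complex.Re z| <= 1 / 2 ->
  exists2 s, ab s <= C0 & HS (fun m : int => (z - m%:~R) ^- 2) (z ^- 2 + s).
Proof.
have [M h] := AS_pw; have M0 := AS_ge0 h; exists (ab (16%:C) * M + 1).
  by rewrite ltr_pwDr // mulr_ge0 // ab_ge0.
move=> z hz; pose f (m : int) := if m == 0 then 0 else (z - m%:~R) ^- 2.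
have hf : AS f (ab (16%:C) * M).
  apply: AS_le (AS_scale (16%:C) h) => m; rewrite /f; case: eqVneq => [_|m0].
    by rewrite ab0 ab_ge0.
  rewrite abV abX -exprVn -rmorphM abR ger0_norm; last by rewrite mulr_ge0 // ltW // pw_gt0.
  by apply: pw_sq; [rewrite lerDl ler0z|exact: strip_lower].
have [s hs] := AS_ex hf; exists s.
  by apply: le_trans (HS_bound hf hs) _; rewrite lerDl.
pose f0 (m : int) := if m == 0 then z ^- 2 else 0.
have h0 : HS f0 (z ^- 2) by apply: (@HS_fin1 R _ f0 0) => m; rewrite /f0 => /negPf ->.
apply: HS_ext (HS_add h0 hs) => m; rewrite /f0 /f; case: eqVneq => [->|_]; rewrite ?addr0 ?add0r //.
by rewrite subr0.
Qed.

Lemma HS_shift (z : C) (n : int) s : HS (fun m : int => (z - n%:~R - m%:~R) ^- 2) s ->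
  HS (fun m : int => (z - m%:~R) ^- 2) s.
Proof.
move=> h; apply: (HS_bij (h := fun m => m + n) (k := fun m => m - n)) => [m|m|].
- by rewrite addrK.
- by rewrite subrK.
- by apply: HS_ext h => m /=; rewrite rmorphD /= opprD addrA addrAC.
Qed.

Lemma int_sum_ex (z : C) : exists s, HS (fun m : int => (z - m%:~R) ^- 2) s.
Proof.
have [C0 _ H] := strip_sum; have [n /H [s _ hs]] := round_Re z.
by exists ((z - n%:~R) ^- 2 + s); exact: HS_shift hs.
Qed.

Fact Hf_key : unit. Proof. exact: tt. Qed.
Definition Hf (z : C) : C := locked_with Hf_key (projT1 (cid (int_sum_ex z))).

Lemma HfP z : HS (fun m : int => (z - m%:~R) ^- 2) (Hf z).
Proof. by rewrite /Hf unlock; case: cid. Qed.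

Lemma Hf_shift z (n : int) : Hf (z - n%:~R) = Hf z.
Proof. exact: HS_uniq (HS_shift (HfP _)) (HfP z). Qed.

Lemma quarter_sqr (F : numFieldType) (a : F) : 4^-1 / (a / 2) ^+ 2 = a ^- 2.
Proof.
have -> : (a / 2) ^+ 2 = a ^+ 2 / 4 by field.
by rewrite invf_div mulrA mulVf ?mul1r // pnatr_eq0.
Qed.

Lemma Hf_dup z : Hf (z / 2) + Hf ((z + 1) / 2) = 4 * Hf z.
Proof.
have h : HS (fun m : int => (z - m%:~R) ^- 2) (4^-1 * Hf (z / 2) + 4^-1 * Hf ((z + 1) / 2)).
  apply: (HS_split (h := fun m : int => 2 * m) (h' := fun m => (m %/ 2)%Z)
    (g := fun m : int => 2 * m - 1) (g' := fun m => ((m + 1) %/ 2)%Z)).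
  - by move=> m; lia.
  - by move=> m; lia.
  - by move=> m; lia.
  - apply: HS_ext (HS_scale 4^-1 (HfP (z / 2))) => m /=.
    have -> : z / 2 - m%:~R = (z - (2 * m)%:~R) / 2 by rewrite rmorphM /=; field.
    exact: quarter_sqr.
  - apply: HS_ext (HS_scale 4^-1 (HfP ((z + 1) / 2))) => m /=.
    have -> : (z + 1) / 2 - m%:~R = (z - (2 * m - 1)%:~R) / 2 by rewrite rmorphB rmorphM /=; field.
    exact: quarter_sqr.
have := HS_uniq h (HfP z); rewrite -mulrDr => <-.
by rewrite mulVKf // pnatr_eq0.
Qed.

Definition ee (z : C) : C := cexp (twopii R * z).

Lemma eeD z w : ee (z + w) = ee z * ee w. Proof. by rewrite /ee mulrDr cexpD. Qed.
Lemma ee_neq0 z : ee z != 0. Proof. exact: cexp_neq0. Qed.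
Lemma ee_int (n : int) : ee n%:~R = 1.
Proof. by rewrite /ee mulrC -[_ * _]add0r cexp_period cexp0. Qed.
Lemma eeN z : ee (- z) = (ee z)^-1. Proof. by rewrite /ee mulrN cexpN. Qed.
Lemma ee_shift z (n : int) : ee (z - n%:~R) = ee z.
Proof. by rewrite eeD eeN ee_int invr1 mulr1. Qed.
Lemma ee_half : ee (1 / 2) = -1. Proof. by rewrite /ee mul1r cexp_pii. Qed.
Lemma ee_eq1 z : ee z = 1 -> exists n : int, z = n%:~R.
Proof.
move=> /cexp_eq1[n]; rewrite mulrC => /(mulIf (@twopii_neq0 R)) ->; by exists n.
Qed.
Lemma ab_ee z : ab (ee z) = expR (- (2 * pi * complex.Im z)).
Proof.
by rewrite /ee ab_cexp /twopii; case: z => a b /=; rewrite mul0r sub0r.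
Qed.

Definition gf (z : C) : C := twopii R ^+ 2 * lam (ee z).
(** The Lipschitz formula is the vanishing of this function off the integers, proved by the Herglotz
    trick: it is periodic, bounded, and satisfies the functional equation [dfun_dup]. *)
Definition dfun (z : C) : C := Hf z - gf z.

Lemma dfun_shift z (n : int) : dfun (z - n%:~R) = dfun z.
Proof. by rewrite /dfun Hf_shift /gf ee_shift. Qed.

Definition nonint (z : C) : Prop := forall m : int, z != m%:~R.

Lemma gf_dup z : nonint z -> gf (z / 2) + gf ((z + 1) / 2) = 4 * gf z.
Proof.
move=> hz; rewrite /gf; have -> : (z + 1) / 2 = z / 2 + 1 / 2 by field.
rewrite eeD ee_half mulrN1 -mulrDr.
have e2 : ee (z / 2) ^+ 2 = ee z by rewrite expr2 -eeD; congr ee; field.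
rewrite lam_dup e2; first by rewrite mulrCA.
by apply/eqP => /ee_eq1[n e]; have := hz n; rewrite e eqxx.
Qed.

Lemma dfun_dup z : nonint z -> 4 * dfun z = dfun (z / 2) + dfun ((z + 1) / 2).
Proof. by move=> hz; rewrite /dfun mulrBr -gf_dup // -Hf_dup; ring. Qed.

Lemma ee_cont z (e : R) : 0 < e -> exists2 d : R, 0 < d &
  forall w, ab (w - z) < d -> ab (ee w - ee z) < e.
Proof.
move=> e0; have /contP/(_ e e0)[d d0 H] := @cexp_cont R (twopii R * z).
have t0 : 0 < ab (twopii R) by rewrite ab_gt0 twopii_neq0.
exists (d / ab (twopii R)); first by rewrite divr_gt0.
by move=> w hw; apply: H; rewrite -mulrBr abM mulrC -ltr_pdivlMr.
Qed.

Lemma pi_ge1 : 1 <= pi :> R.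
Proof. by have := @pi_ge2 R; lra. Qed.

Lemma lam_far (z : C) : 1 <= `|complex.Im z| -> ab (lam (ee z)) <= 2.
Proof.
have pos (x : C) : 1 <= complex.Im x -> ab (lam (ee x)) <= 2.
  move=> h; have hu : ab (ee x) <= 1 / 2.
    rewrite ab_ee expRN mul1r lef_pV2 ?posrE ?expR_gt0 //.
    have := expR_ge1Dx (2 * pi * complex.Im x); have := pi_ge1; nra.
  by have := lam_bound hu; lra.
rewrite ler_normr => /orP[|h]; first exact: pos.
by rewrite -[z]opprK eeN lamV ?ee_neq0 //; apply: pos; rewrite ImN.
Qed.

Lemma compact_box (e : R) :
  compact [set z : C | `|complex.Re z| <= 1 / 2 /\ (`|complex.Im z| <= 1 /\ e <= ab z)].
Proof.
apply: (compactP (M := 2)) => [z [h1 [h2 _]]|z nz].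
  by have := ab_ReIm z; lra.
have [h1|h1] := lerP `|complex.Re z| (1 / 2); last first.
  exists (`|complex.Re z| - 1 / 2); first lra.
  move=> w hw [h _]; have := ab_Re (w - z); rewrite ReD ReN.
  have := lerB_dist (complex.Re z) (complex.Re w); rewrite distrC; lra.
have [h2|h2] := lerP `|complex.Im z| 1; last first.
  exists (`|complex.Im z| - 1); first lra.
  move=> w hw [_ [h _]]; have := ab_Im (w - z); rewrite ImD ImN.
  have := lerB_dist (complex.Im z) (complex.Im w); rewrite distrC; lra.
have [h3|h3] := lerP e (ab z); first by exfalso; apply: nz.
exists (e - ab z); first lra.
move=> w hw [_ [_ h]]; have := abB_ge w z; lra.
Qed.

Lemma lam_mid : exists M : R, forall z : C, `|complex.Re z| <= 1 / 2 -> `|complex.Im z| <= 1 ->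
  1 / 4 <= ab z -> ab (lam (ee z)) <= M.
Proof.
pose A : set C := [set z | `|complex.Re z| <= 1 / 2 /\ (`|complex.Im z| <= 1 /\ 1 / 4 <= ab z)].
have cA : compact A := @compact_box (1 / 4).
have A0 : A !=set0.
  exists (1 / 2)%:C; rewrite /A /= abR normr0 ger0_norm; last lra.
  by split; [lra|split; lra].
have [z1 A1 H1] := ab_max A0 cA (f := ee) (fun z _ => (contP ee z).2 (@ee_cont z)).
have [|z2 A2 H2] := ab_min A0 cA (f := fun z => 1 - ee z).
  move=> z _; apply/contP => e e0; have [d d0 H] := ee_cont z e0.
  exists d => // w /H; have -> : 1 - ee w - (1 - ee z) = - (ee w - ee z) by ring.
  by rewrite abN.
have p : 0 < ab (1 - ee z2).
  rewrite ab_gt0 subr_eq0 eq_sym; apply/eqP => /ee_eq1[n e].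
  case: A2 => h1 [_ h2]; move: h1 h2; rewrite e ab_int intC ReC -intr_norm.
  have [->|/int_ge1 h] := eqVneq n 0; first by rewrite normr0; lra.
  lra.
exists (ab (ee z1) / ab (1 - ee z2) ^+ 2) => z h1 h2 h3.
have Az : A z by [].
rewrite /lam abM abV abX; apply: ler_pM; rewrite ?ab_ge0 ?invr_ge0 ?exprn_ge0 ?ab_ge0 //; first exact: H1.
have := H2 z Az => h4; rewrite lef_pV2 ?posrE ?exprn_gt0 //; last exact: lt_le_trans h4.
by apply: lerXn2r; rewrite ?nnegrE ?ab_ge0.
Qed.

(** By periodicity [z] may be taken in the strip. There [Hf] is bounded by [strip_sum]; [lam] is
    bounded by compactness where the imaginary part is at most 1, and by its decay beyond. *)
Lemma dfun_far : exists2 M : R, 0 < M & forall z : C, (forall m : int, 1 / 4 <= ab (z - m%:~R)) ->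
  ab (dfun z) <= M.
Proof.
have [C0 C00 H] := strip_sum; have [M1 HM1] := lam_mid.
pose T := ab (twopii R ^+ 2); have T0 : 0 <= T by exact: ab_ge0.
have M2 : 0 <= Num.max M1 2 by rewrite le_max; apply/orP; right; lra.
exists (16 + C0 + T * Num.max M1 2); first by have := mulr_ge0 T0 M2; lra.
move=> z0 hz0; have [n hn] := round_Re z0; rewrite -(dfun_shift z0 n).
have hz : 1 / 4 <= ab (z0 - n%:~R) by exact: hz0.
move: (z0 - n%:~R) hn hz => z hn hz.
have [s hs1 hs2] := H z hn.
have z2 : ab (z ^- 2) <= 16.
  rewrite abV abX -[16]invrK lef_pV2 ?posrE ?exprn_gt0 ?invr_gt0 //; last by apply: lt_le_trans hz; lra.
  have h16 : 1 / 4 * (1 / 4) <= ab z * ab z by apply: ler_pM => //; lra.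
  by rewrite expr2; lra.
have g : ab (gf z) <= T * Num.max M1 2.
  rewrite /gf abM ler_wpM2l //; have [h|h] := lerP `|complex.Im z| 1.
    by apply: le_trans (HM1 z hn h hz) _; rewrite le_max lexx.
  by apply: le_trans (lam_far (ltW h)) _; rewrite le_max lexx orbT.
rewrite /dfun; have := abB (z ^- 2 + s) (gf z); have := abD (z ^- 2) s.
have -> : Hf z = z ^- 2 + s by exact: HS_uniq (HfP z) hs2.
lra.
Qed.

Lemma lam_near0 (e : R) : 0 < e -> exists2 d : R, 0 < d & forall t : C, t != 0 -> ab t < d ->
  ab (1 - t ^+ 2 * lam (cexp t)) < e.
Proof.
move=> e0; pose c := Num.min (1 / 2) (e / 20).
have c0 : 0 < c by rewrite lt_min; apply/andP; split; lra.
have c1 : c <= 1 / 2 by rewrite ge_min lexx.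
have c2 : c <= e / 20 by rewrite ge_min lexx orbT.
have [d d0 H] := cexp_near0 c0; clearbody c.
exists (Num.min d (c / 2)); first by rewrite lt_min d0; lra.
move=> t t0; rewrite lt_min => /andP[td tc]; have := H t td => h.
pose n := (cexp t - 1) / t - 1.
have hn : ab n <= c.
  have -> : n = (cexp t - 1 - t) / t by rewrite /n; field.
  by rewrite abM abV ler_pdivrMr ?ab_gt0.
have ue : cexp t = 1 + t * (1 + n) by rewrite /n; field.
have hu : ab (t * (1 + n)) <= c.
  rewrite abM; have := abD 1 n; rewrite ab1; have := ab_ge0 t; have := ab_ge0 (1 + n); nra.
have h1n : 1 / 2 <= ab (1 + n) by have := abD_ge 1 n; rewrite ab1; lra.
have n1 : 1 + n != 0 by rewrite -ab_gt0; lra.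
have -> : 1 - t ^+ 2 * lam (cexp t) = ((1 + n) ^+ 2 - 1 - t * (1 + n)) / (1 + n) ^+ 2.
  rewrite /lam ue; clearbody n.
  have -> : (1 - (1 + t * (1 + n))) ^+ 2 = t ^+ 2 * (1 + n) ^+ 2 by ring.
  by field; rewrite n1 t0.
rewrite abM abV abX ltr_pdivrMr; last by rewrite exprn_gt0; lra.
have -> : (1 + n) ^+ 2 - 1 - t * (1 + n) = n * (2 + n) - t * (1 + n) by ring.
have h2 : ab (n * (2 + n)) <= c * 3.
  rewrite abM; apply: ler_pM; rewrite ?ab_ge0 //.
  by have := abD 2 n; rewrite ab_nat; lra.
have := abB (n * (2 + n)) (t * (1 + n)).
have h4 : 1 / 4 <= ab (1 + n) ^+ 2 by rewrite expr2; nra.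
nra.
Qed.

(** Both terms of [dfun] have the principal part [z ^- 2] at 0, so the double poles cancel. *)
Lemma kfun_near0 (e : R) : 0 < e -> exists2 d : R, 0 < d & forall z : C, z != 0 -> ab z < d ->
  ab (z ^+ 2 * dfun z) < e.
Proof.
move=> e0; have [C0 C00 H] := strip_sum.
have [|d1 d10 H1] := @lam_near0 (e / 2); first lra.
have T0 : 0 < ab (twopii R) by rewrite ab_gt0 twopii_neq0.
have e2 : 0 < e / 2 / C0 by rewrite !divr_gt0.
have [d dd [h1 h2 h3 h4]] : exists2 d : R, 0 < d & [/\ d <= d1 / ab (twopii R), d <= 1 / 2, d <= 1 & d <= e / 2 / C0].
  have h0 : 0 < 1 / 2 :> R by lra.
  have [s s0 [? ? ? ?]] := small_pos4 (divr_gt0 d10 T0) h0 (ltr01 : 0 < 1 :> R) e2.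
  by exists s => //; split; exact: ltW.
exists d => // z z0 hz.
have [s hs1 hs2] : exists2 s, ab s <= C0 & HS (fun m : int => (z - m%:~R) ^- 2) (z ^- 2 + s).
  by apply: H; have := ab_Re z; lra.
rewrite /dfun; have -> : Hf z = z ^- 2 + s by exact: HS_uniq (HfP z) hs2.
have -> : z ^+ 2 * (z ^- 2 + s - gf z) = (1 - (twopii R * z) ^+ 2 * lam (ee z)) + z ^+ 2 * s.
  rewrite /gf; move: (twopii R) (lam _) => T L; by field.
have k1 : ab (1 - (twopii R * z) ^+ 2 * lam (ee z)) < e / 2.
  apply: H1; first by rewrite mulf_neq0 // twopii_neq0.
  rewrite abM mulrC -ltr_pdivlMr //; exact: lt_le_trans h1.
have k2 : ab (z ^+ 2 * s) <= e / 2.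
  rewrite abM abX; have z00 := ab_ge0 z; have zz : ab z ^+ 2 <= ab z by rewrite expr2; nra.
  have : ab z ^+ 2 * ab s <= ab z * C0 by apply: ler_pM; rewrite ?exprn_ge0 ?ab_ge0.
  have : ab z * C0 <= e / 2 by rewrite -ler_pdivlMr //; lra.
  lra.
have := abD (1 - (twopii R * z) ^+ 2 * lam (ee z)) (z ^+ 2 * s); lra.
Qed.

Lemma half_pow (M e : R) : 0 < e -> exists n, M / 2 ^+ n < e.
Proof.
move=> e0; have [||n hn] := @small_pow R (1 / 2) (e / (`|M| + 1)); first by apply/andP; split; lra.
  by rewrite divr_gt0 // ltr_wpDl.
exists n; rewrite ltr_pdivlMr in hn.
  have : 0 < (1 / 2 : R) ^+ n by rewrite exprn_gt0.
  move: hn; rewrite expr_div_n expr1n; have := ler_norm M; move: (2 ^+ n) => x h1 h2 h3.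
  have : M / x <= `|M| / x by rewrite ler_wpM2r // -[x^-1]mul1r ltW.
  rewrite mul1r in h2 h3; nra.
by rewrite ltr_wpDl.
Qed.

Lemma nonint_near0 (z : C) : z != 0 -> ab z <= 1 / 4 -> nonint z.
Proof.
move=> z0 hz m; apply/eqP => e; move: z0 hz; rewrite e ab_int intr_eq0 => /int_ge1; lra.
Qed.

Lemma nonint_half z : nonint z -> nonint (z / 2) /\ nonint ((z + 1) / 2).
Proof.
move=> hz; split=> m; apply/eqP => e.
  have := hz (m * 2); rewrite rmorphM /= -e divfK ?pnatr_eq0 // => /eqP; exact.
have := hz (m * 2 - 1); rewrite rmorphB rmorphM /= -e divfK ?pnatr_eq0 // addrK => /eqP; exact.
Qed.

(** The functional equation gives [ab (dfun (z / 2)) >= 4 * ab (dfun z) - M]. Starting from a value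
    above the fixed point [M / 3], repeated halving would keep [z ^+ 2 * dfun z] away from 0,
    against [kfun_near0]. *)
Lemma dfun_near : exists M : R, forall z : C, z != 0 -> ab z <= 1 / 4 -> ab (dfun z) <= M.
Proof.
have [M M0 H] := dfun_far; exists (M / 3) => z z0 hz; rewrite leNgt; apply/negP => hlt.
(* The excess over the fixed point, scaled by [ab z ^+ 2] so that halving does not decrease it. *)
pose del (z : C) := ab (z ^+ 2 * dfun z) - ab z ^+ 2 * (M / 3).
have step (x : C) : x != 0 -> ab x <= 1 / 4 -> del x <= del (x / 2).
  move=> x0 hx.
  have far : ab (dfun ((x + 1) / 2)) <= M.
    apply: H => m; have -> : (x + 1) / 2 - m%:~R = (1 - (2 * m)%:~R) / 2 + x / 2.
      by rewrite rmorphM /=; field.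
    have := abD_ge ((1 - (2 * m)%:~R) / 2) (x / 2); rewrite !abM !abV !ab_nat.
    have -> : (1 - (2 * m)%:~R : C) = (1 - 2 * m)%:~R by rewrite rmorphB.
    rewrite ab_int; have /int_ge1 : 1 - 2 * m != 0 by lia.
    lra.
  have e : (x / 2) ^+ 2 * dfun (x / 2) = x ^+ 2 * dfun x - x ^+ 2 / 4 * dfun ((x + 1) / 2).
    have -> : dfun (x / 2) = 4 * dfun x - dfun ((x + 1) / 2).
      by rewrite dfun_dup ?addrK //; exact: nonint_near0.
    by field.
  rewrite /del e; have := abB_ge (x ^+ 2 * dfun x) (x ^+ 2 / 4 * dfun ((x + 1) / 2)).
  have -> : ab (x ^+ 2 / 4 * dfun ((x + 1) / 2)) = ab x ^+ 2 / 4 * ab (dfun ((x + 1) / 2)).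
    by rewrite abM [ab (_ / _)]abM abX abV ab_nat.
  have -> : ab (x / 2) ^+ 2 = ab x ^+ 2 / 4 by rewrite abM abV ab_nat expr_div_n -natrX.
  have x2 : 0 <= ab x ^+ 2 by rewrite exprn_ge0 // ab_ge0.
  have : ab x ^+ 2 / 4 * ab (dfun ((x + 1) / 2)) <= ab x ^+ 2 / 4 * M by rewrite ler_wpM2l //; lra.
  lra.
have dz : 0 < del z.
  rewrite /del abM abX subr_gt0 ltr_pM2l // exprn_gt0 // ab_gt0 //.
have [d d0 Hd] := kfun_near0 dz.
have it n : z / 2 ^+ n != 0 /\ (ab (z / 2 ^+ n) <= 1 / 4 /\ del z <= del (z / 2 ^+ n)).
  elim: n => [|n [a1 [a2 a3]]]; first by rewrite expr0 divr1.
  have -> : z / 2 ^+ n.+1 = z / 2 ^+ n / 2 by rewrite exprSr invfM mulrA.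
  split; first by rewrite mulf_neq0 // invr_eq0 pnatr_eq0.
  split; last exact: le_trans a3 (step _ a1 a2).
  by rewrite abM abV ab_nat; have := ab_ge0 (z / 2 ^+ n); lra.
have [n hn] := half_pow (ab z) d0; have [a1 [a2 a3]] := it n.
have : ab ((z / 2 ^+ n) ^+ 2 * dfun (z / 2 ^+ n)) < del z.
  by apply: Hd => //; rewrite abM abV abX ab_nat.
have : 0 <= ab (z / 2 ^+ n) ^+ 2 * (M / 3) by rewrite mulr_ge0 ?exprn_ge0 ?ab_ge0 //; lra.
move: a3; rewrite {2}/del; lra.
Qed.

Lemma dfun_bounded : exists M : R, forall z : C, nonint z -> ab (dfun z) <= M.
Proof.
have [M1 M10 H1] := dfun_far; have [M2 H2] := dfun_near.
exists (Num.max M1 M2) => z hz; rewrite le_max.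
have [h|/existsNP[m /negP]] := pselect (forall m : int, 1 / 4 <= ab (z - m%:~R)).
  by apply/orP; left; exact: H1.
rewrite -ltNge => h; apply/orP; right.
rewrite -(dfun_shift z m); apply: H2 (ltW h).
by rewrite subr_eq0.
Qed.

(** Any bound [M] improves to [M / 2], because 4 times the value is a sum of two values bounded by
    [M]; iterate. *)
Lemma dfun_eq0 z : nonint z -> dfun z = 0.
Proof.
move=> hz; have [M H] := dfun_bounded.
have it n : forall z, nonint z -> ab (dfun z) <= M / 2 ^+ n.
  elim: n => [|n IH] x hx; first by rewrite expr0 divr1; exact: H.
  have [x1 x2] := nonint_half hx; have := IH _ x1; have := IH _ x2.
  have := abD (dfun (x / 2)) (dfun ((x + 1) / 2)); rewrite -dfun_dup // abM ab_nat.
  have -> : M / 2 ^+ n.+1 = M / 2 ^+ n / 2 by rewrite exprSr invfM mulrA.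
  lra.
apply/eqP; rewrite -ab_eq0 eq_le ab_ge0 andbT leNgt; apply/negP => h.
have [n hn] := half_pow M h; have := it n z hz; lra.
Qed.

Lemma lipschitz_formula z : nonint z ->
  HS (fun m : int => (z - m%:~R) ^- 2) (twopii R ^+ 2 * lam (ee z)).
Proof.
by move=> /dfun_eq0/eqP; rewrite subr_eq0 => /eqP e; have := HfP z; rewrite e.
Qed.

Lemma lam_principal : exists2 M : R, 0 < M & forall z : C, z != 0 -> ab z <= 1 / 4 ->
  ab (twopii R ^+ 2 * lam (ee z) - z ^- 2) <= M.
Proof.
have [C0 C00 H] := strip_sum; exists C0 => // z z0 hz.
have [s hs1 hs2] : exists2 s, ab s <= C0 & HS (fun m : int => (z - m%:~R) ^- 2) (z ^- 2 + s).
  by apply: H; have := ab_Re z; lra.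
have -> : twopii R ^+ 2 * lam (ee z) = z ^- 2 + s.
  exact: HS_uniq (lipschitz_formula (nonint_near0 z0 hz)) hs2.
by rewrite addrAC subrr add0r.
Qed.

End LatticeSums.

(** * Transformation of [X] and [Y] under the modular group *)

Section Modularity.
Variable R : realType.
Local Notation C := R[i].
Local Notation omega := (omega R).
Local Notation zeta := (zeta R).
Implicit Types (g h : 'M[int]_2) (tau w : C).

Definition ww (tau : C) : C := cexp (twopii R * tau / 6).

Lemma ww_neq0 tau : ww tau != 0. Proof. exact: cexp_neq0. Qed.

Lemma ab_ww tau : ab (ww tau) = expR (- (pi / 3 * complex.Im tau)).
Proof.
rewrite /ww ab_cexp; congr expR.
have -> : twopii R * tau / 6 = (6^-1 : R)%:C * (twopii R * tau).
  by rewrite mulrC fmorphV /= rmorph_nat.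
by rewrite /twopii; case: tau => a b /=; field.
Qed.

Lemma ww_lt1 tau : 0 < complex.Im tau -> ab (ww tau) < 1.
Proof.
by move=> y0; rewrite ab_ww expR_lt1 oppr_lt0 mulr_gt0 // divr_gt0 // pi_gt0.
Qed.

Lemma ww_surj w : w != 0 -> ab w < 1 -> exists2 tau, 0 < complex.Im tau & ww tau = w.
Proof.
move=> w0 w1; have [z ez] := cexp_surj w0; exists (6 * z / twopii R); last first.
  rewrite /ww -ez; congr cexp; move: (twopii R) (@twopii_neq0 R) => T T0; field.
  by rewrite T0.
have e : ww (6 * z / twopii R) = w.
  rewrite /ww -ez; congr cexp; move: (twopii R) (@twopii_neq0 R) => T T0; field.
  by rewrite T0.
have p3 : 0 < pi / 3 :> R by rewrite divr_gt0 // pi_gt0.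
by move: w1; rewrite -e ab_ww expR_lt1 oppr_lt0 (pmulr_rgt0 _ p3).
Qed.

Lemma ee_dpt tau a b : ee (dpt tau a b) = divpt (ww tau) a b.
Proof.
rewrite /ee /dpt /divpt /ww /zeta -!cexpXz -cexpD; congr cexp.
by move: (twopii R) => T; field.
Qed.

Lemma ee_tau tau : ee tau = ww tau ^+ 6.
Proof. by rewrite /ee /ww -cexpX; congr cexp; move: (twopii R) => T; field. Qed.

(** The symmetric form of [S], indexed by all integers with the sign that matches the rows of the
    lattice. *)
Lemma torus_HS (q u : C) : q != 0 -> ab q < 1 -> u != 0 -> HS (fun n : int => lam (u * q ^ (- n))) (S q u).
Proof.
move=> q0 q1 u0.
have -> : S q u = lamsum u^-1 q + lamsum (u * q) q.
  by rewrite /S (lamsumS u q1) (lamsumS u^-1 q1) lamV // [q / u]mulrC; ring.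
apply: HS_int.
  apply: HS_ext (lamsumP u^-1 q1) => n; rewrite -lamV ?mulf_neq0 ?invr_eq0 ?expf_neq0 //.
  by rewrite invfM invrK -exprnN.
apply: HS_ext (lamsumP (u * q) q1) => n.
by rewrite NegzE opprK -exprnP exprS mulrA.
Qed.

(** The lattice is summed row by row: for a fixed multiple of [tau] the Lipschitz formula evaluates
    the row, and the rows add up to [S]. Fubini is available for the difference, which converges
    absolutely. *)
Lemma wpd_divS tau a b c d : 0 < complex.Im tau -> ~~ lat6 a b -> ~~ lat6 c d ->
  wpd tau a b - wpd tau c d = twopii R ^+ 2 * (divS (ww tau) a b - divS (ww tau) c d).
Proof.
move=> y0 n1 n2; have [K s1 s2] := dpt_sep2 y0 n1 n2.
have [M hM] := AS_diff s1 s2; have hS := wp_diff y0 s1 s2.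
have q0 : ww tau ^+ 6 != 0 by rewrite expf_neq0 // ww_neq0.
have q1 : ab (ww tau ^+ 6) < 1 by rewrite abX exprn_ilt1 ?ab_ge0 // ww_lt1.
pose f (p : int * int) := (dpt tau a b - lpt tau (p.2, p.1)) ^- 2 - (dpt tau c d - lpt tau (p.2, p.1)) ^- 2.
have sw (p : int * int) : ((p.2, p.1).2, (p.2, p.1).1) = p by case: p.
have hM' : AS f M.
  have inj : injective (fun p : int * int => (p.2, p.1)) by move=> [x y] [x' y'] [-> ->].
  exact: AS_inj inj hM.
have hS' : HS f (wpd tau a b - wpd tau c d).
  apply: (HS_bij (h := fun p : int * int => (p.2, p.1)) (k := fun p : int * int => (p.2, p.1))) => //.
have row z n : sep tau z K -> HS (fun m : int => (z - lpt tau (m, n)) ^- 2)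
    (twopii R ^+ 2 * lam (ee z * (ww tau ^+ 6) ^ (- n))).
  move=> hz; have -> : ee z * (ww tau ^+ 6) ^ (- n) = ee (z - n%:~R * tau).
    by rewrite eeD -ee_tau -/(ee _) -mulNr -rmorphN /= /ee mulrCA cexpXz.
  have e m : z - n%:~R * tau - m%:~R = z - lpt tau (m, n).
    by rewrite /lpt /= opprD [- m%:~R - _]addrC addrA.
  have nz : nonint (z - n%:~R * tau) by move=> m; rewrite -subr_eq0 e (sep_neq0 _ hz).
  by move: (lipschitz_formula nz); apply: HS_ext => m; rewrite e.
have rows n : HS (fun m : int => f (n, m))
   (twopii R ^+ 2 * (lam (ee (dpt tau a b) * (ww tau ^+ 6) ^ (- n)) - lam (ee (dpt tau c d) * (ww tau ^+ 6) ^ (- n)))).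
  by rewrite mulrBr; apply: HS_sub; exact: row.
apply: HS_uniq (HS_fubini hM' rows hS') _.
apply: HS_scale; rewrite !divSE -!ee_dpt; apply: HS_sub; apply: torus_HS => //; exact: ee_neq0.
Qed.

Definition act g (F : Type) (e : int -> int -> F) (a b : int) : F :=
  e (a * g 0 0 + b * g 1 0) (a * g 0 1 + b * g 1 1).

(** Agreement up to an additive constant and a factor. Values are only compared through differences,
    since [divS] and [wpd] have different constants. *)
Definition proportional (F : ringType) (k : F) (f e : int -> int -> F) : Prop :=
  forall a b c d, ~~ lat6 a b -> ~~ lat6 c d -> f a b - f c d = k * (e a b - e c d).

(** All four forms have coefficients adding up to 0, for [Aw] and [Bw] because
    [1 + om + om ^+ 2 = 0], so they are combinations of differences. *)
Lemma proportional_forms (F : numFieldType) (k om : F) f e : 1 + om + om ^+ 2 = 0 -> proportional k f e ->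
  [/\ Aw f om = k * Aw e om, Bw f om = k * Bw e om, Cw f = k * Cw e & Dw f = k * Dw e].
Proof.
move=> os H; rewrite /Aw /Bw /Cw /Dw -!H //.
have e23 := H 2 3 2 5 isT isT; have e21 := H 2 1 2 5 isT isT.
have om2 : om ^+ 2 = - (1 + om) by apply/eqP; rewrite -addr_eq0 addrC os.
split=> //.
  have -> : f 2 1 + om ^+ 2 * f 2 3 + om * f 2 5 = (f 2 1 - f 2 5) + om ^+ 2 * (f 2 3 - f 2 5).
    by rewrite om2; ring.
  by rewrite e21 e23 om2; ring.
have -> : f 2 1 + om * f 2 3 + om ^+ 2 * f 2 5 = (f 2 1 - f 2 5) + om * (f 2 3 - f 2 5).
  by rewrite om2; ring.
by rewrite e21 e23 om2; ring.
Qed.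

Lemma proportional_XY (F : numFieldType) (k om : F) f e : 1 + om + om ^+ 2 = 0 -> k != 0 ->
  proportional k f e -> Xw f om = Xw e om /\ Yw f = Yw e.
Proof.
move=> os k0 H; have [hA hB hC hD] := proportional_forms os H.
rewrite /Xw /Yw hA hB hC hD; have sc (c x y : F) : c * (k * x) / (k * y) = c * x / y.
  by rewrite mulrCA -mulf_div divff // mul1r.
by rewrite !sc.
Qed.

Lemma proportional_mobius g tau : SL2Z g -> upper_half tau ->
  proportional (autj g tau ^+ 2 * twopii R ^+ 2) (wpd (mobius g tau)) (act g (divS (ww tau))).
Proof.
move=> dg y0 a b c d n1 n2; rewrite wpd_mobius // wpd_divS ?lat6_act //.
by rewrite mulrA.
Qed.

Lemma XYfun_mobius g tau : SL2Z g -> upper_half tau ->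
  Xfun (mobius g tau) = Xw (act g (divS (ww tau))) omega /\ Yfun (mobius g tau) = Yw (act g (divS (ww tau))).
Proof.
move=> dg y0; have := proportional_XY (omega_sum R) _ (proportional_mobius dg y0); apply.
by rewrite mulf_neq0 // expf_neq0 // ?twopii_neq0 // autj_neq0.
Qed.

Lemma SL2Z1 : SL2Z (1%:M). Proof. exact: det1. Qed.

Lemma mobius1 tau : mobius 1%:M tau = tau.
Proof. by rewrite /mobius /autj !mxE /= mul0r mul1r add0r addr0 divr1. Qed.

Lemma act1 (F : Type) (e : int -> int -> F) a b : act 1%:M e a b = e a b.
Proof. by rewrite /act !mxE /= !mulr1 !mulr0 addr0 add0r. Qed.

Lemma actE1 (F : Type) (e : int -> int -> F) : act 1%:M e = e.
Proof. by apply/funext => a; apply/funext => b; rewrite act1. Qed.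

Lemma mobiusM g h tau : SL2Z g -> SL2Z h -> upper_half tau ->
  mobius (g *m h) tau = mobius g (mobius h tau).
Proof.
move=> dg dh y0; have := mobius_sphereM (Some tau) dg dh; rewrite /=.
have dgh : SL2Z (g *m h) by rewrite /SL2Z /= det_mulmx dg dh mulr1.
rewrite (negPf (autj_neq0 dgh y0)) (negPf (autj_neq0 dh y0)) /=.
by rewrite (negPf (autj_neq0 dg (Im_mobius_gt0 dh y0))) => -[].
Qed.

Lemma actM g h (F : Type) (e : int -> int -> F) : act g (act h e) = act (g *m h) e.
Proof.
by apply/funext => a; apply/funext => b; rewrite /act !mul2; congr e; ring.
Qed.

Definition XX g w := Xw (act g (divS w)) omega.
Definition YY g w := Yw (act g (divS w)).

(** Permuting the indices by [g] yields, up to proportionality, the system at [mobius g tau].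
    Nonvanishing and the curve equation proved for [divS] thus pass to every cusp. *)
Lemma act_scaled g w : SL2Z g -> w != 0 -> ab w < 1 -> exists w' k,
  [/\ w' != 0, ab w' < 1, k != 0 & proportional k (divS w') (act g (divS w))].
Proof.
move=> dg w0 w1; have [tau y0 <-] := ww_surj w0 w1.
have y1 : upper_half (mobius g tau) by exact: Im_mobius_gt0.
exists (ww (mobius g tau)), (autj g tau ^+ 2); split.
- exact: ww_neq0.
- exact: ww_lt1.
- by rewrite expf_neq0 // autj_neq0.
- move=> a b c d n1 n2; apply: (mulfI (expf_neq0 2 (@twopii_neq0 R))).
  by rewrite -wpd_divS // (proportional_mobius dg y0) // -mulrA mulrCA.
Qed.

Lemma act_forms g w : SL2Z g -> w != 0 -> ab w < 1 ->
  [/\ Aw (act g (divS w)) omega != 0, Bw (act g (divS w)) omega != 0, Cw (act g (divS w)) != 0 &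
      Dw (act g (divS w)) != 0] /\ YY g w ^+ 2 = XX g w ^+ 3 + 1.
Proof.
move=> dg w0 w1; have [w' [k [w0' w1' k0 hp]]] := act_scaled dg w0 w1.
have DS := divS_system w0' w1'; have os := omega_sum R.
have [hA hB hC hD] := proportional_forms os hp; have [hX hY] := proportional_XY os k0 hp.
have A0 := Aw_neq0 DS os; have B0 := Bw_neq0 DS os; have [D0 C0 _ _ _] := CD_data DS.
have nz (x y : C) : y = k * x -> y != 0 -> x != 0 by move=> ->; rewrite mulf_eq0 negb_or => /andP[].
split; last by rewrite /XX /YY -hX -hY; exact: curve_w.
by split; [exact: nz hA A0|exact: nz hB B0|exact: nz hC C0|exact: nz hD D0].
Qed.

(** [g] permutes the indices outside the lattice, so each value occurring in the numerators and
    denominators extends analytically to [w = 0]. *)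
Lemma XY_extension g : SL2Z g -> exists A B Cc D : C -> C,
  (forall w, ab w < 1 -> [/\ Ana A w, Ana B w, Ana Cc w & Ana D w]) /\
  (forall w, w != 0 -> ab w < 1 -> [/\ A w != 0, B w != 0, Cc w != 0 & D w != 0] /\
     XX g w = A w / B w /\ YY g w = Cc w / D w).
Proof.
move=> dg.
have ext a b : ~~ lat6 a b -> exists E : C -> C, (forall w : C, ab w < 1 -> Ana E w) /\
    (forall w : C, w != 0 -> ab w < 1 -> act g (divS w) a b = E w).
  by move=> n; apply: divS_extension; rewrite lat6_act.
have [E21 [h21 k21]] := ext 2 1 isT; have [E23 [h23 k23]] := ext 2 3 isT; have [E25 [h25 k25]] := ext 2 5 isT.
have [E01 [h01 k01]] := ext 0 1 isT; have [E04 [h04 k04]] := ext 0 4 isT.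
have [E31 [h31 k31]] := ext 3 1 isT; have [E34 [h34 k34]] := ext 3 4 isT.
exists (fun w => - omega ^+ 2 * (E21 w + omega ^+ 2 * E23 w + omega * E25 w)),
  (fun w => E21 w + omega * E23 w + omega ^+ 2 * E25 w), (fun w => - 3 * (E01 w - E04 w)),
  (fun w => E31 w - E34 w); split=> [w w1|w w0 w1].
  have c (k : C) E : Ana E w -> Ana (fun w => k * E w) w by move=> h; apply: Ana_mul => //; exact: Ana_cst.
  split.
  - by apply: (c); apply: Ana_add; [apply: Ana_add; [exact: h21|apply: (c); exact: h23]|apply: (c); exact: h25].
  - by apply: Ana_add; [apply: Ana_add; [exact: h21|apply: (c); exact: h23]|apply: (c); exact: h25].
  - by apply: (c); apply: Ana_sub; [exact: h01|exact: h04].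
  - by apply: Ana_sub; [exact: h31|exact: h34].
rewrite -!(k21, k23, k25, k01, k04, k31, k34) //.
have [[A0 B0 C0 D0] _] := act_forms dg w0 w1.
have o2 : - omega ^+ 2 != 0 by rewrite oppr_eq0 expf_neq0 // -ab_gt0 ab_omega.
split; last by [].
have n3 : - 3 != 0 :> C by rewrite oppr_eq0 pnatr_eq0.
by split; [exact: mulf_neq0 o2 A0|exact: B0|exact: mulf_neq0 n3 C0|exact: D0].
Qed.

Lemma XX_Ana g w : SL2Z g -> w != 0 -> ab w < 1 -> Ana (XX g) w /\ Ana (YY g) w.
Proof.
move=> dg w0 w1; have [A [B [Cc [D [hA hX]]]]] := XY_extension dg.
have [a1 a2 a3 a4] := hA w w1; have [[_ b2 _ b4] _] := hX w w0 w1.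
pose r := Num.min (ab w) (1 - ab w).
have r0 : 0 < r by rewrite lt_min ab_gt0 w0 subr_gt0.
have near v : ab (v - w) < r -> v != 0 /\ ab v < 1.
  rewrite lt_min => /andP[h1 h2]; split.
    by apply: contraTneq h1 => ->; rewrite sub0r abN ltxx.
  by have := abB_ge v w; lra.
split.
  apply: Ana_ext (Ana_div a1 a2 b2); exists r => // v /near[v0 v1].
  by have [_ [->]] := hX v v0 v1.
apply: Ana_ext (Ana_div a3 a4 b4); exists r => // v /near[v0 v1].
by have [_ [_ ->]] := hX v v0 v1.
Qed.

Lemma XY_mero g : SL2Z g -> meromorphic_at (fun w => XX g w ^+ 3) 0 /\ meromorphic_at (fun w => YY g w ^+ 2) 0.
Proof.
move=> dg; have [A [B [Cc [D [hA hX]]]]] := XY_extension dg.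
have z1 : ab (0 : C) < 1 by rewrite ab0.
have [a1 a2 a3 a4] := hA 0 z1.
have nl (N : C -> C) k : (forall w, w != 0 -> ab w < 1 -> N w != 0) -> ~ locally_eq (fun w => N w ^+ k) 0 0.
  move=> h [d d0 H]; pose v : C := (Num.min d 1 / 2)%:C.
  have m0 : 0 < Num.min d 1 by rewrite lt_min d0 ltr01.
  have md : Num.min d 1 <= d by rewrite ge_min lexx.
  have m1 : Num.min d 1 <= 1 by rewrite ge_min lexx orbT.
  have av : ab v = Num.min d 1 / 2 by rewrite abR ger0_norm //; lra.
  have v0 : v != 0 by rewrite -ab_gt0 av; lra.
  have : N v ^+ k != 0 by rewrite expf_neq0 // h // av; lra.
  by rewrite H ?eqxx // subr0 av; lra.
have mero (f N D0 : C -> C) k : Ana N 0 -> Ana D0 0 -> (forall w, w != 0 -> ab w < 1 -> D0 w != 0) ->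
   (forall w, w != 0 -> ab w < 1 -> f w = N w / D0 w) -> meromorphic_at (fun w => f w ^+ k) 0.
  move=> hN hD hD0 hf.
  apply: (meromorphic_quotient (Ana_exp k hN) (Ana_exp k hD) (nl D0 k hD0)).
  by exists 1 => // z z0; rewrite subr0 => z1'; rewrite hf // expr_div_n.
split.
  by apply: (mero _ A B) => // w w0 w1; have [[? ? ? ?] [? ?]] := hX w w0 w1.
by apply: (mero _ Cc D) => // w w0 w1; have [[? ? ? ?] [? ?]] := hX w w0 w1.
Qed.

(** A chain rule with an analytic outer function and an inner one that is merely derivable, as
    established for [cexp]. *)
Lemma derivable_Ana_comp (f u : C -> C) z : Ana f (u z) -> {for z, continuous u} ->
  derivable u z 1 -> derivable (fun x => f (u x)) z 1.
Proof.
move=> /Ana_slope[k [/Ana_cont kc fE]] uc ud.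
apply/cvg_ex; exists ((lim ((fun t : C => t^-1 *: ((u \o shift z) (t *: (1 : C)) - u z)) @ 0^')) * k (u z)).
have c1 : (fun t : C => k (u (t *: (1 : C) + z))) @ 0^' --> k (u z).
  apply/(@cvgatP _ _ (0^')) => e e0; move/contP: kc => /(_ e e0)[d d0 H].
  move/contP: uc => /(_ d d0)[d' d0' H']; apply/dnearP; exists d' => // h h0; rewrite subr0 => hd.
  by apply: H; apply: H'; rewrite /GRing.scale /= mulr1 addrK.
apply: cvg_trans (cvgM ud c1); apply: near_eq_cvg; apply/dnearP; exists 1 => // h h0 _.
by rewrite /= fE /GRing.scale /=; ring.
Qed.

Lemma ww_cont tau : {for tau, continuous ww}.
Proof.
apply/contP => e e0; have [d d0 H] := @ee_cont R (tau / 6) e e0.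
exists (6 * d); first by rewrite mulr_gt0.
move=> z hz; rewrite /ww -!mulrA; apply: H.
by rewrite -mulrBl abM abV ab_nat ltr_pdivrMr // mulrC.
Qed.

Lemma ww_derivable tau : derivable ww tau 1.
Proof.
have T6 : twopii R / 6 != 0 by rewrite mulf_neq0 ?twopii_neq0 // invr_eq0 pnatr_eq0.
have /cvg_ex[l hl] := @cexp_derivable R (twopii R * tau / 6).
apply/cvg_ex; exists (twopii R / 6 * l); apply/(@cvgatP _ _ (0^')) => e e0.
have c0 : 0 < ab (twopii R / 6) by rewrite ab_gt0.
move/(@cvgatP _ _ (0^')): hl => /(_ (e / ab (twopii R / 6)) (divr_gt0 e0 c0)) /dnearP[d d0 H].
apply/dnearP; exists (d / ab (twopii R / 6)); first by rewrite divr_gt0.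
move=> t t0; rewrite subr0 ltr_pdivlMr // => ht.
have ht' : ab (twopii R / 6 * t - 0) < d by rewrite subr0 abM mulrC.
have := H _ (mulf_neq0 T6 t0) ht'.
rewrite ltr_pdivlMr // -abM; congr (_ < _); congr ab.
rewrite /ww /GRing.scale /= !mulr1; set c1 := cexp _; set c2 := cexp _; set c3 := cexp _.
have -> : c1 = c3 by rewrite /c1 /c3; congr cexp; move: (twopii R) => T; field.
move: c2 c3 (twopii R / 6) T6 => x y T T0; field.
by rewrite t0 T0.
Qed.

Lemma Ana_ww_derivable (f F : C -> C) tau : 0 < complex.Im tau ->
  (forall w, w != 0 -> ab w < 1 -> Ana F w) ->
  (forall z, 0 < complex.Im z -> f z = F (ww z)) -> meromorphic_at f tau.
Proof.
move=> y0 hF hf; exists 0%N, f; split; last by apply/dnearP; exists 1 => // z _ _; rewrite mulr1.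
apply/nearP; exists (complex.Im tau) => // z hz.
have near_im (x : C) (r : C) : ab (r - x) < complex.Im x -> 0 < complex.Im r.
  move=> h; have := ab_Im (r - x); rewrite ImD ImN ler_norml => /andP[h1 _]; lra.
have z0 := near_im _ _ hz.
have := derivable_Ana_comp (hF (ww z) (ww_neq0 z) (ww_lt1 z0)) (@ww_cont z) (@ww_derivable z).
apply: near_eq_derivable.
by apply/nearP; exists (complex.Im z) => // x /near_im /hf ->.
Qed.

Definition periodic6 (F : Type) (e : int -> int -> F) := forall a b c d, lat6 (c - a) (d - b) -> e c d = e a b.
Definition even6 (F : Type) (e : int -> int -> F) := forall a b c d, lat6 (c + a) (d + b) -> e c d = e a b.

Lemma act_Gamma g (F : Type) (e : int -> int -> F) : periodic6 e -> Gamma 6 g -> act g e = e.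
Proof.
move=> pe [_ [h1 h2 h3 h4]]; apply/funext => a; apply/funext => b; apply: pe.
move: h1 h2 h3 h4; rewrite /lat6.
move: (g 0 0) (g 0 1) (g 1 0) (g 1 1) => x y z t h1 h2 h3 h4.
have -> : a * x + b * z - a = a * (x - 1) + b * z by ring.
have -> : a * y + b * t - b = a * y + b * (t - 1) by ring.
by rewrite !rpredD // dvdz_mull.
Qed.

(** The effect of [tau |-> tau + k] on the indices. *)
Definition shift (F : Type) (k : int) (e : int -> int -> F) (a b : int) : F := e a (b + k * a).

Lemma shift_periodic (F : Type) k (e : int -> int -> F) : periodic6 e -> periodic6 (shift k e).
Proof.
move=> pe a b c d /andP[h1 h2]; apply: pe; rewrite /lat6 h1 /=.
have -> : d + k * c - (b + k * a) = d - b + k * (c - a) by ring.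
by rewrite rpredD // dvdz_mull.
Qed.

(** The translation permutes (2,1), (2,3), (2,5) cyclically, which multiplies the resolvents by
    powers of [om], and exchanges (3,1) with (3,4). This is why [X] needs a cube and [Y] a
    square. *)
Lemma shift1_XY (F : numFieldType) (om : F) (e : int -> int -> F) : periodic6 e -> om ^+ 3 = 1 -> om != 0 ->
  Xw (shift 1 e) om = om ^+ 2 * Xw e om /\ Yw (shift 1 e) = - Yw e.
Proof.
move=> pe o3 o0.
have e27 : e 2 7 = e 2 1 by apply: pe.
have e37 : e 3 7 = e 3 1 by apply: pe.
have hA : Aw (shift 1 e) om = om * Aw e om.
  rewrite /Aw /shift /= -!/(e _ _) [1 + _]/= [3 + _]/= [5 + _]/= e27.
  have -> : om * (e 2 1 + om ^+ 2 * e 2 3 + om * e 2 5) = om * e 2 1 + om ^+ 3 * e 2 3 + om ^+ 2 * e 2 5 by ring.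
  by rewrite o3; ring.
have hB : Bw (shift 1 e) om = om ^+ 2 * Bw e om.
  rewrite /Bw /shift /= [1 + _]/= [3 + _]/= [5 + _]/= e27.
  have -> : om ^+ 2 * (e 2 1 + om * e 2 3 + om ^+ 2 * e 2 5) = om ^+ 2 * e 2 1 + om ^+ 3 * e 2 3 + om * om ^+ 3 * e 2 5 by ring.
  by rewrite o3; ring.
have hC : Cw (shift 1 e) = Cw e by rewrite /Cw /shift !mulr0 !addr0.
have hD : Dw (shift 1 e) = - Dw e.
  by rewrite /Dw /shift /= [1 + _]/= [4 + _]/= e37 opprB.
split; last by rewrite /Yw hC hD invrN mulrN.
rewrite /Xw hA hB invfM.
have ov : om / om ^+ 2 = om ^+ 2.
  apply: (mulIf (expf_neq0 2 o0)); rewrite divfK ?expf_neq0 //.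
  by rewrite -exprD (exprD _ 3 1) o3 mul1r.
transitivity ((om / om ^+ 2) * (- om ^+ 2 * Aw e om / Bw e om)); first by ring.
by rewrite ov.
Qed.

Lemma shift_XY (F : numFieldType) (om : F) (e : int -> int -> F) (k : int) : periodic6 e -> om ^+ 3 = 1 -> om != 0 ->
  exists n, Xw (shift k e) om = om ^+ 2 ^+ n * Xw e om /\ Yw (shift k e) = (-1) ^+ n * Yw e.
Proof.
move=> pe o3 o0.
have nat_case n : Xw (shift n%:Z e) om = om ^+ 2 ^+ n * Xw e om /\ Yw (shift n%:Z e) = (-1) ^+ n * Yw e.
  elim: n => [|n [h1 h2]].
    have -> : shift 0%Z e = e by apply/funext => a; apply/funext => b; rewrite /shift mul0r addr0.
    by rewrite !expr0 !mul1r.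
  have -> : shift n.+1%:Z e = shift 1 (shift n%:Z e).
    by apply/funext => a; apply/funext => b; rewrite /shift; congr e; rewrite -addn1 PoszD; ring.
  have [-> ->] := shift1_XY (shift_periodic n%:Z pe) o3 o0.
  by rewrite h1 h2 !exprS; split; [rewrite mulrA|rewrite mulN1r mulNr].
exists `|(k %% 6)%Z|%N; have [<- <-] := nat_case `|(k %% 6)%Z|%N.
have -> : shift k e = shift `|(k %% 6)%Z|%N e => //.
apply/funext => a; apply/funext => b; apply: pe; rewrite /lat6 subrr dvdz0 /=.
rewrite gez0_abs ?modz_ge0 //.
have -> : b + k * a - (b + (k %% 6)%Z * a) = (k - (k %% 6)%Z) * a by ring.
by rewrite {1}(divz_eq k 6) addrK -mulrA mulrCA dvdz_mulr.
Qed.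

Lemma unit6 (a d : int) : (6 %| a * d - 1)%Z -> (6 %| a - 1)%Z && (6 %| d - 1)%Z || (6 %| a + 1)%Z && (6 %| d + 1)%Z.
Proof.
move=> h.
have ha : a = (a %/ 6)%Z * 6 + (a %% 6)%Z by exact: divz_eq.
have hd : d = (d %/ 6)%Z * 6 + (d %% 6)%Z by exact: divz_eq.
have : (6 %| (a %% 6)%Z * (d %% 6)%Z - 1)%Z.
  move: (a %/ 6)%Z (a %% 6)%Z (d %/ 6)%Z (d %% 6)%Z ha hd h => x y z t -> ->.
  have -> : (x * 6 + y) * (z * 6 + t) - 1 = 6 * (x * (z * 6 + t) + y * z) + (y * t - 1) by ring.
  by rewrite rpredDl // dvdz_mulr.
have := modz_ge0 a (isT : 6 != 0 :> int); have := ltz_pmod a (isT : 0 < 6 :> int).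
have := modz_ge0 d (isT : 6 != 0 :> int); have := ltz_pmod d (isT : 0 < 6 :> int).
have ea z : (6 %| a + z)%Z = (6 %| (a %% 6)%Z + z)%Z by rewrite {1}ha -addrA rpredDl // dvdz_mull.
have ed z : (6 %| d + z)%Z = (6 %| (d %% 6)%Z + z)%Z by rewrite {1}hd -addrA rpredDl // dvdz_mull.
rewrite !ea !ed; move: (a %% 6)%Z (d %% 6)%Z => [x|//] [y|//].
by case: x => [|[|[|[|[|[|//]]]]]]; case: y => [|[|[|[|[|[|//]]]]]].
Qed.

(** The units modulo 6 are 1 and -1, so an element of this group acts on the indices as a
    translation up to a common sign, and the values are even. *)
Lemma act_Gamma0 g (F : Type) (e : int -> int -> F) : periodic6 e -> even6 e -> Gamma0 6 g ->
  exists k, act g e = shift k e.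
Proof.
move=> pe ee [dg c0].
have : (6 %| (g 0 0 * g 1 1 - 1)%R)%Z.
  move: dg; rewrite /SL2Z /= det2 => dg; have -> : g 0 0 * g 1 1 - 1 = g 0 1 * g 1 0 by rewrite -dg; ring.
  by rewrite dvdz_mull.
case/unit6/orP => /andP[h1 h2].
  exists (g 0 1); apply/funext => a; apply/funext => b; apply: pe; rewrite /lat6.
  have -> : a * g 0 0 + b * g 1 0 - a = a * (g 0 0 - 1) + b * g 1 0 by ring.
  have -> : a * g 0 1 + b * g 1 1 - (b + g 0 1 * a) = b * (g 1 1 - 1) by ring.
  by rewrite rpredD // dvdz_mull.
exists (- g 0 1); apply/funext => a; apply/funext => b; apply: ee; rewrite /lat6.
have -> : a * g 0 0 + b * g 1 0 + a = a * (g 0 0 + 1) + b * g 1 0 by ring.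
have -> : a * g 0 1 + b * g 1 1 + (b + - g 0 1 * a) = b * (g 1 1 + 1) by ring.
by rewrite rpredD // dvdz_mull.
Qed.

Lemma modular_XY : modular_function (Gamma0 6) 0 (fun tau : C => Xfun tau ^+ 3) /\
  modular_function (Gamma0 6) 0 (fun tau : C => Yfun tau ^+ 2).
Proof.
have E g tau : SL2Z g -> upper_half tau -> Xfun (mobius g tau) = XX g (ww tau) /\ Yfun (mobius g tau) = YY g (ww tau).
  exact: XYfun_mobius.
have E1 tau : upper_half tau -> Xfun tau = XX 1%:M (ww tau) /\ Yfun tau = YY 1%:M (ww tau).
  by move=> y0; have := E _ _ SL2Z1 y0; rewrite mobius1.
have inv g tau : Gamma0 6 g -> upper_half tau ->
    Xfun (mobius g tau) ^+ 3 = Xfun tau ^+ 3 /\ Yfun (mobius g tau) ^+ 2 = Yfun tau ^+ 2.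
  move=> Gg y0; have dg : SL2Z g by case: Gg.
  have [-> ->] := E _ _ dg y0; have [-> ->] := E1 _ y0; rewrite /XX /YY actE1.
  have DS := divS_system (ww_neq0 tau) (ww_lt1 y0).
  have [k ->] := act_Gamma0 (ds_period DS) (ds_sym DS) Gg.
  have o0 : omega != 0 by rewrite -ab_gt0 ab_omega.
  have [n [-> ->]] := shift_XY k (ds_period DS) (@omega3 R) o0.
  move: (Xw _ _) (Yw _) => x y.
  have o1 : omega ^+ 2 ^+ n ^+ 3 = 1 by rewrite exprAC [omega ^+ 2 ^+ 3]exprAC omega3 !expr1n.
  have s1 : (-1) ^+ n ^+ 2 = 1 :> C by rewrite -exprM mulnC exprM sqrrN !expr1n.
  by rewrite (exprMn 3) (exprMn 2) o1 s1 !mul1r.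
have A g w : SL2Z g -> w != 0 -> ab w < 1 -> Ana (fun w => XX g w ^+ 3) w /\ Ana (fun w => YY g w ^+ 2) w.
  by move=> dg w0 w1; have [h1 h2] := XX_Ana dg w0 w1; split; exact: Ana_exp.
split; split.
- move=> tau y0; apply: (Ana_ww_derivable (F := fun w => XX 1%:M w ^+ 3)) => //.
    by move=> w w0 w1; have [] := A _ _ SL2Z1 w0 w1.
  by move=> z z0; have [-> _] := E1 _ z0.
- by move=> g tau Gg y0; rewrite expr0z mul1r; have [] := inv g tau Gg y0.
(* [w = exp(2 pi i tau / 6)] is the local parameter at every cusp, valid on the whole upper
   half-plane. *)
- move=> g dg; exists 6%N, 0, (fun w => XX g w ^+ 3); split=> //.
    by have [] := XY_mero dg.
  by move=> tau y0 _; rewrite oppr0 expr0z mul1r; have [-> _] := E g tau dg y0.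
- move=> tau y0; apply: (Ana_ww_derivable (F := fun w => YY 1%:M w ^+ 2)) => //.
    by move=> w w0 w1; have [] := A _ _ SL2Z1 w0 w1.
  by move=> z z0; have [_ ->] := E1 _ z0.
- by move=> g tau Gg y0; rewrite expr0z mul1r; have [] := inv g tau Gg y0.
- move=> g dg; exists 6%N, 0, (fun w => YY g w ^+ 2); split=> //.
    by have [] := XY_mero dg.
  by move=> tau y0 _; rewrite oppr0 expr0z mul1r; have [_ ->] := E g tau dg y0.
Qed.

End Modularity.

(** * Recovering the torsion values, up to a factor, from [X] and [Y] *)

Section ScalingAlgebra.
Variable F : numFieldType.

(** The sum of the values at a point and at its translates by the points of order 2, in terms of
    [x = S u - e1]; by duplication it equals [4 * (S (u ^+ 2) - e1)]. *)
Definition Rf (e2 e3 k1 k2 k3 x : F) : F := x + k1 / x + (e2 + k2 / (x - e2)) + (e3 + k3 / (x - e3)).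

Lemma Rf_diff (e2 e3 k1 k2 k3 x y : F) : x != 0 -> y != 0 -> x - e2 != 0 -> y - e2 != 0 ->
  x - e3 != 0 -> y - e3 != 0 ->
  Rf e2 e3 k1 k2 k3 x - Rf e2 e3 k1 k2 k3 y =
  (x - y) * (1 - k1 * x^-1 * y^-1 - k2 * (x - e2)^-1 * (y - e2)^-1 - k3 * (x - e3)^-1 * (y - e3)^-1).
Proof. by move=> *; rewrite /Rf; field; do ! (apply/andP; split). Qed.

Lemma Rf_scale (e2 e3 k1 k2 k3 x m : F) : m != 0 ->
  Rf (m * e2) (m * e3) (m ^+ 2 * k1) (m ^+ 2 * k2) (m ^+ 2 * k3) (m * x) = m * Rf e2 e3 k1 k2 k3 x.
Proof.
move=> m0; have sc (k y : F) : m ^+ 2 * k / (m * y) = m * (k / y).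
  by rewrite expr2 -!mulrA mulrCA invfM mulrCA [m * (m^-1 * _)]mulrA divff // mul1r mulrA.
by rewrite /Rf -!mulrBr !sc -!mulrDr.
Qed.

Lemma Rf_scale_eq (a2 a3 l1 l2 l3 e2 e3 k1 k2 k3 x m : F) : m != 0 -> a2 = m * e2 -> a3 = m * e3 ->
  l1 = m ^+ 2 * k1 -> l2 = m ^+ 2 * k2 -> l3 = m ^+ 2 * k3 ->
  Rf a2 a3 l1 l2 l3 (m * x) = m * Rf e2 e3 k1 k2 k3 x.
Proof. by move=> m0 -> -> -> -> ->; exact: Rf_scale. Qed.

Lemma scale_pole (m c z x : F) : m != 0 -> c ^+ 2 = m -> m * x - z ^- 2 = m * (x - (c * z) ^- 2).
Proof. by move=> + e; rewrite -e => c0; rewrite mulrBr exprMn (invfM (c ^+ 2)) mulVKf. Qed.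

(** Product and quotient determine [A' ^+ 2], and together with the cube this fixes [A'] with no
    ambiguity of roots. *)
Lemma A_scale_alg (m A B A' B' y q : F) : m != 0 -> A != 0 -> B != 0 -> B' != 0 ->
  A' ^+ 3 = m ^+ 3 * A ^+ 3 -> A' * B' = m ^+ 2 * (A * B) -> A' / B' = A / B -> A' = m * A /\ B' = m * B.
Proof.
move=> m0 A0 B0 B0' h3 h2 hq.
have e1 : A' = A / B * B' by rewrite -hq divfK.
have A0' : A' != 0 by rewrite e1 !mulf_neq0 // invr_eq0.
have sq : A' ^+ 2 = m ^+ 2 * A ^+ 2.
  have -> : A' ^+ 2 = A' * B' * (A' / B') by field.
  by rewrite h2 hq; field.
have eA : A' = m * A.
  apply: (mulfI (expf_neq0 2 A0')); rewrite -exprSr h3 sq; ring.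
split=> //; apply: (mulfI A0'); rewrite h2 eA; ring.
Qed.

Lemma inv_scale (x y z w k l m : F) : x = k / z -> y = l / w -> l != 0 -> m != 0 ->
  k = m ^+ 2 * l -> x = m * y -> z = m * w.
Proof.
move=> hx hy l0 m0 hk h; have [e|w0] := eqVneq w 0.
  have : x = 0 by rewrite h hy e invr0 !mulr0.
  by rewrite hx e mulr0 => /eqP; rewrite mulf_eq0 invr_eq0 hk mulf_eq0 expf_eq0 /= (negPf m0) (negPf l0) /= => /eqP.
have y0 : y != 0 by rewrite hy mulf_neq0 // invr_eq0.
have z0 : z != 0.
  by apply: contraTneq (mulf_neq0 m0 y0) => e; rewrite -h hx e invr0 mulr0 eqxx.
have ez : k = x * z by rewrite hx divfK.
apply: (mulfI (mulf_neq0 m0 y0)); rewrite -h -ez hk h hy; field.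
by [].
Qed.

(** [Y] gives the order 2 data up to the factor [m], hence [yq] and [mq]. The equation of the right
    branch gives the cube of [Aw], and [X] the quotient of the resolvents; inverting the resolvents
    yields the remaining values. *)
Lemma scale_data (om : F) (e f : int -> int -> F) : 1 + om + om ^+ 2 = 0 -> division_system e -> division_system f ->
  Aw e om ^+ 3 = 8 * yq e * mq e -> Aw f om ^+ 3 = 8 * yq f * mq f ->
  Xw f om = Xw e om -> Yw f = Yw e ->
  exists m, [/\ m != 0, [/\ e2 f - e1 f = m * (e2 e - e1 e), e3 f - e1 f = m * (e3 e - e1 e),
     k1 f = m ^+ 2 * k1 e, k2 f = m ^+ 2 * k2 e & k3 f = m ^+ 2 * k3 e] &
   [/\ f 0 4 - e1 f = m * (e 0 4 - e1 e), f 2 0 - e1 f = m * (e 2 0 - e1 e) & f 2 2 - e1 f = m * (e 2 2 - e1 e)]].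
Proof.
move=> os De Df rbe rbf hX hY.
have om0 : om != 0 by apply: contraTneq (oner_neq0 F) => o; rewrite -os o expr0n /= !addr0 eqxx.
have [[ne1 ne2 ne3] _ _ _ _] := three_torsion_data De (isT : ~~ lat6 0 4) isT.
have [[nf1 nf2 nf3] _ _ _ _] := three_torsion_data Df (isT : ~~ lat6 0 4) isT.
have [_ _ _ ce2 ce3] := CD_data De; have [_ _ _ cf2 cf3] := CD_data Df.
rewrite hY -ce2 in cf2; rewrite hY -ce3 in cf3.
pose m := (f 0 4 - e1 f) / (e 0 4 - e1 e).
have ae : e 0 4 - e1 e != 0 by rewrite subr_eq0.
have af : f 0 4 - e1 f != 0 by rewrite subr_eq0.
have m0 : m != 0 by rewrite mulf_neq0 // invr_eq0.
have h1 : f 0 4 - e1 f = m * (e 0 4 - e1 e) by rewrite /m divfK.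
have rat (x y : F) : x != 0 -> y != 0 -> (f 0 4 - e1 f) / y = (e 0 4 - e1 e) / x -> y = m * x.
  move=> x0 y0 h; rewrite h1 in h; apply: (mulfI ae).
  have : m * (e 0 4 - e1 e) / y * (x * y) = (e 0 4 - e1 e) / x * (x * y) by rewrite h.
  have -> : m * (e 0 4 - e1 e) / y * (x * y) = (e 0 4 - e1 e) * (m * x) by field.
  by have -> : (e 0 4 - e1 e) / x * (x * y) = (e 0 4 - e1 e) * y by field.
have h2 : f 0 4 - e2 f = m * (e 0 4 - e2 e) by apply: rat => //; rewrite subr_eq0.
have h3 : f 0 4 - e3 f = m * (e 0 4 - e3 e) by apply: rat => //; rewrite subr_eq0.
clearbody m.
have d2 : e2 f - e1 f = m * (e2 e - e1 e).
  have -> : e2 f - e1 f = f 0 4 - e1 f - (f 0 4 - e2 f) by ring.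
  by rewrite h1 h2; ring.
have d3 : e3 f - e1 f = m * (e3 e - e1 e).
  have -> : e3 f - e1 f = f 0 4 - e1 f - (f 0 4 - e3 f) by ring.
  by rewrite h1 h3; ring.
have d23 : e3 f - e2 f = m * (e3 e - e2 e).
  have -> : e3 f - e2 f = f 0 4 - e2 f - (f 0 4 - e3 f) by ring.
  by rewrite h2 h3; ring.
have K1 : k1 f = m ^+ 2 * k1 e by rewrite /k1 d2 d3; ring.
have K2 : k2 f = m ^+ 2 * k2 e.
  have -> : k2 f = - (e2 f - e1 f) * (e3 f - e2 f) by rewrite /k2; ring.
  by rewrite d2 d23 /k2; ring.
have K3 : k3 f = m ^+ 2 * k3 e.
  have -> : k3 f = (e3 f - e1 f) * (e3 f - e2 f) by rewrite /k3; ring.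
  by rewrite d3 d23 /k3; ring.
have Y1 : yq f = m * yq e.
  by rewrite (yqE Df) (yqE De) h1 K1; field; rewrite ae m0.
have M1 : mq f = m ^+ 2 * mq e by rewrite /mq Y1 K1; ring.
have [_ se ABe _ _] := resolvent_data De os; have [_ sf ABf _ _] := resolvent_data Df os.
have [hA hB] : Aw f om = m * Aw e om /\ Bw f om = m * Bw e om.
  apply: (@A_scale_alg m (Aw e om) (Bw e om) (Aw f om) (Bw f om) 0 0) => //.
  - exact: Aw_neq0.
  - exact: Bw_neq0.
  - exact: Bw_neq0.
  - by rewrite rbe rbf Y1 M1; ring.
  - by rewrite ABe ABf M1; ring.
  - move: hX; rewrite /Xw -!mulrA => /(mulfI _); apply.
    by rewrite oppr_eq0 expf_neq0.
have o3 : om ^+ 3 = 1.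
  have : (om - 1) * (1 + om + om ^+ 2) = 0 by rewrite os mulr0.
  have -> : (om - 1) * (1 + om + om ^+ 2) = om ^+ 3 - 1 by ring.
  by move/eqP; rewrite subr_eq0 => /eqP.
(* The inverse of the discrete Fourier transform of length 3, with [- yq] as its component of
   frequency 0. *)
have solve (e0 : int -> int -> F) (D : division_system e0) :
    3 * (e0 2 3 - e1 e0) = - yq e0 + om * Aw e0 om + om ^+ 2 * Bw e0 om /\
    3 * (e0 2 5 - e1 e0) = - yq e0 + om ^+ 2 * Aw e0 om + om * Bw e0 om.
  have [_ s0 _ _ _] := resolvent_data D os.
  rewrite -s0 (AwE _ os) (BwE _ os).
  move: (e0 2 1 - e1 e0) (e0 2 3 - e1 e0) (e0 2 5 - e1 e0) => u v t; split.
    transitivity (u * (1 + om + om ^+ 2) + v * (1 + 2 * om ^+ 3) + t * (1 + om ^+ 2 + om * om ^+ 3)); last by ring.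
    have -> : 1 + om ^+ 2 + om * om ^+ 3 = 1 + om + om ^+ 2 by rewrite o3; ring.
    by rewrite os o3; ring.
  transitivity (u * (1 + om + om ^+ 2) + v * (1 + om ^+ 2 + om * om ^+ 3) + t * (1 + 2 * om ^+ 3)); last by ring.
  have -> : 1 + om ^+ 2 + om * om ^+ 3 = 1 + om + om ^+ 2 by rewrite o3; ring.
  by rewrite os o3; ring.
have three : 3 != 0 :> F by rewrite pnatr_eq0.
have [e23 e25] := solve e De; have [f23 f25] := solve f Df.
have v : f 2 3 - e1 f = m * (e 2 3 - e1 e).
  apply: (mulfI three); rewrite f23 mulrCA e23 Y1 hA hB; ring.
have t : f 2 5 - e1 f = m * (e 2 5 - e1 e).
  apply: (mulfI three); rewrite f25 mulrCA e25 Y1 hA hB; ring.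
exists m; split=> //; split=> //.
  have [hf _] := root_at Df (isT : ~~ lat6 2 0) isT (isT : lat6 0 (3 - (0 + 3))).
  have [he _] := root_at De (isT : ~~ lat6 2 0) isT (isT : lat6 0 (3 - (0 + 3))).
  exact: inv_scale hf he (k1_neq0 De) m0 K1 v.
have [hf _] := root_at Df (isT : ~~ lat6 2 2) isT (isT : lat6 0 (5 - (2 + 3))).
have [he _] := root_at De (isT : ~~ lat6 2 2) isT (isT : lat6 0 (5 - (2 + 3))).
exact: inv_scale hf he (k1_neq0 De) m0 K1 t.
Qed.

End ScalingAlgebra.

Lemma half_alg (F : numFieldType) (s a b c d e1 e2 e3 : F) :
  (s - e1) * (a - e1) = (e2 - e1) * (e3 - e1) -> (s - e2) * (b - e2) = (e1 - e2) * (e3 - e2) ->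
  (s - e3) * (c - e3) = (e2 - e3) * (e1 - e3) -> s != e1 -> s != e2 -> s != e3 ->
  s + a + b + c = 4 * d ->
  4 * (d - e1) = Rf (e2 - e1) (e3 - e1) ((e2 - e1) * (e3 - e1)) ((e1 - e2) * (e3 - e2))
    ((e1 - e3) * (e2 - e3)) (s - e1).
Proof.
move=> h1 h2 h3 n1 n2 n3 h; rewrite mulrBr -h.
have sol (x y k : F) : x != y -> forall z, (x - y) * (z - y) = k -> z = y + k / (x - y).
  move=> xy z <-; rewrite mulrC mulKf ?subr_eq0 //; ring.
rewrite (sol _ _ _ n1 _ h1) (sol _ _ _ n2 _ h2) (sol _ _ _ n3 _ h3) /Rf.
have -> : s - e1 - (e2 - e1) = s - e2 by ring.
have -> : s - e1 - (e3 - e1) = s - e3 by ring.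
by rewrite [(e2 - e3) * _]mulrC; ring.
Qed.

(** * From equal coordinates to equivalent lattices with level structure *)

Section LocalUniqueness.
Variable R : realType.
Local Notation C := R[i].

Definition half_map (e2 e3 k1 k2 k3 : C) (H : C -> C) (r M : R) : Prop :=
  forall z, z != 0 -> ab z < r -> ab (H z - z ^- 2) <= M /\ 4 * H (2 * z) = Rf e2 e3 k1 k2 k3 (H z).

(** When all distances are at least [L], each of the three fractions contributes at most [ab ki / L]
    to the difference quotient, in total at most 1 besides the 1 of the identity. *)
Lemma Rf_lipschitz (e2 e3 k1 k2 k3 x y : C) (L : R) : 1 <= L -> ab k1 + ab k2 + ab k3 <= L ->
  L <= ab x -> L <= ab y -> L <= ab (x - e2) -> L <= ab (y - e2) -> L <= ab (x - e3) -> L <= ab (y - e3) ->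
  ab (Rf e2 e3 k1 k2 k3 x - Rf e2 e3 k1 k2 k3 y) <= 2 * ab (x - y).
Proof.
move=> L1 hk hx hy hx2 hy2 hx3 hy3.
have nz (u : C) : L <= ab u -> u != 0 by move=> h; rewrite -ab_gt0; lra.
rewrite Rf_diff ?nz // abM mulrC ler_wpM2r ?ab_ge0 //.
have t (k u v : C) : L <= ab u -> L <= ab v -> ab (k * u^-1 * v^-1) <= ab k / L.
  move=> hu hv; rewrite !abM !abV; have k0 := ab_ge0 k.
  have Lp : 0 < L by lra.
  have up : 0 < ab u by lra.
  have vp : 0 < ab v by lra.
  have iu : (ab u)^-1 <= L^-1 by rewrite lef_pV2.
  have iv : (ab v)^-1 <= 1 by rewrite invf_le1 //; lra.
  have iu0 : 0 <= (ab u)^-1 by rewrite invr_ge0 ltW.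
  have iv0 : 0 <= (ab v)^-1 by rewrite invr_ge0 ltW.
  have : ab k * (ab u)^-1 <= ab k * L^-1 by rewrite ler_wpM2l.
  have : 0 <= ab k * (ab u)^-1 by rewrite mulr_ge0.
  nra.
have t1 := t k1 x y hx hy; have t2 := t k2 _ _ hx2 hy2; have t3 := t k3 _ _ hx3 hy3.
have hs : ab k1 / L + ab k2 / L + ab k3 / L <= 1 by rewrite -!mulrDl ler_pdivrMr ?mul1r //; lra.
move: (k1 * _ * _) (k2 * _ * _) (k3 * _ * _) t1 t2 t3 => a b c t1 t2 t3.
have := abB (1 - a - b) c; have := abB (1 - a) b; have := abB 1 a; rewrite ab1; lra.
Qed.

(** Since 4 times the value at [z] is a 2-Lipschitz function of the value at [z / 2], the distance
    of two solutions at [z] is at most half of that at [z / 2]. It is bounded by [2 * M] near 0,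
    where the poles agree, so it vanishes. *)
Lemma local_unique (e2 e3 k1 k2 k3 : C) (H1 H2 : C -> C) (r M : R) : 0 < r ->
  half_map e2 e3 k1 k2 k3 H1 r M -> half_map e2 e3 k1 k2 k3 H2 r M ->
  exists2 r', 0 < r' & forall z, z != 0 -> ab z < r' -> H1 z = H2 z.
Proof.
move=> r0 h1 h2.
pose L := 1 + (ab k1 + ab k2 + ab k3); have a1 := ab_ge0 k1; have a2 := ab_ge0 k2; have a3 := ab_ge0 k3.
(* Large enough that [ab z < N^-1] puts the values, even after subtracting [e2] or [e3], beyond the
   Lipschitz threshold [L]. *)
pose N := 1 + L + ab e2 + ab e3 + `|M|; have a4 := ab_ge0 e2; have a5 := ab_ge0 e3; have a6 := normr_ge0 M.
have N1 : 1 <= N by rewrite /N /L; lra.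
have N0 : 0 < N by lra.
exists (Num.min r N^-1); first by rewrite lt_min r0 invr_gt0.
have big (H : C -> C) z : half_map e2 e3 k1 k2 k3 H r M -> z != 0 -> ab z < Num.min r N^-1 ->
    [/\ L <= ab (H z), L <= ab (H z - e2) & L <= ab (H z - e3)].
  move=> hH z0; rewrite lt_min => /andP[zr zN]; have [hM _] := hH z z0 zr.
  have zp : 0 < ab z by rewrite ab_gt0.
  have zi : N < (ab z)^-1 by rewrite -[N]invrK ltf_pV2 ?posrE ?invr_gt0.
  have z2 : N <= ab (z ^- 2) by rewrite abV abX -exprVn expr2; nra.
  have hz : N - `|M| <= ab (H z).
    have := abB_ge (z ^- 2) (z ^- 2 - H z); rewrite opprB addrCA subrr addr0 [ab (z ^- 2 - _)]abBC.
    have := ler_norm M; lra.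
  have := abB_ge (H z) e2; have := abB_ge (H z) e3; rewrite /N in hz.
  by split; lra.
have bound n : forall z, z != 0 -> ab z < Num.min r N^-1 -> ab (H1 z - H2 z) <= 2 * M / 2 ^+ n.
  elim: n => [|n IH] z z0 hz.
    rewrite expr0 divr1; move: hz; rewrite lt_min => /andP[zr _].
    have [m1 _] := h1 z z0 zr; have [m2 _] := h2 z z0 zr.
    have := abB (H1 z - z ^- 2) (H2 z - z ^- 2).
    have -> : H1 z - z ^- 2 - (H2 z - z ^- 2) = H1 z - H2 z by ring.
    lra.
  have zz0 : z / 2 != 0 by rewrite mulf_neq0 // invr_eq0 pnatr_eq0.
  have azz : ab (z / 2) < Num.min r N^-1.
    by apply: le_lt_trans hz; rewrite abM abV ab_nat; have := ab_ge0 z; lra.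
  have zr : ab (z / 2) < r by move: azz; rewrite lt_min => /andP[].
  have z2 : 2 * (z / 2) = z by rewrite mulrC divfK // pnatr_eq0.
  have [_ q1] := h1 _ zz0 zr; have [_ q2] := h2 _ zz0 zr; rewrite !z2 in q1 q2.
  have [b1 b2 b3] := big H1 _ h1 zz0 azz; have [c1 c2 c3] := big H2 _ h2 zz0 azz.
  have : ab (4 * H1 z - 4 * H2 z) <= 2 * ab (H1 (z / 2) - H2 (z / 2)).
    by rewrite q1 q2; apply: (Rf_lipschitz (L := L)) => //; rewrite /L; lra.
  have -> : 4 * H1 z - 4 * H2 z = 4 * (H1 z - H2 z) by ring.
  rewrite abM ab_nat; have := IH _ zz0 azz.
  have -> : 2 * M / 2 ^+ n.+1 = 2 * M / 2 ^+ n / 2 by rewrite exprSr invfM mulrA.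
  lra.
move=> z z0 hz; apply/eqP; rewrite -subr_eq0 -ab_eq0 eq_le ab_ge0 andbT leNgt; apply/negP => h.
have [n hn] := half_pow (2 * M) h; have := bound n z z0 hz; lra.
Qed.

Section FixedW.
Variable w : C.
Hypothesis w0 : w != 0.
Hypothesis w1 : ab w < 1.
Local Notation q := (w ^+ 6).
Local Notation e := (divS w).

Definition Fz (z : C) : C := S q (cexp z) - e1 e.

Let q0 := q_neq0 w0.
Let q1 := q_lt1 w1.

(** In the additive variable the principal part at 0 is [z ^- 2], coming from the Lipschitz formula
    after rescaling by [twopii]. *)
Lemma Fz_near : exists r M : R, 0 < r /\ forall z, z != 0 -> ab z < r ->
  ~ inlat q (cexp z) /\ ab (Fz z - z ^- 2) <= M.
Proof.
have [d1 [M1 [d10 H1]]] := Ana_bound (Sreg_Ana q1).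
have [d2 d20 H2] := nlat_near1 q0 q1.
have [M2 M20 H3] := lam_principal R.
have T0 : 0 < ab (twopii R) by rewrite ab_gt0 twopii_neq0.
have [d3 d30 H4] : exists2 d : R, 0 < d & forall z : C, ab z < d -> ab (cexp z - 1) < Num.min d1 d2.
  have m0 : 0 < Num.min d1 d2 by rewrite lt_min d10.
  have /contP/(_ _ m0)[d d0 H] := @cexp_cont R 0; exists d => // z hz.
  by have := H z; rewrite subr0 cexp0; exact.
have T4 : 0 < ab (twopii R) / 4 by rewrite divr_gt0.
exists (Num.min d3 (Num.min (ab (twopii R) / 4) 1)), (M2 / ab (twopii R) ^+ 2 + M1 + ab (e1 e)); split.
  by rewrite !lt_min d30 T4 ltr01.
move=> z z0; rewrite !lt_min => /andP[/H4 zd /andP[z4 zl]].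
move: zd; rewrite lt_min => /andP[/H1 b1 zd2].
have t0 : z / twopii R != 0 by rewrite mulf_neq0 // invr_eq0 twopii_neq0.
have t4 : ab (z / twopii R) <= 1 / 4.
  by rewrite abM abV ler_pdivrMr //; move: z4; move: (ab z) (ab (twopii R)) => x y; lra.
have ez : ee (z / twopii R) = cexp z by rewrite /ee mulrC divfK // twopii_neq0.
have nz1 : cexp z != 1.
  by apply/eqP; rewrite -ez => /ee_eq1[n en]; have := nonint_near0 t0 t4 n; rewrite en eqxx.
split; first exact: H2.
have b2 : ab (lam (cexp z) - z ^- 2) <= M2 / ab (twopii R) ^+ 2.
  have := H3 _ t0 t4; rewrite ez ler_pdivlMr ?exprn_gt0 // -abX -abM; congr (_ <= _); congr ab.
  move: (twopii R) (@twopii_neq0 R) (lam _) => T T0' x; field.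
  by rewrite z0 T0'.
rewrite /Fz SE //.
have -> : lam (cexp z) + Sreg q (cexp z) - e1 e - z ^- 2 = lam (cexp z) - z ^- 2 + Sreg q (cexp z) - e1 e by ring.
have := abB (lam (cexp z) - z ^- 2 + Sreg q (cexp z)) (e1 e); have := abD (lam (cexp z) - z ^- 2) (Sreg q (cexp z)).
lra.
Qed.

Lemma S_shift a b c d (u : C) : ~~ lat6 a b -> lat6 (2 * a) (2 * b) -> ~~ lat6 c d -> ~~ lat6 (a + c) (b + d) ->
  u != 0 -> ~ inlat q u -> ~ inlat q (divpt w a b * u) ->
  (S q u - e a b) * (S q (divpt w a b * u) - e a b) = (e c d - e a b) * (e (a + c) (b + d) - e a b).
Proof.
move=> h1 h2 h3 h4 u0 n1 n2.
have [|k k0 H] := S_two_torsion q0 q1 (pt_neq0 w0 a b) (nlat6P w0 w1 h1).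
  by rewrite ptX; apply/(lat6P w0 w1).
rewrite divSE H // !divSE ptD // H //; [exact: pt_neq0|exact: nlat6P|].
by rewrite -ptD //; exact: nlat6P.
Qed.

Lemma S_half (u : C) : u != 0 -> ~ inlat q (u ^+ 2) ->
  [/\ S q u != e1 e, S q u != e2 e, S q u != e3 e &
    4 * (S q (u ^+ 2) - e1 e) = Rf (e2 e - e1 e) (e3 e - e1 e) (k1 e) (k2 e) (k3 e) (S q u - e1 e)].
Proof.
move=> u0 n2.
have n1 : ~ inlat q u by move=> h; apply: n2; rewrite expr2; exact: (inlatM q0).
have nt a b : lat6 (2 * a) (2 * b) -> ~ inlat q (divpt w a b * u).
  move=> /(lat6P w0 w1) h h'; apply: n2.
  have := inlatM q0 (inlatV h) (inlatM q0 h' h'); rewrite -expr2 exprMn ptX mulKf //.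
  exact: (inlat_neq0 q0 h).
have inj a b : ~~ lat6 a b -> lat6 (2 * a) (2 * b) -> S q u != e a b.
  move=> h1 h2; rewrite divSE; apply: S_two_torsion_inj => //; first exact: pt_neq0.
  - exact: nlat6P.
  - by rewrite ptX; apply/(lat6P w0 w1).
  - exact: nt.
have i1 : S q u != e1 e by exact: (inj 0 3).
have i2 : S q u != e2 e by exact: (inj 3 0).
have i3 : S q u != e3 e by exact: (inj 3 3).
split=> //.
have p2 : (w ^+ 3) ^+ 2 = q by rewrite -exprM.
have m1 : divpt w 0 3 = -1 by rewrite /divpt expr0z mulr1 -exprnP zeta3.
have p3 : divpt w 3 0 = w ^+ 3 by rewrite /divpt expr0z mul1r.
have p33 : divpt w 3 3 = - w ^+ 3 by have := ptD w0 3 0 0 3; rewrite p3 m1 mulrN1 => <-.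
have s1 := @S_shift 0 3 3 0 u isT isT isT isT u0 n1 (nt 0 3 isT).
have s2 := @S_shift 3 0 0 3 u isT isT isT isT u0 n1 (nt 3 0 isT).
have s3 := @S_shift 3 3 3 0 u isT isT isT isT u0 n1 (nt 3 3 isT).
have e60 : e (3 + 3) (3 + 0) = e 0 3 by apply: (ds_period (divS_system w0 w1)).
rewrite e60 in s3.
have := S_dup q0 q1 p2 u0 n2.
rewrite m1 mulN1r in s1; rewrite p3 in s2; rewrite p33 mulNr in s3.
move: s1 s2 s3 i1 i2 i3; rewrite /k1 /k2 /k3 /e1 /e2 /e3 [0 + 3]/= [3 + 0]/=.
move: (S q u) (S q (- u)) (S q (w ^+ 3 * u)) (S q (- (w ^+ 3 * u))) (S q (u ^+ 2)) (e 0 3) (e 3 0) (e 3 3).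
clear; exact: half_alg.
Qed.

(** Such a point has order 2, so up to the lattice it is one of three, decided by the sign of the
    square root and the parity of the exponent. *)
Lemma S_square (u : C) : u != 0 -> ~ inlat q u -> inlat q (u ^+ 2) ->
  [\/ S q u = e1 e, S q u = e2 e | S q u = e3 e].
Proof.
move=> u0 n1 [n en].
have : u ^+ 2 = (w ^ (3 * n)) ^+ 2.
  by rewrite en exprnP exprnP !exprz_exp; congr (w ^ _); ring.
move/eqP; rewrite eqf_sqr => h.
have [b eu] : exists b : bool, u = divpt w (3 * n) (if b then 3 else 0).
  case/orP: h => /eqP ->; [exists false|exists true]; rewrite /divpt ?expr0z ?mul1r //.
  by rewrite -exprnP zeta3 mulN1r.
have per a c a' c' : lat6 (a' - a) (c' - c) -> e a' c' = e a c by exact: (eS_period w0 w1).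
have Se : S q u = e (3 * n) (if b then 3 else 0) by rewrite divSE eu.
have nl : ~~ lat6 (3 * n) (if b then 3 else 0) by apply/negP => /(lat6P w0 w1); rewrite -eu.
rewrite Se; have [n2|n2] := boolP (2 %| n)%Z.
  have b1 : b by apply: contraNT nl => /negPf ->; rewrite /lat6 andbT; move: n2; clear; lia.
  by rewrite b1; constructor 1; apply: per; move: n2; clear; rewrite /lat6; lia.
by case: (b); [constructor 3|constructor 2]; apply: per; move: n2; clear; rewrite /lat6; lia.
Qed.

End FixedW.

Lemma cexp2 (z : C) : cexp (2 * z) = cexp z ^+ 2. Proof. exact: cexpX. Qed.

Section TwoCurves.
Variables (w w' c m : C).
Hypotheses (w0 : w != 0) (w1 : ab w < 1) (w0' : w' != 0) (w1' : ab w' < 1).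
Hypotheses (m0 : m != 0) (cm : c ^+ 2 = m).
Local Notation e := (divS w).
Local Notation f := (divS w').
Local Notation lat z := (inlat (w ^+ 6) (cexp z)).
Local Notation lat' z := (inlat (w' ^+ 6) (cexp z)).
Hypotheses (h2 : e2 f - e1 f = m * (e2 e - e1 e)) (h3 : e3 f - e1 f = m * (e3 e - e1 e)).
Hypotheses (hk1 : k1 f = m ^+ 2 * k1 e) (hk2 : k2 f = m ^+ 2 * k2 e) (hk3 : k3 f = m ^+ 2 * k3 e).

Let c0 : c != 0. Proof. by apply: contraNneq m0 => ce; rewrite -cm ce expr0n. Qed.

Lemma Fz_half (v z : C) : v != 0 -> ab v < 1 -> ~ inlat (v ^+ 6) (cexp (2 * z)) ->
  4 * Fz v (2 * z) = Rf (e2 (divS v) - e1 (divS v)) (e3 (divS v) - e1 (divS v))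
    (k1 (divS v)) (k2 (divS v)) (k3 (divS v)) (Fz v z).
Proof.
by move=> v0 v1; rewrite cexp2 => h; have [_ _ _] := S_half v0 v1 (cexp_neq0 z) h; rewrite -cexp2.
Qed.

Lemma Gz_half z : ~ lat (2 * (c * z)) ->
  4 * (m * Fz w (c * (2 * z))) = Rf (e2 f - e1 f) (e3 f - e1 f) (k1 f) (k2 f) (k3 f) (m * Fz w (c * z)).
Proof.
move=> h; rewrite (Rf_scale_eq (Fz w (c * z)) m0 h2 h3 hk1 hk2 hk3) -(Fz_half w0 w1 h).
have -> : c * (2 * z) = 2 * (c * z) by exact: mulrCA.
exact: mulrCA.
Qed.

(** Poles are compared along with values, since the functions are meaningful only off the
    lattices. *)
Definition agree (z : C) : Prop := (lat' z <-> lat (c * z)) /\ (~ lat' z -> Fz w' z = m * Fz w (c * z)).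

Lemma agree_near0 : exists2 r : R, 0 < r & forall z, ab z < r -> agree z.
Proof.
have [r1 [M1 [r10 H1]]] := Fz_near w0' w1'; have [r2 [M2 [r20 H2]]] := Fz_near w0 w1.
have cp : 0 < ab c by rewrite ab_gt0.
pose r := Num.min (r1 / 2) (r2 / ab c / 2).
have r0 : 0 < r by rewrite lt_min !divr_gt0.
have hr1 z : ab z < r -> ab z < r1 /\ ab (2 * z) < r1.
  rewrite lt_min => /andP[h _]; rewrite abM ab_nat; have := ab_ge0 z; split; lra.
have hr2 z : ab z < r -> ab (c * z) < r2 /\ ab (2 * (c * z)) < r2.
  rewrite lt_min => /andP[_]; rewrite mulrAC ltr_pdivlMr // mulrC => h.
  rewrite !abM ab_nat; have := mulr_ge0 (ab_ge0 c) (ab_ge0 z); split; lra.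
have nz2 (z : C) : z != 0 -> 2 * z != 0 by move=> h; rewrite mulf_neq0 // pnatr_eq0.
pose M := Num.max M1 (ab m * M2).
have hm1 : half_map (e2 f - e1 f) (e3 f - e1 f) (k1 f) (k2 f) (k3 f) (Fz w') r M.
  move=> z z0 /hr1[a b]; have [n1 b1] := H1 z z0 a; have [n2 _] := H1 _ (nz2 _ z0) b.
  by split; [rewrite le_max b1|exact: Fz_half].
have hm2 : half_map (e2 f - e1 f) (e3 f - e1 f) (k1 f) (k2 f) (k3 f) (fun z => m * Fz w (c * z)) r M.
  move=> z z0 /hr2[a b]; have cz0 : c * z != 0 by rewrite mulf_neq0.
  have [n1 b1] := H2 _ cz0 a; have [n2 _] := H2 _ (nz2 _ cz0) b.
  split; last exact: Gz_half.
  have -> : m * Fz w (c * z) - z ^- 2 = m * (Fz w (c * z) - (c * z) ^- 2).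
    exact: scale_pole.
  by rewrite abM le_max ler_wpM2l ?ab_ge0 // orbT.
have [r' r0' H] := local_unique r0 hm1 hm2.
exists (Num.min r r'); first by rewrite lt_min r0.
move=> z; rewrite lt_min => /andP[zr zr']; rewrite /agree; have [->|z0] := eqVneq z 0.
  by rewrite mulr0 cexp0; split=> [|[]]; [split=> _; exact: inlat1|exact: inlat1].
have [n1 _] := H1 z z0 (hr1 z zr).1; have [n2 _] := H2 _ (mulf_neq0 c0 z0) (hr2 z zr).1.
by split=> // _; exact: H.
Qed.

Lemma lat2 (v z : C) : v != 0 -> inlat (v ^+ 6) (cexp z) -> inlat (v ^+ 6) (cexp (2 * z)).
Proof. by move=> v0 h; rewrite cexp2 expr2; apply: inlatM => //; rewrite expf_neq0. Qed.

(** Whether [2 * z] is a lattice point can be read off the value at [z]. This is what lets the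
    agreement of the lattices propagate together with the agreement of the values. *)
Lemma lat2P (v z : C) : v != 0 -> ab v < 1 -> ~ inlat (v ^+ 6) (cexp z) ->
  inlat (v ^+ 6) (cexp (2 * z)) <->
  [\/ Fz v z = 0, Fz v z = e2 (divS v) - e1 (divS v) | Fz v z = e3 (divS v) - e1 (divS v)].
Proof.
move=> v0 v1 n1; rewrite cexp2 /Fz; split=> [h|h].
  have [] := S_square v0 v1 (cexp_neq0 z) n1 h => ->; first by constructor 1; rewrite subrr.
    by constructor 2.
  by constructor 3.
have [//|h'] := pselect (inlat (v ^+ 6) (cexp z ^+ 2)).
have [d1 d2 d3 _] := S_half v0 v1 (cexp_neq0 z) h'; exfalso; case: h.
- by move/eqP; rewrite subr_eq0 (negPf d1).
- by move/(addIr _)/eqP; rewrite (negPf d2).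
- by move/(addIr _)/eqP; rewrite (negPf d3).
Qed.

Lemma or3_scale (k x y a b a' b' : C) : k != 0 -> x = k * y -> a = k * a' -> b = k * b' ->
  [\/ x = 0, x = a | x = b] <-> [\/ y = 0, y = a' | y = b'].
Proof.
move=> k0 -> -> ->; split=> -[h|h|h].
- by constructor 1; apply: (mulfI k0); rewrite mulr0.
- by constructor 2; exact: (mulfI k0 h).
- by constructor 3; exact: (mulfI k0 h).
- by constructor 1; rewrite h mulr0.
- by constructor 2; rewrite h.
- by constructor 3; rewrite h.
Qed.

Lemma agree_double z : agree z -> agree (2 * z).
Proof.
move=> [hl hF]; rewrite /agree [c * (2 * z)]mulrCA.
have [l'|l'] := pselect (lat' z).
  have l := hl.1 l'; split=> [|[]]; last exact: lat2.
  by split=> _; exact: lat2.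
have l : ~ lat (c * z) by move/hl.2.
have e : lat' (2 * z) <-> lat (2 * (c * z)).
  have a1 := lat2P w0' w1' l'; have a2 := lat2P w0 w1 l.
  exact: iff_trans a1 (iff_trans (or3_scale m0 (hF l') h2 h3) (iff_sym a2)).
split=> // n2; have n2' : ~ lat (2 * (c * z)) by move/e.2.
apply: (mulfI (_ : 4 != 0 :> C)); first by rewrite pnatr_eq0.
have := Gz_half n2'; rewrite [c * (2 * z)]mulrCA => ->.
by rewrite Fz_half // hF.
Qed.

(** Every [z] is a power of 2 times a small number, so doubling spreads the agreement from a
    neighbourhood of 0. *)
Lemma agree_all z : agree z.
Proof.
have [r r0 H] := agree_near0; have [n hn] := half_pow (ab z) r0.
have : agree (z / 2 ^+ n) by apply: H; rewrite abM abV abX ab_nat.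
elim: n z {hn} => [|n IH] z; first by rewrite expr0 divr1.
have -> : z / 2 ^+ n.+1 = z / 2 / 2 ^+ n by rewrite exprS invfM mulrA.
by move=> /IH/agree_double; rewrite mulrC divfK // pnatr_eq0.
Qed.

End TwoCurves.

Lemma inlat_cexp (tau z : C) : inlat (ww tau ^+ 6) (cexp z) <->
  exists m n : int, z = twopii R * (m%:~R * tau + n%:~R).
Proof.
rewrite -ee_tau /ee; split=> [[m]|[m [n ->]]].
  rewrite -cexpXz => /cexp_inj[n ->]; exists m, n; ring.
exists m; rewrite -cexpXz.
have -> : twopii R * (m%:~R * tau + n%:~R) = m%:~R * (twopii R * tau) + n%:~R * twopii R by ring.
by rewrite cexp_period.
Qed.

Lemma int_indep (tau : C) (m n : int) : 0 < complex.Im tau -> m%:~R * tau + n%:~R = 0 -> m = 0 /\ n = 0.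
Proof.
move=> y0 h; have := congr1 (@complex.Im R) h; rewrite !intC ImD ImRM /= addr0 => /eqP.
rewrite mulf_eq0 (gt_eqF y0) orbF intr_eq0 => /eqP m0; split=> //.
by move: h; rewrite m0 mul0r add0r => /eqP; rewrite intr_eq0 => /eqP.
Qed.

Lemma Im_frac (a b c d : int) (tau tau' : C) :
  (c%:~R * tau + d%:~R) * tau' = a%:~R * tau + b%:~R ->
  complex.Im tau' * ab (c%:~R * tau + d%:~R) ^+ 2 = (a * d - b * c)%:~R * complex.Im tau.
Proof.
rewrite ab_sqr !intC rmorphB !rmorphM /=.
move: (a%:~R : R) (b%:~R : R) (c%:~R : R) (d%:~R : R) => {}a {}b {}c {}d.
case: tau' => x y; case: tau => s t /= /eqP; rewrite eq_complex /= => /andP[/eqP e1 /eqP e2].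
move: e1 e2; rewrite !mul0r !subr0 !addr0 => e1 e2.
have -> : y * ((c * s + d) ^+ 2 + (c * t) ^+ 2) =
  (c * s + d) * ((c * s + d) * y + c * t * x) - c * t * ((c * s + d) * x - c * t * y) by ring.
by rewrite e1 e2; ring.
Qed.

Definition mk2 (a b c d : int) : 'M[int]_2 :=
  \matrix_(i, j) if i == 0 then (if j == 0 then a else b) else (if j == 0 then c else d).

Lemma mk2E a b c d : [/\ mk2 a b c d 0 0 = a, mk2 a b c d 0 1 = b, mk2 a b c d 1 0 = c & mk2 a b c d 1 1 = d].
Proof. by rewrite !mxE. Qed.

Lemma det_mk2 a b c d : \det (mk2 a b c d) = a * d - b * c.
Proof. by rewrite det2; have [-> -> -> ->] := mk2E a b c d. Qed.

(** Points of order 2 fix the matrix modulo 2. Modulo 3 the vectors (0,1), (1,0), (1,1), up to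
    scaling, are each preserved up to sign, which forces plus or minus the identity. *)
Lemma Gamma6_of_torsion a b c d :
  lat6 (0 + (0 * a + 3 * c)) (3 + (0 * b + 3 * d)) -> lat6 (3 + (3 * a + 0 * c)) (0 + (3 * b + 0 * d)) ->
  lat6 (0 + (0 * a + 4 * c)) (4 + (0 * b + 4 * d)) || lat6 (- 0 + (0 * a + 4 * c)) (- 4 + (0 * b + 4 * d)) ->
  lat6 (2 + (2 * a + 0 * c)) (0 + (2 * b + 0 * d)) || lat6 (- 2 + (2 * a + 0 * c)) (- 0 + (2 * b + 0 * d)) ->
  lat6 (2 + (2 * a + 2 * c)) (2 + (2 * b + 2 * d)) || lat6 (- 2 + (2 * a + 2 * c)) (- 2 + (2 * b + 2 * d)) ->
  [/\ (6 %| a - 1)%Z, (6 %| b)%Z, (6 %| c)%Z & (6 %| d - 1)%Z] \/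
  [/\ (6 %| a + 1)%Z, (6 %| b)%Z, (6 %| c)%Z & (6 %| d + 1)%Z].
Proof.
rewrite /lat6 => h1 h2 h3 h4 h5.
have : ((6 %| a - 1)%Z && (6 %| d - 1)%Z || (6 %| a + 1)%Z && (6 %| d + 1)%Z) && (6 %| b)%Z && (6 %| c)%Z by lia.
by case/andP => /andP[/orP[/andP[? ?]|/andP[? ?]] ? ?]; [left|right].
Qed.

Lemma torsion_Gamma6 (F : numFieldType) (e f : int -> int -> F) (m : F) (a b c d : int) : m != 0 ->
  division_system e -> a * d - b * c = 1 ->
  (forall al be, ~~ lat6 al be -> f al be - e1 f = m * (act (mk2 a b c d) e al be - e1 e)) ->
  e2 f - e1 f = m * (e2 e - e1 e) -> f 0 4 - e1 f = m * (e 0 4 - e1 e) ->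
  f 2 0 - e1 f = m * (e 2 0 - e1 e) -> f 2 2 - e1 f = m * (e 2 2 - e1 e) ->
  [/\ (6 %| a - 1)%Z, (6 %| b)%Z, (6 %| c)%Z & (6 %| d - 1)%Z] \/
  [/\ (6 %| a + 1)%Z, (6 %| b)%Z, (6 %| c)%Z & (6 %| d + 1)%Z].
Proof.
move=> m0 De dt tors h30 h04 h20 h22; have [g00 g01 g10 g11] := mk2E a b c d.
have dg : \det (mk2 a b c d) = 1 by rewrite det_mk2.
have actE al be : act (mk2 a b c d) e al be = e (al * a + be * c) (al * b + be * d).
  by rewrite /act g00 g01 g10 g11.
have same al be : ~~ lat6 al be -> f al be - e1 f = m * (e al be - e1 e) ->
    act (mk2 a b c d) e al be = e al be.
  by move=> nl h; have := tors _ _ nl; rewrite h => /(mulfI m0)/(addIr _).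
have nla al be : ~~ lat6 al be -> ~~ lat6 (al * a + be * c) (al * b + be * d).
  by move=> nl; have := @lat6_act _ al be dg; rewrite g00 g01 g10 g11 => ->.
have i2 t1 t2 : ~~ lat6 t1 t2 -> lat6 (2 * t1) (2 * t2) -> f t1 t2 - e1 f = m * (e t1 t2 - e1 e) ->
    lat6 (t1 + (t1 * a + t2 * c)) (t2 + (t1 * b + t2 * d)).
  move=> nl l2 h; apply: contraT => n2; have := ds_inj2 De nl l2 (nla _ _ nl) n2.
  by rewrite -actE same // eqxx.
have i3 t1 t2 : ~~ lat6 t1 t2 -> lat6 (3 * t1) (3 * t2) -> f t1 t2 - e1 f = m * (e t1 t2 - e1 e) ->
    lat6 (t1 + (t1 * a + t2 * c)) (t2 + (t1 * b + t2 * d)) ||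
    lat6 (- t1 + (t1 * a + t2 * c)) (- t2 + (t1 * b + t2 * d)).
  move=> nl l2 h; apply: contraT; rewrite negb_or => /andP[n2 n3].
  by have := ds_inj3 De nl l2 (nla _ _ nl) n2 n3; rewrite -actE same // eqxx.
have h03 : f 0 3 - e1 f = m * (e 0 3 - e1 e) by rewrite /e1 !subrr mulr0.
have q1 := i2 0 3 isT isT h03; have q2 := i2 3 0 isT isT h30.
have q3 := i3 0 4 isT isT h04; have q4 := i3 2 0 isT isT h20; have q5 := i3 2 2 isT isT h22.
exact: Gamma6_of_torsion q1 q2 q3 q4 q5.
Qed.

(** The matrix and its negative act alike on the upper half-plane, so one of the two may be chosen
    in the group. *)
Lemma Gamma6_pm (a b c d : int) (tau : C) : a * d - b * c = 1 ->
  [/\ (6 %| a - 1)%Z, (6 %| b)%Z, (6 %| c)%Z & (6 %| d - 1)%Z] \/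
  [/\ (6 %| a + 1)%Z, (6 %| b)%Z, (6 %| c)%Z & (6 %| d + 1)%Z] ->
  exists2 g, Gamma 6 g & mobius (mk2 a b c d) tau = mobius g tau.
Proof.
have [g00 g01 g10 g11] := mk2E a b c d.
move=> dt [[h1 h2 h3 h4]|[h1 h2 h3 h4]].
  exists (mk2 a b c d) => //; split; first by rewrite /SL2Z /= det_mk2.
  by rewrite g00 g01 g10 g11.
have [k00 k01 k10 k11] := mk2E (- a) (- b) (- c) (- d).
exists (mk2 (- a) (- b) (- c) (- d)).
  split; first by rewrite /SL2Z /= det_mk2 !mulrNN.
  by rewrite k00 k01 k10 k11 -!opprD !rpredN.
by rewrite /mobius /autj k00 k01 k10 k11 g00 g01 g10 g11 !rmorphN /= !mulNr -!opprD invrN mulrNN.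
Qed.

Lemma cexp_dpt (t : C) x y : cexp (twopii R * dpt t x y) = divpt (ww t) x y.
Proof. exact: ee_dpt. Qed.

Lemma Fz_dpt (t : C) x y : Fz (ww t) (twopii R * dpt t x y) = divS (ww t) x y - e1 (divS (ww t)).
Proof. by rewrite /Fz cexp_dpt -divSE. Qed.

Lemma dpt_nlat (t : C) x y : upper_half t -> ~~ lat6 x y -> ~ inlat (ww t ^+ 6) (cexp (twopii R * dpt t x y)).
Proof. by move=> y0 nl; rewrite cexp_dpt; exact: (nlat6P (ww_neq0 t) (ww_lt1 y0) nl). Qed.

Lemma dpt_scale (t t' c : C) (a b cc d x y : int) : c * t' = a%:~R * t + b%:~R -> c = cc%:~R * t + d%:~R ->
  c * (twopii R * dpt t' x y) = twopii R * dpt t (x * a + y * cc) (x * b + y * d).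
Proof.
move=> hab hcd; rewrite /dpt !rmorphD !rmorphM /=.
have -> : c * (twopii R * ((x%:~R * t' + y%:~R) / 6)) = twopii R * ((x%:~R * (c * t') + y%:~R * c) / 6) by ring.
by rewrite hab hcd; ring.
Qed.

Lemma int_unit_pos (x y : int) : 0 < x -> x * y = 1 -> x = 1.
Proof.
move=> x0 /(congr1 absz); rewrite abszM => /eqP; rewrite muln_eq1 => /andP[/eqP h _].
by rewrite -[LHS]gez0_abs ?h // ltW.
Qed.

Theorem XY_injective (tau tau' : C) : upper_half tau -> upper_half tau' ->
  Xfun tau = Xfun tau' -> Yfun tau = Yfun tau' -> exists2 g, Gamma 6 g & tau' = mobius g tau.
Proof.
move=> y0 y0'; have E t : upper_half t -> Xfun t = Xw (divS (ww t)) (omega R) /\ Yfun t = Yw (divS (ww t)).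
  by move=> yt; have := XYfun_mobius SL2Z1 yt; rewrite mobius1 actE1.
have [-> ->] := E _ y0; have [-> ->] := E _ y0' => hX hY {E}.
have w0 := ww_neq0 tau; have w1 := ww_lt1 y0; have w0' := ww_neq0 tau'; have w1' := ww_lt1 y0'.
have De := divS_system w0 w1; have Df := divS_system w0' w1'.
have [m [m0 [h2 h3 hk1 hk2 hk3] [t04 t20 t22]]] :=
  scale_data (omega_sum R) De Df (right_branch w0 w1) (right_branch w0' w1') (esym hX) (esym hY).
have [c cm] : exists c : C, c ^+ 2 = m by exists (sqrtC m); exact: sqrtCK.
have AG := agree_all w0 w1 w0' w1' m0 cm h2 h3 hk1 hk2 hk3.
have c0 : c != 0 by apply: contraNneq m0 => ce; rewrite -cm ce expr0n.
have cp : 0 < ab c by rewrite ab_gt0.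
have T0 := @twopii_neq0 R.
have lat_fwd (k l : int) : exists a b : int, c * (k%:~R * tau' + l%:~R) = a%:~R * tau + b%:~R.
  have [[h _] _] := AG (twopii R * (k%:~R * tau' + l%:~R)).
  have /h/inlat_cexp[a [b]] : inlat (ww tau' ^+ 6) (cexp (twopii R * (k%:~R * tau' + l%:~R))).
    by apply/inlat_cexp; exists k, l.
  by rewrite mulrCA => /(mulfI T0) e; exists a, b.
have lat_bwd (k l : int) : exists a b : int, k%:~R * tau + l%:~R = c * (a%:~R * tau' + b%:~R).
  have [[_ h] _] := AG (twopii R * ((k%:~R * tau + l%:~R) / c)).
  have cz : c * (twopii R * ((k%:~R * tau + l%:~R) / c)) = twopii R * (k%:~R * tau + l%:~R).
    by rewrite mulrCA [c * (_ / c)]mulrC divfK.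
  rewrite cz in h; have /h/inlat_cexp[a [b]] : inlat (ww tau ^+ 6) (cexp (twopii R * (k%:~R * tau + l%:~R))).
    by apply/inlat_cexp; exists k, l.
  by move/(mulfI T0) => e; exists a, b; rewrite -e [c * _]mulrC divfK.
have [a [b hab]] := lat_fwd 1 0; have [cc [d hcd]] := lat_fwd 0 1.
have [a' [b' hab']] := lat_bwd 1 0; have [c' [d' hcd']] := lat_bwd 0 1.
move: hab hcd hab' hcd'; rewrite !rmorph1 !rmorph0 !mul1r !mul0r !addr0 !add0r mulr1 => hab hcd hab' hcd'.
(* Multiplication by [c] maps one lattice onto the other; writing both inclusions in bases gives two
   integer matrices with product the identity. *)
have dd : (a * d - b * cc) * (a' * d' - b' * c') = 1.
  have lin (x y : int) : c * (x%:~R * tau' + y%:~R) = (x * a + y * cc)%:~R * tau + (x * b + y * d)%:~R.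
    have -> : c * (x%:~R * tau' + y%:~R) = x%:~R * (c * tau') + y%:~R * c by ring.
    by rewrite hab hcd !rmorphD !rmorphM /=; ring.
  have e1 := hab'; rewrite lin in e1; have e2 := hcd'; rewrite lin in e2.
  have [p1 p2] : a' * a + b' * cc - 1 = 0 /\ a' * b + b' * d = 0.
    apply: (int_indep y0); rewrite rmorphB rmorph1 /= mulrBl mul1r addrAC -e1 subrr //.
  have [p3 p4] : c' * a + d' * cc = 0 /\ c' * b + d' * d - 1 = 0.
    apply: (int_indep y0); rewrite rmorphB rmorph1 /= addrA -e2 subrr //.
  have -> : (a * d - b * cc) * (a' * d' - b' * c') =
    (a' * a + b' * cc) * (c' * b + d' * d) - (a' * b + b' * d) * (c' * a + d' * cc) by ring.
  by rewrite (subr0_eq p1) (subr0_eq p4) p2 mul0r subr0 mulr1.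
have j0 : cc%:~R * tau + d%:~R != 0 by rewrite -hcd.
have Im := @Im_frac a b cc d tau tau'; rewrite -hcd -hab in Im; have {}Im := Im (erefl _).
(* Both points have positive imaginary part, so the determinant, already invertible in the integers,
   is 1. *)
have dpos : 0 < a * d - b * cc.
  have : 0 < complex.Im tau' * ab c ^+ 2 by exact: (mulr_gt0 y0' (exprn_gt0 2 cp)).
  rewrite Im (pmulr_lgt0 _ (y0 : 0 < complex.Im tau)) ltr0z; exact.
have det1' : a * d - b * cc = 1 by exact: int_unit_pos dpos dd.
pose g := mk2 a b cc d; have [g00 g01 g10 g11] := mk2E a b cc d.
have dg : SL2Z g by rewrite /SL2Z /= det_mk2.
have tE : tau' = mobius g tau.
  by rewrite /mobius /autj g00 g01 g10 g11 -hab -hcd mulrC mulKf.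
have actE al be : act g (divS (ww tau)) al be = divS (ww tau) (al * a + be * cc) (al * b + be * d).
  by rewrite /act g00 g01 g10 g11.
have tors al be : ~~ lat6 al be ->
    divS (ww tau') al be - e1 (divS (ww tau')) = m * (act g (divS (ww tau)) al be - e1 (divS (ww tau))).
  move=> nl; have [_ h] := AG (twopii R * dpt tau' al be).
  have := h (dpt_nlat y0' nl); rewrite (dpt_scale al be hab hcd) !Fz_dpt actE; exact.
have [k Gk ek] := Gamma6_pm tau det1' (torsion_Gamma6 m0 De det1' tors h2 t04 t20 t22).
by exists k; [exact: Gk|rewrite tE; exact: ek].
Qed.

End LocalUniqueness.

Local Open Scope quotient_scope.

(** * Cusp discs on the modular curve and their separation *)

Section ModularCurvePoints.
Variable R : realType.
Local Notation C := R[i].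
Local Notation msph := (@mobius_sphere R).
Implicit Types (g h : 'M[int]_2) (tau w : C).

Lemma SL2ZM g h : SL2Z g -> SL2Z h -> SL2Z (g *m h).
Proof. by rewrite /SL2Z /= det_mulmx => -> ->. Qed.

Lemma SL2Z_adj g : SL2Z g -> SL2Z (\adj g) /\ (\adj g *m g = 1%:M /\ g *m \adj g = 1%:M).
Proof.
move=> dg; have e1 : \adj g *m g = 1%:M by rewrite mul_adj_mx dg.
have e2 : g *m \adj g = 1%:M by rewrite mul_mx_adj dg.
by split=> //; have := congr1 determinant e1; rewrite det_mulmx dg mulr1 det1.
Qed.

Lemma Gamma6P g : SL2Z g -> Gamma 6 g <-> exists N : 'M[int]_2, g = 1%:M + 6 *: N.
Proof.
move=> dg; split=> [[_ [/dvdzP[a ha] /dvdzP[b hb] /dvdzP[c hc] /dvdzP[d hd]]]|[N e]].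
  exists (mk2 a b c d); have [k00 k01 k10 k11] := mk2E a b c d.
  apply/matrixP => i j; rewrite !mxE.
  have [i0|i1] : i = 0 \/ i = 1 by case: i => [[|[|//]] hi]; [left|right]; apply/val_inj.
    have [j0|j1] : j = 0 \/ j = 1 by case: j => [[|[|//]] hj]; [left|right]; apply/val_inj.
      by rewrite i0 j0 /= mulrC -ha addrC subrK.
    by rewrite i0 j1 /= mulrC -hb add0r.
  have [j0|j1] : j = 0 \/ j = 1 by case: j => [[|[|//]] hj]; [left|right]; apply/val_inj.
    by rewrite i1 j0 /= mulrC -hc add0r.
  by rewrite i1 j1 /= mulrC -hd addrC subrK.
split=> //; rewrite e !mxE /= !add0r ![1 + _ - 1]addrAC !subrr !add0r.
by rewrite !dvdz_mulr.
Qed.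

Lemma Gamma_SL2Z N g : Gamma N g -> SL2Z g. Proof. by case. Qed.

Lemma Gamma6_conj g h : SL2Z g -> Gamma 6 h -> Gamma 6 (g *m h *m \adj g) /\ Gamma 6 (\adj g *m h *m g).
Proof.
move=> dg Gh; have dh := Gamma_SL2Z Gh; have /(Gamma6P dh)[N eh] := Gh.
have [da [e1 e2]] := SL2Z_adj dg; split; apply/Gamma6P; try by rewrite !SL2ZM.
- exact: SL2ZM (SL2ZM dg dh) da.
- by exists (g *m N *m \adj g); rewrite eh mulmxDr mulmxDl mulmx1 e2 -scalemxAr -scalemxAl.
- exact: SL2ZM (SL2ZM da dh) dg.
- by exists (\adj g *m N *m g); rewrite eh mulmxDr mulmxDl mulmx1 e1 -scalemxAr -scalemxAl.
Qed.

Lemma mobius_adj g tau : SL2Z g -> upper_half tau ->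
  mobius (\adj g) (mobius g tau) = tau /\ mobius g (mobius (\adj g) tau) = tau.
Proof.
move=> dg y0; have [da [e1 e2]] := SL2Z_adj dg.
by rewrite -!mobiusM // e1 e2 mobius1.
Qed.

Lemma msph_H g tau : SL2Z g -> upper_half tau -> msph g (Some tau) = Some (mobius g tau).
Proof. by move=> dg y0; rewrite /= (negPf (autj_neq0 dg y0)). Qed.

Lemma upper_mobius g tau : SL2Z g -> upper_half tau -> upper_half (mobius g tau).
Proof. by move=> dg y0; exact: Im_mobius_gt0. Qed.

Lemma SL2Z_upper g : SL2Z g -> g 1 0 = 0 ->
  (g 0 0 = 1 /\ g 1 1 = 1) \/ (g 0 0 = -1 /\ g 1 1 = -1).
Proof.
rewrite /SL2Z /= det2 => dg c0; rewrite c0 mulr0 subr0 in dg.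
have := congr1 absz dg; rewrite abszM => /eqP; rewrite muln_eq1 => /andP[/eqP h1 /eqP h2].
move: dg h1 h2; move: (g 0 0) (g 1 1) => x y; clear; lia.
Qed.

Lemma mobius_upper g tau : SL2Z g -> g 1 0 = 0 -> exists2 k : int,
  mobius g tau = tau + k%:~R & (Gamma 6 g -> (6 %| k)%Z).
Proof.
move=> dg c0; rewrite /mobius /autj c0 mul0r add0r.
have [[-> ->]|[e00 ->]] := SL2Z_upper dg c0.
  by exists (g 0 1); [rewrite mul1r divr1|case=> _ []].
exists (- g 0 1); first by rewrite e00 rmorphN1 rmorphN /= invrN1 mulrN1 mulN1r opprD opprK.
by case=> _ [+ + _ _]; rewrite e00.
Qed.

Lemma translate_Re tau : exists2 g, SL2Z g & exists2 n : int,
  (forall z : C, mobius g z = z - n%:~R) & `|complex.Re (tau - n%:~R)| <= 1 / 2.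
Proof.
have [n hn] := round_Re tau; exists (mk2 1 (- n) 0 1); first by rewrite /SL2Z /= det_mk2 mulr1 mulr0 subr0.
have [k00 k01 k10 k11] := mk2E 1 (- n) 0 1; exists n => // z.
by rewrite /mobius /autj k00 k01 k10 k11 mul1r mul0r add0r divr1 rmorphN.
Qed.

(** After a translation the real part is at most 1/2 in absolute value, so if the imaginary part is
    below 1/2 as well, inversion at least doubles the latter. The resulting bound 1/2 is the origin
    of the smaller discs that cover the curve. *)
Lemma descent tau : upper_half tau -> exists2 g, SL2Z g & 1 / 2 <= complex.Im (mobius g tau).
Proof.
move=> y0.
have key n : forall t : C, upper_half t -> 1 / 2 <= complex.Im t * 2 ^+ n ->
    exists2 g, SL2Z g & 1 / 2 <= complex.Im (mobius g t).
  elim: n => [|n IH] t yt ht.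
    by exists 1%:M; [exact: SL2Z1|rewrite mobius1; rewrite expr0 mulr1 in ht].
  have [h|h] := lerP (1 / 2) (complex.Im t).
    by exists 1%:M; [exact: SL2Z1|rewrite mobius1].
  have [g dg [m gE hm]] := translate_Re t.
  have Imt : complex.Im (t - m%:~R) = complex.Im t by rewrite intC ImD ImN ImC oppr0 addr0.
  pose s := mk2 0 (-1) 1 0; have [k00 k01 k10 k11] := mk2E 0 (-1) 1 0.
  have ds : SL2Z s by rewrite /SL2Z /= det_mk2 mulr0 mulN1r sub0r opprK.
  have yt' : upper_half (t - m%:~R) by rewrite /upper_half /= Imt.
  have js : autj s (t - m%:~R) = t - m%:~R by rewrite /autj k10 k11 mul1r addr0.
  have sq : ab (t - m%:~R) ^+ 2 <= 1 / 2.
    rewrite ab_sqr Imt; have yt0 : 0 < complex.Im t by [].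
    move: hm; rewrite ler_norml !expr2 => /andP[a1 a2]; nra.
  have ab0 : 0 < ab (t - m%:~R) ^+ 2.
    by rewrite exprn_gt0 // ab_gt0; apply: contraTneq yt' => ->; rewrite /upper_half /= ltxx.
  have yt0 : 0 < complex.Im t by [].
  have dbl : complex.Im t * 2 <= complex.Im (mobius s (t - m%:~R)).
    rewrite Im_mobius // js Imt ler_pdivlMr // -mulrA; nra.
  have [||k dk hk] := IH (mobius s (t - m%:~R)); first exact: upper_mobius.
    rewrite exprS mulrA in ht; apply: le_trans ht _.
    by rewrite ler_wpM2r // exprn_ge0.
  exists (k *m (s *m g)); first exact: SL2ZM dk (SL2ZM ds dg).
  rewrite mobiusM //; last exact: SL2ZM.
  by rewrite mobiusM // gE.
have [n hn] := half_pow 1 (y0 : 0 < complex.Im tau).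
apply: (key n) => //; rewrite ltr_pdivrMr ?exprn_gt0 // in hn; lra.
Qed.

Lemma cusp_in g : Hstar_set (msph g None).
Proof.
rewrite /=; case: eqP => // c0; right.
exists ((g 0 0)%:~R / (g 1 0)%:~R); have e : ratr ((g 0 0)%:~R / (g 1 0)%:~R) = (g 0 0)%:~R / (g 1 0)%:~R :> R by rewrite (fmorph_div (@ratr R)); congr (_ / _); exact: ratr_int.
by rewrite e !intC fmorph_div.
Qed.

(** A total map into the subtype; outside of it the value is the cusp at infinity by default. *)
Definition Hpt (s : option C) : Hstar R :=
  if (insub s : option (Hstar R)) is Some t then t else infty R.

Lemma val_Hpt s : Hstar_set s -> val (Hpt s) = s.
Proof. by move=> h; rewrite /Hpt insubT //; exact/mem_set. Qed.

Lemma val_HptH tau : upper_half tau -> val (Hpt (Some tau)) = Some tau.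
Proof. by move=> y0; apply: val_Hpt; left. Qed.

Lemma val_Hptg g tau : SL2Z g -> upper_half tau -> val (Hpt (Some (mobius g tau))) = Some (mobius g tau).
Proof. by move=> dg y0; apply: val_HptH; exact: upper_mobius. Qed.

Lemma Hpt_val (s : Hstar R) : Hpt (val s) = s.
Proof. by apply/val_inj/val_Hpt; exact: set_mem (valP s). Qed.

Lemma proj6_eq (s t : Hstar R) : proj6 s = proj6 t <-> exists2 g, Gamma 6 g & msph g (val s) = val t.
Proof.
split=> [/eqmodP/asboolP //|h].
by apply/eqmodP/asboolP.
Qed.

Lemma proj6_surj (p : X6 R) : exists s, p = proj6 s.
Proof. by exists (repr (p : quotient_topology {eq_quot (Gamma_equiv R 6)})); rewrite /proj6 /proj_X reprK. Qed.

Definition tauof (w : C) : C := xget 0 [set tau | upper_half tau /\ ww tau = w].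

Lemma tauofP w : w != 0 -> ab w < 1 -> upper_half (tauof w) /\ ww (tauof w) = w.
Proof.
move=> w0 w1; have [tau y0 e] := ww_surj w0 w1.
by rewrite /tauof; case: xgetP => [t -> //|/(_ tau)]; case.
Qed.

(* [w] is the coordinate [exp(2 pi i tau / 6)], and [w = 0] the cusp [g(oo)]. *)
Definition P g (w : C) : X6 R :=
  proj6 (Hpt (if w == 0 then msph g None else Some (mobius g (tauof w)))).

Lemma P0 g : P g 0 = proj6 (Hpt (msph g None)). Proof. by rewrite /P eqxx. Qed.

Lemma ww_eq tau tau' : ww tau = ww tau' -> exists k : int, tau' = tau + (6 * k)%:~R.
Proof.
move=> /cexp_inj[k h]; exists (- k); apply: (mulfI (@twopii_neq0 R)).
apply: (@mulIf _ (6^-1)); first by rewrite invr_eq0 pnatr_eq0.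
move: h; rewrite rmorphM rmorphN /= => h.
have -> : twopii R * (tau + 6 * - k%:~R) / 6 = twopii R * tau / 6 - k%:~R * twopii R.
  by move: (twopii R) => T; field.
by rewrite h addrK.
Qed.

Lemma ww_translate tau (k : int) : ww (tau + (6 * k)%:~R) = ww tau.
Proof.
rewrite /ww -[RHS](cexp_period _ k); congr cexp; rewrite rmorphM /=.
by move: (twopii R) => T; field.
Qed.

Lemma translate6 g (k : int) : SL2Z g -> exists2 h, Gamma 6 h & forall tau, upper_half tau ->
  mobius h (mobius g tau) = mobius g (tau + (6 * k)%:~R).
Proof.
move=> dg; pose t := mk2 1 (6 * k) 0 1; have [k00 k01 k10 k11] := mk2E 1 (6 * k) 0 1.
have dt : SL2Z t by rewrite /SL2Z /= det_mk2 mulr1 mulr0 subr0.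
have Gt : Gamma 6 t by split=> //; rewrite k00 k01 k10 k11 !subrr dvdz0 dvdz_mulr.
have [G1 _] := Gamma6_conj dg Gt; have [da [e1 e2]] := SL2Z_adj dg.
exists (g *m t *m \adj g) => // tau y0.
rewrite -mobiusM //; last exact: Gamma_SL2Z G1.
rewrite -!mulmxA e1 mulmx1 mobiusM //; congr mobius.
by rewrite /mobius /autj k00 k01 k10 k11 mul1r mul0r add0r divr1.
Qed.

(** Two choices of [tau] for the same [w] differ by a multiple of 6, and the conjugate by [g] of
    that translation lies in the normal subgroup [Gamma 6]. *)
Lemma P_ww g tau : SL2Z g -> upper_half tau -> P g (ww tau) = proj6 (Hpt (Some (mobius g tau))).
Proof.
move=> dg y0; have w0 := ww_neq0 tau; have w1 := ww_lt1 y0.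
have [yt et] := tauofP w0 w1; rewrite /P (negPf w0); apply/proj6_eq.
rewrite !val_Hptg //; have [k ek] := ww_eq et; have [h Gh hE] := translate6 k dg.
by exists h => //; rewrite msph_H ?hE -?ek //; [exact: Gamma_SL2Z Gh|exact: upper_mobius].
Qed.

Lemma P_eq g h tau tau' : SL2Z g -> SL2Z h -> upper_half tau -> upper_half tau' ->
  P g (ww tau) = P h (ww tau') <-> exists2 k, Gamma 6 k & mobius k (mobius g tau) = mobius h tau'.
Proof.
move=> dg dh y0 y0'; rewrite !P_ww //; split=> [/proj6_eq[k Gk]|[k Gk e]].
  rewrite !val_Hptg // msph_H; [|exact: Gamma_SL2Z Gk|exact: upper_mobius].
  by move=> [e]; exists k.
apply/proj6_eq; exists k => //; rewrite !val_Hptg // msph_H ?e //; [exact: Gamma_SL2Z Gk|exact: upper_mobius].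
Qed.

Lemma msph_None_H g tau : upper_half tau -> msph g None <> Some tau.
Proof.
move=> y0 /=; case: eqP => // _ [e]; move: y0; rewrite -e /upper_half /= !intC -fmorph_div ImC ltxx.
by [].
Qed.

Lemma P0_neq g h tau : SL2Z g -> SL2Z h -> upper_half tau -> P g 0 <> P h (ww tau).
Proof.
move=> dg dh y0; rewrite P0 P_ww // => /proj6_eq[k Gk].
rewrite val_Hptg // val_Hpt; last exact: cusp_in.
rewrite -mobius_sphereM //; last exact: Gamma_SL2Z Gk.
by apply: msph_None_H; exact: upper_mobius.
Qed.

Lemma stab_infty g : SL2Z g -> msph g None = None -> g 1 0 = 0.
Proof. by move=> dg /=; case: eqP. Qed.

Lemma P0_eq g h : SL2Z g -> SL2Z h -> P g 0 = P h 0 <->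
  exists2 k, Gamma 6 k & (\adj h *m (k *m g)) 1 0 = 0.
Proof.
move=> dg dh; have [da [e1 e2]] := SL2Z_adj dh.
rewrite !P0; split=> [/proj6_eq[k Gk]|[k Gk h0]].
  rewrite !val_Hpt; try exact: cusp_in.
  have dk := Gamma_SL2Z Gk; rewrite -mobius_sphereM // => e; exists k => //.
  have dkg := SL2ZM dk dg.
  apply: stab_infty; first exact: SL2ZM.
  by rewrite mobius_sphereM // e -mobius_sphereM // e1 mobius_sphere1.
have dk := Gamma_SL2Z Gk; have dkg := SL2ZM dk dg.
apply/proj6_eq; exists k => //; rewrite !val_Hpt; try exact: cusp_in.
have : msph (\adj h *m (k *m g)) None = None by rewrite /= h0 eqxx.
rewrite mobius_sphereM // => /(congr1 (msph h)).
by rewrite -mobius_sphereM // e2 mobius_sphere1 ; rewrite -[in X in _ -> X]mobius_sphereM.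
Qed.

(** The automorphy factor is at least [N * complex.Im tau] in absolute value, and its square divides
    the imaginary part. *)
Lemma Im_bound g tau (N : nat) : SL2Z g -> upper_half tau -> (N <= `|(g 1 0)%R|)%N ->
  complex.Im tau * complex.Im (mobius g tau) * N%:R ^+ 2 <= 1.
Proof.
move=> dg y0 hN; rewrite Im_mobius //; have y : 0 < complex.Im tau by [].
have j0 : 0 < ab (autj g tau) ^+ 2 by rewrite exprn_gt0 // ab_gt0 autj_neq0.
have h : N%:R * complex.Im tau <= ab (autj g tau).
  apply: le_trans (ab_Im _); rewrite /autj !intC ImD ImRM ImC addr0 normrM (gtr0_norm y).
  apply: ler_wpM2r; [exact: ltW|rewrite -intr_norm].
  have -> : N%:R = N%:Z%:~R :> R by [].
  by rewrite ler_int; lia.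
have -> : complex.Im tau * (complex.Im tau / ab (autj g tau) ^+ 2) * N%:R ^+ 2 =
   (N%:R * complex.Im tau) ^+ 2 / ab (autj g tau) ^+ 2.
  by rewrite exprMn [complex.Im tau * (_ / _)]mulrA mulrAC -expr2 [N%:R ^+ 2 * _]mulrC.
rewrite ler_pdivrMr // mul1r; apply: lerXn2r; rewrite ?nnegrE ?ab_ge0 //.
by rewrite mulr_ge0 // ltW.
Qed.

(** The lower left entry of an element of [Gamma 6] is 0 or at least 6 in absolute value. In the
    first case the element is a translation by a multiple of 6; in the second [Im_bound] excludes
    imaginary parts above 1/6. *)
Lemma P_inj g tau tau' : SL2Z g -> 1 / 6 < complex.Im tau -> 1 / 6 < complex.Im tau' ->
  P g (ww tau) = P g (ww tau') -> ww tau = ww tau'.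
Proof.
move=> dg h1 h2; have y0 : upper_half tau by rewrite /upper_half /=; lra.
have y0' : upper_half tau' by rewrite /upper_half /=; lra.
move=> /(P_eq dg dg y0 y0')[k Gk e]; have [da [e1 e2]] := SL2Z_adj dg.
have [_ G2] := Gamma6_conj dg Gk; set m := \adj g *m k *m g in G2; have dm := Gamma_SL2Z G2.
have em : mobius m tau = tau'.
  have dk := Gamma_SL2Z Gk; rewrite /m -mulmxA mobiusM //; last exact: SL2ZM.
  by rewrite mobiusM // e; have [] := mobius_adj dg y0'.
have [c0|c0] := eqVneq (m 1 0) 0.
  have [j ej /(_ G2)/dvdzP[i ei]] := mobius_upper tau dm c0.
  by rewrite -em ej ei mulrC ww_translate.
have h6 : (6 <= `|(m 1 0)%R|)%N.
  have [_ [_ _ /dvdzP[i ei] _]] := G2; rewrite ei abszM leq_pmull // absz_gt0.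
  by apply: contraNneq c0 => i0; rewrite ei i0 mul0r.
exfalso; have := Im_bound dm y0 h6; rewrite em expr2; nra.
Qed.

Lemma P_sep_cusps g h tau tau' : SL2Z g -> SL2Z h -> 1 < complex.Im tau -> 1 < complex.Im tau' ->
  P g (ww tau) = P h (ww tau') -> P g 0 = P h 0.
Proof.
move=> dg dh h1 h2; have y0 : upper_half tau by rewrite /upper_half /=; lra.
have y0' : upper_half tau' by rewrite /upper_half /=; lra.
move=> /(P_eq dg dh y0 y0')[k Gk e]; have [da [e1 e2]] := SL2Z_adj dh.
have dk := Gamma_SL2Z Gk; set m := \adj h *m (k *m g).
have dkg := SL2ZM dk dg; have dm : SL2Z m by exact: SL2ZM.
have em : mobius m tau = tau'.
  by rewrite /m mobiusM // mobiusM // e; have [] := mobius_adj dh y0'.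
apply/P0_eq => //; exists k => //; apply/eqP; apply: contraT => c0.
have h6 : (1 <= `|(m 1 0)%R|)%N by rewrite absz_gt0.
by have := Im_bound dm y0 h6; rewrite em expr1n mulr1; nra.
Qed.

(** If the lower left entry is 0 the imaginary parts agree; otherwise their product is at most 1.
    The sum of the two bounds covers both cases. *)
Lemma P_sep_mixed g h tau tau' : SL2Z g -> SL2Z h -> upper_half tau -> upper_half tau' ->
  P g (ww tau) = P h (ww tau') -> complex.Im tau <= complex.Im tau' + (complex.Im tau')^-1.
Proof.
move=> dg dh y0 y0' /(P_eq dg dh y0 y0')[k Gk e]; have [da [e1 e2]] := SL2Z_adj dh.
have dk := Gamma_SL2Z Gk; set m := \adj h *m (k *m g).
have dkg := SL2ZM dk dg; have dm : SL2Z m by exact: SL2ZM.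
have em : mobius m tau = tau'.
  by rewrite /m mobiusM // mobiusM // e; have [] := mobius_adj dh y0'.
have i0 : 0 < complex.Im tau' by [].
have i1 : 0 < (complex.Im tau')^-1 by rewrite invr_gt0.
have [c0|c0] := eqVneq (m 1 0) 0.
  have [j ej _] := mobius_upper tau dm c0; rewrite -em ej intC ImD ImC addr0.
  by rewrite -em ej intC ImD ImC addr0 in i1; lra.
have h6 : (1 <= `|(m 1 0)%R|)%N by rewrite absz_gt0.
have := Im_bound dm y0 h6; rewrite em expr1n mulr1 -ler_pdivlMr // mul1r; lra.
Qed.

(** Points of the upper half-plane are treated by descent; a rational cusp is completed to a matrix
    by a Bezout relation between numerator and denominator. *)
Lemma P_surj (p : X6 R) : exists g w, [/\ SL2Z g, p = P g w &
  w = 0 \/ exists2 tau, 1 / 2 <= complex.Im tau & w = ww tau].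
Proof.
have [s ->] := proj6_surj p; have := set_mem (valP s); rewrite -[s in proj6 s]Hpt_val.
case: (val s) => [z|] /=.
  case=> [y0|[q ->]].
    have [g dg hg] := descent y0; have [da [e1 e2]] := SL2Z_adj dg.
    exists (\adj g), (ww (mobius g z)); split=> //; last by right; exists (mobius g z).
    by rewrite P_ww //; [have [-> _] := mobius_adj dg y0|exact: upper_mobius].
  have [u [v uv]] := Bezoutz (numq q) (denq q).
  have cop : gcdz (numq q) (denq q) = 1 by apply/eqP; exact: coprime_num_den.
  rewrite cop in uv; pose g := mk2 (numq q) (- v) (denq q) u.
  have [k00 k01 k10 k11] := mk2E (numq q) (- v) (denq q) u.
  exists g, 0; split; last by left.
    by rewrite /SL2Z /= det_mk2 mulNr opprK mulrC.
  rewrite P0 /= k10 (negPf (denq_neq0 q)) k00; congr (proj6 (Hpt (Some _))).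
  by rewrite /ratr !intC fmorph_div.
move=> _; exists 1%:M, 0; split; [exact: SL2Z1| |by left].
by rewrite P0 mobius_sphere1.
Qed.

End ModularCurvePoints.

(** * Coordinates, topology and charts on the projective curve *)

Section ProjectiveCurve.
Variable R : realType.
Local Notation C := R[i].
Local Notation V := 'rV[C]_3.

Lemma ord3_ind (P : 'I_3 -> Prop) : P 0 -> P 1 -> P 2 -> forall i, P i.
Proof.
move=> h0 h1 h2 [[|[|[|//]]] hi].
- by have -> : Ordinal hi = 0 by apply/val_inj.
- by have -> : Ordinal hi = 1 by apply/val_inj.
- by have -> : Ordinal hi = 2 by apply/val_inj.
Qed.

Lemma row3E (x y z : C) : [/\ row3 x y z 0 0 = x, row3 x y z 0 1 = y & row3 x y z 0 2 = z].
Proof. by rewrite !mxE. Qed.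

Definition pi2 (v : set_type (@nonzero3 R)) : P2 R :=
  \pi_(quotient_topology {eq_quot (homothetic_equiv R)}) v.

Lemma pi2_eq u v : pi2 u = pi2 v <-> exists2 c : C, c != 0 & val v = c *: val u.
Proof.
split=> [/eqmodP/asboolP //|h].
by apply/eqmodP/asboolP.
Qed.

(** Total on vectors, with the point at infinity as default for the zero vector. *)
Definition pt3 (v : V) : P2 R :=
  if (insub v : option (set_type (@nonzero3 R))) is Some u then pi2 u else P2_O R.

Lemma pt3E v (h : v \in @nonzero3 R) : pt3 v = pi2 (exist _ v h).
Proof.
by rewrite /pt3 insubT.
Qed.

Lemma nonzero3P (v : V) : v != 0 -> v \in @nonzero3 R.
Proof. by move=> h; apply/mem_set. Qed.

Lemma P2_affineE (x y : C) : P2_affine x y = pt3 (row3 x y 1).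
Proof. by rewrite (pt3E (row3_affine_neq0 x y)). Qed.

Lemma P2_OE : P2_O R = pt3 (row3 0 1 0).
Proof. by rewrite (pt3E (row3_O_neq0 R)). Qed.

Lemma pt3_eq (u v : V) : u != 0 -> v != 0 -> pt3 u = pt3 v <-> exists2 c : C, c != 0 & v = c *: u.
Proof. by move=> /nonzero3P u0 /nonzero3P v0; rewrite (pt3E u0) (pt3E v0); exact: pi2_eq. Qed.

Lemma hcoord_pt3 (v : V) : v != 0 -> exists2 c : C, c != 0 & forall i, hcoord (pt3 v) i = c * v 0 i.
Proof.
move=> /nonzero3P v0; rewrite (pt3E v0).
have : pi2 (exist _ v v0) = pi2 (repr (pi2 (exist _ v v0))) by rewrite {2}/pi2 reprK.
move=> /pi2_eq[c c0 e]; exists c => // i.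
by rewrite /hcoord e mxE.
Qed.

Lemma hcoord_neq0 (p : P2 R) : \row_i hcoord p i != 0.
Proof.
rewrite /hcoord; have h : val (repr p) != 0 by exact: (set_mem (valP (repr p))).
apply: contraNneq h => /rowP h; apply/eqP/rowP => i; by have := h i; rewrite !mxE.
Qed.

Lemma pt3_hcoord (p : P2 R) : p = pt3 (\row_i hcoord p i).
Proof.
rewrite (pt3E (nonzero3P (hcoord_neq0 p))) -{1}[p]reprK; apply/pi2_eq; exists 1.
  exact: oner_neq0.
by rewrite scale1r; apply/rowP => i; rewrite mxE.
Qed.

Definition ratio (p : E1 R) (i j : 'I_3) : C := hcoord (val p) i / hcoord (val p) j.

Lemma E1_eq (p p' : E1 R) j : hcoord (val p) j != 0 -> hcoord (val p') j != 0 ->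
  (forall i, ratio p i j = ratio p' i j) -> p = p'.
Proof.
move=> h h' e; apply/val_inj; rewrite (pt3_hcoord (val p)) (pt3_hcoord (val p')).
apply/pt3_eq; rewrite ?hcoord_neq0 //.
exists (hcoord (val p') j / hcoord (val p) j); first by rewrite mulf_neq0 // invr_eq0.
apply/rowP => i; rewrite !mxE; have := e i; rewrite /ratio => ei.
have -> : hcoord (val p') i = hcoord (val p') i / hcoord (val p') j * hcoord (val p') j by rewrite divfK.
by rewrite -ei; move: (hcoord (val p) i) (hcoord (val p) j) h => x y y0; ring.
Qed.

Lemma E1_equation (p : E1 R) : hcoord (val p) 1 ^+ 2 * hcoord (val p) 2 = hcoord (val p) 0 ^+ 3 + hcoord (val p) 2 ^+ 3.
Proof. exact: (set_mem (valP p)). Qed.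

Lemma E1_set_pt3 (v : V) : v != 0 -> v 0 1 ^+ 2 * v 0 2 = v 0 0 ^+ 3 + v 0 2 ^+ 3 -> E1_set (pt3 v).
Proof.
move=> v0 e; rewrite /E1_set /=; have [c c0 h] := hcoord_pt3 v0; rewrite !h.
transitivity (c ^+ 3 * (v 0 1 ^+ 2 * v 0 2)); first by ring.
by rewrite e; ring.
Qed.

Lemma E1_O_set : E1_set (P2_O R).
Proof.
rewrite P2_OE; apply: E1_set_pt3; first exact: (set_mem (row3_O_neq0 R)).
by have [h0 h1 h2] := row3E (0 : C) 1 0; rewrite h0 h1 h2; ring.
Qed.

Definition E1_O : E1 R := exist _ (P2_O R) (mem_set E1_O_set).

Definition E1pt (v : V) : E1 R :=
  if pselect (E1_set (pt3 v)) is left h then exist _ (pt3 v) (mem_set h) else E1_O.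

Lemma val_E1pt (v : V) : v != 0 -> v 0 1 ^+ 2 * v 0 2 = v 0 0 ^+ 3 + v 0 2 ^+ 3 -> val (E1pt v) = pt3 v.
Proof.
by move=> v0 e; rewrite /E1pt; case: pselect => [//|]; have := E1_set_pt3 v0 e.
Qed.

Lemma ratio_pt3 (p : E1 R) (v : V) i j : v != 0 -> val p = pt3 v -> v 0 j != 0 ->
  hcoord (val p) j != 0 /\ ratio p i j = v 0 i / v 0 j.
Proof.
move=> v0 e vj; rewrite /ratio e; have [c c0 h] := hcoord_pt3 v0; rewrite !h.
by rewrite mulf_neq0 // -mulf_div divff // mul1r.
Qed.

Lemma affine_E1 (p : E1 R) : hcoord (val p) 2 != 0 -> val p = P2_affine (ratio p 0 2) (ratio p 1 2) /\
  ratio p 1 2 ^+ 2 = ratio p 0 2 ^+ 3 + 1.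
Proof.
move=> h; split.
  rewrite P2_affineE [LHS]pt3_hcoord; apply/pt3_eq; rewrite ?hcoord_neq0 //.
    exact: (set_mem (row3_affine_neq0 _ _)).
  exists (hcoord (val p) 2)^-1; first by rewrite invr_eq0.
  have [e0 e1 e2] := row3E (ratio p 0 2) (ratio p 1 2) 1.
  apply/rowP; apply: ord3_ind; rewrite !mxE /ratio /= ?[_^-1 * _]mulrC //.
  by rewrite divff.
apply: (mulIf (expf_neq0 3 h)); rewrite /ratio mulrDl mul1r.
have -> : (hcoord (val p) 0 / hcoord (val p) 2) ^+ 3 * hcoord (val p) 2 ^+ 3 = hcoord (val p) 0 ^+ 3.
  by rewrite expr_div_n divfK // expf_neq0.
rewrite -E1_equation; move: (hcoord _ 1) (hcoord _ 2) h => x y y0; by field.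
Qed.

Lemma infinite_E1 (p : E1 R) : hcoord (val p) 2 = 0 -> p = E1_O.
Proof.
move=> h; have := E1_equation p; rewrite h mulr0 expr0n addr0 => /esym/eqP; rewrite expf_eq0 /= => /eqP h0.
have h1 : hcoord (val p) 1 != 0.
  apply: contraNneq (hcoord_neq0 (val p)) => h1; apply/eqP/rowP; apply: ord3_ind; rewrite !mxE //.
have O1 : row3 0 1 0 0 1 != 0 :> C by have [_ -> _] := row3E 0 1 0; exact: oner_neq0.
have hO i := @ratio_pt3 E1_O (row3 0 1 0) i 1 (set_mem (row3_O_neq0 R)) P2_OE O1.
apply: (@E1_eq _ _ 1) => //; first by have [] := hO 0.
have [e0 e1 e2] := row3E 0 1 0 : [/\ _ = 0 :> C, _ & _].
apply: ord3_ind; rewrite (hO _).2 /ratio ?h ?h0 ?e0 ?e1 ?e2 ?mul0r // ?divff ?oner_neq0 //.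
Qed.

(** The topology is that of a subspace of a quotient; unfolding it leaves closeness of a
    representative, coordinate by coordinate. *)
Lemma E1_near (p : E1 R) (N : set (E1 R)) (v : V) : nbhs p N -> v != 0 -> val p = pt3 v ->
  exists2 e : R, 0 < e & forall (u : V) (p' : E1 R), u != 0 -> (forall i, ab (u 0 i - v 0 i) < e) ->
    val p' = pt3 u -> N p'.
Proof.
rewrite nbhsE => -[U [oU Up] UN] v0 pv.
have [W oO OU] : exists2 W : set (P2 R), open W & set_val @^-1` W = U by exact: oU.
have {}oO : open ((\pi_(quotient_topology {eq_quot (homothetic_equiv R)}) : set_type (@nonzero3 R) -> _) @^-1` W) by exact: oO.
have [B oB BO] : exists2 B : set V, open B & set_val @^-1` B =
   ((\pi_(quotient_topology {eq_quot (homothetic_equiv R)}) : set_type (@nonzero3 R) -> _) @^-1` W) by exact: oO.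
have Bpt (u : V) (u0 : u \in @nonzero3 R) : B u <-> W (pt3 u).
  by rewrite (pt3E u0); have := congr1 (fun S => S (exist _ u u0)) BO; rewrite /preimage /= => ->.
have Opv : W (pt3 v) by rewrite -pv; have := Up; rewrite -OU.
have Bv : B v by apply/(Bpt _ (nonzero3P v0)).
have : nbhs v B by apply: open_nbhs_nbhs.
move=> /nbhs_ballP[e /= e0 eB].
exists (ab e); first by rewrite ab_gt0 gt_eqF.
move=> u p' u0 h p'u; apply: UN; rewrite -OU /= /preimage /= [set_val p']p'u.
apply/(Bpt _ (nonzero3P u0)); apply: eB; split; first exact: e0.
move=> i j; rewrite (ord1 i) -ball_normE /= distrC.
by rewrite -(abE (u 0 j - v 0 j)) (real_lt e0) ltcR.
Qed.

Lemma ratio_near (v : V) i j (e : R) : v 0 j != 0 -> 0 < e ->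
  nbhs v [set u : V | u 0 j != 0 /\ ab (u 0 i / u 0 j - v 0 i / v 0 j) < e].
Proof.
move=> vj e0.
have ci : (fun u : V => u 0 i) @ v --> v 0 i by exact: coord_continuous.
have cj : (fun u : V => u 0 j) @ v --> v 0 j by exact: coord_continuous.
have cr : (fun u : V => u 0 i / u 0 j) @ v --> v 0 i / v 0 j by exact: (cvgM ci (cvgV vj cj)).
have h1 : nbhs v [set u : V | ab (u 0 i / u 0 j - v 0 i / v 0 j) < e].
  by move/(@cvgatP R _ (nbhs v)): cr; apply.
have h2 : nbhs v [set u : V | ab (u 0 j - v 0 j) < ab (v 0 j)].
  by move/(@cvgatP R _ (nbhs v)): cj; apply; rewrite ab_gt0.
apply: filterS2 h1 h2 => u a1 a2; split=> //.
by apply: contraTneq a2 => ->; rewrite sub0r abN ltxx.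
Qed.

Lemma open_ratio i j (c : C) (r : R) :
  open [set p : E1 R | hcoord (val p) j != 0 /\ ab (ratio p i j - c) < r].
Proof.
pose W : set (P2 R) := [set p | hcoord p j != 0 /\ ab (hcoord p i / hcoord p j - c) < r].
exists W => //.
pose B : set V := [set u | u 0 j != 0 /\ ab (u 0 i / u 0 j - c) < r].
have oB : open B.
  rewrite openE => v [vj hv]; have e0 : 0 < r - ab (v 0 i / v 0 j - c) by rewrite subr_gt0.
  apply: filterS (ratio_near i vj e0) => u [uj hu]; split=> //.
  have := ab_dist (u 0 i / u 0 j) (v 0 i / v 0 j) c; lra.
suff : open ((\pi_(quotient_topology {eq_quot (homothetic_equiv R)}) : set_type (@nonzero3 R) -> _) @^-1` W) by exact.
exists B => //; apply/seteqP; split=> -[u u0] /=; rewrite /preimage /= /B /W /=;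
  have := hcoord_pt3 (set_mem u0); rewrite (pt3E u0) /pi2 => -[k k0 hk]; rewrite /set_val /= !hk.
  by rewrite mulf_eq0 (negPf k0) /= -mulf_div divff // mul1r.
by rewrite mulf_eq0 (negPf k0) /= -mulf_div divff // mul1r.
Qed.

Definition coord_chart (b : chart R (E1 R)) i j : Prop :=
  [/\ atlas_E1 R b, open (chart_dom b), {in chart_dom b &, injective (chart_coord b)} &
    forall p, chart_dom b p -> hcoord (val p) j != 0 /\ chart_coord b p = ratio p i j].

(** A disc around [y0] of radius [ab y0] contains no two opposite numbers; so the sign of [y] is
    fixed on the chart with coordinate [x]. *)
Lemma ab_sqr_eq (y y' y0 : C) : y ^+ 2 = y' ^+ 2 -> ab (y - y0) < ab y0 -> ab (y' - y0) < ab y0 -> y = y'.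
Proof.
move=> /eqP; rewrite eqf_sqr => /orP[/eqP//|/eqP e] h1 h2; exfalso.
have := abB (y - y0) (- (y' - y0)); rewrite abN e.
have -> : - y' - y0 - - (y' - y0) = - (2 * y0) by ring.
by rewrite abN abM ab_nat; move: h1; rewrite e; lra.
Qed.

(** With relative deviations below 1/4, the quadratic factor of the difference of the cubes stays
    near 3 and cannot vanish. *)
Lemma ab_cube_eq (x x' x0 : C) : x0 != 0 -> x ^+ 3 = x' ^+ 3 ->
  ab (x - x0) < ab x0 / 4 -> ab (x' - x0) < ab x0 / 4 -> x = x'.
Proof.
move=> n0 e h1 h2; have p0 : 0 < ab x0 by rewrite ab_gt0.
pose a := (x - x0) / x0; pose b := (x' - x0) / x0.
have ha : ab a < 1 / 4 by rewrite abM abV ltr_pdivrMr //; lra.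
have hb : ab b < 1 / 4 by rewrite abM abV ltr_pdivrMr //; lra.
have ex : x = x0 * (1 + a) by rewrite /a; field.
have ex' : x' = x0 * (1 + b) by rewrite /b; field.
have : x0 ^+ 3 * ((a - b) * (3 + (3 * a + 3 * b + (a ^+ 2 + a * b + b ^+ 2)))) = 0.
  transitivity (x ^+ 3 - x' ^+ 3); last by rewrite e subrr.
  by rewrite ex ex'; ring.
move/eqP; rewrite mulf_eq0 expf_eq0 (negPf n0) /= mulf_eq0 subr_eq0 => /orP[/eqP h|/eqP h].
  by rewrite ex ex' h.
exfalso; have a0 := ab_ge0 a; have b0 := ab_ge0 b.
have t1 : ab (3 * a + 3 * b) <= 3 * ab a + 3 * ab b by apply: le_trans (abD _ _) _; rewrite !abM ab_nat.
have t2 : ab (a ^+ 2 + a * b + b ^+ 2) <= ab a * ab a + ab a * ab b + ab b * ab b.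
  apply: le_trans (abD _ _) _; have := abD (a ^+ 2) (a * b); rewrite !expr2 !abM; lra.
have := abD (3 * a + 3 * b) (a ^+ 2 + a * b + b ^+ 2).
have := abD_ge 3 (3 * a + 3 * b + (a ^+ 2 + a * b + b ^+ 2)); rewrite h ab0 ab_nat; nra.
Qed.

Lemma chart_y (y0 : C) : y0 != 0 ->
  coord_chart (Chart [set p : E1 R | hcoord (val p) 2 != 0 /\ ab (ratio p 1 2 - y0) < ab y0] (fun p => ratio p 0 2)) 0 2.
Proof.
move=> n0; pose U := [set p : E1 R | hcoord (val p) 2 != 0 /\ ab (ratio p 1 2 - y0) < ab y0].
have oU : open U by exact: open_ratio.
have inj : {in U &, injective (fun p : E1 R => ratio p 0 2)}.
  move=> p p' /set_mem[z0 h] /set_mem[z0' h'] e.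
  have [_ c] := affine_E1 z0; have [_ c'] := affine_E1 z0'.
  have ey : ratio p 1 2 = ratio p' 1 2 by apply: ab_sqr_eq h h'; rewrite c c' e.
  apply: (@E1_eq _ _ 2) => //; apply: ord3_ind => //.
  by rewrite /ratio !divff.
split=> //=; last by move=> p [].
split=> //=; constructor 1 => p [z0 h]; split=> //.
apply: contraTneq h => e; by rewrite /ratio e mul0r sub0r abN ltxx.
Qed.

Lemma chart_x (x0 : C) : x0 != 0 ->
  coord_chart (Chart [set p : E1 R | hcoord (val p) 2 != 0 /\ ab (ratio p 0 2 - x0) < ab x0 / 4] (fun p => ratio p 1 2)) 1 2.
Proof.
move=> n0; pose U := [set p : E1 R | hcoord (val p) 2 != 0 /\ ab (ratio p 0 2 - x0) < ab x0 / 4].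
have oU : open U by exact: open_ratio.
have inj : {in U &, injective (fun p : E1 R => ratio p 1 2)}.
  move=> p p' /set_mem[z0 h] /set_mem[z0' h'] e.
  have [_ c] := affine_E1 z0; have [_ c'] := affine_E1 z0'.
  have ex : ratio p 0 2 = ratio p' 0 2.
    by apply: ab_cube_eq n0 _ h h'; apply: (addIr 1); rewrite -c -c' e.
  apply: (@E1_eq _ _ 2) => //; apply: ord3_ind => //.
  by rewrite /ratio !divff.
split=> //=; last by move=> p [].
split=> //=; constructor 2 => p [z0 h]; split=> //.
apply: contraTneq h => e; rewrite /ratio e mul0r sub0r abN -leNgt.
by have := ab_ge0 x0; lra.
Qed.

(** In [t = x / y] and [b = z / y] the curve is [b = t ^+ 3 + b ^+ 3]. For [ab b < 1/2] the map
    [b |-> b - b ^+ 3] is injective, so [t] determines [b]. *)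
Lemma chart_O :
  coord_chart (Chart [set p : E1 R | hcoord (val p) 1 != 0 /\ ab (ratio p 2 1 - 0) < 1 / 2] (fun p => ratio p 0 1)) 0 1.
Proof.
pose U := [set p : E1 R | hcoord (val p) 1 != 0 /\ ab (ratio p 2 1 - 0) < 1 / 2].
have oU : open U by exact: open_ratio.
have eqb (p : E1 R) : hcoord (val p) 1 != 0 -> ratio p 2 1 = ratio p 0 1 ^+ 3 + ratio p 2 1 ^+ 3.
  move=> h; have := E1_equation p; rewrite /ratio => e; apply: (mulIf (expf_neq0 3 h)).
  rewrite mulrDl !expr_div_n !divfK ?expf_neq0 // -e.
  by move: (hcoord _ 1) (hcoord _ 2) h => x y x0; field.
have inj : {in U &, injective (fun p : E1 R => ratio p 0 1)}.
  move=> p p' /set_mem[y0 h] /set_mem[y0' h'] e; rewrite subr0 in h; rewrite subr0 in h'.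
  have eb : ratio p 2 1 = ratio p' 2 1.
    have := eqb _ y0; have := eqb _ y0'; rewrite e; move: (ratio p' 0 1) (ratio p 2 1) (ratio p' 2 1) h h' => t b b' h h' e1 e2.
    have : (b - b') * (1 - (b ^+ 2 + b * b' + b' ^+ 2)) = 0.
      transitivity (b - b ^+ 3 - (b' - b' ^+ 3)); first by ring.
      have e2' : b - b ^+ 3 = t ^+ 3 by rewrite {1}e2 addrK.
      have e1' : b' - b' ^+ 3 = t ^+ 3 by rewrite {1}e1 addrK.
      by rewrite e1' e2' subrr.
    move/eqP; rewrite mulf_eq0 subr_eq0 => /orP[/eqP//|/eqP h0]; exfalso.
    have := abB_ge 1 (b ^+ 2 + b * b' + b' ^+ 2); rewrite h0 ab0 ab1.
    have := abD (b ^+ 2 + b * b') (b' ^+ 2); have := abD (b ^+ 2) (b * b'); rewrite !expr2 !abM.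
    have := ab_ge0 b; have := ab_ge0 b'; nra.
  apply: (@E1_eq _ _ 1) => //; apply: ord3_ind => //.
  by rewrite /ratio !divff.
split=> //=; last by move=> p [].
split=> //=; constructor 3 => p [y0 h]; split=> //; rewrite subr0 in h.
have -> : hcoord (val p) 1 ^+ 2 - 3 * hcoord (val p) 2 ^+ 2 = hcoord (val p) 1 ^+ 2 * (1 - 3 * ratio p 2 1 ^+ 2).
  by rewrite /ratio; move: (hcoord _ 1) (hcoord _ 2) y0 => x y x0; field.
rewrite mulf_neq0 ?expf_neq0 // -ab_gt0; have := abB_ge 1 (3 * ratio p 2 1 ^+ 2).
rewrite abM abX ab_nat ab1 expr2; have := ab_ge0 (ratio p 2 1); nra.
Qed.

Lemma chart_at (p : E1 R) : exists b i j, coord_chart b i j /\ chart_dom b p.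
Proof.
have [z0|z0] := eqVneq (hcoord (val p) 2) 0.
  exists (Chart [set p : E1 R | hcoord (val p) 1 != 0 /\ ab (ratio p 2 1 - 0) < 1 / 2] (fun p => ratio p 0 1)), 0, 1.
  split; first exact: chart_O.
  rewrite /= /ratio z0 mul0r subr0 ab0; split; last lra.
  apply: contraNneq (hcoord_neq0 (val p)) => h1.
  have := E1_equation p; rewrite z0 mulr0 expr0n addr0 => /esym/eqP; rewrite expf_eq0 /= => /eqP h0.
  by apply/eqP/rowP; apply: ord3_ind; rewrite !mxE.
have [_ c] := affine_E1 z0; have [y0|y0] := eqVneq (ratio p 1 2) 0; last first.
  exists (Chart [set q : E1 R | hcoord (val q) 2 != 0 /\ ab (ratio q 1 2 - ratio p 1 2) < ab (ratio p 1 2)] (fun p => ratio p 0 2)), 0, 2.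
  split; first exact: chart_y.
  by rewrite /= subrr ab0 ab_gt0.
have x0 : ratio p 0 2 != 0.
  apply: contraTneq (oner_neq0 C) => e; move: c; rewrite e y0 !expr0n add0r => <-.
  by rewrite eqxx.
exists (Chart [set q : E1 R | hcoord (val q) 2 != 0 /\ ab (ratio q 0 2 - ratio p 0 2) < ab (ratio p 0 2) / 4] (fun p => ratio p 1 2)), 1, 2.
split; first exact: chart_x.
by rewrite /= subrr ab0 divr_gt0 // ab_gt0.
Qed.

End ProjectiveCurve.

(** * The maps [P g] are open and continuous *)

Section ModularCurveTopology.
Variable R : realType.
Local Notation C := R[i].
Local Notation msph := (@mobius_sphere R).
Implicit Types (g h : 'M[int]_2) (tau w : C).

(** A continuous logarithm at 1: on the part of the strip at distance at least [e] from 0, [ee z]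
    stays away from 1 by compactness. *)
Lemma ee_near1 (e : R) : 0 < e -> exists2 d : R, 0 < d & forall v : C, ab (v - 1) < d ->
  exists2 z : C, ab z < e & ee z = v.
Proof.
move=> e0; pose A : set C := [set z | `|complex.Re z| <= 1 / 2 /\ (`|complex.Im z| <= 1 /\ e <= ab z)].
have [d d0 H] : exists2 d : R, 0 < d & forall z, A z -> d <= ab (ee z - 1).
  have [A0|A0] := pselect (A !=set0); last first.
    by exists 1 => // z Az; exfalso; apply: A0; exists z.
  have [|z2 A2 H2] := ab_min A0 (@compact_box R e) (f := fun z => ee z - 1).
    move=> z _; apply/contP => r r0; have [d d0 H] := ee_cont z r0.
    exists d => // w /H; have -> : ee w - 1 - (ee z - 1) = ee w - ee z by ring.
    by [].
  exists (ab (ee z2 - 1)) => //; rewrite ab_gt0 subr_eq0; apply/eqP => /ee_eq1[n en].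
  case: A2 => h1 [_ h2]; move: h1 h2; rewrite en ab_int intC ReC -intr_norm.
  have [->|/(int_ge1 R) h] := eqVneq n 0; first by rewrite normr0; lra.
  lra.
exists (Num.min d (1 / 2)); first by rewrite lt_min d0; lra.
move=> v; rewrite lt_min => /andP[vd v2].
have v0 : v != 0 by apply: contraTneq v2 => ->; rewrite sub0r abN ab1 -leNgt; lra.
have [t et] := cexp_surj v0.
have [n hn] := round_Re (t / twopii R); exists (t / twopii R - n%:~R); last first.
  by rewrite ee_shift /ee mulrC divfK // twopii_neq0.
have ez : ee (t / twopii R - n%:~R) = v by rewrite ee_shift /ee mulrC divfK // twopii_neq0.
move: (t / twopii R - n%:~R) hn ez => z hn ez; rewrite ltNge; apply/negP => ez'.
have Iz : `|complex.Im z| <= 1.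
  have := ab_ee z; rewrite ez => av; have := abB_ge v 1; have := abB_ge 1 v; rewrite abBC ab1 => u1 u2.
  rewrite leNgt; apply/negP; rewrite lter_normr => /orP[h|h].
    have := expR_ge1Dx (2 * pi * complex.Im z); move: av; rewrite expRN; have := expR_gt0 (2 * pi * complex.Im z).
    have := @pi_ge1 R; move: (expR _) => x p1 x0 av hx; have x3 : 3 <= x by nra.
    have : ab v <= 3^-1 by rewrite av lef_pV2 ?posrE.
    lra.
  have := expR_ge1Dx (- (2 * pi * complex.Im z)); rewrite -av; have := @pi_ge1 R; nra.
have : A z by [].
by move=> /H; rewrite ez; lra.
Qed.

Lemma pi3_gt0 : 0 < pi / 3 :> R. Proof. by rewrite divr_gt0 // pi_gt0. Qed.

Lemma ww_lt (tau : C) (M : R) : ab (ww tau) < expR (- (pi / 3 * M)) -> M < complex.Im tau.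
Proof. by rewrite ab_ww ltr_expR ltrN2 ltr_pM2l // pi3_gt0. Qed.

Lemma ww_le (tau : C) (M : R) : M <= complex.Im tau -> ab (ww tau) <= expR (- (pi / 3 * M)).
Proof. by rewrite ab_ww ler_expR lerN2 ler_pM2l // pi3_gt0. Qed.

Lemma ww_small (d : R) : 0 < d -> exists2 M : R, 0 < M & forall tau, M < complex.Im tau -> ab (ww tau) < d.
Proof.
move=> d0; have p3 := pi3_gt0; exists ((pi / 3)^-1 / d); first by rewrite divr_gt0 // invr_gt0.
move=> tau h; rewrite ab_ww expRN -[d]invrK ltf_pV2 ?posrE ?expR_gt0 ?invr_gt0 //.
have := expR_ge1Dx (pi / 3 * complex.Im tau).
have : d^-1 < pi / 3 * complex.Im tau by rewrite mulrC -ltr_pdivrMr // mulrC.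
lra.
Qed.

Lemma mobius_cont g tau : SL2Z g -> upper_half tau -> forall e : R, 0 < e ->
  exists2 d : R, 0 < d & forall z : C, ab (z - tau) < d -> ab (mobius g z - mobius g tau) < e.
Proof.
move=> dg y0 e; apply: (Ana_near_ball (f := mobius g)).
apply: Ana_div; last exact: autj_neq0.
- by apply: Ana_add; [apply: Ana_mul; [exact: Ana_cst|exact: Ana_id]|exact: Ana_cst].
- by apply: Ana_add; [apply: Ana_mul; [exact: Ana_cst|exact: Ana_id]|exact: Ana_cst].
Qed.

Lemma near_upper (x z : C) : ab (z - x) < complex.Im x -> upper_half z.
Proof. move=> h; have := ab_Im (z - x); rewrite /upper_half /= ImD ImN ler_norml => /andP[h1 _]; lra. Qed.

Lemma P_Some (s : Hstar R) z : val s = Some z -> upper_half z -> proj6 s = P 1%:M (ww z).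
Proof.
by move=> e y0; rewrite P_ww //; [rewrite mobius1 -e Hpt_val|exact: SL2Z1].
Qed.

Lemma P_None (s : Hstar R) g : val s = msph g None -> proj6 s = P g 0.
Proof. by move=> e; rewrite P0 -e Hpt_val. Qed.

Lemma P_nonzero g h w : SL2Z g -> SL2Z h -> w != 0 -> ab w < 1 -> P h 0 <> P g w.
Proof.
by move=> dg dh w0 w1; have [tau y0 <-] := ww_surj w0 w1; exact: P0_neq.
Qed.

(** Openness is checked in the extended half-plane: at points of the upper half-plane by continuity
    of a Moebius map, and at cusps, which only [w = 0] can reach, because the stabilizer of infinity
    preserves heights. *)
Lemma P_open g w0 (d : R) : SL2Z g -> ab w0 < 1 -> 0 < d ->
  nbhs (P g w0) [set p | exists2 w, ab (w - w0) < d & ab w < 1 /\ p = P g w].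
Proof.
move=> dg w01 d0; pose V w := ab (w - w0) < d /\ ab w < 1.
pose U : set (X6 R) := [set p | exists2 w, V w & p = P g w].
have Vopen w : V w -> exists2 r : R, 0 < r & forall w', ab (w' - w) < r -> V w'.
  move=> [h1 h2]; exists (Num.min (d - ab (w - w0)) (1 - ab w)); first by rewrite lt_min !subr_gt0 h1.
  move=> w'; rewrite lt_min => /andP[a1 a2]; split.
    by have := ab_dist w' w w0; lra.
  by have := abB_ge w' w; lra.
suff oU : open U.
  apply: (@filterS _ _ _ U); last by apply: open_nbhs_nbhs; split=> //; exists w0 => //; split=> //; rewrite subrr ab0.
  by move=> p [w [h1 h2] e]; exists w.
have [da [e1 e2]] := SL2Z_adj dg.
suff : Hstar_open [set s : Hstar R | U (proj6 s)] by exact.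
split=> [s z [w Vw ps] sz y0|s h [w Vw ps] dh sh].
  have w1 : ab w < 1 by case: Vw.
  have w0' : w != 0.
    apply/eqP => ew; rewrite ew (P_Some sz y0) in ps.
    by have := @P0_neq _ g 1%:M z dg SL2Z1 y0; rewrite ps.
  have [tau yt et] := ww_surj w0' w1; rewrite -et (P_Some sz y0) in ps.
  have [k Gk ek] := (P_eq SL2Z1 dg y0 yt).1 ps; rewrite mobius1 in ek.
  have dk := Gamma_SL2Z Gk; pose m := \adj g *m k.
  have dm : SL2Z m by exact: SL2ZM.
  have em : mobius m z = tau by rewrite /m mobiusM // ek; have [] := mobius_adj dg yt.
  have [r r0 Hr] := Vopen w Vw.
  have /contP/(_ r r0)[r1 r10 H1] := @ww_cont R (mobius m z).
  have [r2 r20 H2] := mobius_cont dm y0 r10.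
  apply/nearP; exists (Num.min r2 (complex.Im z)); first by rewrite lt_min r20.
  move=> z'; rewrite lt_min => /andP[h1 /near_upper yz'] t tz'.
  exists (ww (mobius m z')); first by apply: Hr; have := H1 _ (H2 _ h1); rewrite em et.
  rewrite (P_Some tz' yz'); apply/(P_eq SL2Z1 dg yz'); first exact: upper_mobius.
  exists k => //; rewrite mobius1 /m mobiusM //.
  by have [_ ->] := mobius_adj dg (upper_mobius dk yz').
have w1 : ab w < 1 by case: Vw.
have ew : w = 0.
  apply/eqP; apply: contraT => w0'; exfalso.
  by rewrite (P_None sh) in ps; exact: (P_nonzero dg dh w0' w1 ps).
rewrite ew in Vw ps; rewrite (P_None sh) in ps.
have [k Gk hk] := (P0_eq R dh dg).1 ps; have dk := Gamma_SL2Z Gk.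
have dkh := SL2ZM dk dh; set m := \adj g *m (k *m h) in hk.
have dm : SL2Z m by exact: SL2ZM.
have [r r0 Hr] := Vopen 0 Vw; have [M M0 HM] := ww_small r0.
exists M => // z t hz tz; have yz : upper_half z by rewrite /upper_half /=; lra.
rewrite msph_H // in tz.
have [j ej _] := mobius_upper z dm hk.
exists (ww (mobius m z)).
  by apply: Hr; rewrite subr0; apply: HM; rewrite ej intC ImD ImC addr0.
rewrite (P_Some tz (upper_mobius dh yz)); apply/(P_eq SL2Z1 dg (upper_mobius dh yz)); first exact: upper_mobius.
exists k => //; rewrite mobius1 /m [in RHS]mobiusM // mobiusM //.
by have [_ ->] := mobius_adj dg (upper_mobius dk (upper_mobius dh yz)).
Qed.

(** Near a nonzero [w0] write [w = w0 * ee z] with small [z]; then [w] comes from [tau + 6 * z],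
    close to the given [tau]. *)
Lemma P_cont g w0 (U : set (X6 R)) : SL2Z g -> ab w0 < 1 -> open U -> U (P g w0) ->
  exists2 d : R, 0 < d & forall w, ab (w - w0) < d -> ab w < 1 /\ U (P g w).
Proof.
move=> dg w01 oU Uw0; have [op1 op2] : Hstar_open [set s : Hstar R | U (proj6 s)] by exact: oU.
have lt1 : 0 < 1 - ab w0 by rewrite subr_gt0.
have [e|n0] := eqVneq w0 0.
  rewrite e in Uw0 *; have vs : val (Hpt (msph g None)) = msph g None by apply: val_Hpt; exact: cusp_in.
  have Us : U (proj6 (Hpt (msph g None))) by rewrite -P0.
  have [M M0 H] := op2 _ g Us dg vs.
  exists (Num.min 1 (expR (- (pi / 3 * M)))); first by rewrite lt_min ltr01 expR_gt0.
  move=> w; rewrite subr0 lt_min => /andP[w1 wM]; split=> //.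
  have [->|wn0] := eqVneq w 0; first by [].
  have [tau y0 et] := ww_surj wn0 w1; rewrite -et in wM *; rewrite P_ww //.
  by apply: (H tau); [exact: ww_lt|rewrite msph_H // val_Hptg].
have [tau y0 et] := ww_surj n0 w01.
have vs := val_Hptg dg y0.
have Us : U (proj6 (Hpt (Some (mobius g tau)))) by rewrite -P_ww // et.
have /nearP[r r0 H] := op1 _ _ Us vs (upper_mobius dg y0).
have [r1 r10 H1] := mobius_cont dg y0 r0.
have yy : 0 < complex.Im tau by [].
have m0 : 0 < Num.min r1 (complex.Im tau) / 6 by rewrite divr_gt0 // lt_min r10.
have [d d0 Hd] := ee_near1 m0.
have w0p : 0 < ab w0 by rewrite ab_gt0.
exists (Num.min (d * ab w0) (1 - ab w0)); first by rewrite lt_min mulr_gt0.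
move=> w; rewrite lt_min => /andP[h1 h2]; split; first by have := abB_ge w w0; lra.
have [|z hz ez] := Hd (w / w0).
  have -> : w / w0 - 1 = (w - w0) / w0 by field.
  by rewrite abM abV ltr_pdivrMr.
have z6 : ab (tau + 6 * z - tau) < Num.min r1 (complex.Im tau).
  by rewrite addrC addKr abM ab_nat mulrC -ltr_pdivlMr.
move: z6; rewrite lt_min => /andP[z6 /near_upper yt].
have ew : ww (tau + 6 * z) = w.
  have -> : ww (tau + 6 * z) = ww tau * ee z.
    by rewrite /ww /ee -cexpD; congr cexp; move: (twopii R) => T; field.
  by rewrite et ez mulrC divfK.
rewrite -ew P_ww //; apply: H; [exact: H1 z6|exact: val_Hptg].
Qed.

Lemma XY_Gamma k tau : Gamma 6 k -> upper_half tau -> Xfun (mobius k tau) = Xfun tau /\ Yfun (mobius k tau) = Yfun tau.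
Proof.
move=> Gk y0; have [-> ->] := XYfun_mobius (Gamma_SL2Z Gk) y0.
have := XYfun_mobius SL2Z1 y0; rewrite mobius1 => -[-> ->].
have DS := divS_system (ww_neq0 tau) (ww_lt1 y0).
by rewrite (act_Gamma (ds_period DS) Gk) actE1.
Qed.

Lemma XX_P g h tau tau' : SL2Z g -> SL2Z h -> upper_half tau -> upper_half tau' ->
  P g (ww tau) = P h (ww tau') -> XX g (ww tau) = XX h (ww tau') /\ YY g (ww tau) = YY h (ww tau').
Proof.
move=> dg dh y0 y0' /(P_eq dg dh y0 y0')[k Gk ek].
have [x1 x2] := XYfun_mobius dg y0; have [x3 x4] := XYfun_mobius dh y0'.
have [x5 x6] := XY_Gamma Gk (upper_mobius dg y0); rewrite ek in x5 x6.
by split; [exact: etrans (esym x1) (etrans (esym x5) x3)|exact: etrans (esym x2) (etrans (esym x6) x4)].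
Qed.

Lemma XX_inj g h tau tau' : SL2Z g -> SL2Z h -> upper_half tau -> upper_half tau' ->
  XX g (ww tau) = XX h (ww tau') -> YY g (ww tau) = YY h (ww tau') -> P g (ww tau) = P h (ww tau').
Proof.
move=> dg dh y0 y0' eX eY.
have [x1 x2] := XYfun_mobius dg y0; have [x3 x4] := XYfun_mobius dh y0'.
have [k Gk ek] := XY_injective (upper_mobius dg y0) (upper_mobius dh y0')
  (etrans x1 (etrans eX (esym x3))) (etrans x2 (etrans eY (esym x4))).
by apply: (P_eq dg dh y0 y0').2; exists k; [exact: Gk|exact: esym ek].
Qed.

Definition lim0 (f : C -> C) (x : C) : Prop := forall e : R, 0 < e -> exists2 d : R, 0 < d &
  forall w, w != 0 -> ab w < d -> ab (f w - x) < e.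

(** The images of small discs are neighbourhoods of the cusp, so a limit in the coordinate [w] is a
    limit within the upper half-plane. *)
Lemma value_at_cusp (f F : C -> C) (s : Hstar R) g x : SL2Z g -> val s = msph g None ->
  (forall z tau, upper_half z -> upper_half tau -> P 1%:M (ww z) = P g (ww tau) -> f z = F (ww tau)) ->
  lim0 F x -> value_at f s x.
Proof.
move=> dg sg fF hl; split=> [|_].
  rewrite /in_upper /= sg; case E : (msph g None) => [z|//] y0.
  by exfalso; exact: (msph_None_H y0 E).
apply/(@cvgatP _ _ (within (@in_upper R) (nbhs s))) => e e0; have [d d0 H] := hl e e0.
have z1 : ab (0 : C) < 1 by rewrite ab0.
have := P_open dg z1 d0; rewrite -(P_None sg) => hN.
have hc : nbhs s (@proj6 R @^-1` [set p | exists2 w, ab (w - 0) < d & ab w < 1 /\ p = P g w]).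
  exact: (@pi_continuous (Hstar R) _ s).
rewrite /within /=; apply: filterS hc => t [w]; rewrite subr0 => wd [w1 pt].
rewrite /in_upper /complex_of /=; case E : (val t) => [z|//] y0 /=.
rewrite (P_Some E y0) in pt.
have w0 : w != 0.
  by apply/eqP => ew; rewrite ew in pt; exact: (@P0_neq _ g 1%:M z dg SL2Z1 y0 (esym pt)).
have [tau yt et] := ww_surj w0 w1; rewrite -et in pt wd w0 *.
by rewrite (fF z tau y0 yt pt); exact: H.
Qed.

End ModularCurveTopology.

(** * Extending [(X, Y)] over the cusps into the projective curve *)

Section Parametrization.
Variable R : realType.
Local Notation C := R[i].
Implicit Types (g h : 'M[int]_2) (tau w : C).

Lemma Ana_zero_ext (f : C -> C) z0 : Ana f z0 ->
  (exists2 d : R, 0 < d & forall w, w != z0 -> ab (w - z0) < d -> f w = 0) -> f z0 = 0.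
Proof.
move=> hf [d d0 H]; apply/eqP; apply: contraT => n0; have [e e0 He] := Ana_near_neq0 hf n0.
have [s s0 [sd se _ _]] := small_pos4 d0 e0 d0 e0.
have zs : ab (z0 + s%:C - z0) = s by rewrite addrAC subrr add0r abR gtr0_norm.
have ne : z0 + s%:C != z0 by rewrite -subr_eq0 -ab_gt0 zs.
by have := He (z0 + s%:C); rewrite zs => /(_ se); rewrite H ?eqxx // zs.
Qed.

(** Analytic homogeneous coordinates of the parametrization near [w0], with the middle or the last
    one nonzero, as on every point of the curve. *)
Definition is_lift g w0 (d : R) (a b c : C -> C) : Prop := 0 < d /\ forall w, ab (w - w0) < d ->
  [/\ ab w < 1, [/\ Ana a w, Ana b w & Ana c w], (b w != 0 \/ c w != 0),
    b w ^+ 2 * c w = a w ^+ 3 + c w ^+ 3 &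
    w != 0 -> [/\ c w != 0, XX g w = a w / c w & YY g w = b w / c w]].

Definition affine_lift w0 (d : R) (c : C -> C) : Prop := forall w, ab (w - w0) < d -> c w = 1.

Definition polar_lift w0 (d : R) (a b c : C -> C) : Prop :=
  [/\ w0 = 0, a 0 = 0, c 0 = 0 & forall w, ab (w - w0) < d -> b w = 1].

Lemma lift_regular g w0 : SL2Z g -> w0 != 0 -> ab w0 < 1 ->
  exists d a b c, is_lift g w0 d a b c /\ affine_lift w0 d c.
Proof.
move=> dg n0 w1; exists (Num.min (ab w0) (1 - ab w0)), (XX g), (YY g), (fun=> 1); split=> //.
have p0 : 0 < ab w0 by rewrite ab_gt0.
split; first by rewrite lt_min p0 subr_gt0.
move=> w; rewrite lt_min => /andP[h1 h2].
have wn0 : w != 0 by apply: contraTneq h1 => ->; rewrite sub0r abN ltxx.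
have wl : ab w < 1 by have := abB_ge w w0; lra.
have [hX hY] := XX_Ana dg wn0 wl; have [_ e] := act_forms dg wn0 wl.
split=> //.
- by split=> //; exact: Ana_cst.
- by right; exact: oner_neq0.
- by rewrite mulr1 expr1n.
- by move=> _; rewrite !divr1; split=> //; exact: oner_neq0.
Qed.

Lemma nonvanishing_nl (N : C -> C) : (forall w, w != 0 -> ab w < 1 -> N w != 0) -> ~ locally_eq N 0 0.
Proof.
move=> h [d d0 H]; have [s s0 [sd s1 _ _]] := small_pos4 d0 ltr01 d0 ltr01.
have av : ab (s%:C : C) = s by rewrite abR gtr0_norm.
have v0 : s%:C != 0 :> C by rewrite -ab_gt0 av.
by have := h _ v0; rewrite av => /(_ s1); rewrite H ?eqxx // subr0 av.
Qed.

Lemma one_contra (u v : C -> C) z0 (d : R) : Ana u z0 -> Ana v z0 -> u z0 = 0 -> v z0 = 1 -> 0 < d ->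
  (forall w, w != z0 -> ab (w - z0) < d -> u w = v w) -> False.
Proof.
move=> hu hv u0 v1 d0 H.
have := Ana_zero_ext (Ana_sub hu hv); rewrite u0 v1 sub0r => h.
have /eqP : -1 = 0 :> C by apply: h; exists d => // w wz /H -> //; rewrite subrr.
by rewrite oppr_eq0 oner_eq0.
Qed.

(** At a cusp each of [X] and [Y] is finite or has a pole, and the curve equation excludes the mixed
    cases. With two poles the coordinates are [X / Y : 1 : 1 / Y]. *)
Lemma lift_cusp g : SL2Z g ->
  exists d a b c, is_lift g 0 d a b c /\ (affine_lift 0 d c \/ polar_lift 0 d a b c).
Proof.
move=> dg; have [A [B [Cc [D [hA hX]]]]] := XY_extension R dg.
have z1 : ab (0 : C) < 1 by rewrite ab0.
have [aA aB aC aD] := hA 0 z1.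
have nB : ~ locally_eq B 0 0 by apply: nonvanishing_nl => w w0 w1; have [[]] := hX w w0 w1.
have nD : ~ locally_eq D 0 0 by apply: nonvanishing_nl => w w0 w1; have [[]] := hX w w0 w1.
have nBC : ~ locally_eq (fun w => B w * Cc w) 0 0.
  by apply: nonvanishing_nl => w w0 w1; have [[? ? ? ?] _] := hX w w0 w1; rewrite mulf_neq0.
have curve w : w != 0 -> ab w < 1 -> YY g w ^+ 2 = XX g w ^+ 3 + 1.
  by move=> w0 w1; have [_ e] := act_forms dg w0 w1.
have cst1 : Ana (fun=> 1 : C) 0 by exact: Ana_cst.
have [[x hx [dx dx0 Hx]]|[x [hx x0] [dx dx0 Hx]]] := Ana_quotient aA aB nB;
  have [[y hy [dy dy0 Hy]]|[y [hy y0] [dy dy0 Hy]]] := Ana_quotient aC aD nD;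
  have [d d0 [d1 d2 d3 _]] := small_pos4 dx0 dy0 (ltr01 : 0 < 1 :> R) dx0.
- have [d' d0' Hd'] := Ana_near hx; have [d'' d0'' Hd''] := Ana_near hy.
  have [r r0 [r1 r2 r3 _]] := small_pos4 d0 d0' d0'' d0.
  exists r, x, y, (fun=> 1); split; last by left.
  have XE w : w != 0 -> ab w < r -> XX g w = x w /\ YY g w = y w.
    move=> w0 wr; have w1 : ab w < 1 by lra.
    have [_ [-> ->]] := hX w w0 w1; have := Hx w w0; have := Hy w w0; rewrite subr0.
    by move=> /(_ (lt_trans wr (lt_trans r1 d2)))[_ ->] /(_ (lt_trans wr (lt_trans r1 d1)))[_ ->].
  have e0 : y 0 ^+ 2 - (x 0 ^+ 3 + 1) = 0.
    apply: (Ana_zero_ext (f := fun w => y w ^+ 2 - (x w ^+ 3 + 1))).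
      by apply: Ana_sub; [exact: Ana_exp|apply: Ana_add => //; exact: Ana_exp].
    exists r => // w w0; rewrite subr0 => wr; have [<- <-] := XE w w0 wr.
    by rewrite curve ?subrr //; lra.
  split=> // w; rewrite subr0 => wr; split; [lra| | | |].
  + by split; [apply: Hd'; rewrite subr0; lra|apply: Hd''; rewrite subr0; lra|exact: Ana_cst].
  + by right; exact: oner_neq0.
  + rewrite mulr1 expr1n; have [->|w0] := eqVneq w 0; first exact: subr0_eq e0.
    by have [<- <-] := XE w w0 wr; apply: curve => //; lra.
  + by move=> w0; have [-> ->] := XE w w0 wr; rewrite !divr1; split=> //; exact: oner_neq0.
(* [Y] has a pole and [X] is finite: here [y] is the inverse of [Y], and [y ^+ 2 * (x ^+ 3 + 1)] is
   1 off the cusp but 0 at it. *)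
- exfalso; apply: (@one_contra (fun w => y w ^+ 2 * (x w ^+ 3 + 1)) (fun=> 1) 0 d) => //.
  + by apply: Ana_mul; [exact: Ana_exp|apply: Ana_add => //; exact: Ana_exp].
  + by rewrite y0 expr0n mul0r.
  + move=> w w0 hw; have wd : ab w < d by rewrite subr0 in hw.
    have w1 : ab w < 1 by lra.
    have [_ hxw] := Hx w w0 (lt_trans hw d1); have [D0 C0 hyw] := Hy w w0 (lt_trans hw d2).
    have [_ [eX eY]] := hX w w0 w1; rewrite -hxw -eX -curve // -hyw eY -exprMn.
    by rewrite mulf_div [D w * _]mulrC divff ?mulf_neq0 // expr1n.
(* [X] has a pole and [Y] is finite: with [x] the inverse of [X], the equation becomes
   [y ^+ 2 * x ^+ 3 = 1 + x ^+ 3], which fails at the cusp. *)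
- exfalso; apply: (@one_contra (fun w => y w ^+ 2 * x w ^+ 3) (fun w => 1 + x w ^+ 3) 0 d) => //.
  + by apply: Ana_mul; exact: Ana_exp.
  + by apply: Ana_add => //; exact: Ana_exp.
  + by rewrite x0 expr0n mulr0.
  + by rewrite x0 expr0n addr0.
  + move=> w w0 hw; have wd : ab w < d by rewrite subr0 in hw.
    have w1 : ab w < 1 by lra.
    have [B0 A0 hxw] := Hx w w0 (lt_trans hw d1); have [_ hyw] := Hy w w0 (lt_trans hw d2).
    have [_ [eX eY]] := hX w w0 w1; have := curve w w0 w1; rewrite -hyw -eY => ->.
    rewrite -hxw eX mulrDl mul1r.
    by have -> : (A w / B w) ^+ 3 * (B w / A w) ^+ 3 = 1 by field; rewrite ?A0 ?B0 ?C0 ?D0.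
have [[t ht [dt dt0 Ht]]|[t [ht t0] [dt dt0 Ht]]] := Ana_quotient (Ana_mul aA aD) (Ana_mul aB aC) nBC;
  have [e e0 [e1 e2 _ _]] := small_pos4 d0 dt0 d0 dt0.
- have [d' d0' Hd'] := Ana_near ht; have [d'' d0'' Hd''] := Ana_near hy.
  have [r r0 [r1 r2 r3 _]] := small_pos4 e0 d0' d0'' d0.
  have data w : w != 0 -> ab w < r -> [/\ y w != 0, XX g w = t w / y w, YY g w = 1 / y w & t w ^+ 2 * (1 + x w ^+ 3) = x w].
    move=> w0 wr; have w1 : ab w < 1 by lra.
    have hw : ab (w - 0) < e by rewrite subr0; lra.
    have [[A0 B0 C0 D0] [eX eY]] := hX w w0 w1.
    have [_ _ hxw] := Hx w w0 (lt_trans hw (lt_trans e1 d1)).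
    have [_ _ hyw] := Hy w w0 (lt_trans hw (lt_trans e1 d2)).
    have [_ htw] := Ht w w0 (lt_trans hw e2).
    have c := curve w w0 w1; rewrite eX eY in c.
    rewrite -hxw -hyw -htw eX eY; split.
    * by rewrite mulf_neq0 // invr_eq0.
    * by field; rewrite ?A0 ?B0 ?C0 ?D0.
    * by field; rewrite ?A0 ?B0 ?C0 ?D0.
    * have -> : (A w * D w / (B w * Cc w)) ^+ 2 = (A w / B w) ^+ 2 / (Cc w / D w) ^+ 2.
        by field; rewrite ?A0 ?B0 ?C0 ?D0.
      rewrite c; have n0 : (A w / B w) ^+ 3 + 1 != 0 by rewrite -c expf_neq0 // mulf_neq0 // invr_eq0.
      have -> : 1 + (B w / A w) ^+ 3 = ((A w / B w) ^+ 3 + 1) / (A w / B w) ^+ 3 by field; rewrite ?A0 ?B0 ?C0 ?D0.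
      have -> : B w / A w = (A w / B w) ^+ 2 / (A w / B w) ^+ 3 by field; rewrite ?A0 ?B0 ?C0 ?D0.
      by rewrite mulrA divfK.
  (* The curve equation in [t = X / Y] and [x = 1 / X] is [t ^+ 2 * (1 + x ^+ 3) = x], evaluated at
     the cusp. *)
  have t0 : t 0 = 0.
    have e00 : t 0 ^+ 2 * (1 + x 0 ^+ 3) - x 0 = 0.
      apply: (Ana_zero_ext (f := fun w => t w ^+ 2 * (1 + x w ^+ 3) - x w)).
        apply: Ana_sub => //; apply: Ana_mul; first exact: Ana_exp.
        by apply: Ana_add => //; exact: Ana_exp.
      by exists r => // w w0; rewrite subr0 => wr; have [_ _ _ ->] := data w w0 wr; rewrite subrr.
    by move: e00; rewrite x0 expr0n addr0 mulr1 subr0 => /eqP; rewrite expf_eq0 => /eqP.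
  exists r, t, (fun=> 1), y; split; last by right; split.
  split=> // w; rewrite subr0 => wr; split; [lra| | | |].
  + by split; [apply: Hd'; rewrite subr0; lra|exact: Ana_cst|apply: Hd''; rewrite subr0; lra].
  + by left; exact: oner_neq0.
  + have [->|w0] := eqVneq w 0; first by rewrite t0 y0 mulr0 !expr0n addr0.
    have w1 : ab w < 1 by lra.
    have [yn eX eY _] := data w w0 wr; have := curve w w0 w1; rewrite eX eY => c.
    rewrite expr1n mul1r; apply: (mulfI (expf_neq0 3 (invr_neq0 yn))).
    transitivity ((1 / y w) ^+ 2); first by field.
    by rewrite c; field.
  + by move=> w0; have [? ? ? _] := data w w0 wr; split.
(* Here [t] is [Y / X] and vanishes at the cusp, but [t ^+ 2 * x = 1 + x ^+ 3]. *)
exfalso; apply: (@one_contra (fun w => t w ^+ 2 * x w) (fun w => 1 + x w ^+ 3) 0 e) => //.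
+ by apply: Ana_mul => //; exact: Ana_exp.
+ by apply: Ana_add => //; exact: Ana_exp.
+ by rewrite x0 mulr0.
+ by rewrite x0 expr0n addr0.
move=> w w0 hw; have wd : ab w < e by rewrite subr0 in hw.
have w1 : ab w < 1 by lra.
have [[A0 B0 C0 D0] [eX eY]] := hX w w0 w1.
have [_ _ hxw] := Hx w w0 (lt_trans hw (lt_trans e1 d1)).
have [_ _ htw] := Ht w w0 (lt_trans hw e2).
have c := curve w w0 w1; rewrite eX eY in c; rewrite -hxw -htw.
have -> : (B w * Cc w / (A w * D w)) ^+ 2 * (B w / A w) = (Cc w / D w) ^+ 2 / (A w / B w) ^+ 3.
  by field; rewrite ?A0 ?B0 ?C0 ?D0.
by rewrite c; field; rewrite ?A0 ?B0 ?C0 ?D0.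
Qed.

Lemma lift_ex g w0 : SL2Z g -> ab w0 < 1 ->
  exists d a b c, is_lift g w0 d a b c /\ (affine_lift w0 d c \/ polar_lift w0 d a b c).
Proof.
move=> dg w1; have [->|n0] := eqVneq w0 0; first exact: lift_cusp.
by have [d [a [b [c [h1 h2]]]]] := lift_regular dg n0 w1; exists d, a, b, c; split=> //; left.
Qed.

Lemma lim0_uniq (f : C -> C) x y : lim0 f x -> lim0 f y -> x = y.
Proof.
move=> hx hy; apply/eqP; rewrite -subr_eq0 -ab_eq0 eq_le ab_ge0 andbT leNgt; apply/negP => h.
have h2 : 0 < ab (x - y) / 2 by rewrite divr_gt0.
have [d d0 H] := hx _ h2; have [e e0 K] := hy _ h2.
have [s s0 [sd se _ _]] := small_pos4 d0 e0 d0 e0.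
have av : ab (s%:C : C) = s by rewrite abR gtr0_norm.
have v0 : s%:C != 0 :> C by rewrite -ab_gt0 av.
have := H _ v0; have := K _ v0; rewrite av => /(_ se) k1 /(_ sd) k2.
by have := ab_dist x (f s%:C) y; rewrite (abBC x (f s%:C)); lra.
Qed.

Definition lims g (xy : C * C) : Prop := lim0 (XX g) xy.1 /\ lim0 (YY g) xy.2.

(* The point [(XX g w, YY g w)], continued to [w = 0] by its limit if it has one
   and by [O] otherwise. *)
Definition Q g w : E1 R :=
  if w != 0 then E1pt (row3 (XX g w) (YY g w) 1)
  else if pselect (exists xy, lims g xy) is left h then
    E1pt (row3 (projT1 (cid h)).1 (projT1 (cid h)).2 1) else E1_O R.

Lemma row3_neq0 (x y z : C) : y != 0 \/ z != 0 -> row3 x y z != 0.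
Proof.
have [e0 e1 e2] := row3E x y z.
case=> n; apply: contraNneq n => e.
  by rewrite -e1 e mxE.
by rewrite -e2 e mxE.
Qed.

Lemma row3_affine_eq (x y : C) : y ^+ 2 = x ^+ 3 + 1 -> val (E1pt (row3 x y 1)) = P2_affine x y.
Proof.
move=> e; rewrite P2_affineE; apply: val_E1pt; first by apply: row3_neq0; right; exact: oner_neq0.
by have [-> -> ->] := row3E x y 1; rewrite mulr1 expr1n.
Qed.

Lemma Q_affine g w : SL2Z g -> w != 0 -> ab w < 1 -> val (Q g w) = P2_affine (XX g w) (YY g w).
Proof.
move=> dg w0 w1; rewrite /Q w0; apply: row3_affine_eq.
by have [_ ->] := act_forms dg w0 w1.
Qed.

Lemma affine_lims g w0 (d : R) a b c : is_lift g w0 d a b c -> affine_lift w0 d c -> ab (0 - w0) < d ->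
  lims g (a 0, b 0).
Proof.
move=> [d0 H] ha zd; have [_ [aA bA _] _ _ _] := H 0 zd.
have lim (f F : C -> C) : Ana f 0 -> (forall w, w != 0 -> ab (w - w0) < d -> F w = f w) -> lim0 F (f 0).
  move=> hf hF e e0; have [r r0 K] := Ana_near_ball hf e0.
  have dd : 0 < d - ab (0 - w0) by rewrite subr_gt0.
  exists (Num.min r (d - ab (0 - w0))); first by rewrite lt_min r0.
  move=> v v0; rewrite lt_min => /andP[vr vd]; rewrite hF //.
    by apply: K; rewrite subr0.
  by have := ab_dist v 0 w0; rewrite (subr0 v); lra.
split.
  apply: lim => // w wn wd; have [_ _ _ _ /(_ wn)[_ eX _]] := H w wd.
  by rewrite eX (ha w wd) divr1.
apply: lim => // w wn wd; have [_ _ _ _ /(_ wn)[_ _ eY]] := H w wd.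
by rewrite eY (ha w wd) divr1.
Qed.

(** [Y] is the inverse of [c], which tends to 0; so the default branch in the definition of [Q] is
    taken exactly at the poles. *)
Lemma polar_no_lims g w0 (d : R) a b c xy : is_lift g w0 d a b c -> polar_lift w0 d a b c -> ~ lims g xy.
Proof.
move=> [d0 H] [w00 a0 c0 hb] [_ hl]; rewrite w00 in H hb; have [r r0 K] := hl 1 ltr01.
have z0 : ab (0 - 0 : C) < d by rewrite subrr ab0.
have [_ [_ _ cA] _ _ _] := H 0 z0.
pose M := ab xy.2 + 1; have M0 : 0 < M by rewrite /M; have := ab_ge0 xy.2; lra.
have Mi : 0 < M^-1 by rewrite invr_gt0.
have [r' r0' K'] := Ana_near_ball cA Mi.
have [s s0 [s1 s2 s3 _]] := small_pos4 r0 r0' d0 d0.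
have av : ab (s%:C : C) = s by rewrite abR gtr0_norm.
have v0 : s%:C != 0 :> C by rewrite -ab_gt0 av.
have sd : ab (s%:C - 0 : C) < d by rewrite subr0 av.
have [_ _ _ _ /(_ v0)[cn _ eY]] := H _ sd.
have k1 : ab (YY g s%:C - xy.2) < 1 by apply: K => //; rewrite av.
have k2 : ab (c s%:C) < M^-1 by have := K' s%:C; rewrite c0 !subr0 av; exact.
have cp : 0 < ab (c s%:C) by rewrite ab_gt0.
have : M < (ab (c s%:C))^-1 by rewrite -[M]invrK ltf_pV2 ?posrE.
move: k1; rewrite eY (hb _ sd) mul1r => k1.
by have := abB_ge (c s%:C)^-1 xy.2; rewrite abV /M; lra.
Qed.

Lemma Q0_cases g : SL2Z g ->
  (exists x y, [/\ lims g (x, y), y ^+ 2 = x ^+ 3 + 1 & val (Q g 0) = P2_affine x y]) \/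
  ((forall xy, ~ lims g xy) /\ Q g 0 = E1_O R).
Proof.
move=> dg; have [d [a [b [c [hL [ha|hp]]]]]] := lift_cusp dg; last first.
  right; have nl xy := polar_no_lims (xy := xy) hL hp.
  split=> //; rewrite /Q eqxx /=; case: pselect => // -[xy hl].
  by exfalso; exact: nl hl.
left; exists (a 0), (b 0); have [d0 H] := hL.
have z0 : ab (0 - 0 : C) < d by rewrite subrr ab0.
have [_ _ _ eq0 _] := H 0 z0.
have hl := affine_lims hL ha z0.
have ec : b 0 ^+ 2 = a 0 ^+ 3 + 1 by move: eq0; rewrite (ha 0 z0) mulr1 expr1n.
split=> //; rewrite /Q eqxx /=; case: pselect => [h|[]]; last by exists (a 0, b 0).
case: (cid h) => -[x y] [/= h1 h2].
rewrite (lim0_uniq h1 hl.1) (lim0_uniq h2 hl.2).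
exact: row3_affine_eq.
Qed.

Lemma Q_lims g x y : SL2Z g -> lims g (x, y) -> val (Q g 0) = P2_affine x y.
Proof.
move=> dg [/= h1 h2]; have [[x' [y' [[/= h1' h2'] _ ->]]]|[nl _]] := Q0_cases dg.
  by rewrite (lim0_uniq h1 h1') (lim0_uniq h2 h2').
by exfalso; apply: (nl (x, y)).
Qed.

Lemma Q_lift g w0 (d : R) a b c : SL2Z g -> is_lift g w0 d a b c ->
  affine_lift w0 d c \/ polar_lift w0 d a b c ->
  forall w, ab (w - w0) < d -> val (Q g w) = pt3 (row3 (a w) (b w) (c w)).
Proof.
move=> dg hL ht w hw; have [d0 H] := hL; have [w1 _ nz eq hX] := H w hw.
have [ew|n0] := eqVneq w 0; last first.
  have [cn eX eY] := hX n0; rewrite Q_affine // P2_affineE eX eY.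
  apply/pt3_eq; [by apply: row3_neq0; right; exact: oner_neq0|exact: row3_neq0|].
  exists (c w); first exact: cn.
  apply/rowP; apply: ord3_ind; rewrite !mxE /=.
  - by rewrite mulrC divfK.
  - by rewrite mulrC divfK.
  - by rewrite mulr1.
rewrite ew in hw *; case: ht => [ha|hp].
  by rewrite (Q_lims dg (affine_lims hL ha hw)) P2_affineE (ha 0 hw).
have [[x [y [hl _ _]]]|[_ ->]] := Q0_cases dg.
  by exfalso; exact: (polar_no_lims hL hp hl).
have [_ a0 c0 hb] := hp; rewrite a0 c0 (hb 0 hw) -P2_OE.
by [].
Qed.

End Parametrization.

(** * The map [phi], its continuity and injectivity *)

Section Isomorphism.
Variable R : realType.
Local Notation C := R[i].
Local Notation V := 'rV[C]_3.
Implicit Types (g h : 'M[int]_2) (tau w : C).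

Lemma P2_affine_inj (x y x' y' : C) : P2_affine x y = P2_affine x' y' -> x = x' /\ y = y'.
Proof.
have n0 a b : row3 a b 1 != 0 :> V by apply: row3_neq0; right; exact: oner_neq0.
rewrite !P2_affineE => /(pt3_eq (n0 _ _) (n0 _ _))[c c0 e].
have [e0 e1 e2] := row3E x y 1; have [f0 f1 f2] := row3E x' y' 1.
have c1 : c = 1 by rewrite -f2 e mxE e2 mulr1.
rewrite c1 scale1r in e; split; first by rewrite -f0 e e0.
by rewrite -f1 e e1.
Qed.

Lemma P2_affine_neq_O (x y : C) : P2_affine x y <> P2_O R.
Proof.
rewrite P2_affineE P2_OE => /(pt3_eq _ _)[||c c0 e].
- by apply: row3_neq0; right; exact: oner_neq0.
- by apply: row3_neq0; left; exact: oner_neq0.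
have [_ _ f2] := row3E 0 1 0 : [/\ _, _ & _ = 0 :> C]; have [_ _ e2] := row3E x y 1.
by move: c0; rewrite -[c]mulr1 -e2; move: f2; rewrite e mxE => ->; rewrite eqxx.
Qed.

(* [ab (ww tau) < rho] means [1/6 < Im tau], where [P g] is injective. *)
Definition rho : R := expR (- (pi / 3 * (1 / 6))).

Lemma rho_gt0 : 0 < rho. Proof. exact: expR_gt0. Qed.

Lemma rho_lt1 : rho < 1.
Proof.
rewrite /rho -[ltRHS]expR0 ltr_expR oppr_lt0 mulr_gt0 //; exact: pi3_gt0.
Qed.

Lemma ww_rho w : w != 0 -> ab w < rho -> exists2 tau, 1 / 6 < complex.Im tau & ww tau = w.
Proof.
move=> w0 w1; have [tau _ e] := ww_surj w0 (lt_trans w1 rho_lt1).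
by exists tau => //; apply: ww_lt; rewrite e.
Qed.

Lemma P_injective g w w' : SL2Z g -> ab w < rho -> ab w' < rho -> P g w = P g w' -> w = w'.
Proof.
move=> dg h h'; have [->|n] := eqVneq w 0; have [->|n'] := eqVneq w' 0 => //.
- by move=> e; exfalso; exact: (P_nonzero dg dg n' (lt_trans h' rho_lt1) e).
- by move=> e; exfalso; exact: (P_nonzero dg dg n (lt_trans h rho_lt1) (esym e)).
have [t ht <-] := ww_rho n h; have [t' ht' <-] := ww_rho n' h'.
exact: P_inj.
Qed.

Lemma P_cover (p : X6 R) : exists gw : 'M[int]_2 * C,
  [/\ SL2Z gw.1, ab gw.2 <= expR (- (pi / 3 * (1 / 2))) & p = P gw.1 gw.2].
Proof.
have [g [w [dg -> [->|[tau h ->]]]]] := P_surj p.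
  by exists (g, 0); split=> //=; rewrite ab0 expR_ge0.
by exists (g, ww tau); split=> //=; exact: ww_le.
Qed.

Lemma lt_rho w : ab w <= expR (- (pi / 3 * (1 / 2))) -> ab w < rho.
Proof.
move=> h; apply: le_lt_trans h _; rewrite /rho ltr_expR ltrN2 ltr_pM2l; first lra.
exact: pi3_gt0.
Qed.

(** Defined through a chosen disc coordinate of [p]; [Q_welldef] makes the choice immaterial. *)
Definition phi (p : X6 R) : E1 R := Q (projT1 (cid (P_cover p))).1 (projT1 (cid (P_cover p))).2.

(** Two descriptions of the same cusp differ by a translation of [tau], which preserves [ab w] and
    hence limits at [w = 0]. *)
Lemma lims_transfer g h (x y : C) : SL2Z g -> SL2Z h -> P g 0 = P h 0 :> X6 R -> lims g (x, y) -> lims h (x, y).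
Proof.
move=> dg dh /esym e; have [k Gk hk] := (P0_eq R dh dg).1 e; have dk := Gamma_SL2Z Gk.
have dkh := SL2ZM dk dh; set m := \adj g *m (k *m h) in hk.
have [da _] := SL2Z_adj dg; have dm : SL2Z m by exact: SL2ZM.
have E tau : upper_half tau -> upper_half (mobius m tau) /\
    (ab (ww (mobius m tau)) = ab (ww tau) /\ P h (ww tau) = P g (ww (mobius m tau))).
  move=> y0; have ym := upper_mobius dm y0; split=> //; split.
    by have [j ej _] := mobius_upper tau dm hk; rewrite !ab_ww ej intC ImD ImC addr0.
  apply/(P_eq dh dg y0 ym); exists k => //; rewrite /m [in RHS]mobiusM // mobiusM //.
  by have [_ ->] := mobius_adj dg (upper_mobius dk (upper_mobius dh y0)).
have tr (F G : C -> C) l : (forall tau tau', upper_half tau -> upper_half tau' ->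
    P h (ww tau) = P g (ww tau') -> G (ww tau) = F (ww tau')) -> lim0 F l -> lim0 G l.
  move=> FG hl r r0; have [d d0 H] := hl r r0; exists (Num.min d 1); first by rewrite lt_min d0 ltr01.
  move=> w w0; rewrite lt_min => /andP[wd w1]; have [tau y0 et] := ww_surj w0 w1.
  have [ym [ea eP]] := E tau y0; rewrite -et (FG _ _ y0 ym eP); apply: H; first exact: ww_neq0.
  by rewrite ea et.
move=> [/= h1 h2]; split; [apply: tr h1|apply: tr h2] => t t' yt yt' eP.
  by have [] := XX_P dh dg yt yt' eP.
by have [] := XX_P dh dg yt yt' eP.
Qed.

Lemma E1_val_inj (p q : E1 R) : val p = val q -> p = q. Proof. exact: val_inj. Qed.

Lemma Q_welldef g h w w' : SL2Z g -> SL2Z h -> ab w < 1 -> ab w' < 1 -> P g w = P h w' -> Q g w = Q h w'.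
Proof.
move=> dg dh w1 w1'; have [->|n] := eqVneq w 0; have [->|n'] := eqVneq w' 0.
- move=> e; have [[x [y [hl _ eg]]]|[nl eg]] := Q0_cases R dg.
    exact: E1_val_inj (etrans eg (esym (Q_lims dh (lims_transfer dg dh e hl)))).
  have [[x [y [hl _ _]]]|[_ eh]] := Q0_cases R dh; last by rewrite eg eh.
  by exfalso; exact: (nl _ (lims_transfer dh dg (esym e) hl)).
- by move=> e; exfalso; exact: (P_nonzero dh dg n' w1' e).
- by move=> e; exfalso; exact: (P_nonzero dg dh n w1 (esym e)).
have [t yt et] := ww_surj n w1; have [t' yt' et'] := ww_surj n' w1' => e.
have [|hX hY] := XX_P dg dh yt yt'; first by rewrite et et'.
rewrite et et' in hX hY; apply: E1_val_inj.
exact: etrans (Q_affine dg n w1) (etrans (f_equal2 (@P2_affine R) hX hY) (esym (Q_affine dh n' w1'))).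
Qed.

Lemma phiE g w : SL2Z g -> ab w < 1 -> phi (P g w) = Q g w.
Proof.
move=> dg w1; rewrite /phi; case: (cid _) => -[h v] [/= dh /lt_rho hv e].
by apply: Q_welldef => //; exact: lt_trans hv rho_lt1.
Qed.

Lemma P_coverE (p : X6 R) : exists g w, [/\ SL2Z g, ab w < rho & p = P g w].
Proof. by have [[g w] [dg /lt_rho hw e]] := P_cover p; exists g, w. Qed.

Lemma Q_inj g h w w' : SL2Z g -> SL2Z h -> w != 0 -> w' != 0 -> ab w < 1 -> ab w' < 1 ->
  Q g w = Q h w' -> P g w = P h w'.
Proof.
move=> dg dh n n' w1 w1' e.
have eq : val (Q g w) = val (Q h w') by rewrite e.
have [eX eY] := P2_affine_inj (etrans (esym (Q_affine dg n w1)) (etrans eq (Q_affine dh n' w1'))).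
have [t yt et] := ww_surj n w1; have [t' yt' et'] := ww_surj n' w1'.
by rewrite -et -et' in eX eY *; exact: XX_inj.
Qed.

(** Among three nearby points at least two are nonzero. There [Q g] separates points, because [P g]
    is injective on the disc. *)
Lemma Q_nonconst g w0 (r : R) : SL2Z g -> ab w0 < rho -> 0 < r ->
  ~ (forall w, ab (w - w0) < r -> Q g w = Q g w0).
Proof.
move=> dg w1 r0 H; have r1 := rho_lt1.
have lt1 : 0 < rho - ab w0 by rewrite subr_gt0.
have [s s0 [s1 s2 s3 _]] := small_pos4 r0 lt1 (ltr01 : 0 < 1 :> R) r0.
have pt (x : R) : 0 < x -> x <= s -> ab (w0 + x%:C - w0) = x /\ ab (w0 + x%:C) < rho.
  move=> x0 xs; have e : ab (w0 + x%:C - w0) = x by rewrite addrAC subrr add0r abR gtr0_norm.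
  by split=> //; have := abB_ge (w0 + x%:C) w0; rewrite e; lra.
have key (x y : R) : 0 < x -> x <= s -> 0 < y -> y <= s -> x != y -> w0 + x%:C != 0 -> w0 + y%:C != 0 -> False.
  move=> x0 xs y0 ys xy nx ny; have [ex hx] := pt x x0 xs; have [ey hy] := pt y y0 ys.
  have eQ : Q g (w0 + x%:C) = Q g (w0 + y%:C) by rewrite !H // ?ex ?ey; lra.
  have := Q_inj dg dg nx ny (lt_trans hx r1) (lt_trans hy r1) eQ.
  move=> /(P_injective dg hx hy) /addrI /(congr1 (@complex.Re R)) /= exy.
  by rewrite exy eqxx in xy.
have dif (x y : R) : x != y -> w0 + x%:C != 0 \/ w0 + y%:C != 0.
  move=> xy; have [ex|] := eqVneq (w0 + x%:C) 0; last by left.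
  right; apply: contraNneq xy => ey; move: ex; rewrite -ey => /addrI /(congr1 (@complex.Re R)) /= ->.
  by rewrite eqxx.
have n12 : s != s / 2 by apply/eqP; lra.
have n13 : s != s / 3 by apply/eqP; lra.
have n23 : s / 2 != s / 3 by apply/eqP; lra.
have p2 : 0 < s / 2 <= s by apply/andP; split; lra.
have p3 : 0 < s / 3 <= s by apply/andP; split; lra.
case/andP: p2 => p2 q2; case/andP: p3 => p3 q3.
have [h1|h1] := eqVneq (w0 + s%:C) 0; last first.
  have [h2|h2] := dif _ _ n23; first exact: (key s (s / 2)).
  exact: (key s (s / 3)).
have [|h2] := dif _ _ n12; first by rewrite h1 eqxx.
have [|h3] := dif _ _ n13; first by rewrite h1 eqxx.
exact: (key (s / 2) (s / 3)).
Qed.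

Lemma lift_near g w0 : SL2Z g -> ab w0 < rho -> exists d a b c,
  [/\ is_lift g w0 d a b c, affine_lift w0 d c \/ polar_lift w0 d a b c,
    forall w, ab (w - w0) < d -> ab w < rho /\ val (Q g w) = pt3 (row3 (a w) (b w) (c w)) &
    forall i w, ab (w - w0) < d -> Ana (fun v => row3 (a v) (b v) (c v) 0 i) w].
Proof.
move=> dg w1; have [d [a [b [c [hL ht]]]]] := lift_ex dg (lt_trans w1 rho_lt1).
have lt1 : 0 < rho - ab w0 by rewrite subr_gt0.
have [d0 H] := hL; pose d' := Num.min d (rho - ab w0).
have dd w : ab (w - w0) < d' -> ab (w - w0) < d by rewrite lt_min => /andP[].
have hL' : is_lift g w0 d' a b c.
  by split; [rewrite lt_min d0|move=> w /dd; exact: H].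
have ht' : affine_lift w0 d' c \/ polar_lift w0 d' a b c.
  case: ht => [ha|[h1 h2 h3 h4]]; [left|right]; first by move=> w /dd; exact: ha.
  by split=> // w /dd; exact: h4.
exists d', a, b, c; split=> // [w hw|i w hw].
  split; last exact: (Q_lift dg hL' ht').
  by move: hw; rewrite lt_min => /andP[_ hw]; have := abB_ge w w0; lra.
have [_ [aA bA cA] _ _ _] := H w (dd w hw).
move: i; apply: ord3_ind.
- by apply: Ana_eq aA => v; have [-> _ _] := row3E (a v) (b v) (c v).
- by apply: Ana_eq bA => v; have [_ -> _] := row3E (a v) (b v) (c v).
- by apply: Ana_eq cA => v; have [_ _ ->] := row3E (a v) (b v) (c v).
Qed.

Lemma Q_cont g w0 (N : set (E1 R)) : SL2Z g -> ab w0 < rho -> nbhs (Q g w0) N ->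
  exists2 d : R, 0 < d & forall w, ab (w - w0) < d -> ab w < rho /\ N (Q g w).
Proof.
move=> dg w1 hN; have [d [a [b [c [[d0 H] ht hQ hA]]]]] := lift_near dg w1.
have z0 : ab (w0 - w0) < d by rewrite subrr ab0.
have nz w : ab (w - w0) < d -> row3 (a w) (b w) (c w) != 0.
  by move=> /H[_ _ h _ _]; exact: row3_neq0.
have [e e0 He] := E1_near hN (nz _ z0) (hQ _ z0).2.
have [d1 d10 H1] := Ana_near_ball (hA 0 w0 z0) e0.
have [d2 d20 H2] := Ana_near_ball (hA 1 w0 z0) e0.
have [d3 d30 H3] := Ana_near_ball (hA 2 w0 z0) e0.
have [s s0 [s1 s2 s3 s4]] := small_pos4 d0 d10 d20 d30.
exists s => // w ws; have wd := lt_trans ws s1; have [h1 h2] := hQ w wd; split=> //.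
apply: (He _ _ (nz w wd) _ h2); apply: ord3_ind.
- exact: H1 (lt_trans ws s2).
- exact: H2 (lt_trans ws s3).
- exact: H3 (lt_trans ws s4).
Qed.

Lemma chart_lift g w0 bb i j : SL2Z g -> ab w0 < rho -> coord_chart bb i j -> chart_dom bb (Q g w0) ->
  exists f d, [/\ 0 < d, ~ locally_eq f (f w0) w0 & forall w, ab (w - w0) < d ->
    [/\ ab w < rho, chart_dom bb (Q g w), Ana f w & f w = chart_coord bb (Q g w)]].
Proof.
move=> dg w1 [_ oU inj hc] hU; have [d [a [b [c [[d0 H] ht hQ hA]]]]] := lift_near dg w1.
have [d1 d10 H1] := Q_cont dg w1 (open_nbhs_nbhs (conj oU hU)).
pose f w := row3 (a w) (b w) (c w) 0 i / row3 (a w) (b w) (c w) 0 j.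
have key w : ab (w - w0) < Num.min d d1 ->
    [/\ ab w < rho, chart_dom bb (Q g w), Ana f w & f w = chart_coord bb (Q g w)].
  rewrite lt_min => /andP[wd /H1[wr hw]]; have [_ e] := hQ w wd; have [nj ec] := hc _ hw.
  have nz : row3 (a w) (b w) (c w) != 0 by have [_ _ h _ _] := H w wd; exact: row3_neq0.
  have vj : row3 (a w) (b w) (c w) 0 j != 0.
    apply: contraNneq nj => vj; rewrite e; have [k _ ->] := hcoord_pt3 nz.
    by rewrite vj mulr0.
  split=> //; first by apply: Ana_div => //; exact: hA.
  by rewrite ec; have [_ ->] := ratio_pt3 i nz e vj.
have m0 : 0 < Num.min d d1 by rewrite lt_min d0.
have z0 : ab (w0 - w0) < Num.min d d1 by rewrite subrr ab0.
exists f, (Num.min d d1); split=> //; move=> [r r0 Hr].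
have r0' : 0 < Num.min r (Num.min d d1) by rewrite lt_min r0.
apply: (Q_nonconst dg w1 r0') => w; rewrite lt_min => /andP[wr wd].
have [_ hw _ ew] := key w wd; have [_ hw0 _ ew0] := key w0 z0.
apply: (inj _ _ (mem_set hw) (mem_set hw0)); exact: (etrans (esym ew) (etrans (Hr w wr) ew0)).
Qed.

Lemma phi_continuous : continuous phi.
Proof.
move=> p; have [g [w0 [dg w1 ->]]] := P_coverE p; have w1' := lt_trans w1 rho_lt1.
move=> N; rewrite /= phiE // => /(Q_cont dg w1)[d d0 H].
apply: filterS (P_open dg w1' d0) => q [w wd [wl ->]] /=; rewrite phiE //.
by have [] := H w wd.
Qed.

(** Hausdorff separation at a cusp. Points close to a cusp have large imaginary part, while points
    close to a fixed [w'] other than 0 have imaginary part in a compact range, which [P_sep_mixed]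
    forbids. *)
Lemma P_separated g h w w' : SL2Z g -> SL2Z h -> ab w' < 1 -> w = 0 ->
  (forall r : R, 0 < r -> exists v v', [/\ v != 0, v' != 0, ab (v - w) < r, ab (v' - w') < r & P g v = P h v']) ->
  P g w = P h w'.
Proof.
move=> dg dh w1' -> H; have [e|n0] := eqVneq w' 0.
  rewrite e in H *; have r0 : 0 < Num.min 1 (expR (- (pi / 3 * 1))) :> R by rewrite lt_min ltr01 expR_gt0.
  have [v [v' [v0 v0']]] := H _ r0; rewrite !subr0 !lt_min => /andP[v1 vr] /andP[v1' vr'].
  have [t yt et] := ww_surj v0 v1; have [t' yt' et'] := ww_surj v0' v1'.
  rewrite -et -et' in vr vr' *; apply: P_sep_cusps => //; exact: ww_lt.
exfalso; have p0 : 0 < ab w' by rewrite ab_gt0.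
have p1 : 0 < (1 - ab w') / 2 by rewrite divr_gt0 // subr_gt0.
have p2 : 0 < ab w' / 2 by rewrite divr_gt0.
have p3 := @pi3_gt0 R.
(* For [v'] near [w'] these logarithms bound the imaginary part of [t'] below by [m] and above by
   [- K / (pi / 3)]; [M] bounds the resulting sum of it and its inverse. *)
pose c := ln ((1 + ab w') / 2); pose K := ln (ab w' / 2).
have q1 : 0 < (1 + ab w') / 2 by rewrite divr_gt0 // addr_gt0.
have c0 : c < 0 by rewrite /c ln_lt0 // q1 /=; lra.
pose m := - c / (pi / 3); have m0 : 0 < m by rewrite divr_gt0 // oppr_gt0.
pose M := `|K| / (pi / 3) + m^-1.
have M0 : 0 < expR (- (pi / 3 * M)) by exact: expR_gt0.
have [s s0 [s1 s2 s3 s4]] := small_pos4 p1 p2 M0 (ltr01 : 0 < 1 :> R).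
have [v [v' [v0 v0']]] := H _ s0; rewrite subr0 => vs vs'.
have v1 : ab v < 1 by lra.
have l1 : ab v' < (1 + ab w') / 2 by have := abB_ge v' w'; lra.
have l2 : ab w' / 2 < ab v' by have := abB_ge w' v'; rewrite abBC; lra.
have v1' : ab v' < 1 by lra.
have [t yt et] := ww_surj v0 v1; have [t' yt' et'] := ww_surj v0' v1'.
rewrite -et -et' => /(P_sep_mixed dg dh yt yt') hI.
have hM : M < complex.Im t by apply: ww_lt; rewrite et; lra.
have hm : m < complex.Im t'.
  apply: ww_lt; rewrite et' /m [pi / 3 * _]mulrC divfK ?gt_eqF // opprK /c lnK //.
have hk : complex.Im t' < - K / (pi / 3).
  rewrite ltr_pdivlMr // mulrC ltrNr -ltr_expR /K lnK ?posrE // -ab_ww et'.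
  exact: l2.
have : (complex.Im t')^-1 < m^-1 by rewrite ltf_pV2 ?posrE //; lra.
have : - K / (pi / 3) <= `|K| / (pi / 3) by rewrite ler_pM2r ?invr_gt0 // -normrN ler_norm.
by move: hM; rewrite /M; lra.
Qed.

(** Near two points with the same image, the open mapping theorem provides noncuspidal points,
    arbitrarily close to each, that again share an image; these are equal in the curve. Separation
    carries the equality to the limit. *)
Lemma phi_injective : injective phi.
Proof.
move=> p p'; have [g [w [dg w1 ->]]] := P_coverE p; have [h [w' [dh w1' ->]]] := P_coverE p'.
have r1 := rho_lt1; rewrite !phiE //; [|exact: lt_trans w1' r1|exact: lt_trans w1 r1] => eQ.
have key r : 0 < r -> exists v v', [/\ v != 0, v' != 0, ab (v - w) < r, ab (v' - w') < r & P g v = P h v'].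
  move=> r0; have [bb [i [j [hc hd]]]] := chart_at (Q g w).
  have [f [d [d0 nf Hf]]] := chart_lift dg w1 hc hd; rewrite eQ in hd.
  have [f' [d' [d0' nf' Hf']]] := chart_lift dh w1' hc hd.
  have z0 : ab (w - w) < d by rewrite subrr ab0.
  have z0' : ab (w' - w') < d' by rewrite subrr ab0.
  have [_ _ fA fE] := Hf w z0; have [_ _ fA' fE'] := Hf' w' z0'.
  have ez : f' w' = f w := etrans fE' (etrans (congr1 (chart_coord bb) (esym eQ)) (esym fE)).
  (* Within this radius of [w] the only point that can be 0 is [w] itself. *)
  pose n := if w == 0 then 1 else ab w; have n0 : 0 < n.
    by rewrite /n; case: eqVneq => [_|h0]; [exact: ltr01|rewrite ab_gt0].
  pose n' := if w' == 0 then 1 else ab w'; have n0' : 0 < n'.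
    by rewrite /n'; case: eqVneq => [_|h0]; [exact: ltr01|rewrite ab_gt0].
  have [s s0 [s1 s2 s3 _]] := small_pos4 r0 d0 n0 r0.
  have [e e0 He] := open_mapping fA nf s0.
  have [k k0 Hk] := Ana_near_ball fA' e0.
  have [q q0 [Hq|Hq]] := Ana_dichotomy (f' w') fA'.
    by exfalso; apply: nf'; exists q.
  have [s' s0' [t1 t2 t3 t4]] := small_pos4 r0 d0' n0' k0.
  have [u u0 [u1 u2 _ _]] := small_pos4 s0' q0 s0' q0.
  pose v' := w' + u%:C; have av : ab (v' - w') = u by rewrite addrAC subrr add0r abR gtr0_norm.
  have vn : v' != w' by rewrite -subr_eq0 -ab_gt0 av.
  have nn (x y : C) m : m = (if x == 0 then 1 else ab x) -> y != x -> ab (y - x) < m -> y != 0.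
    move=> -> yx; case: eqVneq => [<-//|x0]; apply: contraTneq => ->.
    by rewrite sub0r abN ltxx.
  have v0' : v' != 0 by apply: nn vn _; [reflexivity|rewrite av -/n'; lra].
  have fv : f' v' != f w by rewrite -ez; apply: Hq => //; rewrite av.
  have [|v vs ev] := He (f' v'); first by rewrite -ez; apply: Hk; rewrite av; lra.
  have vw : v != w by apply: contraNneq fv => ev'; rewrite -ev ev'.
  have v0 : v != 0 by apply: nn vw _; [reflexivity|rewrite -/n; exact: lt_trans vs s3].
  have vd : ab (v - w) < d by lra.
  have vd' : ab (v' - w') < d' by rewrite av; lra.
  have [hv dv _ cv] := Hf v vd; have [hv' dv' _ cv'] := Hf' v' vd'.
  exists v, v'; split; [exact: v0|exact: v0'|exact: lt_trans vs s1|rewrite av; exact: lt_trans u1 t1|].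
  have [_ _ inj _] := hc.
  apply: (Q_inj dg dh v0 v0' (lt_trans hv r1) (lt_trans hv' r1)).
  apply: (inj _ _ (mem_set dv) (mem_set dv')); exact: (etrans (esym cv) (etrans ev cv')).
have [e0|n0] := eqVneq w 0; first exact: (P_separated dg dh (lt_trans w1' r1) e0 key).
have [e0'|n0'] := eqVneq w' 0; last exact: (Q_inj dg dh n0 n0' (lt_trans w1 r1) (lt_trans w1' r1)).
apply/esym; apply: (P_separated dh dg (lt_trans w1 r1) e0') => r /key[v [v' [h1 h2 h3 h4 h5]]].
by exists v', v.
Qed.

End Isomorphism.

(** * Surjectivity, the inverse map and values at the cusps *)

Section IsomorphismProof.
Variable R : realType.
Local Notation C := R[i].
Local Notation msph := (@mobius_sphere R).
Implicit Types (g h : 'M[int]_2) (tau w : C).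

Definition cusp_at g : chart R (X6 R) :=
  Chart [set P g w | w in [set w | ab w < rho R]] (fun p => xget 0 [set w | ab w < rho R /\ p = P g w]).

Lemma cusp_atE g w : SL2Z g -> ab w < rho R ->
  chart_dom (cusp_at g) (P g w) /\ chart_coord (cusp_at g) (P g w) = w.
Proof.
move=> dg hw; split; first by exists w.
rewrite /=; case: xgetP => [v -> [hv e]|/(_ w)]; last by case.
exact: (P_injective dg hv hw (esym e)).
Qed.

Lemma P_msph (s : Hstar R) g tau : SL2Z g -> upper_half tau -> val s = msph g (Some tau) -> proj6 s = P g (ww tau).
Proof. by move=> dg y0; rewrite msph_H // => e; rewrite P_ww // -e Hpt_val. Qed.

Lemma ww_lt_rho tau : 1 / 6 < complex.Im tau -> ab (ww tau) < rho R.
Proof. by move=> h; rewrite ab_ww /rho ltr_expR ltrN2 ltr_pM2l // pi3_gt0. Qed.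

Lemma cusp_at_atlas g : SL2Z g -> atlas_X6 R (cusp_at g).
Proof.
move=> dg; right; exists g, (1 / 6); have z0 : ab (0 : C) < rho R by rewrite ab0 rho_gt0.
have up tau : 1 / 6 < complex.Im tau -> upper_half tau by rewrite /upper_half /=; lra.
split=> //.
- apply/seteqP; split=> [p [w hw <-]|p [s hs <-]].
    have [->|n0] := eqVneq w 0.
      exists (Hpt (msph g None)); last by rewrite P0.
      by left; apply: val_Hpt; exact: cusp_in.
    have [tau ht <-] := ww_rho n0 hw; have y0 := up _ ht.
    exists (Hpt (Some (mobius g tau))); last by rewrite P_ww.
    by right; exists tau => //; rewrite val_Hptg // msph_H.
  case: hs => [hs|[tau ht hs]]; first by exists 0 => //; rewrite (P_None hs).
  by exists (ww tau); [exact: ww_lt_rho|rewrite (P_msph dg (up _ ht) hs)].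
- by move=> s hs; rewrite (P_None hs); have [_ ->] := cusp_atE dg z0.
- move=> s tau ht hs; rewrite (P_msph dg (up _ ht) hs).
  by have [_ ->] := cusp_atE dg (ww_lt_rho ht).
Qed.

Lemma pt3_affine (a b c : C) : c != 0 -> pt3 (row3 a b c) = P2_affine (a / c) (b / c).
Proof.
move=> c0; rewrite P2_affineE; apply/pt3_eq.
- by apply: row3_neq0; right.
- by apply: row3_neq0; right; exact: oner_neq0.
exists c^-1; first by rewrite invr_eq0.
by apply/rowP; apply: ord3_ind; rewrite !mxE /= ?[_^-1 * _]mulrC ?divff.
Qed.

Lemma pt3_affine_inv (a b c x y : C) : b != 0 \/ c != 0 -> pt3 (row3 a b c) = P2_affine x y ->
  [/\ c != 0, x = a / c & y = b / c].
Proof.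
move=> nz e; have c0 : c != 0.
  move: e; rewrite P2_affineE => /(pt3_eq _ _)[||k k0 e].
  - exact: row3_neq0.
  - by apply: row3_neq0; right; exact: oner_neq0.
  have [_ _ e2] := row3E a b c; have [_ _ f2] := row3E x y 1.
  apply: contraTneq (oner_neq0 C) => c0; rewrite -f2 e mxE e2 c0 mulr0.
  by rewrite eqxx.
by move: e; rewrite pt3_affine // => /P2_affine_inj[<- <-].
Qed.

Definition hit (x : C) : Prop := exists g w y, [/\ SL2Z g, ab w < rho R & val (Q g w) = P2_affine x y].

(** The function [a / c] is not locally constant: otherwise the second coordinate, being continuous
    with constant square, would be constant too, and so would [Q g]. Then the open mapping theorem
    applies. *)
Lemma hit_open x : hit x -> exists2 r : R, 0 < r & forall x', ab (x' - x) < r -> hit x'.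
Proof.
move=> [g [w0 [y [dg w1 eQ]]]]; have [d [a [b [c [[d0 H] _ hQ _]]]]] := lift_near dg w1.
have z0 : ab (w0 - w0) < d by rewrite subrr ab0.
have [_ [aA bA cA] nz _ _] := H w0 z0.
have [c0 ex ey] := pt3_affine_inv nz (etrans (esym (hQ w0 z0).2) eQ).
have [d1 d10 H1] := Ana_near_neq0 cA c0.
have fA : Ana (fun w => a w / c w) w0 by exact: Ana_div.
have hA : Ana (fun w => b w / c w) w0 by exact: Ana_div.
have QE w : ab (w - w0) < d -> ab (w - w0) < d1 -> val (Q g w) = P2_affine (a w / c w) (b w / c w).
  by move=> h1 h2; exact: etrans (hQ w h1).2 (pt3_affine _ _ (H1 w h2)).
have curve w : ab (w - w0) < d -> ab (w - w0) < d1 -> (b w / c w) ^+ 2 = (a w / c w) ^+ 3 + 1.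
  move=> h1 h2; have [_ _ _ e _] := H w h1; have cn := H1 w h2.
  move: (a w) (b w) (c w) e cn => aw bw cw e cn; apply: (mulIf (expf_neq0 3 cn)).
  transitivity (bw ^+ 2 * cw); first by field.
  by rewrite e; field.
have nc : ~ locally_eq (fun w => a w / c w) (a w0 / c w0) w0.
  move=> [r r0 Hr].
  have [q q0 Hq] : exists2 q : R, 0 < q & forall w, ab (w - w0) < q -> ab (w - w0) < d -> ab (w - w0) < d1 ->
      ab (w - w0) < r -> b w / c w = b w0 / c w0.
    have [yz|yn] := eqVneq (b w0 / c w0) 0.
      exists 1 => // w _ h1 h2 h3; have := curve w h1 h2; rewrite (Hr w h3).
      rewrite -(curve w0 z0) ?subrr ?ab0 // yz expr0n => /eqP; rewrite sqrf_eq0 => /eqP ->.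
      by [].
    have yp : 0 < ab (b w0 / c w0) by rewrite ab_gt0.
    have [q q0 Hq] := Ana_near_ball hA yp; exists q => // w hq h1 h2 h3.
    apply: (@ab_sqr_eq _ _ _ (b w0 / c w0)).
    - by rewrite (curve w h1 h2) (Hr w h3) -(curve w0 z0) // subrr ab0.
    - exact: Hq w hq.
    - by rewrite subrr ab0.
  have [s s0 [s1 s2 s3 s4]] := small_pos4 q0 d0 d10 r0.
  apply: (Q_nonconst dg w1 s0) => w ws; apply: E1_val_inj.
  have k1 := lt_trans ws s1; have k2 := lt_trans ws s2; have k3 := lt_trans ws s3; have k4 := lt_trans ws s4.
  have zz : ab (w0 - w0) < d1 by rewrite subrr ab0.
  exact: etrans (QE w k2 k3) (etrans (f_equal2 (@P2_affine R) (Hr w k4) (Hq w k1 k2 k3 k4)) (esym (QE w0 z0 zz))).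
have [s s0 [s1 s2 _ _]] := small_pos4 d0 d10 d0 d10.
have [e e0 He] := open_mapping fA nc s0.
exists e => // x'; rewrite ex => /He[w ws ew].
have k1 := lt_trans ws s1; have k2 := lt_trans ws s2.
exists g, w, (b w / c w); split; [exact: dg|exact: (hQ w k1).1|].
by have := QE w k1 k2; rewrite ew; apply.
Qed.

(** At a pole the curve equation reads [c ^+ 2 * (x' ^+ 3 + 1) = 1]; as [c] is small nearby, [x'] is
    large and stays away from [x]. *)
Lemma unhit_local x g w0 : SL2Z g -> ab w0 < rho R -> ~ hit x -> exists2 r : R, 0 < r &
  forall w, ab (w - w0) < r -> forall x' y, ab (x' - x) < r -> val (Q g w) <> P2_affine x' y.
Proof.
move=> dg w1 nh; have [d [a [b [c [[d0 H] ht hQ _]]]]] := lift_near dg w1.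
have z0 : ab (w0 - w0) < d by rewrite subrr ab0.
have [_ [aA bA cA] nz _ _] := H w0 z0.
have [c0|c0] := eqVneq (c w0) 0; last first.
  have [d1 d10 H1] := Ana_near_neq0 cA c0.
  have fA : Ana (fun w => a w / c w) w0 by exact: Ana_div.
  have nx : a w0 / c w0 != x.
    apply/eqP => e; apply: nh; exists g, w0, (b w0 / c w0); split; [exact: dg|exact: w1|].
    by rewrite -e -pt3_affine //; exact: (hQ w0 z0).2.
  have dl : 0 < ab (a w0 / c w0 - x) / 2 by rewrite divr_gt0 // ab_gt0 subr_eq0.
  have [d2 d20 H2] := Ana_near_ball fA dl.
  have [s s0 [s1 s2 s3 s4]] := small_pos4 d0 d10 d20 dl.
  exists s => // w ws x' y xs eQ.
  have [_ _ nzw _ _] := H w (lt_trans ws s1).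
  have [_ ex _] := pt3_affine_inv nzw (etrans (esym (hQ w (lt_trans ws s1)).2) eQ).
  have := H2 w (lt_trans ws s3); rewrite -ex abBC => h2.
  have := ab_dist (a w0 / c w0) x' x; move: (ab (a w0 / c w0 - x)) (ab (a w0 / c w0 - x')) s4 h2 => u v; lra.
have [ha|[_ _ _ hb]] := ht.
  by exfalso; move: c0; rewrite (ha w0 z0) => /eqP; rewrite oner_eq0.
pose K := (ab x + 1) ^+ 3 + 1; have x0 := ab_ge0 x.
have K1 : 1 <= K by rewrite /K lerDr exprn_ge0 //; lra.
have Ki : 0 < K^-1 by rewrite invr_gt0; lra.
have [d1 d10 H1] := Ana_near_ball cA Ki.
have [s s0 [s1 s2 s3 _]] := small_pos4 d0 d10 (ltr01 : 0 < 1 :> R) d0.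
exists s => // w ws x' y xs eQ; have wd := lt_trans ws s1.
have [_ _ nzw cur _] := H w wd; have b1 := hb w wd.
have [cn ex _] := pt3_affine_inv nzw (etrans (esym (hQ w wd).2) eQ).
have := H1 w (lt_trans ws s2); rewrite c0 subr0 => hc.
have e1 : c w ^+ 2 * (x' ^+ 3 + 1) = 1.
  move: cur; rewrite b1 ex; move: (a w) (c w) cn => aw cw cn cur; apply: (mulIf cn).
  by transitivity (aw ^+ 3 + cw ^+ 3); [field|rewrite -cur; ring].
have hx : ab (x' ^+ 3 + 1) <= K.
  apply: le_trans (abD _ _) _; rewrite ab1 abX /K lerD2r lerXn2r ?nnegrE //; first exact: ab_ge0.
  - by lra.
  - by have := abB_ge x' x; lra.
have := congr1 (@ab R) e1; rewrite abM ab1 abX.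
have cK : ab (c w) * K < 1 by rewrite -ltr_pdivlMr ?mul1r //; lra.
have c1 : ab (c w) < 1 by apply: lt_le_trans hc _; rewrite invf_le1 //; lra.
move: (ab (c w)) (ab (x' ^+ 3 + 1)) (ab_ge0 (c w)) (ab_ge0 (x' ^+ 3 + 1)) hx cK c1 => u v u0 v0 hx cK c1 e.
have : u * v <= u * K by rewrite ler_wpM2l.
have : u ^+ 2 * v <= u * v by rewrite ler_wpM2r // expr2 ler_piMr //; lra.
lra.
Qed.

(* [ab (ww tau) <= rho0] means [1/2 <= Im tau]: these discs cover [X(6)]. *)
Definition rho0 : R := expR (- (pi / 3 * (1 / 2))).

(** Compactness of the closed disc makes the radius of [unhit_local] uniform in [w]. *)
Lemma unhit_disc x g : SL2Z g -> ~ hit x -> exists2 r : R, 0 < r &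
  forall w, ab w <= rho0 -> forall x' y, ab (x' - x) < r -> val (Q g w) <> P2_affine x' y.
Proof.
move=> dg nh.
have cD : compact [set w : C | ab w <= rho0].
  apply: (compactP (M := rho0)) => // z /= /negP; rewrite -ltNge => h.
  exists (ab z - rho0); first by rewrite subr_gt0.
  by move=> w hw /=; have := abB_ge z w; rewrite abBC; lra.
pose S (r : R) (w : C) := forall x' y, ab (x' - x) < r -> val (Q g w) <> P2_affine x' y.
have near : \forall r \near 0^'+, [set w : C | ab w <= rho0] `<=` S r.
  apply: ((compact_near_coveringP _).1 cD R (0^'+) S _) => w0 /lt_rho w1.
  have [r r0 Hr] := unhit_local dg w1 nh.
  exists ([set w | ab (w - w0) < r], [set s | s < r]).
    split; last exact: nbhs_right_lt.
    by apply/nearP; exists r.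
  move=> [w s] [/= hw hs] x' y hx; apply: Hr => //; exact: lt_trans hx hs.
have [r [r0 Hr]] : exists r : R, 0 < r /\ [set w : C | ab w <= rho0] `<=` S r.
  apply: (@filter_ex _ (0^'+)); apply: filterI => //; exact: nbhs_right_gt.
by exists r => // w hw; exact: Hr.
Qed.

Lemma P_Gamma k g w : Gamma 6 k -> SL2Z g -> ab w < 1 -> P (k *m g) w = P g w.
Proof.
move=> Gk dg w1; have dk := Gamma_SL2Z Gk; have dkg := SL2ZM dk dg; apply/esym.
have [->|n0] := eqVneq w 0.
  apply/(P0_eq R dg dkg); exists k => //.
  by have [_ [-> _]] := SL2Z_adj dkg; rewrite mxE.
have [tau y0 <-] := ww_surj n0 w1; apply/(P_eq dg dkg y0 y0).
by exists k => //; rewrite mobiusM.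
Qed.

Definition res6 (x : int) : 'I_6 := inord `|(x %% 6)%Z|%N.

Lemma res6_eq x y : res6 x = res6 y -> exists k, x = y + 6 * k.
Proof.
move=> /(congr1 val) /=; rewrite !inordK; last 2 first.
- by have := @ltz_pmod x 6 isT; have := @modz_ge0 x 6 isT; lia.
- by have := @ltz_pmod y 6 isT; have := @modz_ge0 y 6 isT; lia.
move=> e; exists ((x %/ 6)%Z - (y %/ 6)%Z); have := divz_eq x 6; have := divz_eq y 6.
by have := @modz_ge0 x 6 isT; have := @modz_ge0 y 6 isT; lia.
Qed.

Definition resM g := (res6 (g 0 0), res6 (g 0 1), res6 (g 1 0), res6 (g 1 1)).

(** Finite index of [Gamma 6]: the residues of the entries modulo 6 determine the coset. *)
Lemma resM_eq g h : SL2Z g -> SL2Z h -> resM g = resM h -> exists2 k, Gamma 6 k & g = k *m h.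
Proof.
move=> dg dh [/res6_eq[a ea] /res6_eq[b eb] /res6_eq[c ec] /res6_eq[d ed]].
have [da [e1 e2]] := SL2Z_adj dh; have eg : g = h + 6 *: mk2 a b c d.
  apply/matrixP => i j; rewrite !mxE.
  have [->|->] : i = 0 \/ i = 1 by case: i => [[|[|//]] hi]; [left|right]; apply/val_inj.
    have [->|->] : j = 0 \/ j = 1 by case: j => [[|[|//]] hj]; [left|right]; apply/val_inj.
      exact: ea.
    exact: eb.
  have [->|->] : j = 0 \/ j = 1 by case: j => [[|[|//]] hj]; [left|right]; apply/val_inj.
    exact: ec.
  exact: ed.
exists (g *m \adj h); last by rewrite -mulmxA e1 mulmx1.
apply/Gamma6P; first exact: SL2ZM.
by exists (mk2 a b c d *m \adj h); rewrite {1}eg mulmxDl e2 -scalemxAl.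
Qed.

Lemma rho0_lt1 : rho0 < 1.
Proof.
have h : ab (rho0%:C : C) <= rho0 by rewrite abR gtr0_norm // expR_gt0.
have h' := lt_rho h; rewrite abR gtr0_norm ?expR_gt0 // in h'; exact: lt_trans h' (rho_lt1 R).
Qed.

(** [Q g] depends on [g] only through its residues modulo 6, so finitely many compact discs have to
    be considered and a minimum of radii exists. *)
Lemma unhit_open x : ~ hit x -> exists2 r : R, 0 < r & forall x', ab (x' - x) < r -> ~ hit x'.
Proof.
move=> nh; pose ok (r : R) g := forall w, ab w <= rho0 -> forall x' y, ab (x' - x) < r -> val (Q g w) <> P2_affine x' y.
have one t : exists2 r : R, 0 < r & forall g, SL2Z g -> resM g = t -> ok r g.
  have [[g0 [dg0 e0]]|no] := pselect (exists g0, SL2Z g0 /\ resM g0 = t); last first.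
    by exists 1 => // g dg e; exfalso; apply: no; exists g.
  have [r r0 Hr] := unhit_disc dg0 nh; exists r; first exact: r0.
  move=> g dg e w hw.
  have w1 : ab w < 1 := le_lt_trans hw rho0_lt1.
  have [k Gk eg] := resM_eq dg dg0 (etrans e (esym e0)).
  have eP : P g w = P g0 w by rewrite eg; exact: P_Gamma.
  by rewrite (Q_welldef dg dg0 w1 w1 eP); exact: Hr.
have all (s : seq ('I_6 * 'I_6 * 'I_6 * 'I_6)) : exists2 r : R, 0 < r & forall g, SL2Z g -> resM g \in s -> ok r g.
  elim: s => [|t s [r r0 Hr]]; first by exists 1.
  have [q q0 Hq] := one t; exists (Num.min r q); first by rewrite lt_min r0.
  move=> g dg; rewrite inE => /orP[/eqP e|e] w hw x' y; rewrite lt_min => /andP[h1 h2].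
    exact: (Hq g dg e w hw x' y h2).
  exact: (Hr g dg e w hw x' y h1).
have [r r0 Hr] := all (enum {: 'I_6 * 'I_6 * 'I_6 * 'I_6}).
exists r => // x' hx [g [w [y [dg w1 eQ]]]].
have [[h v] [/= dh hv eP]] := P_cover (P g w).
have w1' := lt_trans w1 (rho_lt1 R).
apply: (Hr h dh _ v hv x' y hx); first by rewrite mem_enum.
by rewrite -(Q_welldef dg dh w1' (le_lt_trans hv rho0_lt1) eP).
Qed.

(** [hit] and its negation are both open, so [segment_ind] extends it from one value of [X] to
    all. *)
Lemma hit_all x : hit x.
Proof.
pose w1 : C := (rho R / 2)%:C; have r0 := rho_gt0 R.
have aw : ab w1 = rho R / 2 by rewrite abR gtr0_norm // divr_gt0.
have n0 : w1 != 0 by rewrite -ab_gt0 aw divr_gt0.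
have l1 : ab w1 < rho R by rewrite aw; lra.
apply: (@segment_ind R hit (XX 1%:M w1) x) => [t _|]; last first.
  exists 1%:M, w1, (YY 1%:M w1); split=> //; first exact: SL2Z1.
  exact: (Q_affine SL2Z1 n0 (lt_trans l1 (rho_lt1 R))).
have [h|h] := pselect (hit (seg (XX 1%:M w1) x t)).
  by have [r rp H] := hit_open h; exists r => //; left.
by have [r rp H] := unhit_open h; exists r => //; right.
Qed.

Lemma act_periodic g (F : Type) (e : int -> int -> F) : periodic6 e -> periodic6 (act g e).
Proof.
move=> pe a b c d /andP[h1 h2]; apply: pe; rewrite /lat6.
have -> : c * g 0 0 + d * g 1 0 - (a * g 0 0 + b * g 1 0) = (c - a) * g 0 0 + (d - b) * g 1 0 by ring.
have -> : c * g 0 1 + d * g 1 1 - (a * g 0 1 + b * g 1 1) = (c - a) * g 0 1 + (d - b) * g 1 1 by ring.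
by rewrite !rpredD // dvdz_mulr.
Qed.

Definition t3 : 'M[int]_2 := mk2 1 3 0 1.

Lemma SL2Z_t3 : SL2Z t3. Proof. by rewrite /SL2Z /= det_mk2. Qed.

(** Three unit translations multiply [X] by [omega ^+ 6 = 1] and [Y] by [-1], so both points above a
    given first coordinate are reached. *)
Lemma t3_XY g w : SL2Z g -> w != 0 -> ab w < 1 -> XX (t3 *m g) w = XX g w /\ YY (t3 *m g) w = - YY g w.
Proof.
move=> dg w0 w1; have pe := act_periodic g (ds_period (divS_system w0 w1)).
have o0 : omega R != 0 by rewrite -ab_gt0 ab_omega.
rewrite /XX /YY -actM; move: (act g (divS w)) pe => e pe.
have -> : act t3 e = shift 1 (shift 1 (shift 1 e)).
  apply/funext => a; apply/funext => b; rewrite /act /shift; have [-> -> -> ->] := mk2E 1 3 0 1.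
  by congr e; ring.
have p1 := shift_periodic 1 pe; have p2 := shift_periodic 1 p1.
have [-> ->] := shift1_XY p2 (@omega3 R) o0; have [-> ->] := shift1_XY p1 (@omega3 R) o0.
have [-> ->] := shift1_XY pe (@omega3 R) o0; rewrite opprK; split=> //.
move: (Xw e _) (@omega3 R) => x o3.
by transitivity (omega R ^+ 3 ^+ 2 * x); [ring|rewrite o3 expr1n mul1r].
Qed.

Lemma t3_Q g w x y : SL2Z g -> ab w < 1 -> val (Q g w) = P2_affine x y -> val (Q (t3 *m g) w) = P2_affine x (- y).
Proof.
move=> dg w1; have dtg := SL2ZM SL2Z_t3 dg; have [->|n0] := eqVneq w 0; last first.
  move=> e; have [<- <-] := P2_affine_inj (etrans (esym (Q_affine dg n0 w1)) e).
  by have [<- <-] := t3_XY dg n0 w1; exact: Q_affine.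
have [[x' [y' [[/= h1 h2] _ e']]]|[_ ->] e] := Q0_cases R dg; last by exfalso; exact: P2_affine_neq_O (esym e).
move=> e; have [ex ey] := P2_affine_inj (etrans (esym e') e); rewrite ex in h1; rewrite ey in h2.
apply: (Q_lims dtg); split=> /= r r0.
  have [d d0 Hd] := h1 r r0; exists (Num.min d 1); first by rewrite lt_min d0 ltr01.
  by move=> v v0; rewrite lt_min => /andP[vd v1]; have [-> _] := t3_XY dg v0 v1; exact: Hd.
have [d d0 Hd] := h2 r r0; exists (Num.min d 1); first by rewrite lt_min d0 ltr01.
move=> v v0; rewrite lt_min => /andP[vd v1]; have [_ ->] := t3_XY dg v0 v1.
by rewrite -opprD abN; exact: Hd.
Qed.

Lemma phi_infty : phi (P 1%:M 0) = E1_O R.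
Proof.
rewrite phiE; [|exact: SL2Z1|by rewrite ab0].
have [[x [y [[/= h1 _] _ _]]]|[_ ->//]] := Q0_cases R SL2Z1; exfalso.
have [d d0 Hd] := h1 1 ltr01; have [e e0 He] := X_pole (ab x + 1).
have [s s0 [s1 s2 _ _]] := small_pos4 d0 e0 d0 e0.
have av : ab (s%:C : C) = s by rewrite abR gtr0_norm.
have v0 : s%:C != 0 :> C by rewrite -ab_gt0 av.
have k1 : ab (XX 1%:M s%:C - x) < 1 by apply: Hd => //; rewrite av.
have k2 : ab x + 1 < ab (XX 1%:M s%:C) by rewrite /XX actE1; apply: He => //; rewrite av.
by have := abB_ge (XX 1%:M s%:C) x; lra.
Qed.

Lemma phi_surjective (q : E1 R) : exists p, phi p = q.
Proof.
have [z0|z0] := eqVneq (hcoord (val q) 2) 0.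
  by exists (P 1%:M 0); rewrite phi_infty (infinite_E1 z0).
have [eq eqc] := affine_E1 z0; have [g [w [y [dg w1 e]]]] := hit_all (ratio q 0 2).
have w1' := lt_trans w1 (rho_lt1 R).
have ey : y ^+ 2 = ratio q 1 2 ^+ 2.
  have nq : hcoord (val (Q g w)) 2 != 0.
    have n3 : row3 (ratio q 0 2) y 1 != 0 by apply: row3_neq0; right; exact: oner_neq0.
    have [k k0 hk] := hcoord_pt3 n3; rewrite e P2_affineE hk.
    by have [_ _ ->] := row3E (ratio q 0 2) y 1; rewrite mulr1.
  have [eQ eQc] := affine_E1 nq; have [ex ->] := P2_affine_inj (etrans (esym e) eQ).
  by rewrite eQc eqc ex.
move/eqP: ey; rewrite eqf_sqr => /orP[/eqP ey|/eqP ey].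
  exists (P g w); rewrite phiE //; apply: E1_val_inj; rewrite ey in e.
  exact: etrans e (esym eq).
exists (P (t3 *m g) w); rewrite phiE //; last exact: SL2ZM SL2Z_t3 dg.
have := t3_Q dg w1' e; rewrite ey opprK => e'; apply: E1_val_inj.
exact: etrans e' (esym eq).
Qed.

Definition psi (q : E1 R) : X6 R := projT1 (cid (phi_surjective q)).

Lemma psiK q : phi (psi q) = q. Proof. by rewrite /psi; case: cid. Qed.

Lemma phiK p : psi (phi p) = p. Proof. by apply: phi_injective; rewrite psiK. Qed.

Lemma psiQ g w : SL2Z g -> ab w < 1 -> psi (Q g w) = P g w.
Proof. by move=> dg w1; rewrite -(phiE dg w1) phiK. Qed.

Lemma phi_holomorphic : holomorphic_map (atlas_X6 R) (atlas_E1 R) (@phi R).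
Proof.
split=> [|p]; first exact: phi_continuous.
have [g [w0 [dg w1 ->]]] := P_coverE p; have w1' := lt_trans w1 (rho_lt1 R).
have [bb [i [j [hc hd]]]] := chart_at (Q g w0).
have [f [d [d0 _ Hf]]] := chart_lift dg w1 hc hd.
have [da ca] := cusp_atE dg w1; have [hb _ _ _] := hc.
exists (cusp_at g), bb; split.
- exact: cusp_at_atlas.
- exact: hb.
- exact: da.
- by rewrite (phiE dg w1').
exists (fun w => chart_coord bb (Q g w)).
  rewrite ca; apply: Ana_holomorphic; have z0 : ab (w0 - w0) < d by rewrite subrr ab0.
  have [_ _ fA _] := Hf w0 z0; apply: Ana_ext fA; exists d => // w wd.
  by have [_ _ _ ->] := Hf w wd.
move=> x [w hw <-] _; have [_ ->] := cusp_atE dg hw.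
by rewrite (phiE dg (lt_trans hw (rho_lt1 R))).
Qed.

(** The open mapping theorem in a chart: every point of the curve near [q] is [Q g w] for some [w]
    near [w0], and [psi] sends it to [P g w]. *)
Lemma psi_continuous : continuous psi.
Proof.
move=> q; have [p ep] := phi_surjective q.
have [g [w0 [dg w1 eP]]] := P_coverE p; have w1' := lt_trans w1 (rho_lt1 R).
have eq : q = Q g w0 by rewrite -ep eP (phiE dg w1').
have eq' : psi q = P g w0 by rewrite -ep phiK.
move=> N hN; rewrite eq' nbhsE in hN; have [U [oU Up] UN] := hN; rewrite eq.
have [r r0 Hr] := P_cont dg w1' oU Up.
have [bb [i [j [hc hd]]]] := chart_at (Q g w0).
have [f [d [d0 nf Hf]]] := chart_lift dg w1 hc hd.
have z0 : ab (w0 - w0) < d by rewrite subrr ab0.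
have [_ _ fA fE] := Hf w0 z0.
have [s s0 [s1 s2 _ _]] := small_pos4 d0 r0 d0 r0.
have [e e0 He] := open_mapping fA nf s0.
have [_ oD inj hcd] := hc; have [nj cE] := hcd _ hd.
have oB := @open_ratio R i j (f w0) e.
have hB : nbhs (Q g w0) [set q : E1 R | hcoord (val q) j != 0 /\ ab (ratio q i j - f w0) < e].
  by apply: open_nbhs_nbhs; split=> //; split=> //; rewrite -cE -fE subrr ab0.
apply: filterS2 hB (open_nbhs_nbhs (conj oD hd)) => q' [_ hq] dq.
have [_ cq] := hcd _ dq; rewrite -cq in hq; have [w ws ew] := He _ hq.
have [hw dw _ fw] := Hf w (lt_trans ws s1).
have ew' : Q g w = q' := inj _ _ (mem_set dw) (mem_set dq) (etrans (esym fw) ew).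
rewrite /= -ew' (psiQ dg (lt_trans hw (rho_lt1 R))); apply: UN.
by have [] := Hr w (lt_trans ws s2).
Qed.

Lemma psi_holomorphic : holomorphic_map (atlas_E1 R) (atlas_X6 R) psi.
Proof.
split=> [|q]; first exact: psi_continuous.
have [p <-] := phi_surjective q; rewrite phiK.
have [g [w0 [dg w1 ep]]] := P_coverE p; have w1' := lt_trans w1 (rho_lt1 R); rewrite ep (phiE dg w1').
have [bb [i [j [hc hd]]]] := chart_at (Q g w0).
have [f [d [d0 _ Hf]]] := chart_lift dg w1 hc hd.
have [da ca] := cusp_atE dg w1; have [hb _ inj _] := hc.
exists bb, (cusp_at g); split.
- exact: hb.
- exact: cusp_at_atlas.
- exact: hd.
- exact: da.
(* [xget] inverts the chart coordinate; the default [Q g w0] occurs only off the image of the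
   chart. *)
pose h z := chart_coord (cusp_at g) (psi (xget (Q g w0) [set q' | chart_dom bb q' /\ chart_coord bb q' = z])).
have hE q' : chart_dom bb q' -> h (chart_coord bb q') = chart_coord (cusp_at g) (psi q').
  move=> dq; rewrite /h; case: xgetP => [u -> [du cu]|/(_ q')]; last by case.
  by rewrite (inj _ _ (mem_set du) (mem_set dq) cu).
exists h; last by move=> q' dq _; exact: hE.
have z0 : ab (w0 - w0) < d by rewrite subrr ab0.
have [_ _ _ <-] := Hf w0 z0; apply: (inverse_holomorphic d0) => w wd.
have [hw dw fA ->] := Hf w wd; split; first exact: fA.
by rewrite hE // (psiQ dg (lt_trans hw (rho_lt1 R))); have [_ ->] := cusp_atE dg hw.
Qed.

Lemma phi_isomorphism : isomorphism (atlas_X6 R) (atlas_E1 R) (@phi R).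
Proof.
exists psi; split; [exact: phiK|exact: psiK|exact: phi_holomorphic|exact: psi_holomorphic].
Qed.

(** By [P_surj] the class of [s] is represented by some [P g w]. A noncuspidal [w] would move [s]
    into the upper half-plane, and for [w = 0] an element of [Gamma 6] carries the cusp of [g] to
    [s]. *)
Lemma cusp_rep (s : Hstar R) : ~ in_upper s -> exists2 g, SL2Z g & val s = msph g None.
Proof.
move=> ns; have [g [w [dg e h]]] := P_surj (proj6 s); have [ew|[tau ht ew]] := h; rewrite ew in e.
  move: e; rewrite P0 => /esym/proj6_eq[k Gk]; have dk := Gamma_SL2Z Gk.
  rewrite val_Hpt; last exact: cusp_in.
  by rewrite -mobius_sphereM // => e; exists (k *m g); [exact: SL2ZM|rewrite e].
exfalso; apply: ns; have y0 : upper_half tau by rewrite /upper_half /=; lra.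
move: e; rewrite P_ww // => /esym/proj6_eq[k Gk]; have dk := Gamma_SL2Z Gk.
rewrite val_Hptg // msph_H //; last exact: upper_mobius.
rewrite /in_upper /= => <-; exact: upper_mobius dk (upper_mobius dg y0).
Qed.

Lemma XY_ww tau : upper_half tau -> Xfun tau = XX 1%:M (ww tau) /\ Yfun tau = YY 1%:M (ww tau).
Proof. by move=> y0; have := XYfun_mobius SL2Z1 y0; rewrite mobius1. Qed.

Lemma XY_curve tau : upper_half tau -> Yfun tau ^+ 2 = Xfun tau ^+ 3 + 1.
Proof.
move=> y0; have [-> ->] := XY_ww y0.
by have [_ ->] := act_forms SL2Z1 (ww_neq0 tau) (ww_lt1 y0).
Qed.

Lemma proj6_infty : proj6 (infty R) = P 1%:M 0.
Proof. by apply: P_None; rewrite mobius_sphere1. Qed.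

Lemma phi_value (s : Hstar R) : proj6 s <> proj6 (infty R) ->
  exists x y, [/\ value_at (@Xfun R) s x, value_at (@Yfun R) s y & val (phi (proj6 s)) = P2_affine x y].
Proof.
rewrite proj6_infty => ns; have [hs|hs] := pselect (in_upper s).
  case E : (val s) (hs) => [z|]; rewrite /in_upper /= E // => y0.
  have cz : complex_of s = z by rewrite /complex_of E.
  exists (Xfun z), (Yfun z); split.
  - by split=> // _; rewrite cz.
  - by split=> // _; rewrite cz.
  have w1 := ww_lt1 y0; rewrite (P_Some E y0) (phiE SL2Z1 w1); have [-> ->] := XY_ww y0.
  exact: (Q_affine SL2Z1 (ww_neq0 z) w1).
have [g dg sg] := cusp_rep hs; have z1 : ab (0 : C) < 1 by rewrite ab0.
rewrite (P_None sg) in ns *; have eQ := phiE dg z1.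
have [[x [y [[/= hx hy] _ e]]]|[_ eO]] := Q0_cases R dg; last first.
  by exfalso; apply: ns; apply: phi_injective; rewrite eQ eO phi_infty.
exists x, y; split; last by rewrite eQ.
- apply: (value_at_cusp dg sg _ hx) => z tau yz yt eP; have [-> _] := XY_ww yz.
  by have [] := XX_P SL2Z1 dg yz yt eP.
- apply: (value_at_cusp dg sg _ hy) => z tau yz yt eP; have [_ ->] := XY_ww yz.
  by have [] := XX_P SL2Z1 dg yz yt eP.
Qed.

End IsomorphismProof.

Theorem theorem2p9 (R : realType) :
  [/\ modular_function (Gamma0 6) 0 (fun tau : R[i] => Xfun tau ^+ 3),
      modular_function (Gamma0 6) 0 (fun tau : R[i] => Yfun tau ^+ 2),
      forall tau : R[i], upper_half tau -> Yfun tau ^+ 2 = Xfun tau ^+ 3 + 1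
    & exists phi : X6 R -> E1 R,
        [/\ forall s : Hstar R, proj6 s <> proj6 (infty R) ->
              exists x y : R[i], [/\ value_at (@Xfun R) s x,
                value_at (@Yfun R) s y
                & set_val (phi (proj6 s)) = P2_affine x y],
            set_val (phi (proj6 (infty R))) = P2_O R
          & isomorphism (atlas_X6 R) (atlas_E1 R) phi]].
Proof.
have [hX hY] := modular_XY R; split; [exact: hX|exact: hY|exact: XY_curve|].
exists (@phi R); split; [exact: phi_value| |exact: phi_isomorphism].
by rewrite proj6_infty phi_infty.
Qed.
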